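(* Let $\Omega\subset\mathbb{R}^n$ be a mean-convex domain with a $C^2$ boundary, and let $u$ be a smooth solution of the mean curvature flow for graphs $$\frac{\partial u}{\partial t}=\left(\delta_{ij}-\frac{D_iu\,D_ju}{1+|Du|^2}\right)D_{ij}u\quad\text{in }\Omega,\ t>0,$$ with prescribed values $u(x,t)=0$ for $x\in\partial\Omega$, $t>0$, and $u(\cdot,0)=u_0$. Let $\varphi$ be a smooth solution of the curve shortening flow $$\varphi_t=\frac{\varphi''}{1+(\varphi')^2}$$ for $z>0$, $t>0$, satisfying $\lim_{t\to0}\varphi(z,t)=1$ for $z\ne0$, $\varphi(0,t)=0$ for all $t>0$, and $\lim_{z\to\infty}\varphi(z,t)=1$ for all $t>0$. Then $$|u(y,t)-u(x,t)|\le 2M\varphi\!\left(\frac{|y-x|}{2M},\frac{t}{4M^2}\right)$$ for all $x,y\in\Omega$ and $t>0$, where $M=\sup|u_0|$.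
   Context: Repeated indices are summed. $\Omega$ is mean-convex if at every boundary point the sum of the principal curvatures of $\partial\Omega$ satisfies $\sum_{i=1}^{n-1}\kappa_i\ge0$. $'$ denotes the derivative of $\varphi$ in its first (space) variable. *)

(* Defs.v *)
From HB Require Import structures.
From mathcomp Require Import all_boot all_order all_algebra.
From mathcomp Require Import all_classical all_reals all_analysis.
Set Implicit Arguments.
Unset Strict Implicit.
Unset Printing Implicit Defensive.
Import Order.TTheory GRing.Theory Num.Theory.
Import numFieldNormedType.Exports.
Local Open Scope classical_set_scope.
Local Open Scope ring_scope.

(* The library norm on ['rV[R]_n] is the sup norm, hence a separate Euclidean
   structure; the two norms define the same topology and derivatives. *)
Definition dotp (R : realType) (n : nat) (v w : 'rV[R]_n) : R :=
  \sum_(i < n) v ord0 i * w ord0 i.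

Definition enorm (R : realType) (n : nat) (v : 'rV[R]_n) : R :=
  Num.sqrt (dotp v v).

Definition partial (R : realType) (n : nat) (i : 'I_n) (f : 'rV[R]_n -> R)
    (x : 'rV[R]_n) : R :=
  'D_(delta_mx ord0 i) f x.

Definition grad (R : realType) (n : nat) (f : 'rV[R]_n -> R) (x : 'rV[R]_n) :
    'rV[R]_n :=
  \row_(i < n) partial i f x.

(* Intended for open [U] in a finite-dimensional [V], where it is the usual
   notion. *)
Fixpoint Ck_on (R : realType) (V : normedModType R) (k : nat) (U : set V)
    (f : V -> R) : Prop :=
  match k with
  | 0 => forall x, U x -> {for x, continuous f}
  | k'.+1 => (forall x, U x -> differentiable f x) /\
             (forall v, Ck_on k' U ('D_v f))
  end.

Definition smooth_on (R : realType) (V : normedModType R) (U : set V)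
    (f : V -> R) : Prop :=
  forall k, Ck_on k U f.

Definition boundary (T : topologicalType) (A : set T) : set T :=
  closure A `\` interior A.

Definition domain (T : topologicalType) (A : set T) : Prop :=
  [/\ A !=set0, open A & connected A].

Definition local_defining_function (R : realType) (n : nat)
    (Omega : set 'rV[R]_n) (p : 'rV[R]_n) (rho : 'rV[R]_n -> R) : Prop :=
  exists U : set 'rV[R]_n,
    [/\ open U, U p, Ck_on 2 U rho, grad rho p != 0 &
        forall x, U x -> (Omega x <-> rho x < 0)].

Definition C2_boundary (R : realType) (n : nat) (Omega : set 'rV[R]_n) : Prop :=
  forall p, boundary Omega p ->
    exists rho, local_defining_function Omega p rho.

(* The principal curvatures are the eigenvalues of the second fundamental form
   of {rho = 0} on its tangent space at p, which is D^2 rho(p) / |grad rho(p)|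
   (independently of the choice of rho); [e] is an orthonormal frame of
   principal directions.  Since rho < 0 inside, the curvatures of the boundary
   of a ball are positive. *)
Definition principal_curvatures (R : realType) (n : nat)
    (Omega : set 'rV[R]_n) (p : 'rV[R]_n) (kappa : 'I_n.-1 -> R) : Prop :=
  exists (rho : 'rV[R]_n -> R) (e : 'I_n.-1 -> 'rV[R]_n),
    [/\ local_defining_function Omega p rho,
        forall i, dotp (e i) (grad rho p) = 0,
        forall i j, dotp (e i) (e j) = (i == j)%:R &
        forall i j, 'D_(e j) ('D_(e i) rho) p / enorm (grad rho p)
                    = kappa i * (i == j)%:R].

Definition mean_convex (R : realType) (n : nat) (Omega : set 'rV[R]_n) : Prop :=
  forall p, boundary Omega p ->
    exists2 kappa : 'I_n.-1 -> R,
      principal_curvatures Omega p kappa & 0 <= \sum_(i < n.-1) kappa i.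

Definition graphical_mcf (R : realType) (n : nat) (Omega : set 'rV[R]_n)
    (u : 'rV[R]_n -> R -> R) : Prop :=
  forall (x : 'rV[R]_n) (t : R), Omega x -> 0 < t ->
    derive1 (u x) t =
      \sum_(i < n) \sum_(j < n)
        ((i == j)%:R - partial i (u^~ t) x * partial j (u^~ t) x
                       / (1 + enorm (grad (u^~ t) x) ^+ 2))
        * partial i (partial j (u^~ t)) x.

(* The boundary values are prescribed for t > 0 only, and [u0] need not vanish
   on the boundary of [Omega]; hence no continuity is asked at the corner
   boundary x {0}, only local boundedness. *)
Definition smooth_dirichlet_mcf_solution (R : realType) (n : nat)
    (Omega : set 'rV[R]_n) (u0 : 'rV[R]_n -> R) (u : 'rV[R]_n -> R -> R) :
    Prop :=
  let U := fun p : 'rV[R]_n * R => u p.1 p.2 in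
  let Q := [set p : 'rV[R]_n * R | (closure Omega p.1 /\ 0 < p.2) \/
                                   (Omega p.1 /\ p.2 = 0)] in
  [/\ smooth_on [set p : 'rV[R]_n * R | Omega p.1 /\ 0 < p.2] U,
      {within Q, continuous U},
      forall x, boundary Omega x ->
        exists B : R, \forall p \near within Q (nbhs (x, 0)), `|U p| <= B,
      graphical_mcf Omega u &
      (forall (x : 'rV[R]_n) (t : R), boundary Omega x -> 0 < t -> u x t = 0) /\
      (forall x, Omega x -> u x 0 = u0 x)].

Definition curve_shortening_flow (R : realType) (phi : R -> R -> R) : Prop :=
  forall z t : R, 0 < z -> 0 < t ->
    derive1 (phi z) t = derive1n 2 (phi^~ t) z / (1 + derive1 (phi^~ t) z ^+ 2).

Definition csf_from_one (R : realType) (phi : R -> R -> R) : Prop :=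
  let Phi := fun p : R * R => phi p.1 p.2 in
  [/\ smooth_on [set p : R * R | 0 < p.1 /\ 0 < p.2] Phi,
      {within [set p : R * R | 0 <= p.1 /\ 0 < p.2], continuous Phi},
      curve_shortening_flow phi,
      forall t : R, 0 < t -> phi 0 t = 0 &
      (forall z : R, 0 < z -> phi z t @[t --> 0^'+] --> (1 : R)) /\
      (forall t : R, 0 < t -> phi z t @[z --> +oo] --> (1 : R))].

(* Main.v *)
Require Import Defs.
From mathcomp Require Import all_boot all_order all_algebra.
From mathcomp Require Import all_classical all_reals all_analysis.
From mathcomp Require Import ring lra.
Import Order.TTheory GRing.Theory Num.Theory.
Import numFieldNormedType.Exports.
Local Open Scope classical_set_scope.
Local Open Scope ring_scope.

(* If the inequality failed, [u y t - u x t - 2 M phi (|y - x| / 2 M, t / 4 M^2)], corrected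
   by small penalties, would have a positive maximum.  At an interior maximum the points are
   moved along the directions orthogonal to [y - x] in pairs, coupled by the square root of
   the coefficient matrix at [y]; with the variations along [y - x] the second-order
   conditions sum to the one-dimensional operator of the curve shortening flow.  When [x]
   lies outside [Omega] it is moved along parabolas that stay outside [Omega], and mean
   convexity gives the curvature terms a sign.

   The maximum has to be attained although at the corner of the parabolic boundary [u] is
   only locally bounded and [phi] not even that, and although [Omega] may be unbounded.
   - Near a boundary point [|u| <= M] for small times, up to an error: a barrier with a pole
     on a moving wall controls [u] outside a layer of width proportional to [t], and inside
     it a concave barrier descends by a multiple of the logarithm of the elapsed time.
     A shrinking paraboloid then gives [|u| <= M] everywhere.
   - For times [t >= s > 0] the solution has a modulus of continuity depending only on [M]
     and [s]: this is the same two-point argument, with the spatial profile replaced by its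
     inverse function [beta].
   - As [t] tends to [0], [phi] tends to [1] uniformly away from [z = 0]: by Baire's theorem
     it suffices to exclude isolated bad points, which is again done by barriers. *)

(** * Second-order expansions of functions of one variable *)

(** The hypotheses give neither monotonicity nor concavity of the profile in [z]. Hence the
    variations along [y - x] must reproduce the coefficient of the second derivative exactly, not up
    to a favourable sign, and a nonpositive slope at the boundary needs an argument of its own.
    Letting [x] range over the closed complement of [Omega], with the value 0 there, means that no
    derivative of [u] is ever taken on the boundary. The comparison of two points of [Omega] relies
    on this one-sided comparison to exclude maxima with a point on the boundary. A penalty in
    [|y|^2] tilts the gradient at [y] away from [y - x], so the coefficient matrices at the two
    points differ. Pairing the directions through a rotation or a matrix square root keeps the error
    controllable, and it vanishes with the penalty. The maximum principles are run on expansions of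
    functions of one real variable, because the admissible variations are curves, parabolas
    included, and a maximum is only ever tested along them. *)

Definition small {R : realType} (k : nat) (r : R -> R) : Prop :=
  forall e, 0 < e -> \forall s \near (0 : R), `|r s| <= e * `|s| ^+ k.

Definition jet1 {R : realType} (f : R -> R) (a b : R) : Prop :=
  small 1 (fun s => f s - (a + b * s)).

(* [c] is half the second derivative. *)
Definition jet2 {R : realType} (f : R -> R) (a b c : R) : Prop :=
  small 2 (fun s => f s - (a + b * s + c * s ^+ 2)).

Definition bounded_near0 {R : realType} (g : R -> R) : Prop :=
  exists B, \forall s \near (0 : R), `|g s| <= B.

Lemma near0_norm {R : realType} {e : R} : 0 < e -> \forall s \near (0 : R), `|s| <= e.
Proof.
move=> e0; exists e => //= s; rewrite /= sub0r normrN; exact: ltW.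
Qed.

Lemma smallD {R : realType} {k : nat} {r1 r2 : R -> R} :
  small k r1 -> small k r2 -> small k (fun s => r1 s + r2 s).
Proof.
move=> h1 h2 e e0; have e20 : 0 < e / 2 by lra.
near=> s; have b1 : `|r1 s| <= e / 2 * `|s| ^+ k by near: s; exact: h1.
have b2 : `|r2 s| <= e / 2 * `|s| ^+ k by near: s; exact: h2.
by apply: (le_trans (ler_normD _ _)); lra.
Unshelve. all: by end_near.
Qed.

Lemma smallM {R : realType} {k : nat} {g r : R -> R} :
  bounded_near0 g -> small k r -> small k (fun s => g s * r s).
Proof.
move=> [B hB] hr e e0.
have B0 : 0 < `|B| + 1 by rewrite ltr_wpDl.
have e10 : 0 < e / (`|B| + 1) by rewrite divr_gt0.
near=> s; have b1 : `|g s| <= B by near: s.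
have b2 : `|r s| <= e / (`|B| + 1) * `|s| ^+ k by near: s; exact: hr.
rewrite normrM.
have -> : e * `|s| ^+ k = (`|B| + 1) * (e / (`|B| + 1) * `|s| ^+ k).
  by field; rewrite gt_eqF.
by apply: ler_pM => //; have := ler_norm B; lra.
Unshelve. all: by end_near.
Qed.

Lemma bounded_near0_cst {R : realType} (a : R) : bounded_near0 (fun=> a).
Proof. by exists `|a|; apply: filterE. Qed.

Lemma bounded_near0_id {R : realType} : bounded_near0 (fun s : R => s).
Proof. by exists 1; exact: near0_norm. Qed.

Lemma bounded_near0D {R : realType} {f g : R -> R} :
  bounded_near0 f -> bounded_near0 g -> bounded_near0 (fun s => f s + g s).
Proof.
move=> [A hA] [B hB]; exists (A + B); near=> s.
have a1 : `|f s| <= A by near: s.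
have a2 : `|g s| <= B by near: s.
by apply: (le_trans (ler_normD _ _)); exact: lerD.
Unshelve. all: by end_near.
Qed.

Lemma bounded_near0M {R : realType} {f g : R -> R} :
  bounded_near0 f -> bounded_near0 g -> bounded_near0 (fun s => f s * g s).
Proof.
move=> [A hA] [B hB]; exists (A * B); near=> s.
have a1 : `|f s| <= A by near: s.
have a2 : `|g s| <= B by near: s.
by rewrite normrM; exact: ler_pM.
Unshelve. all: by end_near.
Qed.

Lemma bounded_near0X {R : realType} {f : R -> R} n :
  bounded_near0 f -> bounded_near0 (fun s => f s ^+ n).
Proof.
move=> [A hA]; exists (A ^+ n); near=> s.
have h : `|f s| <= A by near: s.
by rewrite normrX lerXn2r ?nnegrE //; apply: le_trans h.
Unshelve. all: by end_near.
Qed.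

Lemma small_pow {R : realType} (k : nat) : small k (fun s : R => s ^+ k.+1).
Proof.
move=> e e0; near=> s; have h : `|s| <= e by near: s; exact: near0_norm.
by rewrite normrX exprS ler_wpM2r ?exprn_ge0.
Unshelve. all: by end_near.
Qed.

Lemma small_bounded {R : realType} {k : nat} {r : R -> R} : small k r -> bounded_near0 r.
Proof.
move=> hr; exists 1; near=> s.
have h1 : `|r s| <= 1 * `|s| ^+ k by near: s; exact: hr.
have h2 : `|s| <= 1 by near: s; exact: near0_norm.
apply: (le_trans h1); rewrite mul1r; exact: exprn_ile1.
Unshelve. all: by end_near.
Qed.

Lemma small_ext {R : realType} {k : nat} (r1 : R -> R) {r2 : R -> R} :
  small k r1 -> (forall s, r2 s = r1 s) -> small k r2.
Proof. by move=> h E e e0; have := h e e0; apply: filterS => s; rewrite E. Qed.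

Lemma small_near {R : realType} {k : nat} (r1 : R -> R) {r2 : R -> R} :
  small k r1 -> (\forall s \near (0 : R), r2 s = r1 s) -> small k r2.
Proof.
move=> h E e e0; near=> s.
have -> : r2 s = r1 s by near: s.
by near: s; exact: h.
Unshelve. all: by end_near.
Qed.

Lemma jet2_bounded {R : realType} {f : R -> R} {a b c : R} : jet2 f a b c -> bounded_near0 f.
Proof.
move=> /small_bounded h.
have h2 : bounded_near0 (fun s => (f s - (a + b * s + c * s ^+ 2)) + (a + b * s + c * s ^+ 2)).
  apply: bounded_near0D => //; apply: bounded_near0D; first apply: bounded_near0D.
  - exact: bounded_near0_cst.
  - by apply: bounded_near0M; [exact: bounded_near0_cst|exact: bounded_near0_id].
  - apply: bounded_near0M; [exact: bounded_near0_cst|].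
    by apply: bounded_near0X; exact: bounded_near0_id.
by case: h2 => B hB; exists B; move: hB; apply: filterS => s; rewrite subrK.
Qed.

Lemma jet2_poly {R : realType} (a b c : R) : jet2 (fun s => a + b * s + c * s ^+ 2) a b c.
Proof.
move=> e e0; apply: filterE => s; rewrite subrr normr0; apply: mulr_ge0; [lra|exact: exprn_ge0].
Qed.

Lemma jet2_ext {R : realType} (f : R -> R) {g : R -> R} {a b c : R} (a' b' c' : R) :
  jet2 f a' b' c' -> (forall s, g s = f s) -> a = a' -> b = b' -> c = c' -> jet2 g a b c.
Proof. by move=> h E -> -> ->; apply: small_ext h _ => s; rewrite E. Qed.

Lemma jet2D {R : realType} {f g : R -> R} {a b c a' b' c' : R} :
  jet2 f a b c -> jet2 g a' b' c' -> jet2 (fun s => f s + g s) (a + a') (b + b') (c + c').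
Proof. by move=> h1 h2; apply: small_ext (smallD h1 h2) _ => s; ring. Qed.

Lemma jet2Z {R : realType} {f : R -> R} {a b c : R} (k : R) :
  jet2 f a b c -> jet2 (fun s => k * f s) (k * a) (k * b) (k * c).
Proof.
move=> h; apply: small_ext (smallM (bounded_near0_cst k) h) _ => s; ring.
Qed.

Lemma jet2N {R : realType} {f : R -> R} {a b c : R} :
  jet2 f a b c -> jet2 (fun s => - f s) (- a) (- b) (- c).
Proof.
by move=> /(jet2Z (-1)) h; apply: (jet2_ext _ _ _ _ h) => *; rewrite mulN1r.
Qed.

Lemma jet2B {R : realType} {f g : R -> R} {a b c a' b' c' : R} :
  jet2 f a b c -> jet2 g a' b' c' -> jet2 (fun s => f s - g s) (a - a') (b - b') (c - c').
Proof. by move=> h1 /jet2N h2; exact: jet2D h1 h2. Qed.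

Lemma jet2M {R : realType} {f g : R -> R} {a b c a' b' c' : R} :
  jet2 f a b c -> jet2 g a' b' c' ->
  jet2 (fun s => f s * g s) (a * a') (a * b' + b * a') (a * c' + b * b' + c * a').
Proof.
move=> h1 h2.
have bf := jet2_bounded h1.
have bP := jet2_bounded (jet2_poly a' b' c').
have k1 := smallM bf h2; have k2 := smallM bP h1.
have k3 : small 2 (fun s : R => (b * c' + c * b' + c * c' * s) * s ^+ 3).
  apply: smallM; last exact: small_pow.
  apply: bounded_near0D; first exact: bounded_near0_cst.
  by apply: bounded_near0M; [exact: bounded_near0_cst|exact: bounded_near0_id].
by apply: small_ext (smallD (smallD k1 k2) k3) _ => s; ring.
Qed.

Lemma jet2_lip {R : realType} {f : R -> R} {a b c : R} : jet2 f a b c ->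
  exists2 B, 0 < B & \forall s \near (0 : R), `|f s - a| <= B * `|s|.
Proof.
move=> h; exists (`|b| + `|c| + 1).
  by rewrite ltr_wpDl // addr_ge0.
near=> s.
have h1 : `|f s - (a + b * s + c * s ^+ 2)| <= 1 * `|s| ^+ 2 by near: s; exact: h.
have h2 : `|s| <= 1 by near: s; exact: near0_norm.
have -> : f s - a = (f s - (a + b * s + c * s ^+ 2)) + (b * s + c * s ^+ 2) by ring.
apply: (le_trans (ler_normD _ _)).
have h3 : `|b * s + c * s ^+ 2| <= `|b| * `|s| + `|c| * `|s| ^+ 2.
  by apply: (le_trans (ler_normD _ _)); rewrite (normrM b) (normrM c) normrX.
have h4 : `|s| ^+ 2 <= `|s| by rewrite expr2 ler_piMr.
have h5 : `|c| * `|s| ^+ 2 <= `|c| * `|s| by rewrite ler_wpM2l.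
lra.
Unshelve. all: by end_near.
Qed.

Lemma jet2_cvg0 {R : realType} {f : R -> R} {a b c : R} : jet2 f a b c ->
  (fun s => f s - a) @ (0 : R) --> (0 : R).
Proof.
move=> /jet2_lip [B B0 hB]; apply/cvgrPdist_le => e e0.
near=> s; rewrite sub0r normrN.
have h1 : `|f s - a| <= B * `|s| by near: s.
have h2 : `|s| <= e / B by near: s; apply: near0_norm; rewrite divr_gt0.
by apply: (le_trans h1); rewrite mulrC -ler_pdivlMr.
Unshelve. all: by end_near.
Qed.

Lemma jet2_comp {R : realType} {g f : R -> R} {a b c g0 g1 g2 : R} :
  jet2 f a b c -> jet2 (fun h => g (a + h)) g0 g1 g2 ->
  jet2 (fun s => g (f s)) g0 (g1 * b) (g1 * c + g2 * b ^+ 2).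
Proof.
move=> hf hg.
have [B B0 hB] := jet2_lip hf.
have s1 : small 2 (fun s => g (f s) - (g0 + g1 * (f s - a) + g2 * (f s - a) ^+ 2)).
  move=> e e0.
  have e1 : 0 < e / B ^+ 2 by rewrite divr_gt0 // exprn_gt0.
  have /= hh := jet2_cvg0 hf _ (hg _ e1).
  near=> s.
  have h1 : `|f s - a| <= B * `|s| by near: s.
  have h2 : `|g (a + (f s - a)) - (g0 + g1 * (f s - a) + g2 * (f s - a) ^+ 2)|
      <= e / B ^+ 2 * `|f s - a| ^+ 2 by near: s.
  rewrite (addrC a) subrK in h2; apply: (le_trans h2).
  have h3 : `|f s - a| ^+ 2 <= (B * `|s|) ^+ 2.
    by rewrite lerXn2r ?nnegrE // mulr_ge0 // ltW.
  apply: (le_trans (ler_wpM2l (ltW e1) h3)).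
  by rewrite exprMn mulrA divfK // expf_neq0 // gt_eqF.
have s2 : small 2 (fun s => g1 * (f s - (a + b * s + c * s ^+ 2))).
  exact: (smallM (bounded_near0_cst g1) hf).
have hp : jet2 (fun s => (f s - a) ^+ 2) 0 0 (b ^+ 2).
  have h0 := jet2B hf (jet2_poly a 0 0).
  apply: (jet2_ext _ _ _ _ (jet2M h0 h0)) => [s|||]; ring.
have s3 := smallM (bounded_near0_cst g2) hp.
by apply: small_ext (smallD (smallD s1 s2) s3) _ => s; ring.
Unshelve. all: by end_near.
Qed.

Lemma jet2_max {R : realType} {f : R -> R} {a b c : R} : jet2 f a b c ->
  (\forall s \near (0 : R), f s <= a) -> b = 0 /\ c <= 0.
Proof.
move=> h hm.
have b0 : b = 0.
  apply: contrapT => /eqP bn0.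
  have B0 : 0 < `|b| by rewrite normr_gt0.
  pose d : R := `|c| + 1.
  have d0 : 0 < d by rewrite /d ltr_wpDl.
  have hh : \forall s \near (0 : R), f s <= a /\
      `|f s - (a + b * s + c * s ^+ 2)| <= 1 * `|s| ^+ 2.
    by near=> s; split; near: s => //; exact: h.
  have [e /= e0 he] := hh.
  near (0 : R)^'+ => s0.
  have s00 : 0 < s0 by near: s0; exact: nbhs_right_gt.
  have [s sE [s1 s2]] : exists2 s, `|s| = s0 & b * s = `|b| * s0 /\
     (f s <= a /\ `|f s - (a + b * s + c * s ^+ 2)| <= 1 * `|s| ^+ 2).
    have se : s0 < e by by near: s0; apply: nbhs_right_lt; exact: e0.
    have [bp|bm] := leP 0 b.
      exists s0; first by rewrite gtr0_norm.
      split; first by rewrite ger0_norm.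
      by apply: he; rewrite /= sub0r normrN gtr0_norm.
    exists (- s0); first by rewrite normrN gtr0_norm.
    split; first by rewrite ltr0_norm // mulrN mulNr.
    by apply: he; rewrite /= sub0r opprK gtr0_norm.
  case: s2 => s2 s3; move: s3; rewrite ler_norml => /andP[s3 _].
  have s4 : d * s0 < `|b|.
    rewrite mulrC -ltr_pdivlMr //; near: s0; apply: nbhs_right_lt; exact: divr_gt0.
  have cs : - (`|c| * s0 ^+ 2) <= c * s ^+ 2.
    rewrite -sE real_normK ?num_real // -mulNr; apply: ler_wpM2r; first exact: sqr_ge0.
    by rewrite lerNl -normrN ler_norm.
  rewrite sE in s3.
  have : d * s0 * s0 < `|b| * s0 by rewrite ltr_pM2r.
  rewrite s1 in s3; rewrite /d; move: s2 s3 cs; rewrite !mul1r expr2; lra.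
split => //; rewrite leNgt; apply/negP => c0.
have c20 : 0 < c / 2 by lra.
near (0 : R)^'+ => s.
have s00 : 0 < s by near: s; exact: nbhs_right_gt.
have h1 : f s <= a by near: s; rewrite near_withinE; apply: filterS hm.
have : `|f s - (a + b * s + c * s ^+ 2)| <= c / 2 * `|s| ^+ 2.
  by near: s; rewrite near_withinE; apply: filterS (h _ c20).
rewrite b0 mul0r addr0 ler_norml => /andP[h2 _].
have : 0 < c * s ^+ 2 by rewrite mulr_gt0 // exprn_gt0.
move: h2; rewrite gtr0_norm //; lra.
Unshelve. all: by end_near.
Qed.

Lemma jet1_ext {R : realType} (f : R -> R) {g : R -> R} {a b : R} (a' b' : R) :
  jet1 f a' b' -> (forall s, g s = f s) -> a = a' -> b = b' -> jet1 g a b.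
Proof. by move=> h E -> ->; apply: small_ext h _ => s; rewrite E. Qed.

Lemma jet1D {R : realType} {f g : R -> R} {a b a' b' : R} :
  jet1 f a b -> jet1 g a' b' -> jet1 (fun s => f s + g s) (a + a') (b + b').
Proof. by move=> h1 h2; apply: small_ext (smallD h1 h2) _ => s; ring. Qed.

Lemma jet1Z {R : realType} {f : R -> R} {a b : R} (k : R) :
  jet1 f a b -> jet1 (fun s => k * f s) (k * a) (k * b).
Proof. by move=> h; apply: small_ext (smallM (bounded_near0_cst k) h) _ => s; ring. Qed.

Lemma jet1N {R : realType} {f : R -> R} {a b : R} :
  jet1 f a b -> jet1 (fun s => - f s) (- a) (- b).
Proof. by move=> /(jet1Z (-1)) h; apply: (jet1_ext _ _ _ h) => *; rewrite mulN1r. Qed.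

Lemma jet1B {R : realType} {f g : R -> R} {a b a' b' : R} :
  jet1 f a b -> jet1 g a' b' -> jet1 (fun s => f s - g s) (a - a') (b - b').
Proof. by move=> h1 /jet1N h2; exact: jet1D h1 h2. Qed.

Lemma jet1_poly {R : realType} (a b c : R) : jet1 (fun s => a + b * s + c * s ^+ 2) a b.
Proof.
apply: small_ext (smallM (bounded_near0_cst c) (small_pow 1)) _ => s; ring.
Qed.

Lemma jet1_cst {R : realType} (a : R) : jet1 (fun=> a) a 0.
Proof. by apply: (jet1_ext _ _ _ (jet1_poly a 0 0)) => // s; ring. Qed.

Lemma jet2_cst {R : realType} (a : R) : jet2 (fun=> a) a 0 0.
Proof. by apply: (jet2_ext _ _ _ _ (jet2_poly a 0 0)) => // s; ring. Qed.

Lemma jet1M {R : realType} {f g : R -> R} {a b a' b' : R} :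
  jet1 f a b -> jet1 g a' b' -> jet1 (fun s => f s * g s) (a * a') (a * b' + b * a').
Proof.
move=> h1 h2.
have bl c d : bounded_near0 (fun s : R => c + d * s).
  apply: bounded_near0D; first exact: bounded_near0_cst.
  by apply: bounded_near0M; [exact: bounded_near0_cst|exact: bounded_near0_id].
have bf : bounded_near0 f.
  have [B hB] := bounded_near0D (small_bounded h1) (bl a b).
  by exists B; move: hB; apply: filterS => s; rewrite subrK.
have k1 := smallM bf h2; have k2 := smallM (bl a' b') h1.
have k3 := smallM (bounded_near0_cst (b * b')) (@small_pow R 1).
by apply: small_ext (smallD (smallD k1 k2) k3) _ => s; ring.
Qed.

Lemma jet1_comp {R : realType} {g f : R -> R} {a b g0 g1 : R} :
  jet1 f a b -> jet1 (fun h => g (a + h)) g0 g1 -> jet1 (fun s => g (f s)) g0 (g1 * b).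
Proof.
move=> hf hg; pose B := `|b| + 1.
have B0 : 0 < B by rewrite ltr_wpDl.
have hB : \forall s \near (0 : R), `|f s - a| <= B * `|s|.
  near=> s.
  have h1 : `|f s - (a + b * s)| <= 1 * `|s| ^+ 1 by near: s; exact: hf.
  have -> : f s - a = (f s - (a + b * s)) + b * s by ring.
  apply: (le_trans (ler_normD _ _)); rewrite (normrM b) /B; rewrite expr1 in h1; lra.
have c0 : (fun s => f s - a) @ (0 : R) --> (0 : R).
  apply/cvgrPdist_le => e e0; near=> s; rewrite sub0r normrN.
  have h1 : `|f s - a| <= B * `|s| by near: s.
  have h2 : `|s| <= e / B by near: s; apply: near0_norm; rewrite divr_gt0.
  by apply: (le_trans h1); rewrite mulrC -ler_pdivlMr.
have s1 : small 1 (fun s => g (f s) - (g0 + g1 * (f s - a))).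
  move=> e e0; have e1 : 0 < e / B by rewrite divr_gt0.
  have /= hh := c0 _ (hg _ e1).
  near=> s.
  have h1 : `|f s - a| <= B * `|s| by near: s.
  have h2 : `|g (a + (f s - a)) - (g0 + g1 * (f s - a))| <= e / B * `|f s - a| ^+ 1 by near: s.
  rewrite (addrC a) subrK in h2; apply: (le_trans h2); rewrite !expr1.
  apply: (le_trans (ler_wpM2l (ltW e1) h1)).
  by rewrite mulrA divfK // gt_eqF.
have s2 := smallM (bounded_near0_cst g1) hf.
by apply: small_ext (smallD s1 s2) _ => s; ring.
Unshelve. all: by end_near.
Qed.

Lemma jet1_left_max {R : realType} {f : R -> R} {a b : R} : jet1 f a b ->
  (\forall s \near (0 : R), s <= 0 -> f s <= a) -> 0 <= b.
Proof.
move=> h hm; rewrite leNgt; apply/negP => b0.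
have b1 : 0 < - b / 2 by lra.
have [e /= e0 he] := filterI hm (h _ b1).
have [|h1 h2] := he (- (e / 2)).
  rewrite /= sub0r opprK gtr0_norm; last by lra.
  by lra.
have e2 : 0 < e / 2 by lra.
have := h1 ltac:(lra); move: h2; rewrite expr1 normrN (gtr0_norm e2) ler_norml => /andP[h2 _] h3.
have : 0 < - b * (e / 2) by rewrite mulr_gt0 // oppr_gt0.
lra.
Qed.

Lemma is_derive_line {R : realType} {V : normedModType R} {f : V -> R} {x v : V} {s a : R} :
  is_derive (x + s *: v) v f a -> is_derive s 1 (fun s => f (x + s *: v)) a.
Proof.
move=> [h1 h2].
have E : (fun h : R => h^-1 *: ((f \o shift (x + s *: v)) (h *: v) - f (x + s *: v)))
  = (fun h => h^-1 *: (((fun s => f (x + s *: v)) \o shift s) (h *: (1 : R)) - f (x + s *: v))).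
  apply/funext => h /=; congr (_ *: (f _ - _)).
  by rewrite [h *: 1]mulr1 scalerDl addrCA addrA addrAC.
by split; [rewrite /derivable -E|rewrite -h2 /derive E].
Qed.

Lemma jet1_derive {R : realType} {V : normedModType R} {f : V -> R} {x v : V} {a : R} :
  is_derive x v f a -> jet1 (fun s => f (x + s *: v)) (f x) a.
Proof.
move=> [h1 h2] e e0.
have : (fun h : R => h^-1 *: ((f \o shift x) (h *: v) - f x)) @ 0^' --> a.
  by rewrite -h2; exact: h1.
move=> /cvgrPdist_le /(_ e e0) /=.
rewrite near_withinE; apply: filterS => s hs.
have [->|s0] := eqVneq s 0.
  by rewrite scale0r addr0 mulr0 addr0 subrr normr0 expr1 mulr0.
have s1 : 0 < `|s| by rewrite normr_gt0.
have := hs s0; rewrite -(ler_pM2r s1) -normrM expr1 addrC => hh.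
apply: le_trans hh; rewrite -normrN le_eqVlt; apply/orP; left; apply/eqP; congr (`|_|).
rewrite /= [s *: v + x]addrC; set A := f _; set B := f _.
by rewrite -[_ *: _]/(s^-1 * (A - B)); field.
Qed.

(** The derivative [g] along [v] need only be differentiable at the single point [x]: the mean value
    theorem, applied to the error of the quadratic polynomial, reduces the claim to the first-order
    expansion of [g]. *)
Lemma jet2_taylor {R : realType} {V : normedModType R} {f g : V -> R} {x v : V} {d : R} :
  (\forall y \near x, is_derive y v f (g y)) -> is_derive x v g d ->
  jet2 (fun s => f (x + s *: v)) (f x) (g x) (d / 2).
Proof.
move=> hf /jet1_derive hg e e0.
have cx : (fun s : R => x + s *: v) @ (0 : R) --> x.
  rewrite -[in X in _ --> X](addr0 x) -(scale0r v).
  apply: cvgD; first exact: cvg_cst.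
  by apply: cvgZr_tmp; exact: cvg_id.
have hf0 : \forall s \near (0 : R), is_derive (x + s *: v) v f (g (x + s *: v)) by exact: (cx _ hf).
have [r /= r0 hr] := filterI hf0 (hg _ e0).
exists r => //= s; rewrite /= sub0r normrN => sr.
pose F := fun t : R => f (x + t *: v) - (f x + g x * t + d / 2 * t ^+ 2).
have dF (t : R) : `|t| < r -> is_derive t 1 F (g (x + t *: v) - (g x + d * t)).
  move=> tr; have [|h1 _] := hr t; first by rewrite /= sub0r normrN.
  have h2 := is_derive_line h1.
  apply: is_derive_eq.
  by rewrite /GRing.scale /= !(mulr0, addr0, mulr1, add0r); field.
(* Rescaling to the unit interval treats both signs of [s] at once. *)
pose G := F \o ( *%R s).
have dG (q : R) : `|q| <= 1 -> is_derive q 1 G ((g (x + (s * q) *: v) - (g x + d * (s * q))) * s).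
  move=> t1; apply: is_derive1_comp.
    by apply: dF; rewrite normrM (le_lt_trans _ sr) // ler_piMr.
  by apply: is_derive_eq; rewrite /GRing.scale /= mulr1.
have [||c] := @MVT R G (fun t => (g (x + (s * t) *: v) - (g x + d * (s * t))) * s) 0 1 ltr01.
- by move=> t; rewrite in_itv /= => /andP[t0 t1]; apply: dG; rewrite ger0_norm ltW.
- apply: derivable_within_continuous => t; rewrite in_itv /= => /andP[t0 t1].
  by have [] := dG t _; first by rewrite ger0_norm.
rewrite in_itv /= => /andP[c0 c1].
rewrite /G /= mulr0 mulr1 subr0 mulr1 /F scale0r addr0 !(mulr0, addr0, expr0n, subrr, subr0) /= => ->.
have sc : `|s * c| <= `|s| by rewrite normrM ler_piMr // ger0_norm // ltW.
have [|_] := hr (s * c); first by rewrite /= sub0r normrN (le_lt_trans sc).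
rewrite expr1 => h3; rewrite (normrM _ s) (expr2 `|s|).
have h4 : e * `|s * c| <= e * `|s| by rewrite ler_wpM2l // ltW.
by rewrite (mulrA e); apply: ler_wpM2r => //; exact: le_trans h3 h4.
Qed.

Lemma jet2_jet1 {R : realType} {f : R -> R} {a b c : R} : jet2 f a b c -> jet1 f a b.
Proof.
move=> h e e0; have e20 : 0 < e / 2 by lra.
have c0 : 0 < `|c| + 1 by rewrite ltr_wpDl.
near=> s; rewrite expr1.
have h1 : `|f s - (a + b * s + c * s ^+ 2)| <= e / 2 * `|s| ^+ 2 by near: s; exact: h.
have h2 : `|s| <= 1 by near: s; exact: near0_norm.
have h3 : `|s| <= e / 2 / (`|c| + 1) by near: s; apply: near0_norm; exact: divr_gt0.
have -> : f s - (a + b * s) = (f s - (a + b * s + c * s ^+ 2)) + c * s ^+ 2 by ring.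
apply: (le_trans (ler_normD _ _)); rewrite (normrM c) normrX.
have h4 : `|s| ^+ 2 <= `|s| by rewrite expr2 ler_piMr.
have h5 : `|c| * `|s| ^+ 2 <= e / 2 * `|s|.
  rewrite expr2 mulrA ler_wpM2r //.
  apply: (@le_trans _ _ ((`|c| + 1) * (e / 2 / (`|c| + 1)))).
    by apply: ler_pM => //; lra.
  by rewrite mulrC divfK // gt_eqF.
have h6 : e / 2 * `|s| ^+ 2 <= e / 2 * `|s| by rewrite ler_wpM2l // ltW.
lra.
Unshelve. all: by end_near.
Qed.

Lemma jet2_sqrt {R : realType} {f : R -> R} {a b c : R} : 0 < a ->
  jet2 f (a ^+ 2) b c ->
  jet2 (fun s => Num.sqrt (f s)) a (b / (2 * a)) (c / (2 * a) - b ^+ 2 / (8 * a ^+ 3)).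
Proof.
move=> a0 h.
have a20 : 0 < a ^+ 2 by rewrite exprn_gt0.
have hs : jet2 (fun s => Num.sqrt (a ^+ 2 + s)) a (2 * a)^-1 (- (8 * a ^+ 3)^-1).
  have s1 : \forall y \near (a ^+ 2 : R), is_derive (y : R) (1 : R) (Num.sqrt : R -> R) (2 * Num.sqrt y)^-1.
    near=> y; apply: is_derive1_sqrt; near: y; apply: (@cvgr_gt R R (nbhs (a ^+ 2)) _ id (a ^+ 2)) => //; exact: cvg_id.
  have E : Num.sqrt (a ^+ 2) = a by rewrite sqrtr_sqr gtr0_norm.
  have s2 : is_derive (a ^+ 2 : R) (1 : R) (fun y : R => (2 * Num.sqrt y)^-1) (- (4 * a ^+ 3)^-1).
    have hq := is_derive1_sqrt a20.
    have n0 : 2 * Num.sqrt (a ^+ 2) != 0 by rewrite E gt_eqF // mulr_gt0.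
    have n1 : a != 0 by rewrite gt_eqF.
    have hm := @is_deriveZ R R R Num.sqrt 2 (a ^+ 2) 1 _ hq.
    have [d1 d2] : is_derive (a ^+ 2 : R) (1 : R) (fun y : R => 2 * Num.sqrt y)
      (2 * (2 * Num.sqrt (a ^+ 2))^-1) := hm.
    split; first by apply: derivableV.
    rewrite deriveV // d2 E -[_ *: _]/(_ * _).
    by field.
  have := jet2_taylor s1 s2; rewrite E => hh.
  apply: (jet2_ext _ _ _ _ hh) => // [s|]; first by rewrite [s *: 1]mulr1.
  by field; rewrite gt_eqF.
apply: (jet2_ext _ _ _ _ (jet2_comp h hs)) => //; field; rewrite gt_eqF //.
Unshelve. all: by end_near.
Qed.

(** * The operator of the mean curvature flow *)

Section Dot.
Context {R : realType} {n : nat}.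
Implicit Types (u v w p e b : 'rV[R]_n).

Lemma dotpC v w : dotp v w = dotp w v.
Proof. by apply: eq_bigr => i _; rewrite mulrC. Qed.

Lemma dotpDl u v w : dotp (u + v) w = dotp u w + dotp v w.
Proof. by rewrite /dotp -big_split; apply: eq_bigr => i _; rewrite !mxE mulrDl. Qed.

Lemma dotpZl (k : R) v w : dotp (k *: v) w = k * dotp v w.
Proof. by rewrite /dotp mulr_sumr; apply: eq_bigr => i _; rewrite !mxE mulrA. Qed.

Lemma dotpNl v w : dotp (- v) w = - dotp v w.
Proof. by rewrite -scaleN1r dotpZl mulN1r. Qed.

Lemma dotpDr u v w : dotp u (v + w) = dotp u v + dotp u w.
Proof. by rewrite dotpC dotpDl !(dotpC u). Qed.

Lemma dotpZr (k : R) v w : dotp v (k *: w) = k * dotp v w.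
Proof. by rewrite dotpC dotpZl (dotpC v). Qed.

Lemma dotpNr v w : dotp v (- w) = - dotp v w.
Proof. by rewrite dotpC dotpNl (dotpC v). Qed.

Lemma dotp0l v : dotp 0 v = 0.
Proof. by rewrite -(scale0r 0) dotpZl mul0r. Qed.

Lemma dotp0r v : dotp v 0 = 0.
Proof. by rewrite dotpC dotp0l. Qed.

Definition dotpE := (dotpDl, dotpDr, dotpZl, dotpZr, dotpNl, dotpNr, dotp0l, dotp0r).

Lemma dotp_ge0 v : 0 <= dotp v v.
Proof. by apply: sumr_ge0 => i _; rewrite -expr2 sqr_ge0. Qed.

Lemma dotp_eq0 v : dotp v v = 0 -> v = 0.
Proof.
move=> /eqP; rewrite psumr_eq0 => [/allP h|i _]; last by rewrite -expr2 sqr_ge0.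
apply/rowP => i; rewrite mxE; apply/eqP.
by have := h i (mem_index_enum _); rewrite implyTb -expr2 sqrf_eq0.
Qed.

Lemma dotp_CS v w : dotp v w ^+ 2 <= dotp v v * dotp w w.
Proof.
have [w0|w0] := eqVneq (dotp w w) 0.
  by rewrite (dotp_eq0 _ w0) !dotpE expr0n /= mulr0.
have wp : 0 < dotp w w by rewrite lt_neqAle eq_sym w0 dotp_ge0.
have := dotp_ge0 (dotp w w *: v - dotp v w *: w).
rewrite !dotpE (dotpC w v) => h.
have : 0 <= dotp w w * (dotp v v * dotp w w - dotp v w ^+ 2) by nra.
by rewrite pmulr_rge0 // subr_ge0.
Qed.

Lemma enorm_ge0 v : 0 <= enorm v.
Proof. exact: sqrtr_ge0. Qed.

Lemma enorm_sqr v : enorm v ^+ 2 = dotp v v.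
Proof. by rewrite sqr_sqrtr // dotp_ge0. Qed.

Lemma dotp_eps (k : 'I_n) v : dotp v (delta_mx ord0 k) = v ord0 k.
Proof.
rewrite /dotp (bigD1 k) //= big1 ?addr0 => [|i ik]; rewrite !mxE !eqxx /=.
  by rewrite mulr1.
by rewrite (negbTE ik) mulr0.
Qed.

Lemma sum_dotp_eps v w :
  \sum_(k < n) dotp v (delta_mx ord0 k) * dotp w (delta_mx ord0 k) = dotp v w.
Proof. by apply: eq_bigr => k _; rewrite !dotp_eps. Qed.

Lemma sum_dotp_eps2 v : \sum_(k < n) dotp v (delta_mx ord0 k) ^+ 2 = dotp v v.
Proof. by rewrite -sum_dotp_eps; apply: eq_bigr => k _; rewrite expr2. Qed.

Definition qf (H : 'M[R]_n) v : R := \sum_i \sum_j H i j * (v ord0 i * v ord0 j).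

Lemma qfZ H (k : R) v : qf H (k *: v) = k ^+ 2 * qf H v.
Proof.
rewrite /qf mulr_sumr; apply: eq_bigr => i _; rewrite mulr_sumr.
by apply: eq_bigr => j _; rewrite !mxE; ring.
Qed.

Definition mcfa p (i j : 'I_n) : R := (i == j)%:R - p ord0 i * p ord0 j / (1 + dotp p p).

Definition mcfop p (H : 'M[R]_n) : R := \sum_i \sum_j mcfa p i j * H i j.

Lemma onep_gt0 p : 0 < 1 + dotp p p.
Proof. by rewrite ltr_pwDl // dotp_ge0. Qed.

(** The matrix [I + a' a^T + b' b^T]. All direction fields used in the couplings have this form, so
    one computation of a matrix times its transpose serves them all. *)
Definition rk2 (a a' b b' v : 'rV[R]_n) : 'rV[R]_n := v + dotp a v *: a' + dotp b v *: b'.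

Definition covrk2 (a a' b b' : 'rV[R]_n) (i j : 'I_n) : R :=
  (i == j)%:R + a' ord0 i * a ord0 j + a ord0 i * a' ord0 j
  + b' ord0 i * b ord0 j + b ord0 i * b' ord0 j
  + dotp a a * (a' ord0 i * a' ord0 j) + dotp b b * (b' ord0 i * b' ord0 j)
  + dotp a b * (a' ord0 i * b' ord0 j + b' ord0 i * a' ord0 j).

(** The sum of [H] over the images of the standard basis under a matrix [A] is the trace of
    [H A A^T], and [covrk2] lists the entries of [A A^T]. *)
Lemma sum_qf_rk2 H a a' b b' :
  \sum_(k < n) qf H (rk2 a a' b b' (delta_mx ord0 k))
  = \sum_i \sum_j H i j * covrk2 a a' b b' i j.
Proof.
rewrite /qf exchange_big; apply: eq_bigr => i _; rewrite exchange_big; apply: eq_bigr => j _.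
rewrite -mulr_sumr; congr (_ * _).
pose D (m : 'I_n) (k : 'I_n) : R := (m == k)%:R.
have D1 c m : \sum_(k < n) c ord0 k * D m k = c ord0 m :> R.
  rewrite (bigD1 m) //= big1 ?addr0 /D ?eqxx ?mulr1 // => k km.
  by rewrite eq_sym (negbTE km) mulr0.
have D2 : \sum_(k < n) D i k * D j k = (i == j)%:R :> R.
  rewrite (bigD1 j) //= big1 ?addr0 /D ?eqxx ?mulr1 // => k km.
  by rewrite [j == k]eq_sym (negbTE km) mulr0.
transitivity (\sum_(k < n) (D i k * D j k + a' ord0 j * (a ord0 k * D i k)
   + a' ord0 i * (a ord0 k * D j k) + b' ord0 j * (b ord0 k * D i k)
   + b' ord0 i * (b ord0 k * D j k)
   + (a' ord0 i * a' ord0 j) * (a ord0 k * a ord0 k)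
   + (b' ord0 i * b' ord0 j) * (b ord0 k * b ord0 k)
   + (a' ord0 i * b' ord0 j + b' ord0 i * a' ord0 j) * (a ord0 k * b ord0 k))).
  apply: eq_bigr => k _; rewrite /rk2 !mxE !dotp_eps /D eqxx /=; ring.
rewrite !big_split /= -!mulr_sumr !D1 D2 /covrk2 /dotp; ring.
Qed.

Lemma mcfop_cov p (H : 'M[R]_n) (C : 'I_n -> 'I_n -> R) :
  (forall i j, C i j = mcfa p i j) -> \sum_i \sum_j H i j * C i j = mcfop p H.
Proof.
by move=> E; apply: eq_bigr => i _; apply: eq_bigr => j _; rewrite E mulrC.
Qed.

(* [I - msq p *: p^T p] is the positive square root of the matrix [mcfa p]. *)
Definition msq p : R :=
  let w := Num.sqrt (1 + dotp p p) in (w * (1 + w))^-1.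

(** With [c = msq p] this compares the coefficients of [p p^T] in [(I - c p p^T)^2 = I - p p^T / (1
    + |p|^2)]. *)
Lemma msq_eq p : dotp p p * msq p ^+ 2 = 2 * msq p - (1 + dotp p p)^-1.
Proof.
rewrite /msq; set w := Num.sqrt _.
have w0 : 0 < w by rewrite sqrtr_gt0 onep_gt0.
have wE : 1 + dotp p p = w ^+ 2 by rewrite sqr_sqrtr // ltW // onep_gt0.
have -> : dotp p p = w ^+ 2 - 1 by rewrite -wE; ring.
have -> : 1 + (w ^+ 2 - 1) = w ^+ 2 by ring.
by field; rewrite !gt_eqF //; lra.
Qed.

(** Unlike [rotv] it makes sense for every gradient, zero included. It is used where the slope of
    the profile may vanish. *)
Definition msqv p v : 'rV[R]_n := v - (msq p * dotp p v) *: p.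

Lemma sum_qf_msq p H : \sum_(k < n) qf H (msqv p (delta_mx ord0 k)) = mcfop p H.
Proof.
have E k : msqv p (delta_mx ord0 k) = rk2 p (- msq p *: p) 0 0 (delta_mx ord0 k).
  by rewrite /rk2 /msqv scaler0 addr0 scalerA mulrN scaleNr (mulrC (dotp _ _)).
under eq_bigr do rewrite E.
rewrite sum_qf_rk2; apply: mcfop_cov => i j.
rewrite /covrk2 /mcfa !dotpE !mxE.
have := msq_eq p; set c := msq p; set q := dotp p p.
set s := (1 + q)^-1 => h; set pi := p _ i; set pj := p _ j.
have -> : pi * pj * s = pi * pj * (2 * c - q * c ^+ 2) by rewrite h; ring.
by ring.
Qed.

(** The projections of the standard basis vectors form a Parseval frame of the complement of [e].
    Summing over all [n] of them replaces a choice of orthonormal basis there, and [e] itself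
    supplies the missing direction. *)
Lemma sum_qf_msqP p e H : dotp e e = 1 ->
  \sum_(k < n) qf H (msqv p (delta_mx ord0 k - dotp e (delta_mx ord0 k) *: e))
  + qf H (msqv p e) = mcfop p H.
Proof.
move=> e1; pose c := msq p; pose t := dotp p e.
have E k : msqv p (delta_mx ord0 k - dotp e (delta_mx ord0 k) *: e) =
    rk2 e (- e) (p - t *: e) (- c *: p) (delta_mx ord0 k).
  rewrite /rk2 /msqv !dotpE scalerN scalerA mulrN scaleNr; congr (_ - _ *: _).
  by rewrite /c -/t; ring.
under eq_bigr do rewrite E.
rewrite sum_qf_rk2 /qf -big_split /= -(mcfop_cov _ _ _ (fun i j => erefl)).
apply: eq_bigr => i _; rewrite -big_split /=; apply: eq_bigr => j _.
rewrite -mulrDr; congr (_ * _).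
rewrite /covrk2 /mcfa !dotpE !mxE e1 (dotpC e p).
have := msq_eq p; rewrite -/c -/t; set q := dotp p p.
set s := (1 + q)^-1 => h; set pi := p _ i; set pj := p _ j.
have -> : pi * pj * s = pi * pj * (2 * c - q * c ^+ 2) by rewrite h; ring.
ring.
Qed.

Definition rotv e b v : 'rV[R]_n := v - (dotp b v / (1 + dotp e b)) *: (e + b).

(* [rotv e b] is the rotation taking the unit vector [e] to the unit vector [b],
   on the orthogonal complement of [e]. *)
Lemma sum_qf_rot p e b (k0 : R) H : dotp e e = 1 -> dotp b b = 1 -> 0 <= dotp e b ->
  p = k0 *: b ->
  \sum_(k < n) qf H (rotv e b (delta_mx ord0 k - dotp e (delta_mx ord0 k) *: e))
  + qf H b / (1 + dotp p p) = mcfop p H.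
Proof.
move=> e1 b1 eb pE; pose t := dotp e b; pose c := (1 + t)^-1.
have t1 : 1 + t != 0 by rewrite gt_eqF // ltr_pwDl.
have E k : rotv e b (delta_mx ord0 k - dotp e (delta_mx ord0 k) *: e) =
    rk2 e (- e) (b - t *: e) (- c *: (e + b)) (delta_mx ord0 k).
  rewrite /rk2 /rotv !dotpE scalerN scalerA mulrN scaleNr; congr (_ - _ *: _).
  by rewrite -/t -/c (dotpC b e) -/t; ring.
under eq_bigr do rewrite E.
rewrite sum_qf_rk2 /qf mulr_suml -big_split /= -(mcfop_cov _ _ _ (fun i j => erefl)).
apply: eq_bigr => i _; rewrite mulr_suml -big_split /=; apply: eq_bigr => j _.
rewrite -mulrA -mulrDr; congr (_ * _).
have pp : dotp p p = k0 ^+ 2 by rewrite pE !dotpE b1; ring.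
have k1 : 1 + k0 ^+ 2 != 0 by rewrite -pp gt_eqF // onep_gt0.
rewrite /covrk2 /mcfa pp pE !dotpE !mxE e1 b1 (dotpC b e) -/t /c; field.
by rewrite k1 t1.
Qed.

Lemma mcfop_dotp (p c : 'rV[R]_n) : \sum_i \sum_j mcfa p i j * (c ord0 i * c ord0 j) =
  dotp c c - dotp c p ^+ 2 / (1 + dotp p p).
Proof.
pose D (m : 'I_n) (k : 'I_n) : R := (m == k)%:R.
have E i : \sum_j mcfa p i j * (c ord0 i * c ord0 j) =
    c ord0 i * c ord0 i - c ord0 i * p ord0 i / (1 + dotp p p) * dotp c p.
  transitivity (\sum_j (D i j * (c ord0 i * c ord0 j)
      - c ord0 i * p ord0 i / (1 + dotp p p) * (c ord0 j * p ord0 j))).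
    by apply: eq_bigr => j _; rewrite /mcfa -/(D i j); ring.
  rewrite sumrB -mulr_sumr; congr (_ - _).
  rewrite (bigD1 i) //= big1 ?addr0 /D ?eqxx ?mul1r // => j ji.
  by rewrite eq_sym (negbTE ji) mul0r.
rewrite (eq_bigr _ (fun i _ => E i)) sumrB -!mulr_suml expr2 /dotp.
by rewrite mulrAC.
Qed.

Lemma sum_dotp_msq (p c : 'rV[R]_n) : \sum_(k < n) dotp c (msqv p (delta_mx ord0 k)) ^+ 2 =
  dotp c c - dotp c p ^+ 2 / (1 + dotp p p).
Proof.
rewrite -mcfop_dotp.
have := sum_qf_msq p (\matrix_(i, j) (c ord0 i * c ord0 j)).
rewrite /mcfop; under [X in _ = X]eq_bigr do under eq_bigr do rewrite mxE.
move=> <-; apply: eq_bigr => k _; rewrite /qf /dotp expr2 mulr_suml; apply: eq_bigr => i _.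
by rewrite mulr_sumr; apply: eq_bigr => j _; rewrite !mxE; ring.
Qed.

Lemma sum_mcfa_diag p : \sum_i mcfa p i i = n%:R - dotp p p / (1 + dotp p p).
Proof.
rewrite /mcfa sumrB -mulr_suml; congr (_ - _ / _).
rewrite (eq_bigr (fun=> 1)) => [|i _]; last by rewrite eqxx.
by rewrite sumr_const card_ord.
Qed.

Lemma dotp_qf v : dotp v v = qf 1%:M v.
Proof.
apply: eq_bigr => i _; rewrite (bigD1 i) //= big1 ?addr0 => [|j ji].
  by rewrite mxE eqxx mul1r.
by rewrite mxE eq_sym (negbTE ji) mul0r.
Qed.

Lemma mcfop1_le p : mcfop p 1%:M <= n%:R.
Proof.
have -> : mcfop p 1%:M = \sum_i mcfa p i i.
  apply: eq_bigr => i _; rewrite (bigD1 i) //= big1 ?addr0 => [|j ji].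
    by rewrite mxE eqxx mulr1.
  by rewrite mxE eq_sym (negbTE ji) mulr0.
rewrite sum_mcfa_diag gerBl divr_ge0 ?dotp_ge0 // ltW // onep_gt0 //.
Qed.

Lemma sum_dotp_msq_le p : \sum_(k < n) dotp (msqv p (delta_mx ord0 k)) (msqv p (delta_mx ord0 k)) <= n%:R.
Proof.
under eq_bigr do rewrite dotp_qf.
by rewrite sum_qf_msq mcfop1_le.
Qed.

Lemma jet2_sqn (h0 h1 h2 : 'rV[R]_n) :
  jet2 (fun s => dotp (h0 + s *: h1 + s ^+ 2 *: h2) (h0 + s *: h1 + s ^+ 2 *: h2))
    (dotp h0 h0) (2 * dotp h0 h1) (dotp h1 h1 + 2 * dotp h0 h2).
Proof.
have b : bounded_near0 (fun s : R => 2 * dotp h1 h2 + dotp h2 h2 * s).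
  apply: bounded_near0D; first exact: bounded_near0_cst.
  by apply: bounded_near0M; [exact: bounded_near0_cst|exact: bounded_near0_id].
apply: small_ext (smallM b (small_pow 2)) _ => s.
by rewrite !dotpE !(dotpC h1 h0) !(dotpC h2 h0) !(dotpC h2 h1); ring.
Qed.

Lemma jet2_enorm (z : R) (h0 h1 h2 : 'rV[R]_n) : 0 < z -> enorm h0 = z ->
  jet2 (fun s => enorm (h0 + s *: h1 + s ^+ 2 *: h2)) z (dotp h0 h1 / z)
    ((dotp h1 h1 + 2 * dotp h0 h2) / (2 * z) - dotp h0 h1 ^+ 2 / (2 * z ^+ 3)).
Proof.
move=> z0 hz; have h := jet2_sqn h0 h1 h2.
rewrite -enorm_sqr hz in h.
apply: (jet2_ext _ _ _ _ (jet2_sqrt z0 h)) => //; by field; rewrite gt_eqF.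
Qed.

End Dot.

(** * Continuity and compactness *)

Definition cont_on {R : realType} {T : topologicalType} (A : set T) (f : T -> R) : Prop :=
  forall p, A p -> f @ within A (nbhs p) --> f p.

Lemma cont_onP {R : realType} {T : topologicalType} (A : set T) (f : T -> R) :
  {within A, continuous f} <-> cont_on A f.
Proof.
split=> [/subspace_continuousP h p Ap|h]; first exact: h.
by apply/subspace_continuousP => p Ap; exact: h.
Qed.

Lemma compact_max {R : realType} {T : topologicalType} (A : set T) (f : T -> R) :
  compact A -> A !=set0 -> cont_on A f ->
  exists2 p, A p & forall q, A q -> f q <= f p.
Proof.
move=> cA A0 /cont_onP cf; have [p pA h] := compact_EVT_max A0 cA cf.
by exists p; [rewrite inE in pA|move=> q Aq; apply: h; rewrite inE].
Qed.

Lemma compact_min {R : realType} {T : topologicalType} (A : set T) (f : T -> R) :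
  compact A -> A !=set0 -> cont_on A f ->
  exists2 p, A p & forall q, A q -> f p <= f q.
Proof.
move=> cA A0 /cont_onP cf; have [p pA h] := compact_EVT_min A0 cA cf.
by exists p; [rewrite inE in pA|move=> q Aq; apply: h; rewrite inE].
Qed.

Lemma continuous_cont_on {R : realType} {T : topologicalType} (A : set T) (f : T -> R) :
  continuous f -> cont_on A f.
Proof. move=> cf p _; exact: (cvg_within_filter _ (cf p)). Qed.

Lemma cont_on_sub {R : realType} {T : topologicalType} (A B : set T) (f : T -> R) :
  A `<=` B -> cont_on B f -> cont_on A f.
Proof.
move=> AB cf p Ap P hP; have := cf p (AB _ Ap) P hP.
by rewrite /nbhs /= /within /=; apply: filterS => q h Aq; exact/h/AB.
Qed.

Lemma cont_on_comp {R : realType} {S T : topologicalType} (A : set S) (B : set T)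
    (g : S -> T) (f : T -> R) :
  continuous g -> (forall p, A p -> B (g p)) -> cont_on B f -> cont_on A (f \o g).
Proof.
move=> cg AB cf p Ap P /= hP; have h := cf _ (AB _ Ap) P hP.
rewrite /nbhs /= /within /= in h *.
have := cg p _ h; rewrite /nbhs /=; apply: filterS => q hq Aq; exact/hq/AB.
Qed.

Lemma cont_onD {R : realType} {T : topologicalType} (A : set T) (f g : T -> R) :
  cont_on A f -> cont_on A g -> cont_on A (fun p => f p + g p).
Proof. by move=> hf hg p Ap; apply: cvgD; [exact: hf|exact: hg]. Qed.

Lemma cont_onN {R : realType} {T : topologicalType} (A : set T) (f : T -> R) :
  cont_on A f -> cont_on A (fun p => - f p).
Proof. by move=> hf p Ap; apply: cvgN; exact: hf. Qed.

Lemma cont_onB {R : realType} {T : topologicalType} (A : set T) (f g : T -> R) :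
  cont_on A f -> cont_on A g -> cont_on A (fun p => f p - g p).
Proof. by move=> hf hg; apply: cont_onD => //; exact: cont_onN. Qed.

Lemma cont_onM {R : realType} {T : topologicalType} (A : set T) (f g : T -> R) :
  cont_on A f -> cont_on A g -> cont_on A (fun p => f p * g p).
Proof. by move=> hf hg p Ap; apply: cvgM; [exact: hf|exact: hg]. Qed.

Lemma cont_onX {R : realType} {T : topologicalType} (A : set T) (f : T -> R) k :
  cont_on A f -> cont_on A (fun p => f p ^+ k).
Proof.
move=> hf; elim: k => [|k IH]; first by move=> p _; exact: cvg_cst.
have -> : (fun p => f p ^+ k.+1) = (fun p => f p * f p ^+ k).
  by apply/funext => p; rewrite exprS.
exact: cont_onM.
Qed.

Lemma cont_onV {R : realType} {T : topologicalType} (A : set T) (f : T -> R) :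
  (forall p, A p -> f p != 0) -> cont_on A f -> cont_on A (fun p => (f p)^-1).
Proof. by move=> f0 hf p Ap; apply: cvgV; [exact: f0|exact: hf]. Qed.

Lemma cont_on_cst {R : realType} {T : topologicalType} (A : set T) (c : R) :
  cont_on A (fun=> c).
Proof. by move=> p _; exact: cvg_cst. Qed.

Lemma cont_on_postcomp {R : realType} {T : topologicalType} (A : set T) (f : T -> R) (h : R -> R) :
  cont_on A f -> (forall p, A p -> {for f p, continuous h}) -> cont_on A (fun p => h (f p)).
Proof. by move=> cf ch p Ap; apply: continuous_cvg; [exact: ch|exact: cf]. Qed.

(** All domains with a curved or moving boundary are cut out of compact products in this way; [f]
    need be continuous only relative to [A]. *)
Lemma compact_ge {R : realType} {T : topologicalType} (A : set T) (f : T -> R) c :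
  compact A -> cont_on A f -> compact [set p | A p /\ c <= f p].
Proof.
move=> cA cf F PF FA.
have FA1 : F A by apply: filterS FA => p [].
have [p [Ap clp]] := cA F PF FA1.
exists p; split=> //; split=> //; rewrite leNgt; apply/negP => fc.
have h1 : nbhs p (fun q => A q -> f q < c).
  exact: (@cvgr_lt R T (within A (nbhs p)) _ f (f p) (cf p Ap) c fc).
have [q [[Aq cq] hq]] := clp _ _ FA h1.
by have := hq Aq; rewrite ltNge cq.
Qed.

Lemma compact_prod3 {S T U : topologicalType} (A : set S) (B : set T) (C : set U) :
  compact A -> compact B -> compact C ->
  compact [set p : S * T * U | [/\ A p.1.1, B p.1.2 & C p.2]].
Proof.
move=> cA cB cC; have := compact_setX (compact_setX cA cB) cC.
by congr compact; apply/seteqP; split=> [p [[? ?] ?]|p [? ? ?]].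
Qed.

Lemma itv_compact {R : realType} (a b : R) : compact [set t : R | a <= t <= b].
Proof.
have := @segment_compact R a b; congr compact.
Qed.

Lemma rV_ball_compact {R : realType} {n : nat} (p : 'rV[R]_n) (r : R) :
  compact [set x : 'rV[R]_n | `|x - p| <= r].
Proof.
apply: bounded_closed_compact.
  exists (r + `|p|); split; first exact: num_real.
  move=> B rB x /= xr; apply: le_trans (ltW rB).
  by rewrite -[x](subrK p) (le_trans (ler_normD _ _)) // lerD2r.
have c : continuous (fun x : 'rV[R]_n => `|x - p|).
  move=> x; exact: cvg_norm (cvgB (@cvg_id _ (nbhs x)) (@cvg_cst _ p _ (nbhs x) _)).
by apply: (closed_comp (f := fun x : 'rV[R]_n => `|x - p|) (D := [set t : R | t <= r]));
  [move=> x _; exact: c|exact: closed_le].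
Qed.

Lemma compact_closedIl {T : topologicalType} (A B : set T) :
  compact A -> closed B -> compact (B `&` A).
Proof. by move=> cA cB; rewrite setIC; exact: compact_closedI. Qed.

(** * Euclidean norm against sup norm *)

Section Euclid.
Context {R : realType} {n : nat}.
Implicit Types (x y v w : 'rV[R]_n).

Lemma coord_le_norm x i : `|x ord0 i| <= `|x|.
Proof.
by rewrite [leRHS]/Num.norm /= mx_normrE; apply/bigmax_geP; right => /=; exists (ord0, i).
Qed.

Lemma coord_le_enorm x i : `|x ord0 i| <= enorm x.
Proof.
rewrite -[`|_|]sqrtr_sqr /enorm ler_sqrt ?dotp_ge0 // /dotp (bigD1 i) //= -expr2 lerDl.
by apply: sumr_ge0 => j _; rewrite -expr2 sqr_ge0.
Qed.

Lemma norm_le_enorm x : `|x| <= enorm x.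
Proof.
rewrite [leLHS]/Num.norm /= mx_normrE; apply/bigmax_leP; split; first exact: enorm_ge0.
by move=> [i j] _ /=; rewrite ord1; exact: coord_le_enorm.
Qed.

Lemma dotp_le_norm x : dotp x x <= n%:R * `|x| ^+ 2.
Proof.
rewrite /dotp -[n in n%:R]card_ord -sum1_card natr_sum mulr_suml; apply: ler_sum => i _.
rewrite mul1r -expr2 -[leLHS]real_normK ?num_real //.
by rewrite lerXn2r ?nnegrE // coord_le_norm.
Qed.

Lemma continuous_dotp {T : topologicalType} (f g : T -> 'rV[R]_n) :
  continuous f -> continuous g -> continuous (fun p => dotp (f p) (g p)).
Proof.
move=> cf cg.
suff H l : continuous (fun p => \sum_(i <- l) f p ord0 i * g p ord0 i) by exact: H.
elim: l => [|i l IH].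
  have -> : (fun p => \sum_(i <- [::]) f p ord0 i * g p ord0 i) = (fun=> 0).
    by apply/funext => p; rewrite big_nil.
  exact: cst_continuous.
have -> : (fun p => \sum_(j <- i :: l) f p ord0 j * g p ord0 j) =
    (fun p => f p ord0 i * g p ord0 i + \sum_(j <- l) f p ord0 j * g p ord0 j).
  by apply/funext => p; rewrite big_cons.
move=> p; apply: (@cvgD _ _ _ (nbhs p)); last exact: IH.
apply: (@cvgM _ _ (nbhs p)).
  exact: (continuous_comp (cf p) (@coord_continuous _ _ _ ord0 i (f p))).
exact: (continuous_comp (cg p) (@coord_continuous _ _ _ ord0 i (g p))).
Qed.

Lemma continuous_enorm {T : topologicalType} (f : T -> 'rV[R]_n) :
  continuous f -> continuous (fun p => enorm (f p)).
Proof.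
move=> cf p; exact: (continuous_comp (continuous_dotp _ _ cf cf p) (@sqrt_continuous R _)).
Qed.

Lemma near_curve (A : set 'rV[R]_n) x v w : open A -> A x ->
  \forall s \near (0 : R), A (x + s *: v + s ^+ 2 *: w).
Proof.
move=> oA Ax.
have c : (fun s : R => x + s *: v + s ^+ 2 *: w) @ (0 : R) --> x + (0 : R) *: v + (0 : R) ^+ 2 *: w.
  apply: cvgD; first apply: cvgD; first exact: cvg_cst.
    by apply: cvgZ; [exact: cvg_id|exact: cvg_cst].
  by apply: cvgZ; [exact: exprn_continuous|exact: cvg_cst].
move: c; rewrite expr0n /= !scale0r !addr0 => c.
by apply: c; exact: open_nbhs_nbhs.
Qed.

End Euclid.

(** * The initial modulus of continuity *)

Lemma jet1_expR {R : realType} (a : R) : jet1 (fun s => expR (a + s)) (expR a) (expR a).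
Proof.
have := @jet1_derive R R expR a 1 _ (is_derive_expR a).
by move=> h; apply: (jet1_ext _ _ _ h) => // s; rewrite [s *: 1]mulr1.
Qed.

Lemma jet2_expR {R : realType} (a : R) : jet2 (fun s => expR (a + s)) (expR a) (expR a) (expR a / 2).
Proof.
have hn : \forall y \near (a : R), is_derive (y : R) (1 : R) expR (expR y).
  by apply: filterE => y; exact: is_derive_expR.
have h := jet2_taylor hn (is_derive_expR a).
by apply: (jet2_ext _ _ _ _ h) => // s; rewrite [s *: 1]mulr1.
Qed.

Lemma jet1_inv {R : realType} {f : R -> R} {a b : R} : a != 0 ->
  jet1 f a b -> jet1 (fun s => (f s)^-1) a^-1 (- b / a ^+ 2).
Proof.
move=> a0 h.
have hi : jet1 (fun s => (a + s)^-1) a^-1 (- (a ^+ 2)^-1).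
  have hd : is_derive (a : R) (1 : R) (fun y : R => y^-1) (- (a ^+ 2)^-1).
    split; first by apply: (@derivableV R R (fun y : R => y)) => //; exact: derivable_id.
    rewrite (@deriveV R R (fun y : R => y) a 1 a0 (@derivable_id _ _ _ _)) derive_id.
    by rewrite -[_ *: _]/(_ * _) mulr1.
  have := jet1_derive hd => hh.
  by apply: (jet1_ext _ _ _ hh) => // s; rewrite [s *: 1]mulr1.
apply: (jet1_ext _ _ _ (jet1_comp h hi)) => //; by field.
Qed.

(* A subsolution of the inverse curve shortening flow [b_t <= b'' / (1 + b'^2)]
   issuing from a vertical segment: for fixed [w < H], [beta H t w] tends to
   [0] as [t] tends to [0]. *)
Definition beta {R : realType} (H t w : R) : R :=
  (expR (- (2 * (H - w) ^+ 2) / t) - expR (- (2 * H ^+ 2) / t)) / 4.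

Lemma mul_expRN_le1 {R : realType} (X : R) : X * expR (- X) <= 1.
Proof.
rewrite expRN ler_pdivrMr ?expR_gt0 // mul1r.
by apply: le_trans (expR_ge1Dx X); lra.
Qed.

Lemma beta_lt {R : realType} (H t w : R) : 0 < t -> w <= H - 1 ->
  beta H t w <= expR (- 2 / t) / 4.
Proof.
move=> t0 wH; rewrite /beta ler_pM2r ?invr_gt0 //.
have h1 : expR (- (2 * (H - w) ^+ 2) / t) <= expR (- 2 / t).
  by rewrite ler_expR ler_pM2r ?invr_gt0 //; nra.
by have := expR_gt0 (- (2 * H ^+ 2) / t); lra.
Qed.

Lemma beta_lt4 {R : realType} (H t w : R) : 0 < t -> w <= H - 1 -> beta H t w <= 1 / 4.
Proof.
move=> t0 wH; apply: le_trans (beta_lt _ _ _ t0 wH) _.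
rewrite ler_pM2r ?invr_gt0 // -[leRHS]expR0 ler_expR mulNr oppr_le0.
by rewrite divr_ge0 // ltW.
Qed.

Lemma beta_small {R : realType} (z0 : R) : 0 < z0 ->
  exists2 tau, 0 < tau & forall H t w, 0 < t -> t <= tau -> w <= H - 1 -> beta H t w < z0.
Proof.
move=> z00; exists z0 => // H t w t0 tz wH.
apply: le_lt_trans (beta_lt _ _ _ t0 wH) _.
have := mul_expRN_le1 (2 / t); rewrite -mulNr.
set E := expR _ => h.
have E0 : 0 < E by exact: expR_gt0.
have h2 : E <= t / 2.
  have -> : E = (2 / t * E) * (t / 2) by field; rewrite gt_eqF.
  by rewrite ler_piMl // divr_ge0 // ltW.
lra.
Qed.

Lemma beta_gt0 {R : realType} (H t w : R) : 0 < t -> w <= H - 1 -> 0 <= H ->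
  (0 < beta H t w) = (0 < w).
Proof.
move=> t0 wH H0; rewrite /beta pmulr_lgt0 ?invr_gt0 // subr_gt0 ltr_expR ltr_pM2r ?invr_gt0 //.
rewrite ltrN2; apply/idP/idP => h; [rewrite ltNge; apply/negP => w0|]; nra.
Qed.

Lemma beta_continuous {R : realType} {T : topologicalType} (A : set T) (H : R) (f g : T -> R) :
  (forall p, A p -> f p != 0) -> cont_on A f -> cont_on A g ->
  cont_on A (fun p => beta H (f p) (g p)).
Proof.
move=> f0 cf cg; rewrite /beta.
have ce h : cont_on A h -> cont_on A (fun p => expR (h p)).
  by move=> ch; apply: (cont_on_postcomp _ _ expR ch) => p _; exact: continuous_expR.
have ci := cont_onV _ _ f0 cf.
apply: cont_onM; last exact: cont_on_cst.
apply: cont_onB; apply: ce; apply: cont_onM => //; last exact: cont_on_cst.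
apply: cont_onN; apply: cont_onM; first exact: cont_on_cst.
by apply: cont_onX; apply: cont_onB => //; exact: cont_on_cst.
Qed.

(** A subsolution would only need [bt <= b2 / (1 + b1 ^+ 2)]; the stronger bounds [bt <= b2 / 4] and
    [b1 <= 1 / 2] leave room for the errors caused by the penalty. The conditions [t <= 2] and
    [w <= H - 1] make [1 / t] at most half of [4 D^2 / t^2], where [D = H - w], so that [b2] stays
    comparable to [D^2 / t^2] times the Gaussian. *)
Lemma beta_jets {R : realType} (H t w : R) : 0 < t -> t <= 2 -> w <= H - 1 ->
  exists b1 b2 bt, [/\
    [/\ 0 < b1, b1 <= 1 / 2, 0 < b2, b1 ^+ 2 <= b2 / 2 & bt <= b2 / 4],
    forall f a c, jet2 f w a c -> jet2 (fun s => beta H t (f s)) (beta H t w)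
      (b1 * a) (b1 * c + b2 / 2 * a ^+ 2)
    & forall f a, jet1 f w a -> jet1 (fun s => beta H (t + s) (f s)) (beta H t w) (b1 * a + bt)].
Proof.
move=> t0 t2 wH; pose D := H - w; pose E := expR (- (2 * D ^+ 2) / t).
pose E0 := expR (- (2 * H ^+ 2) / t).
have D1 : 1 <= D by rewrite /D; lra.
have D21 : 1 <= D ^+ 2 by nra.
have Ep : 0 < E by exact: expR_gt0.
have E0p : 0 < E0 by exact: expR_gt0.
have E1 : E <= 1.
  by rewrite /E -[leRHS]expR0 ler_expR mulNr oppr_le0 divr_ge0 ?(ltW t0) //; nra.
have ti : 0 < t^-1 by rewrite invr_gt0.
have tn : t != 0 by rewrite gt_eqF.
have XE : 2 * D ^+ 2 / t * E <= 1.
  by have := mul_expRN_le1 (2 * D ^+ 2 / t); rewrite -mulNr.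
have q1 : D ^+ 2 / t >= 1 / 2.
  by rewrite ler_pdivlMr //; nra.
have hb1 : D * E / t <= 1 / 2.
  have -> : D * E / t = (2 * D ^+ 2 / t * E) * (1 / (2 * D)) by field; rewrite tn /= gt_eqF //; lra.
  have h : 1 / (2 * D) <= 1 / 2 by rewrite ler_pdivrMr; nra.
  have h' : 0 <= 1 / (2 * D) by rewrite divr_ge0 //; lra.
  have : 0 <= 2 * D ^+ 2 / t * E by rewrite mulr_ge0 ?(ltW Ep) // divr_ge0 ?(ltW t0) // mulr_ge0 // sqr_ge0.
  nra.
have hb2 : 2 * (D ^+ 2 / t ^+ 2 * E) <= (4 * (D ^+ 2 / t ^+ 2) - 1 / t) * E.
  rewrite mulrA ler_pM2r //.
  have -> : D ^+ 2 / t ^+ 2 = (D ^+ 2 / t) / t by field.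
  have : 1 / 2 * t^-1 <= (D ^+ 2 / t) / t by rewrite ler_pM2r.
  lra.
have q2 : 0 < D ^+ 2 / t ^+ 2 * E by rewrite mulr_gt0 // divr_gt0 ?exprn_gt0 //; lra.
exists (D * E / t), ((4 * (D ^+ 2 / t ^+ 2) - 1 / t) * E),
  ((2 * D ^+ 2 * E - 2 * H ^+ 2 * E0) / (4 * t ^+ 2)); split; first split => //.
- by rewrite divr_gt0 // mulr_gt0 //; lra.
- by lra.
- have -> : (D * E / t) ^+ 2 = D ^+ 2 / t ^+ 2 * E * E by field.
  have : D ^+ 2 / t ^+ 2 * E * E <= D ^+ 2 / t ^+ 2 * E by rewrite ler_piMr // ltW.
  lra.
- apply: (@le_trans _ _ (D ^+ 2 / t ^+ 2 * E / 2)); last by lra.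
  have -> : D ^+ 2 / t ^+ 2 * E / 2 = (2 * D ^+ 2 * E) / (4 * t ^+ 2) by field.
  rewrite ler_pM2r ?invr_gt0 ?mulr_gt0 ?exprn_gt0 // gerBl.
  by rewrite mulr_ge0 ?(ltW E0p) // mulr_ge0 // sqr_ge0.
- move=> f a c hf.
  have h1 := jet2B (jet2_cst H) hf.
  have h2 := jet2Z (- 2 / t) (jet2M h1 h1).
  have -> : beta H t w = (E - E0) / 4 by [].
  have E' : expR (- 2 / t * (D * D)) = E by congr expR; rewrite /D; ring.
  have h3 := jet2_expR (- 2 / t * (D * D)); rewrite E' in h3.
  have h4 := jet2_comp h2 h3.
  have h5 := jet2Z 4^-1 (jet2B h4 (jet2_cst E0)).
  apply: (jet2_ext _ _ _ _ h5) => [s|||]; rewrite /beta.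
  + by rewrite [RHS]mulrC; congr ((expR _ - _) / _); ring.
  + by field.
  + by rewrite /D; field.
  + by rewrite /D; field.
- move=> f a hf.
  have ht : jet1 (fun s => t + s) t 1.
    by apply: (jet1_ext _ _ _ (jet1_poly t 1 0)) => // s; ring.
  have hi := jet1_inv tn ht.
  have h1 := jet1B (jet1_cst H) hf.
  have h2 := jet1M (jet1Z (- 2) (jet1M h1 h1)) hi.
  have h2' := jet1M (jet1_cst (- (2 * H ^+ 2))) hi.
  have h3 := jet1_comp h2 (jet1_expR _); have h3' := jet1_comp h2' (jet1_expR _).
  have E' : expR (- 2 * ((H - w) * (H - w)) / t) = E by congr expR; rewrite /D; ring.
  rewrite E' in h3; rewrite -/E0 in h3'.
  have h5 := jet1Z 4^-1 (jet1B h3 h3').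
  apply: (jet1_ext _ _ _ h5) => [s||]; rewrite /beta.
  + by rewrite [RHS]mulrC; congr ((expR _ - _) / _); ring.
  + by rewrite -/E -/E0; field.
  + by rewrite /D; field.
Qed.

(** The flow equation at one point, recorded only through expansions in time and along lines. This
    is all that a maximum sees, and it is preserved by changing the sign of [v]. *)
Definition mcf_jet {R : realType} {n : nat} (v : 'rV[R]_n -> R -> R) (x : 'rV[R]_n) (t : R)
    (p : 'rV[R]_n) (H : 'M[R]_n) (vt : R) : Prop :=
  [/\ jet1 (fun s => v x (t + s)) (v x t) vt,
      forall xi, jet2 (fun s => v (x + s *: xi) t) (v x t) (dotp p xi) (qf H xi / 2)
    & vt = mcfop p H].

(** The product of the gradients of [beta] and of the penalty is small against the diffusion
    [F ^+ 2 * b2]: from [P * b1 * F ^+ 2 >= 31 / 32] follows [wt * P <= 32 / 31 * b1 * F ^+ 2],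
    while [eps <= 1 / 1024] and [eps * Y <= 1] give [eps * |yb| <= 1 / 32], and [b1 ^+ 2 <= b2 / 2]
    closes the estimate. *)
Lemma modulus_algebra_cross {R : realType} (eps m F Y N2 b1 b2 P wt yb : R) :
  0 < eps -> eps <= 1 / 1024 -> 1 <= m -> 0 < F -> F <= 1 -> eps * Y <= 1 ->
  0 < b1 -> 0 < b2 -> b1 ^+ 2 <= b2 / 2 -> (31 / 32) ^+ 2 <= N2 ->
  0 < P -> P ^+ 2 * (b1 * F ^+ 2) ^+ 2 = m ^+ 2 * N2 -> 0 < wt -> wt * P ^+ 2 <= 1 ->
  yb ^+ 2 <= Y ->
  wt * (8 * eps * F * b1 * P * yb) <= F ^+ 2 * b2 * (9 / 64).
Proof.
move=> e0 e1 m1 F0 F1 eY b10 b20 hb12 hN P0 hP w0 wPP hyb.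
have F20 : 0 < F ^+ 2 by rewrite exprn_gt0.
have bF : 0 < b1 * F ^+ 2 by rewrite mulr_gt0.
have N20 : 0 < N2 by apply: lt_le_trans hN; rewrite exprn_gt0.
have mN : 31 / 32 <= P * (b1 * F ^+ 2).
  have h1 : 1 <= m ^+ 2 by rewrite expr_ge1 //; apply: le_trans m1.
  have h2 : N2 <= m ^+ 2 * N2 by rewrite ler_peMl // ltW.
  have h3 : (31 / 32) ^+ 2 <= (P * (b1 * F ^+ 2)) ^+ 2.
    by rewrite [in leRHS]exprMn hP; exact: le_trans h2.
  by move: h3; rewrite ler_sqr ?nnegrE ?mulr_ge0 // ltW.
have wPb : wt * P * (31 / 32) <= b1 * F ^+ 2.
  have h : wt * P * (31 / 32) <= wt * P * (P * (b1 * F ^+ 2)).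
    by rewrite ler_pM2l // mulr_gt0.
  apply: (le_trans h).
  have -> : wt * P * (P * (b1 * F ^+ 2)) = (wt * P ^+ 2) * (b1 * F ^+ 2) by ring.
  by rewrite ler_piMl // ltW.
have ey : eps * `|yb| <= 1 / 32.
  have h : (eps * `|yb|) ^+ 2 <= (1 / 32) ^+ 2.
    rewrite exprMn real_normK ?num_real //.
    have h1 : eps ^+ 2 * yb ^+ 2 <= eps * (eps * Y).
      by rewrite mulrA -expr2 ler_pM2l ?exprn_gt0.
    have h2 : eps * (eps * Y) <= eps by rewrite ler_piMr // ltW.
    apply: (le_trans h1); apply: (le_trans h2); apply: (le_trans e1).
    by clear; lra.
  by move: h; rewrite ler_sqr ?nnegrE // mulr_ge0 // ltW.
have h1 : wt * (8 * eps * F * b1 * P * yb) <= (8 * F * b1) * (wt * P) * (1 / 32).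
  have -> : wt * (8 * eps * F * b1 * P * yb) = (8 * F * b1 * (wt * P)) * (eps * yb) by ring.
  rewrite ler_pM2l; last by rewrite !mulr_gt0.
  by apply: le_trans ey; rewrite ler_pM2l // ler_norm.
apply: (le_trans h1).
have h2 : 8 * F * b1 * (wt * P) * (1 / 32) <= F * b1 / 4 * (32 / 31 * (b1 * F ^+ 2)).
  have -> : 8 * F * b1 * (wt * P) * (1 / 32) = F * b1 / 4 * (wt * P) by field.
  rewrite ler_pM2l ?divr_gt0 ?mulr_gt0 //.
  by move: wPb; clear; lra.
apply: (le_trans h2).
have -> : F * b1 / 4 * (32 / 31 * (b1 * F ^+ 2)) = (8 / 31) * F ^+ 2 * (F * b1 ^+ 2) by field.
have h3 : F * b1 ^+ 2 <= b2 / 2.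
  by apply: le_trans hb12; rewrite ler_piMl // sqr_ge0.
have h4 : 8 / 31 * F ^+ 2 * (F * b1 ^+ 2) <= 8 / 31 * F ^+ 2 * (b2 / 2).
  by rewrite ler_pM2l // mulr_gt0.
have h5 : 0 < F ^+ 2 * b2 by rewrite mulr_gt0.
by move: h4 h5; clear; lra.
Qed.

(** [S2] is the squared sine of the angle between [e] and the gradient, of order
    [eps^2 z^2 Y / F^2], and [S4] is the cost of the rotation. The factor [m / z] looks singular,
    but [m * z = b0 * F ^+ 2] with [1 <= m] bounds [z] and turns the product into a multiple of
    [eps * F * b0]. *)
Lemma modulus_algebra_rot {R : realType} (eps m z F Y b0 b1 G2 N2 P wt S2 S4 : R) :
  0 < eps -> eps <= 1 / 1024 -> 1 <= m -> 0 < z -> 0 < F -> F <= 1 ->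
  eps * Y <= 1 -> m * z = b0 * F ^+ 2 -> 0 < b0 -> b0 <= 1 / 4 ->
  0 < b1 -> b1 <= 1 / 2 ->
  G2 = 16 * eps ^+ 2 * z ^+ 2 * Y / F ^+ 2 -> (31 / 32) ^+ 2 <= N2 ->
  P ^+ 2 * (b1 * F ^+ 2) ^+ 2 = m ^+ 2 * N2 -> 0 < wt -> wt * P ^+ 2 <= 1 ->
  0 <= S2 -> S2 * N2 <= G2 -> S4 <= S2 ^+ 2 ->
  m / z * (S4 + wt * S2) <= 7 * (eps * F * b0).
Proof.
move=> e0 e1 m1 z0 F0 F1 eY mz b00 b04 b10 b12 hG hN hP w0 wPP S20 hS2 hS4.
have F20 : 0 < F ^+ 2 by rewrite exprn_gt0.
have F21 : F ^+ 2 <= F by rewrite expr2 ler_piMr // ltW.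
have zb : z <= b0 * F ^+ 2 by rewrite -mz ler_peMl // ltW.
have zF : z <= F ^+ 2 / 4.
  by apply: (le_trans zb); rewrite mulrC ler_pM2l //; apply: (le_trans b04); clear; lra.
have m0 : 0 < m by apply: lt_le_trans m1.
have mz0 : 0 < m / z by rewrite divr_gt0.
have G20 : G2 <= 16 * eps * z ^+ 2 / F ^+ 2.
  rewrite hG ler_pM2r ?invr_gt0 //.
  have -> : 16 * eps ^+ 2 * z ^+ 2 * Y = (16 * eps * z ^+ 2) * (eps * Y) by ring.
  by rewrite ler_piMr // !mulr_ge0 ?sqr_ge0 // ltW.
have zF2 : z ^+ 2 <= F ^+ 2 * F ^+ 2 / 16.
  have -> : F ^+ 2 * F ^+ 2 / 16 = (F ^+ 2 / 4) ^+ 2 by field.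
  by rewrite ler_sqr ?nnegrE ?(ltW z0) // divr_ge0 // ltW.
have G21 : G2 <= eps * F ^+ 2.
  apply: (le_trans G20); rewrite ler_pdivrMr //.
  have : 16 * eps * z ^+ 2 <= 16 * eps * (F ^+ 2 * F ^+ 2 / 16) by rewrite ler_pM2l // mulr_gt0.
  by clear; lra.
have hS : S2 * (31 / 32) ^+ 2 <= G2 by apply: le_trans hS2; rewrite ler_wpM2l.
have G2p : 0 <= G2 by apply: le_trans hS; rewrite mulr_ge0 // exprn_ge0.
have S2G : S2 <= 11 / 10 * G2.
  by move: hS S20 G2p; clear; rewrite expr2; lra.
have F2n : F ^+ 2 != 0 by rewrite gt_eqF.
have Fn : F != 0 by rewrite gt_eqF.
have zn : z != 0 by rewrite gt_eqF.
have mn : m != 0 by rewrite gt_eqF.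
have p2 : 0 < eps * F * b0 by rewrite !mulr_gt0.
have T2 : m / z * S4 <= eps * F * b0.
  have h1 : S4 <= 5 / 4 * (16 * eps * z ^+ 2 / F ^+ 2 * (eps * F ^+ 2)).
    apply: (le_trans hS4).
    have h1 : S2 ^+ 2 <= (11 / 10 * G2) ^+ 2 by rewrite ler_sqr ?nnegrE // mulr_ge0.
    have h2 : G2 * G2 <= 16 * eps * z ^+ 2 / F ^+ 2 * (eps * F ^+ 2) by apply: ler_pM.
    by apply: (le_trans h1); move: h2 (mulr_ge0 G2p G2p); rewrite exprMn !expr2; clear; lra.
  have h2 : m / z * S4 <= m / z * (5 / 4 * (16 * eps * z ^+ 2 / F ^+ 2 * (eps * F ^+ 2))).
    by rewrite ler_pM2l.
  apply: (le_trans h2).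
  have -> : m / z * (5 / 4 * (16 * eps * z ^+ 2 / F ^+ 2 * (eps * F ^+ 2)))
     = 20 * eps * (eps * (m * z)) by field; rewrite Fn zn.
  rewrite mz.
  have h3 : b0 * F ^+ 2 <= F * b0 by rewrite mulrC ler_pM2r.
  have h4 : 20 * eps * (eps * (b0 * F ^+ 2)) <= 20 * eps * (eps * (F * b0)).
    by rewrite !ler_pM2l ?mulr_gt0.
  apply: (le_trans h4).
  have -> : 20 * eps * (eps * (F * b0)) = (20 * eps) * (eps * F * b0) by ring.
  rewrite ler_piMl ?(ltW p2) //; move: e1; clear; lra.
have T3 : m / z * (wt * S2) <= 6 * (eps * F * b0).
  have h1 : wt * (m ^+ 2 * N2) <= F ^+ 2 * F ^+ 2 / 4.
    rewrite -hP.
    have -> : wt * (P ^+ 2 * (b1 * F ^+ 2) ^+ 2) = (wt * P ^+ 2) * (b1 ^+ 2 * (F ^+ 2 * F ^+ 2)) by ring.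
    have hb : b1 ^+ 2 <= 1 / 4.
      have -> : 1 / 4 = (1 / 2) ^+ 2 :> R by field.
      by rewrite ler_sqr ?nnegrE ?divr_ge0 // ltW.
    have q0 : 0 <= b1 ^+ 2 * (F ^+ 2 * F ^+ 2) by rewrite mulr_ge0 ?sqr_ge0 // mulr_ge0 // ltW.
    apply: (@le_trans _ _ (b1 ^+ 2 * (F ^+ 2 * F ^+ 2))); first by rewrite ler_piMl.
    have : b1 ^+ 2 * (F ^+ 2 * F ^+ 2) <= 1 / 4 * (F ^+ 2 * F ^+ 2) by rewrite ler_pM2r // mulr_gt0.
    by clear; lra.
  have h2 : wt * m ^+ 2 <= (11 / 10) * (F ^+ 2 * F ^+ 2 / 4).
    have q0 : 0 <= wt * m ^+ 2 by rewrite mulr_ge0 ?sqr_ge0 // ltW.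
    have q1 : wt * m ^+ 2 * (31 / 32) ^+ 2 <= wt * m ^+ 2 * N2 by rewrite ler_wpM2l.
    move: q0 q1 h1; rewrite -[wt * m ^+ 2 * N2]mulrA; set A := wt * m ^+ 2.
    by clear; rewrite !expr2; lra.
  have h3 : S2 <= 11 / 10 * (16 * eps * z ^+ 2 / F ^+ 2).
    by apply: (le_trans S2G); rewrite ler_pM2l.
  have h4 : (wt * m ^+ 2) * S2 <= (11 / 10) * (F ^+ 2 * F ^+ 2 / 4) * (11 / 10 * (16 * eps * z ^+ 2 / F ^+ 2)).
    by apply: ler_pM => //; rewrite mulr_ge0 ?sqr_ge0 // ltW.
  have -> : m / z * (wt * S2) = (wt * m ^+ 2 * S2) / (m * z) by field; rewrite zn mn.
  rewrite ler_pdivrMr ?mulr_gt0 //; apply: (le_trans h4).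
  have -> : 11 / 10 * (F ^+ 2 * F ^+ 2 / 4) * (11 / 10 * (16 * eps * z ^+ 2 / F ^+ 2)) =
     (11 / 10) ^+ 2 * 4 * (eps * F ^+ 2) * z ^+ 2 by field.
  have h5 : z ^+ 2 <= (m * z) * (b0 * F ^+ 2).
    rewrite mz; have : z ^+ 2 <= (b0 * F ^+ 2) ^+ 2.
      by rewrite ler_sqr ?nnegrE ?(ltW z0) // mulr_ge0 // ltW.
    by rewrite [in leRHS]expr2.
  have eF : 0 < eps * F ^+ 2 by rewrite mulr_gt0.
  have h6 : (11 / 10) ^+ 2 * 4 * (eps * F ^+ 2) * z ^+ 2 <= 6 * (eps * F ^+ 2) * ((m * z) * (b0 * F ^+ 2)).
    apply: ler_pM => //; rewrite ?sqr_ge0 //; move: eF; rewrite expr2; clear; lra.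
  apply: (le_trans h6).
  have -> : 6 * (eps * F * b0) * (m * z) = 6 * eps * F * b0 * (m * z) by ring.
  have -> : 6 * (eps * F ^+ 2) * (m * z * (b0 * F ^+ 2)) = 6 * eps * F * b0 * (m * z) * (F ^+ 2 * F) by ring.
  rewrite ler_piMr //; last by rewrite mulr_ile1 // ?(ltW F0) ?(ltW F20) //; apply: le_trans F21 F1.
  by rewrite !mulr_ge0 // ltW.
by rewrite mulrDr; move: T2 T3; clear; lra.
Qed.

(** Two balances. Since [P ^+ 2 >= 3], diffusion gains [3 / 4] of [F ^+ 2 * b2], against [1 / 4]
    from [bt] and [9 / 64] from the cross term. The decay of the penalty in time gains
    [(4 nn + 8) * eps * F * b0], of which [4 nn] pays for its Hessian and at most 7 of the remaining
    8 for the rotation. This is the origin of the constant [2 * n + 4]. *)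
Lemma modulus_algebra {R : realType} (nn eps m z F Y b0 b1 b2 bt G2 N2 P wt S2 S4 yb : R) :
  0 < eps -> eps <= 1 / 1024 -> 1 <= m -> 0 < z -> 0 < F -> F <= 1 ->
  eps * Y <= 1 -> m * z = b0 * F ^+ 2 -> 0 < b0 -> b0 <= 1 / 4 ->
  0 < b1 -> b1 <= 1 / 2 -> 0 < b2 -> b1 ^+ 2 <= b2 / 2 -> bt <= b2 / 4 ->
  G2 = 16 * eps ^+ 2 * z ^+ 2 * Y / F ^+ 2 -> (31 / 32) ^+ 2 <= N2 ->
  0 < P -> P ^+ 2 * (b1 * F ^+ 2) ^+ 2 = m ^+ 2 * N2 -> wt * (1 + P ^+ 2) = 1 ->
  0 <= S2 -> S2 * N2 <= G2 -> S4 <= S2 ^+ 2 -> yb ^+ 2 <= Y ->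
  0 < - bt * F ^+ 2 + 2 * eps * (2 * nn + 4) * F * b0
      + wt * (F ^+ 2 * b2 * P ^+ 2 - 8 * eps * F * b1 * P * yb)
      - 4 * nn * eps * F * b0 - m / z * (S4 + wt * S2).
Proof.
move=> e0 e1 m1 z0 F0 F1 eY mz b00 b04 b10 b12 b20 hb12 hbt hG hN P0 hP hw S20 hS2 hS4 hyb.
have w0 : 0 < wt.
  have : 0 < wt * (1 + P ^+ 2) by rewrite hw.
  by rewrite pmulr_lgt0 // ltr_pwDl // sqr_ge0.
have F20 : 0 < F ^+ 2 by rewrite exprn_gt0.
have P2 : 3 <= P ^+ 2.
  have h1 : b1 * F ^+ 2 <= 1 / 2.
    apply: le_trans b12; rewrite ler_piMr ?(ltW b10) //.
    by rewrite expr2 mulr_ile1 // ltW.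
  have h2 : (b1 * F ^+ 2) ^+ 2 <= (1 / 2) ^+ 2.
    by rewrite ler_sqr ?nnegrE ?divr_ge0 // mulr_ge0 // ltW.
  have h3 : 1 <= m ^+ 2 by rewrite expr_ge1 //; apply: le_trans m1.
  have h4 : N2 <= m ^+ 2 * N2.
    by rewrite ler_peMl //; apply: le_trans hN; rewrite exprn_ge0.
  have h5 : P ^+ 2 * (b1 * F ^+ 2) ^+ 2 <= P ^+ 2 * (1 / 2) ^+ 2 by rewrite ler_wpM2l // sqr_ge0.
  move: h5 h4 hN; rewrite hP; set A := m ^+ 2 * N2; set B := P ^+ 2; clear; rewrite !expr2; lra.
have wPP : wt * P ^+ 2 <= 1 by move: hw w0; clear; rewrite mulrDr mulr1; lra.
have wP : 3 / 4 <= wt * P ^+ 2.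
  have h : wt * 3 <= wt * P ^+ 2 by rewrite ler_pM2l.
  by move: hw h; rewrite mulrDr mulr1; clear; lra.
have T1 := modulus_algebra_cross eps m F Y N2 b1 b2 P wt yb e0 e1 m1 F0 F1 eY b10 b20 hb12 hN P0 hP w0 wPP hyb.
have T2 := modulus_algebra_rot eps m z F Y b0 b1 G2 N2 P wt S2 S4 e0 e1 m1 z0 F0 F1 eY mz b00 b04
  b10 b12 hG hN hP w0 wPP S20 hS2 hS4.
have T4 : F ^+ 2 * b2 * (3 / 4) <= wt * (F ^+ 2 * b2 * P ^+ 2).
  have -> : wt * (F ^+ 2 * b2 * P ^+ 2) = F ^+ 2 * b2 * (wt * P ^+ 2) by ring.
  by rewrite ler_pM2l // mulr_gt0.
have T5 : bt * F ^+ 2 <= F ^+ 2 * b2 / 4.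
  have : bt * F ^+ 2 <= b2 / 4 * F ^+ 2 by rewrite ler_pM2r.
  by clear; lra.
have p1 : 0 < F ^+ 2 * b2 by rewrite mulr_gt0.
have p2 : 0 < eps * F * b0 by rewrite !mulr_gt0.
move: T1 T2 T4 T5 p1 p2; rewrite mulrBr.
have -> : 2 * eps * (2 * nn + 4) * F * b0 = 4 * nn * eps * F * b0 + 8 * (eps * F * b0) by ring.
set a1 := wt * (8 * _ * _ * _ * _ * _); set a2 := m / z * _.
set a4 := wt * (F ^+ 2 * b2 * P ^+ 2).
rewrite mulNr; set a5 := bt * F ^+ 2; set a6 := eps * F * b0; set a7 := F ^+ 2 * b2.
set a8 := 4 * nn * eps * F * b0; clear; lra.
Qed.

(** * The contradiction at a touching point for the inverse profile *)

Section Touch.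
Context {R : realType} {n : nat}.
Implicit Types (e b p xi y : 'rV[R]_n) (H : 'M[R]_n).

Definition perp e xi : 'rV[R]_n := xi - dotp e xi *: e.

Lemma dotp_perp e xi : dotp e e = 1 -> dotp e (perp e xi) = 0.
Proof. by move=> e1; rewrite /perp !dotpE e1; ring. Qed.

Lemma dotp_rot e b xi : dotp b b = 1 -> 0 <= dotp e b -> dotp b (rotv e b xi) = 0.
Proof.
move=> b1 eb; rewrite /rotv !dotpE b1 (dotpC b e); field.
by rewrite gt_eqF // ltr_pwDl.
Qed.

Lemma sum_dotp_perp e b : dotp e e = 1 -> dotp b b = 1 ->
  \sum_(k < n) dotp b (perp e (delta_mx ord0 k)) ^+ 2 = 1 - dotp e b ^+ 2.
Proof.
move=> e1 b1; transitivity (dotp (b - dotp e b *: e) (b - dotp e b *: e)).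
  rewrite -sum_dotp_eps2; apply: eq_bigr => k _; rewrite /perp !dotpE (dotpC b e).
  by congr (_ ^+ 2); ring.
by rewrite !dotpE e1 b1 (dotpC b e); ring.
Qed.

Lemma rotB e b xi : dotp e e = 1 -> dotp b b = 1 -> 0 <= dotp e b ->
  let d := rotv e b xi - xi in
  dotp d d - dotp e d ^+ 2 =
  dotp b xi ^+ 2 * (1 - dotp e b ^+ 2) / (1 + dotp e b) ^+ 2.
Proof.
move=> e1 b1 eb d.
have -> : d = - (dotp b xi / (1 + dotp e b)) *: (e + b).
  by rewrite /d /rotv addrAC subrr add0r scaleNr.
rewrite !dotpE e1 b1 (dotpC b e); field.
by rewrite gt_eqF // ltr_pwDl.
Qed.

(** Common to the boundary and the interior case: [T k] is what the motion of [x] along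
    [perp e (delta_mx ord0 k)] contributes, namely boundary curvature or the Hessian at [x]. The
    gradient [p] is a positive multiple of a unit vector [b] near [e], so rotating the complement of
    [e] onto that of [b] matches the directions in which the coefficient matrix at [y] is the
    identity. Moving [y] alone along [b] supplies the remaining, one-dimensional part. *)
Lemma modulus_touch (eps m z F b0 b1 b2 bt vt ut : R) y e p H (T : 'I_n -> R) :
  0 < eps -> eps <= 1 / 1024 -> 1 <= m -> 0 < z -> 0 < F -> F <= 1 ->
  eps * dotp y y <= 1 -> m * z = b0 * F ^+ 2 -> 0 < b0 -> b0 <= 1 / 4 ->
  0 < b1 -> b1 <= 1 / 2 -> 0 < b2 -> b1 ^+ 2 <= b2 / 2 -> bt <= b2 / 4 ->
  dotp e e = 1 ->
  (forall xi, b1 * F ^+ 2 * dotp p xi = m * dotp e xi + 4 * eps * F * b0 * dotp y xi) ->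
  (forall b k0, dotp b b = 1 -> 0 <= dotp e b -> p = k0 *: b -> forall k,
    let xi := perp e (delta_mx ord0 k) in let xi' := rotv e b xi in
    F ^+ 2 * (b1 * (qf H xi' / 2))
    + b0 * (4 * eps ^+ 2 * dotp y xi' ^+ 2 - 2 * eps * F * dotp xi' xi')
    - m * ((dotp (xi' - xi) (xi' - xi) - dotp e (xi' - xi) ^+ 2) / (2 * z)) + T k <= 0) ->
  (forall xi, F ^+ 2 * (b1 * (qf H xi / 2) + b2 / 2 * dotp p xi ^+ 2)
    + b1 * dotp p xi * (- 4 * eps * F * dotp y xi)
    + b0 * (4 * eps ^+ 2 * dotp y xi ^+ 2 - 2 * eps * F * dotp xi xi)
    - m * ((dotp xi xi - dotp e xi ^+ 2) / (2 * z)) <= 0) ->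
  0 <= (b1 * (vt - ut) + bt) * F ^+ 2 - 2 * eps * (2 * n%:R + 4) * F * b0 ->
  - (F ^+ 2 * b1 * ut / 2) <= \sum_k T k ->
  vt = mcfop p H -> False.
Proof.
move=> e0 e1 m1 z0 F0 F1 eY mz b00 b04 b10 b12 b20 hb12 hbt ee hF1 hF2 hF3 hT hX hv.
have Y0 := dotp_ge0 y; set Y := dotp y y in eY Y0.
have F20 : 0 < F ^+ 2 by rewrite exprn_gt0.
have zb : z <= F ^+ 2 / 4.
  apply: (@le_trans _ _ (b0 * F ^+ 2)); first by rewrite -mz ler_peMl // ltW.
  by rewrite mulrC ler_pM2l //; apply: (le_trans b04); clear; lra.
(* By [m * z = b0 * F ^+ 2] the first-order condition reads [b1 F^2 p = m (e + q y)]. *)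
pose q := 4 * eps * z / F; pose ey := dotp e y.
have q0 : 0 <= q by rewrite /q divr_ge0 ?(ltW F0) // !mulr_ge0 // ltW.
pose a := e + q *: y; pose N2 := dotp a a.
have N2E : N2 = 1 + 2 * (q * ey) + q ^+ 2 * Y.
  by rewrite /N2 /a !dotpE ee (dotpC y e) -/ey -/Y; ring.
have eyY : ey ^+ 2 <= Y by have := dotp_CS e y; rewrite ee mul1r.
have qe : q <= eps.
  rewrite /q ler_pdivrMr //.
  have : z <= F / 4.
    by apply: (le_trans zb); rewrite ler_pM2r // expr2 ler_piMr // ltW.
  have : 4 * eps * z <= 4 * eps * (F / 4) -> 4 * eps * z <= eps * F by clear; lra.
  by move=> h1 h2; apply: h1; rewrite ler_pM2l // mulr_gt0.
have G2 : q ^+ 2 * Y <= eps.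
  have : q ^+ 2 * Y <= eps ^+ 2 * Y by rewrite ler_wpM2r // ler_sqr ?nnegrE // ltW.
  move=> h; apply: (le_trans h); rewrite expr2 -mulrA.
  by rewrite ler_piMr // ltW.
have qe2 : (q * ey) ^+ 2 <= q ^+ 2 * Y by rewrite exprMn ler_wpM2l // sqr_ge0.
have qe3 : `|q * ey| <= 1 / 32.
  have : `|q * ey| ^+ 2 <= (1 / 32) ^+ 2.
    rewrite real_normK ?num_real //; apply: (le_trans qe2); apply: (le_trans G2); apply: (le_trans e1).
    by rewrite expr2; clear; lra.
  by rewrite ler_sqr ?nnegrE // divr_ge0.
have h31 : 31 / 32 <= 1 + q * ey.
  by move: qe3; rewrite ler_norml => /andP[+ _]; clear; lra.
have hN : (31 / 32) ^+ 2 <= N2.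
  apply: (@le_trans _ _ ((1 + q * ey) ^+ 2)).
    by rewrite ler_sqr ?nnegrE ?divr_ge0 //; apply: le_trans h31; rewrite divr_ge0.
  by rewrite N2E; move: qe2; rewrite !expr2; clear; lra.
have N20 : 0 < N2 by apply: lt_le_trans hN; rewrite exprn_gt0 // divr_gt0.
pose N := Num.sqrt N2.
have N0 : 0 < N by rewrite sqrtr_gt0.
have NN : N ^+ 2 = N2 by rewrite sqr_sqrtr // ltW.
have Nn : N != 0 by rewrite gt_eqF.
pose b := N^-1 *: a.
have bb : dotp b b = 1 by rewrite /b dotpZl dotpZr -/N2 -NN; field.
have ebE : dotp e b = (1 + q * ey) / N by rewrite /b /a !dotpE ee -/ey mulrC.
have eb : 0 <= dotp e b by rewrite ebE divr_ge0 ?(ltW N0) //; apply: le_trans h31; rewrite divr_ge0.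
pose P := m * N / (b1 * F ^+ 2).
have m0 : 0 < m by apply: lt_le_trans m1.
have bF : 0 < b1 * F ^+ 2 by rewrite mulr_gt0.
have bFn : b1 * F ^+ 2 != 0 by rewrite gt_eqF.
have P0 : 0 < P by rewrite divr_gt0 // mulr_gt0.
have Fn : F != 0 by rewrite gt_eqF.
have b1n : b1 != 0 by rewrite gt_eqF.
have pE : p = P *: b.
  apply/rowP => i; have := hF1 (delta_mx ord0 i); rewrite !dotp_eps => h.
  apply: (mulfI bFn); rewrite h /b /a !mxE /P.
  have -> : 4 * eps * F * b0 = m * q.
    have -> : m * q = 4 * eps * (m * z) / F by rewrite /q; ring.
    by rewrite mz; field.
  by field; rewrite Nn b1n Fn.
have pp : dotp p p = P ^+ 2 by rewrite pE dotpZl dotpZr bb; ring.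
have pb : dotp p b = P by rewrite pE dotpZl bb mulr1.
pose wt := (1 + P ^+ 2)^-1.
have P21 : 1 + P ^+ 2 != 0 by rewrite gt_eqF // ltr_pwDl // sqr_ge0.
have w0 : 0 < wt by rewrite invr_gt0 ltr_pwDl // sqr_ge0.
have wE : wt * (1 + P ^+ 2) = 1 by rewrite mulVf.
pose S2 := 1 - dotp e b ^+ 2; pose S4 := S2 * S2 / (1 + dotp e b) ^+ 2.
have S20 : 0 <= S2 by have := dotp_CS e b; rewrite ee bb mulr1 /S2 subr_ge0.
have S2N : S2 * N2 <= q ^+ 2 * Y.
  have -> : S2 * N2 = N2 - (1 + q * ey) ^+ 2 by rewrite /S2 ebE -NN; field.
  rewrite N2E; have := sqr_ge0 (q * ey); rewrite !expr2; clear; lra.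
have S4le : S4 <= S2 ^+ 2.
  rewrite /S4 -expr2 ler_pdivrMr ?exprn_gt0 ?ltr_pwDl // ler_peMr ?sqr_ge0 //.
  by rewrite expr_ge1 ?addr_ge0 // lerDl.
have G2E : q ^+ 2 * Y = 16 * eps ^+ 2 * z ^+ 2 * Y / F ^+ 2 by rewrite /q; field.
have PE : P ^+ 2 * (b1 * F ^+ 2) ^+ 2 = m ^+ 2 * N2 by rewrite /P -NN; field; rewrite b1n Fn.
have yb : dotp y b ^+ 2 <= Y by have := dotp_CS y b; rewrite bb mulr1.
have alg := modulus_algebra n%:R eps m z F Y b0 b1 b2 bt _ N2 P wt S2 S4 (dotp y b)
  e0 e1 m1 z0 F0 F1 eY mz b00 b04 b10 b12 b20 hb12 hbt G2E hN P0 PE wE S20 S2N S4le yb.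
pose X k := rotv e b (perp e (delta_mx ord0 k)).
have s1 : \sum_(k < n) qf H (X k) + wt * qf H b = vt.
  by rewrite hv -(sum_qf_rot p e b P H ee bb eb pE) pp /wt mulrC.
have s2 : \sum_(k < n) dotp (X k) (X k) + wt * 1 <= n%:R.
  apply: le_trans (mcfop1_le p); rewrite -(sum_qf_rot p e b P _ ee bb eb pE) pp -!dotp_qf bb.
  rewrite (mulrC _ 1) !mul1r lerD2r; apply: ler_sum => k _; by rewrite -dotp_qf.
have s3 : \sum_(k < n) (dotp (X k - perp e (delta_mx ord0 k)) (X k - perp e (delta_mx ord0 k))
     - dotp e (X k - perp e (delta_mx ord0 k)) ^+ 2) = S4.
  under eq_bigr do rewrite (rotB _ _ _ ee bb eb).
  by rewrite -!mulr_suml sum_dotp_perp.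
have g2 : \sum_(k < n) (F ^+ 2 * (b1 * (qf H (X k) / 2))
    - b0 * (2 * eps * F * dotp (X k) (X k))
    - m * ((dotp (X k - perp e (delta_mx ord0 k)) (X k - perp e (delta_mx ord0 k))
     - dotp e (X k - perp e (delta_mx ord0 k)) ^+ 2) / (2 * z)) + T k) <= 0.
  apply: sumr_le0 => k _; apply: le_trans (hF2 b P bb eb pE k); rewrite -/(X k).
  have h : 0 <= b0 * (4 * eps ^+ 2 * dotp y (X k) ^+ 2).
    by rewrite mulr_ge0 ?(ltW b00) // mulr_ge0 ?sqr_ge0 // mulr_ge0 // sqr_ge0.
  by move: h; clear; lra.
move: g2; rewrite !big_split /= !sumrN -!mulr_sumr -!mulr_suml s3.
have zi : (2 * z)^-1 = z^-1 / 2 by field; rewrite gt_eqF.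
have hb := hF3 b; rewrite pb bb in hb.
have {hb} g3 : wt * (F ^+ 2 * (b1 * (qf H b / 2) + b2 / 2 * P ^+ 2) + b1 * P * (- 4 * eps * F * dotp y b)
   - b0 * (2 * eps * F) - m * (S2 * (z^-1 / 2))) <= 0.
  rewrite pmulr_rle0 // -zi; apply: le_trans hb; rewrite -/S2.
  have h : 0 <= b0 * (4 * eps ^+ 2 * dotp y b ^+ 2).
    by rewrite mulr_ge0 ?(ltW b00) // mulr_ge0 ?sqr_ge0 // mulr_ge0 // sqr_ge0.
  by move: h; clear; lra.
have s1' : F ^+ 2 * b1 * (\sum_(k < n) qf H (X k)) + F ^+ 2 * b1 * (wt * qf H b) = F ^+ 2 * b1 * vt.
  by rewrite -mulrDr s1.
have s2' : b0 * (2 * eps * F) * (\sum_(k < n) dotp (X k) (X k)) + b0 * (2 * eps * F) * wt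
    <= b0 * (2 * eps * F) * n%:R.
  by rewrite -mulrDr; move: s2; rewrite mulr1 => s2; rewrite ler_pM2l // !mulr_gt0.
rewrite zi => g2.
move: alg g2 g3 s1' s2' hT hX; set A := \sum_(k < n) qf H (X k).
set Q := qf H b; set D := \sum_(k < n) dotp (X k) (X k); set TT := \sum_(k < n) T k.
set yb0 := dotp y b; clearbody S2 S4 wt P A Q D TT yb0; clear; lra.
Qed.
End Touch.

Lemma continuousB {R : realType} {T : topologicalType} {V : normedModType R} (f g : T -> V) :
  continuous f -> continuous g -> continuous (fun p => f p - g p).
Proof. by move=> cf cg p; apply: (@cvgB _ _ _ (nbhs p)); [exact: cf|exact: cg]. Qed.

Lemma continuous_fst {S T : topologicalType} : continuous (@fst S T).
Proof. by move=> p; exact: cvg_fst. Qed.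

Lemma continuous_snd {S T : topologicalType} : continuous (@snd S T).
Proof. by move=> p; exact: cvg_snd. Qed.

Lemma continuous_comp2 {S T U : topologicalType} (f : S -> T) (g : T -> U) :
  continuous f -> continuous g -> continuous (fun p => g (f p)).
Proof. by move=> cf cg p; exact: (continuous_comp (cf p) (cg (f p))). Qed.

Lemma enorm_eq0 {R : realType} {n : nat} (v : 'rV[R]_n) : enorm v = 0 -> v = 0.
Proof. by move=> h; apply: dotp_eq0; rewrite -enorm_sqr h expr0n. Qed.

(** * Existence of a touching point for the inverse profile *)

Section Core.
Context {R : realType} {n : nat}.
Implicit Types (x y : 'rV[R]_n) (X D : set 'rV[R]_n) (v u : 'rV[R]_n -> R -> R).

Let T : topologicalType := ('rV[R]_n * 'rV[R]_n * R)%type.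

Lemma continuous_T1 : continuous (fun p : T => p.1.1).
Proof. by apply: (continuous_comp2 _ _ continuous_fst continuous_fst). Qed.

Lemma continuous_T2 : continuous (fun p : T => p.1.2).
Proof. by apply: (continuous_comp2 _ _ continuous_fst continuous_snd). Qed.

Lemma continuous_dist : continuous (fun p : T => enorm (p.1.2 - p.1.1)).
Proof.
apply: continuous_enorm; apply: continuousB; [exact: continuous_T2|exact: continuous_T1].
Qed.

Lemma continuous_pair2 {S U W : topologicalType} (f : S -> U) (g : S -> W) :
  continuous f -> continuous g -> continuous (fun p => (f p, g p)).
Proof. by move=> cf cg p; apply: cvg_pair; [exact: cf|exact: cg]. Qed.

Definition cyl (A : set 'rV[R]_n) : set ('rV[R]_n * R) := [set p | A p.1 /\ 0 < p.2].

Lemma cont_on_diff X D u v (K : set T) :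
  (forall p, K p -> [/\ X p.1.1, D p.1.2 & 0 < p.2]) ->
  cont_on (cyl D) (fun p => v p.1 p.2) -> cont_on (cyl X) (fun p => u p.1 p.2) ->
  cont_on K (fun p : T => v p.1.2 p.2 - u p.1.1 p.2).
Proof.
move=> hK cv cu; apply: cont_onB.
  apply: (cont_on_comp K (cyl D) (fun p : T => (p.1.2, p.2)) (fun p => v p.1 p.2)) => //.
    by apply: continuous_pair2; [exact: continuous_T2|exact: continuous_snd].
  by move=> p /hK[].
apply: (cont_on_comp K (cyl X) (fun p : T => (p.1.1, p.2)) (fun p => u p.1 p.2)) => //.
  by apply: continuous_pair2; [exact: continuous_T1|exact: continuous_snd].
by move=> p /hK[].
Qed.

(** Positive only for [y] in a ball that shrinks with time: it confines [y], and its decrease at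
    rate [eps * C] pays for its own space derivatives. *)
Definition pen (eps C : R) y (tau : R) : R := 1 - eps * (dotp y y + C * tau).

Lemma continuous_pen (eps C s : R) : continuous (fun p : T => pen eps C p.1.2 (p.2 - s)).
Proof.
move=> p; rewrite /pen; apply: (@cvgB _ _ _ (nbhs p)); first exact: cvg_cst.
apply: (@cvgM _ _ (nbhs p)); first exact: cvg_cst.
apply: (@cvgD _ _ _ (nbhs p)).
  by apply: (continuous_dotp _ _ continuous_T2 continuous_T2).
apply: (@cvgM _ _ (nbhs p)); first exact: cvg_cst.
by apply: (@cvgB _ _ _ (nbhs p)); [exact: continuous_snd|exact: cvg_cst].
Qed.

(** The quotient of [beta * F ^+ 2] by the distance is maximised, not their difference: its maximal
    value [m > 1] provides the identity [beta * F ^+ 2 = m * z], on which the later estimates rest.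
    A violation of the bound keeps [x] and [y] in a bounded set because [beta <= 1 / 4] bounds the
    distance and the penalty bounds [y]. *)
Lemma modulus_core X D u v (Hh dl s eps C : R) : closed X -> closed D ->
  cont_on (cyl D) (fun p => v p.1 p.2) -> cont_on (cyl X) (fun p => u p.1 p.2) ->
  (forall x y t, X x -> D y -> 0 < t -> v y t - u x t - dl <= Hh - 1) ->
  (forall x t, X x -> D x -> 0 < t -> v x t - u x t - dl < 0) ->
  0 < s -> 0 < eps -> 0 <= C -> 1 <= Hh ->
  (forall x y t m, X x -> D y -> s < t -> t <= s + 2 ->
    let z := enorm (y - x) in let w := v y t - u x t - dl in let F := pen eps C y (t - s) in
    0 < z -> 0 < w -> 0 < F -> F <= 1 -> eps * dotp y y <= 1 -> 1 <= m ->
    beta Hh (t - s) w * F ^+ 2 = m * z ->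
    (\forall q \near ((x, y, t) : T), X q.1.1 -> D q.1.2 -> q.2 <= t ->
       beta Hh (q.2 - s) (v q.1.2 q.2 - u q.1.1 q.2 - dl) * pen eps C q.1.2 (q.2 - s) ^+ 2
       <= m * enorm (q.1.2 - q.1.1)) -> False) ->
  forall x y t, X x -> D y -> s < t -> t <= s + 2 -> 0 <= pen eps C y (t - s) ->
  beta Hh (t - s) (v y t - u x t - dl) * pen eps C y (t - s) ^+ 2 <= enorm (y - x).
Proof.
move=> cX cD cv cu hB hdiag s0 e0 C0 H1 touch x y t Xx Dy st ts2 F0.
rewrite leNgt; apply/negP => hbad.
pose w (p : T) := v p.1.2 p.2 - u p.1.1 p.2 - dl.
pose z (p : T) := enorm (p.1.2 - p.1.1).
pose F (p : T) := pen eps C p.1.2 (p.2 - s).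
pose r0 := 1 + eps^-1.
pose K0 : set T := [set p | [/\ (X `&` [set x : 'rV[R]_n | `|x - 0| <= r0 + 1]) p.1.1,
   (D `&` [set x : 'rV[R]_n | `|x - 0| <= r0]) p.1.2 & s <= p.2 <= s + 2]].
have cK0 : compact K0.
  exact: (compact_prod3 _ _ _ (compact_closedIl _ _ (rV_ball_compact 0 _) cX)
    (compact_closedIl _ _ (rV_ball_compact 0 _) cD) (itv_compact _ _)).
have K0h p : K0 p -> [/\ X p.1.1, D p.1.2 & 0 < p.2].
  by case=> [[? _] [? _] /andP[? _]]; split => //; exact: lt_le_trans s0 _.
have cw : cont_on K0 w.
  by apply: cont_onB; [apply: (cont_on_diff X D)|exact: cont_on_cst].
pose K1 : set T := [set p | K0 p /\ 0 <= w p].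
have cK1 : compact K1 by exact: compact_ge.
have cz A : cont_on A z by apply: continuous_cont_on; exact: continuous_dist.
have cF A : cont_on A F by apply: continuous_cont_on; exact: continuous_pen.
have inK1 p : X p.1.1 -> D p.1.2 -> s < p.2 -> p.2 <= s + 2 -> 0 < F p ->
    z p < beta Hh (p.2 - s) (w p) * F p ^+ 2 ->
    [/\ K1 p, 0 < w p, F p <= 1 & eps * dotp p.1.2 p.1.2 <= 1].
  move=> Xp Dp sp p2 Fp hp.
  have tp : 0 < p.2 - s by rewrite subr_gt0.
  have p20 : 0 < p.2 by apply: lt_trans sp.
  have wH : w p <= Hh - 1 by exact: hB.
  have F2 : 0 < F p ^+ 2 by rewrite exprn_gt0.
  have zp0 : 0 <= z p by exact: enorm_ge0.
  have b0 : 0 < beta Hh (p.2 - s) (w p).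
    by have := le_lt_trans zp0 hp; rewrite pmulr_lgt0.
  have wp : 0 < w p.
    by rewrite -(beta_gt0 Hh (p.2 - s)) //; apply: le_trans H1.
  have yy0 : 0 <= eps * dotp p.1.2 p.1.2 by rewrite mulr_ge0 ?dotp_ge0 // ltW.
  have ct0 : 0 <= eps * (C * (p.2 - s)) by rewrite !mulr_ge0 // ltW.
  have FE : F p = 1 - (eps * dotp p.1.2 p.1.2 + eps * (C * (p.2 - s))) by rewrite /F /pen mulrDr.
  have F1 : F p <= 1 by rewrite FE gerBl addr_ge0.
  have ey : eps * dotp p.1.2 p.1.2 <= 1.
    by move: Fp ct0; rewrite FE; clear -n; lra.
  have yr : enorm p.1.2 <= r0.
    have ei : 0 < eps^-1 by rewrite invr_gt0.
    have h1 : dotp p.1.2 p.1.2 <= eps^-1.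
      by rewrite -[leRHS]mul1r ler_pdivlMr // mulrC.
    have h2 : enorm p.1.2 ^+ 2 <= r0 ^+ 2.
      rewrite enorm_sqr; apply: (le_trans h1); rewrite /r0; move: ei.
      set a := eps^-1; have := sqr_ge0 a; rewrite sqrrD expr1n mul1r; clear -n; lra.
    by move: h2; rewrite ler_sqr ?nnegrE ?enorm_ge0 // addr_ge0 // ltW.
  have yn : `|p.1.2| <= r0 by apply: le_trans (norm_le_enorm _) yr.
  have zl : z p <= 1.
    apply: ltW; apply: lt_le_trans hp _.
    have : beta Hh (p.2 - s) (w p) <= 1.
      by apply: le_trans (beta_lt4 _ _ _ tp wH) _; clear -n; lra.
    by move=> h; rewrite mulr_ile1 // ?(ltW b0) // ?(ltW F2) // expr2 mulr_ile1 // ltW.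
  have xn : `|p.1.1| <= r0 + 1.
    have -> : p.1.1 = p.1.2 - (p.1.2 - p.1.1) by rewrite subKr.
    apply: le_trans (ler_normB _ _) _; apply: lerD => //.
    by apply: le_trans (norm_le_enorm _) _.
  split => //; split; last exact: ltW.
  by split; [rewrite /= subr0|rewrite /= subr0|rewrite ltW].
pose p0 : T := (x, y, t).
have Fp0 : 0 < F p0.
  rewrite lt_neqAle F0 andbT eq_sym; apply/eqP => h0.
  by move: hbad; rewrite -[pen _ _ _ _]/(F p0) h0 expr0n mulr0 ltNge enorm_ge0.
have [p0K1 _ _ _] : [/\ K1 p0, 0 < w p0, F p0 <= 1 & eps * dotp y y <= 1] by apply: inK1.
(* The points with [0 <= w] form a compact set down to time [s], where [u] and [v] are still
   continuous, and [w < 0] on the diagonal. So the distance is bounded below on it, whereas [beta]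
   tends to 0 at time [s]: violations avoid the initial time. *)
have [pm pmK1 hpm] := compact_min K1 z cK1 (ex_intro _ p0 p0K1) (cz K1).
have zm0 : 0 < z pm.
  rewrite lt_neqAle enorm_ge0 andbT eq_sym; apply/eqP => /enorm_eq0/eqP; rewrite subr_eq0 => /eqP E.
  case: pmK1 => K0pm; have [X1 D1 t1] := K0h _ K0pm.
  by rewrite /w E; apply/negP; rewrite -ltNge; apply: hdiag => //; rewrite -E.
have [tau tau0 htau] := beta_small (z pm) zm0.
pose K : set T := [set p | [set p | K1 p /\ s + tau <= p.2] p /\ 0 <= F p].
have cK : compact K.
  apply: compact_ge => //; apply: compact_ge => //.
  by apply: continuous_cont_on; exact: continuous_snd.
have inK p : X p.1.1 -> D p.1.2 -> s < p.2 -> p.2 <= s + 2 -> 0 < F p ->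
    z p < beta Hh (p.2 - s) (w p) * F p ^+ 2 ->
    [/\ K p, 0 < w p, F p <= 1 & eps * dotp p.1.2 p.1.2 <= 1].
  move=> Xp Dp sp p2 Fp hp; have [K1p wp F1 ey] := inK1 _ Xp Dp sp p2 Fp hp.
  split => //; split; last exact: ltW.
  split => //; rewrite leNgt; apply/negP => h.
  have tp : 0 < p.2 - s by rewrite subr_gt0.
  have wH : w p <= Hh - 1 by apply: hB => //; apply: lt_trans sp.
  have h1 : beta Hh (p.2 - s) (w p) < z pm by apply: htau => //; rewrite lerBlDl ltW.
  have h2 := hpm _ K1p.
  have b0 : 0 <= beta Hh (p.2 - s) (w p).
    by rewrite ltW // beta_gt0 //; apply: le_trans H1.
  have : beta Hh (p.2 - s) (w p) * F p ^+ 2 <= beta Hh (p.2 - s) (w p).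
    by rewrite ler_piMr // expr2 mulr_ile1 // ltW.
  by move: h1 h2 hp; clear -n; lra.
have p0K : K p0 by have [] := inK p0 Xx Dy st ts2 Fp0 hbad.
have Kz p : K p -> 0 < z p.
  by case=> [[K1p _] _]; apply: lt_le_trans zm0 _; exact: hpm.
pose Q (p : T) := beta Hh (p.2 - s) (w p) * F p ^+ 2 / z p.
have cQ : cont_on K Q.
  apply: cont_onM; last by apply: cont_onV => [p /Kz h|//]; rewrite gt_eqF.
  apply: cont_onM; last exact: cont_onX.
  apply: beta_continuous.
  - move=> p [[_ h] _]; rewrite gt_eqF //; move: h tau0; clear -n; lra.
  - apply: continuous_cont_on; apply: continuousB; first exact: continuous_snd.
    exact: cst_continuous.
  - by apply: (cont_on_sub _ _ _ _ cw) => p [[[? _] _] _].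
have [p Kp hp] := compact_max K Q cK (ex_intro _ p0 p0K) cQ.
pose m := Q p.
have m1 : 1 < m.
  apply: lt_le_trans (hp _ p0K); rewrite /Q ltr_pdivlMr ?Kz // mul1r; exact: hbad.
have zp := Kz _ Kp.
have mE : beta Hh (p.2 - s) (w p) * F p ^+ 2 = m * z p by rewrite /m /Q divfK // gt_eqF.
have [[[[ [Xp _] [Dp _] /andP[sp ps2]] wp0] tp] Fp0'] := Kp.
have stp : s < p.2 by move: tp tau0; clear -n; lra.
have Fpp : 0 < F p.
  rewrite lt_neqAle Fp0' andbT eq_sym; apply/eqP => h0.
  have : 0 < m * z p by rewrite mulr_gt0 //; apply: lt_trans m1.
  by rewrite -mE h0 expr0n mulr0 ltxx.
have hbp : z p < beta Hh (p.2 - s) (w p) * F p ^+ 2 by rewrite mE ltr_pMl.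
have [_ wp F1 ey] := inK p Xp Dp stp ps2 Fpp hbp.
have pE : (p.1.1, p.1.2, p.2) = p by rewrite -!surjective_pairing.
apply: (touch p.1.1 p.1.2 p.2 m) => //; first exact: ltW.
rewrite pE.
have nF : \forall q \near p, 0 < F q.
  by apply: (@cvgr_gt R T (nbhs p) _ F _ (continuous_pen eps C s p)).
have nt : \forall q \near p, s < q.2.
  by apply: (@cvgr_gt R T (nbhs p) _ snd _ (@continuous_snd _ _ p)).
near=> q => Xq Dq qt.
rewrite leNgt; apply/negP => hq.
have Fq : 0 < F q by near: q.
have sq : s < q.2 by near: q.
have zq : z q < beta Hh (q.2 - s) (w q) * F q ^+ 2.
  by apply: le_lt_trans hq; rewrite ler_peMl ?enorm_ge0 // ltW.
have [Kq _ _ _] := inK q Xq Dq sq (le_trans qt ps2) Fq zq.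
have := hp _ Kq; rewrite -/m leNgt => /negP; apply.
by rewrite /Q ltr_pdivlMr ?Kz.
Unshelve. all: by end_near.
Qed.

End Core.

(** * Expansions of differentiable functions and the boundary *)

(** The frame forms a square matrix [B] with [B B^T = 1]; then [B^T B = 1], and this is the
    expansion of [xi]. *)
Lemma frame_complete {R : realType} {n : nat} (f : 'I_n -> 'rV[R]_n.+1) (nu xi : 'rV[R]_n.+1) :
  dotp nu nu = 1 -> (forall i, dotp (f i) nu = 0) ->
  (forall i j, dotp (f i) (f j) = (i == j)%:R) ->
  xi = dotp nu xi *: nu + \sum_i dotp (f i) xi *: f i.
Proof.
move=> h1 h2 h3.
pose r (i : 'I_n.+1) := if unlift ord0 i is Some k then f k else nu.
have r0 : r ord0 = nu by rewrite /r unlift_none.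
have rl k : r (lift ord0 k) = f k by rewrite /r liftK.
pose B : 'M[R]_n.+1 := \matrix_(i, j) r i ord0 j.
have BB : B *m B^T = 1%:M.
  apply/matrixP => i j; rewrite !mxE.
  transitivity (dotp (r i) (r j)); first by apply: eq_bigr => k _; rewrite !mxE.
  case: (unliftP ord0 i) => [i' ->|->]; case: (unliftP ord0 j) => [j' ->|->];
    rewrite ?rl ?r0 ?h1 ?h2 ?h3 //.
  by rewrite dotpC h2.
have {}BB := mulmx1C BB.
apply/rowP => j.
have : \sum_k (\sum_i B i j * B i k) * xi ord0 k = xi ord0 j.
  rewrite (bigD1 j) //= [X in _ + X]big1 ?addr0 => [|k kj].
    have /matrixP/(_ j j) := BB; rewrite !mxE eqxx => h.
    rewrite (_ : \sum_i _ = 1) ?mul1r // -[RHS]h.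
    by apply: eq_bigr => i _; rewrite !mxE.
  have /matrixP/(_ j k) := BB; rewrite !mxE eq_sym (negbTE kj) => h.
  rewrite (_ : \sum_i _ = 0) ?mul0r // -[RHS]h.
  by apply: eq_bigr => i _; rewrite !mxE.
move=> <-; under eq_bigr do rewrite mulr_suml.
rewrite exchange_big /= !mxE summxE big_ord_recl; congr (_ + _).
  rewrite /dotp mulr_suml; apply: eq_bigr => k _; rewrite !mxE r0; ring.
apply: eq_bigr => i _; rewrite !mxE /dotp mulr_suml; apply: eq_bigr => k _.
rewrite !mxE rl; ring.
Qed.

Section Calc.
Context {R : realType} {n : nat}.
Implicit Types (f : 'rV[R]_n -> R) (x v : 'rV[R]_n).

Lemma derive_lin {I : finType} f x (a : I -> R) (w : I -> 'rV[R]_n) : differentiable f x ->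
  'D_(\sum_i a i *: w i) f x = \sum_i a i * 'D_(w i) f x.
Proof.
move=> df; rewrite deriveE // linear_sum; apply: eq_bigr => i _.
by rewrite linearZ /= deriveE.
Qed.

Lemma derive_grad f x v : differentiable f x -> 'D_v f x = dotp (grad f x) v.
Proof.
move=> df; rewrite {1}[v]row_sum_delta derive_lin // /dotp; apply: eq_bigr => i _.
by rewrite !mxE mulrC.
Qed.

End Calc.

Lemma near_line {R : realType} {n : nat} (P : 'rV[R]_n -> Prop) (x v w : 'rV[R]_n) :
  (\forall y \near x, P y) -> \forall s \near (0 : R), P (x + s *: v + s ^+ 2 *: w).
Proof.
move=> h; have hi : nbhs x [set y | P y] by [].
rewrite nbhsE in hi; have [A [oA Ax] AP] := hi.
by apply: filterS (near_curve _ _ v w oA Ax) => s /AP.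
Qed.

Lemma dotp_gt0 {R : realType} {n : nat} (v : 'rV[R]_n) : v != 0 -> 0 < dotp v v.
Proof.
move=> v0; rewrite lt_neqAle dotp_ge0 andbT eq_sym; apply: contra_neq v0; exact: dotp_eq0.
Qed.

Lemma enormZ {R : realType} {n : nat} (k : R) (v : 'rV[R]_n) : enorm (k *: v) = `|k| * enorm v.
Proof. by rewrite /enorm !dotpE mulrA -expr2 sqrtrM ?sqr_ge0 // sqrtr_sqr. Qed.

Lemma jet2_parabola {R : realType} {n : nat} (f : 'rV[R]_n -> R) (x v w : 'rV[R]_n) :
  (\forall y \near x, differentiable f y) -> (forall u, differentiable ('D_u f) x) ->
  jet2 (fun s => f (x + s *: v + s ^+ 2 *: w)) (f x) ('D_v f x)
    ('D_v ('D_v f) x / 2 + 'D_w f x).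
Proof.
move=> df d2f e e0.
have hline : jet2 (fun s => f (x + s *: v)) (f x) ('D_v f x) ('D_v ('D_v f) x / 2).
  have h1 : \forall y \near x, is_derive y v f ('D_v f y).
    by apply: filterS df => y dy; apply: derivableP; exact: diff_derivable.
  have h2 : is_derive x v ('D_v f) ('D_v ('D_v f) x) by apply: derivableP; exact: diff_derivable.
  exact: jet2_taylor h1 h2.
have e20 : 0 < e / 2 by lra.
have cw : \forall y \near x, `|'D_w f x - 'D_w f y| <= e / 2.
  have := differentiable_continuous (d2f w) => /cvgrPdist_le /(_ _ e20); exact.
have hnb : nbhs x [set y | differentiable f y /\ `|'D_w f x - 'D_w f y| <= e / 2].
  by near=> y; split; near: y.
have [r /= r0 hr] := (nbhs_ballP _ _).1 hnb.
have r20 : 0 < r / 2 by lra.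
have hv : \forall s \near (0 : R), `|s *: v| <= r / 4.
  have v1 : 0 < `|v| + 1 by rewrite ltr_wpDl.
  have : 0 < r / 4 / (`|v| + 1) by rewrite divr_gt0 // divr_gt0.
  move=> /near0_norm; apply: filterS => s hs; rewrite normrZ.
  apply: (@le_trans _ _ (r / 4 / (`|v| + 1) * (`|v| + 1))); last by rewrite divfK // gt_eqF.
  by apply: ler_pM => //; rewrite lerDl.
have hw : \forall s \near (0 : R), `|s ^+ 2 *: w| <= r / 4.
  have v1 : 0 < `|w| + 1 by rewrite ltr_wpDl.
  have h1 : 0 < r / 4 / (`|w| + 1) by rewrite divr_gt0 // divr_gt0.
  near=> s.
  have s1 : `|s| <= 1 by near: s; exact: near0_norm.
  have s2 : `|s| <= r / 4 / (`|w| + 1) by near: s; exact: near0_norm.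
  rewrite normrZ normrX.
  apply: (@le_trans _ _ (r / 4 / (`|w| + 1) * (`|w| + 1))); last by rewrite divfK // gt_eqF.
  apply: ler_pM => //; rewrite ?lerDl //.
  by apply: le_trans s2; rewrite expr2 ler_piMr.
near=> s.
have hs1 : `|s *: v| <= r / 4 by near: s.
have hs2 : `|s ^+ 2 *: w| <= r / 4 by near: s.
have hs3 : `|f (x + s *: v) - (f x + 'D_v f x * s + 'D_v ('D_v f) x / 2 * s ^+ 2)| <= e / 2 * `|s| ^+ 2.
  by near: s; exact: hline.
(* The displacement [s ^+ 2 *: w] is treated by the mean value theorem along [w]; continuity of the
   derivative along [w] at [x] makes its error of order [o(s^2)]. *)
pose g (t : R) : R := f (x + s *: v + t *: (s ^+ 2 *: w)).
have inb (t : R) : 0 <= t <= 1 -> differentiable f (x + s *: v + t *: (s ^+ 2 *: w)) /\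
    `|'D_w f x - 'D_w f (x + s *: v + t *: (s ^+ 2 *: w))| <= e / 2.
  move=> /andP[t0 t1]; apply: hr; rewrite -ball_normE /= distrC.
  have -> : x + s *: v + t *: (s ^+ 2 *: w) - x = s *: v + t *: (s ^+ 2 *: w).
    by rewrite addrAC; congr (_ + _); rewrite addrAC subrr add0r.
  apply: le_lt_trans (ler_normD _ _) _.
  have h3 : `|t *: (s ^+ 2 *: w)| <= r / 4.
    by apply: le_trans hs2; rewrite normrZ ger0_norm // ler_piMl.
  by move: hs1 h3 r0; clear -R; lra.
have dg (t : R) : 0 <= t <= 1 -> is_derive t 1 g (s ^+ 2 * 'D_w f (x + s *: v + t *: (s ^+ 2 *: w))).
  move=> ht; have [dfx _] := inb t ht.
  apply: is_derive_line.
  have -> : s ^+ 2 * 'D_w f (x + s *: v + t *: (s ^+ 2 *: w)) =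
     'D_(s ^+ 2 *: w) f (x + s *: v + t *: (s ^+ 2 *: w)).
    rewrite (deriveE w dfx) (deriveE (s ^+ 2 *: w) dfx).
    exact: (esym (linearZ_LR _ _ _)).
  by apply: derivableP; exact: diff_derivable.
have [c] : exists2 c, c \in `]0, 1[%R &
    g 1 - g 0 = s ^+ 2 * 'D_w f (x + s *: v + c *: (s ^+ 2 *: w)) * (1 - 0).
  apply: (@MVT R g (fun c => s ^+ 2 * 'D_w f (x + s *: v + c *: (s ^+ 2 *: w)))) => //.
    by move=> t; rewrite in_itv /= => /andP[t0 t1]; apply: dg; rewrite !ltW.
  apply: derivable_within_continuous => t; rewrite in_itv /= => ht.
  by have [] := dg t ht.
rewrite in_itv /= => /andP[c0 c1]; rewrite subr0 mulr1 /g scale1r scale0r addr0 => hc.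
have [|_ hc2] := inb c; first by rewrite !ltW.
have -> : f (x + s *: v + s ^+ 2 *: w) -
   (f x + 'D_v f x * s + ('D_v ('D_v f) x / 2 + 'D_w f x) * s ^+ 2) =
  (f (x + s *: v) - (f x + 'D_v f x * s + 'D_v ('D_v f) x / 2 * s ^+ 2)) -
  s ^+ 2 * ('D_w f x - 'D_w f (x + s *: v + c *: (s ^+ 2 *: w))).
  by rewrite mulrBr -hc; ring.
apply: le_trans (ler_normB _ _) _.
rewrite (normrM (s ^+ 2)) (normrX 2 s).
have : `|s| ^+ 2 * `|'D_w f x - 'D_w f (x + s *: v + c *: (s ^+ 2 *: w))| <= `|s| ^+ 2 * (e / 2).
  by rewrite ler_wpM2l // exprn_ge0.
by move: hs3; set A := `|s| ^+ 2; clear; lra.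
Unshelve. all: by end_near.
Qed.

Lemma C2_facts {R : realType} {n : nat} (U : set 'rV[R]_n) (f : 'rV[R]_n -> R) (x : 'rV[R]_n) :
  open U -> U x -> Ck_on 2 U f ->
  [/\ \forall y \near x, differentiable f y, forall u, differentiable ('D_u f) x &
      forall u w, {for x, continuous ('D_w ('D_u f))}].
Proof.
move=> oU Ux [h1 h2]; split.
- have : nbhs x U by exact: open_nbhs_nbhs.
  by apply: filterS => y; exact: h1.
- by move=> u; have [h3 _] := h2 u; exact: h3.
- by move=> u w; have [_ h3] := h2 u; exact: h3.
Qed.

(** * The complement of the domain at a nearest point *)

Section BG.
Context {R : realType} {n : nat}.
Implicit Types (Omega : set 'rV[R]_n.+1) (x e : 'rV[R]_n.+1).

(** A point with a whole neighbourhood outside [Omega] could be moved along [e] and would come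
    closer to [x + z *: e]. *)
Lemma closest_boundary Omega x e (z : R) : open Omega -> ~ Omega x -> 0 < z -> dotp e e = 1 ->
  (\forall x' \near x, ~ Omega x' -> z <= enorm (x + z *: e - x')) -> boundary Omega x.
Proof.
move=> oO nOx z0 e1 hmin; split; last by move=> /interior_subset.
move=> B hB; apply: contrapT => h0.
have nO y : B y -> ~ Omega y by move=> By Oy; apply: h0; exists y.
have hz : \forall s \near (0 : R), B (x + s *: e + s ^+ 2 *: (0 : 'rV[R]_n.+1)).
  exact: near_line hB.
have hm := near_line _ x e 0 hmin.
have [r /= r0 hr] := filterI hz hm.
pose s := Num.min (r / 2) (z / 2).
have s0 : 0 < s by rewrite lt_min !divr_gt0.
have sr : s <= r / 2 by rewrite ge_min lexx.
have sz : s <= z / 2 by rewrite ge_min lexx orbT.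
have [|h1 h2] := hr s; first by rewrite /= sub0r normrN gtr0_norm //; move: sr r0; clear; lra.
have := h2 (nO _ h1); rewrite scaler0 addr0.
have -> : x + z *: e - (x + s *: e) = (z - s) *: e.
  by rewrite scalerBl opprD addrA (addrC x) addrK.
rewrite enormZ /enorm e1 sqrtr1 mulr1 ger0_norm; last by move: sz z0; clear; lra.
by move: s0; clear; lra.
Qed.

(** Minimality forces [e] to be the inner normal. The parabolas bend towards [Omega] as far as the
    second fundamental form allows; the loss [eta] makes the defining function grow by a positive
    multiple of [s ^+ 2], which beats the remainder. Summed over the projected basis vectors the
    [kappa k] give half the mean curvature, so mean convexity is the sign of the sum. *)
Lemma boundary_touch Omega x e (z : R) : open Omega -> mean_convex Omega -> ~ Omega x ->
  0 < z -> dotp e e = 1 ->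
  (\forall x' \near x, ~ Omega x' -> z <= enorm (x + z *: e - x')) ->
  exists2 kappa : 'I_n.+1 -> R, 0 <= \sum_k kappa k &
    forall k eta, 0 < eta -> \forall s \near (0 : R),
      ~ Omega (x + s *: perp e (delta_mx ord0 k) + s ^+ 2 *: ((kappa k - eta) *: e)).
Proof.
move=> oO mc nOx z0 e1 hmin.
have bx := closest_boundary _ _ _ _ oO nOx z0 e1 hmin.
have [kap [rho [f [[U [oU Ux C2 g0 hU]] f1 f2 f3]]] skap] := mc x bx.
have [df d2f _] := C2_facts _ _ _ oU Ux C2.
have dfx : differentiable rho x by exact: nbhs_singleton df.
pose N := grad rho x.
have NN0 : 0 < dotp N N by exact: dotp_gt0.
pose g := enorm N.
have g0' : 0 < g by rewrite sqrtr_gt0.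
have gg : g ^+ 2 = dotp N N by rewrite enorm_sqr.
have gn : g != 0 by rewrite gt_eqF.
have rx : 0 <= rho x by rewrite leNgt; apply/negP => h; apply: nOx; exact/hU.
have nU : \forall y \near x, U y by exact: open_nbhs_nbhs.
(* A direction that leaves [Omega] to first order is admissible for [x], so it cannot lead towards
   [x + z *: e]. *)
have hout v : 0 < dotp N v -> dotp e v <= 0.
  move=> Nv.
  have jr := jet2_parabola rho x v 0 df d2f.
  rewrite derive_grad // -/N in jr.
  have jn := jet1N (jet2_jet1 jr).
  have o1 : \forall s \near (0 : R), 0 < s -> ~ Omega (x + s *: v + s ^+ 2 *: (0 : 'rV[R]_n.+1)).
    have h2 : 0 < dotp N v / 2 by rewrite divr_gt0.
    have nUs := near_line _ x v 0 nU.
    near=> s => s0.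
    have h1 : `|rho (x + s *: v + s ^+ 2 *: (0 : 'rV[R]_n.+1)) - (rho x + dotp N v * s)|
       <= dotp N v / 2 * `|s| ^+ 1 by near: s; exact: (jet2_jet1 jr).
    have Us : U (x + s *: v + s ^+ 2 *: (0 : 'rV[R]_n.+1)) by near: s.
    move=> /(hU _ Us); move: h1; rewrite expr1 (gtr0_norm s0) ler_norml => /andP[+ _].
    have : 0 < dotp N v * s by rewrite mulr_gt0.
    by move: rx; clear -R; lra.
  have hm := near_line _ x v 0 hmin.
  rewrite leNgt; apply/negP => ev.
  have [r /= r0 hr] := filterI o1 hm.
  have [s s0 [sr sv]] : exists2 s, 0 < s & s < r /\ s * dotp v v < 2 * z * dotp e v.
    have q0 : 0 < 2 * z * dotp e v by rewrite !mulr_gt0.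
    have p0 : 0 < dotp v v + 1 by rewrite ltr_wpDl // dotp_ge0.
    exists (Num.min (r / 2) (2 * z * dotp e v / (dotp v v + 1))).
      by rewrite lt_min !divr_gt0.
    split; first by rewrite gt_min; apply/orP; left; move: r0; clear -R; lra.
    apply: (@le_lt_trans _ _ (2 * z * dotp e v / (dotp v v + 1) * dotp v v)).
      by rewrite ler_wpM2r ?dotp_ge0 // ge_min lexx orbT.
    by rewrite mulrAC ltr_pdivrMr // ltr_pM2l // ltrDl.
  have [|h1 h2] := hr s; first by rewrite /= sub0r normrN gtr0_norm.
  have := h2 (h1 s0); rewrite scaler0 addr0.
  have -> : x + z *: e - (x + s *: v) = z *: e - s *: v by rewrite opprD addrA (addrC x) addrK.
  move=> h3; have : z ^+ 2 <= enorm (z *: e - s *: v) ^+ 2.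
    by rewrite ler_sqr ?nnegrE ?enorm_ge0 // ltW.
  rewrite enorm_sqr !dotpE e1 (dotpC v e).
  have : s * (s * dotp v v) < s * (2 * z * dotp e v) by rewrite ltr_pM2l.
  by set a := dotp v v; set b := dotp e v; clear; rewrite expr2; lra.
pose w := g ^+ 2 *: e - dotp N e *: N.
have Nw : dotp N w = 0 by rewrite /w !dotpE gg; ring.
(* [w] is a multiple of the tangential part of [e]. Adding any multiple of it to the outer normal
   leaves an outward direction, so its product with [e] must vanish. *)
have ew0 : dotp e w = 0.
  have key c : dotp e N + c * dotp e w <= 0.
    by rewrite -dotpZr -dotpDr; apply: hout; rewrite dotpDr dotpZr Nw mulr0 addr0.
  apply: contrapT => /eqP ew.
  have := key ((1 - dotp e N) / dotp e w); rewrite divfK //; clear; lra.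
have eN : e = - g^-1 *: N.
  have w0 : w = 0.
    apply: dotp_eq0; rewrite {1}/w dotpDl dotpNl !dotpZl Nw ew0; ring.
  have E : g ^+ 2 *: e = dotp N e *: N by apply/eqP; rewrite -subr_eq0 -/w w0.
  have E2 : e = (dotp N e / g ^+ 2) *: N.
    by rewrite mulrC -scalerA -E scalerA mulVf ?scale1r // expf_neq0.
  have Ne : dotp N e <= 0 by rewrite dotpC; apply: hout.
  have Ne2 : dotp N e ^+ 2 = g ^+ 2.
    have : dotp e e = dotp N e ^+ 2 / g ^+ 2.
      by rewrite {1}E2 dotpZl; field.
    rewrite e1 => /esym h; rewrite -[RHS]mul1r -h divfK // expf_neq0 //.
  have Ne3 : dotp N e = - g.
    apply/eqP; move/eqP: Ne2; rewrite eqf_sqr => /orP[/eqP h|//].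
    by move: Ne; rewrite h leNgt g0'.
  by rewrite {1}E2 Ne3; congr (_ *: _); field.
have fe i : dotp (f i) e = 0 by rewrite eN dotpZr f1 mulr0.
pose P k := perp e (delta_mx ord0 k).
pose a (k : 'I_n.+1) (i : 'I_n) := dotp (f i) (delta_mx ord0 k).
have PE k : P k = \sum_i a k i *: f i.
  rewrite {1}(frame_complete f e (P k) e1 fe f2) dotp_perp // scale0r add0r.
  by apply: eq_bigr => i _; rewrite /P /perp dotpDr dotpNr dotpZr fe mulr0 subr0.
have D1 k y : differentiable rho y -> 'D_(P k) rho y = \sum_i a k i * 'D_(f i) rho y.
  by move=> dy; rewrite PE derive_lin.
have D2 k : 'D_(P k) ('D_(P k) rho) x = \sum_i a k i ^+ 2 * (kap i * g).
  have -> : 'D_(P k) ('D_(P k) rho) x = 'D_(P k) (\sum_i (a k i \*: 'D_(f i) rho)) x.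
    apply: near_eq_derive; apply: filterS df => y dy.
    by rewrite D1 // fct_sumE.
  rewrite derive_sum => [|i]; last by apply: derivableZ; exact: diff_derivable.
  apply: eq_bigr => i _; rewrite deriveZ; last exact: diff_derivable.
  rewrite PE derive_lin // (bigD1 i) //= big1 => [|j ji].
    have -> : 'D_(f i) ('D_(f i) rho) x = kap i * g.
      by have := f3 i i; rewrite eqxx mulr1 => <-; rewrite divfK.
    by rewrite addr0 expr2 -mulrA.
  have := f3 i j; rewrite eq_sym (negbTE ji) mulr0 => /eqP.
  by rewrite mulf_eq0 invr_eq0 (negbTE gn) orbF => /eqP ->; rewrite mulr0.
(* The factor one half appears because the parabolas carry [s ^+ 2] and not half of it. *)
exists (fun k => 'D_(P k) ('D_(P k) rho) x / (2 * g)).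
  have -> : \sum_k 'D_(P k) ('D_(P k) rho) x / (2 * g) = (\sum_i kap i) / 2.
    under eq_bigr do rewrite D2 mulr_suml.
    rewrite exchange_big mulr_suml /=; apply: eq_bigr => i _.
    rewrite -mulr_suml -mulr_suml /a sum_dotp_eps2 f2 eqxx /= mul1r; field.
    by rewrite gn.
  by rewrite divr_ge0.
move=> k eta eta0; set c := _ - eta.
have jr := jet2_parabola rho x (P k) (c *: e) df d2f.
have nUs := near_line _ x (P k) (c *: e) nU.
have De : 'D_(c *: e) rho x = - c * g.
  by rewrite derive_grad // -/N eN !dotpE -gg; field.
have DP : 'D_(P k) rho x = 0.
  have NE : N = - g *: e by rewrite {1}eN scalerA mulrNN mulfV // scale1r.
  by rewrite derive_grad // -/N NE dotpZl dotp_perp // mulr0.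
rewrite De DP in jr.
have hg : 0 < eta * g / 2 by rewrite divr_gt0 // mulr_gt0.
near=> s.
have h1 : `|rho (x + s *: P k + s ^+ 2 *: (c *: e)) -
   (rho x + 0 * s + ('D_(P k) ('D_(P k) rho) x / 2 + - c * g) * s ^+ 2)| <= eta * g / 2 * `|s| ^+ 2.
  by near: s; exact: jr.
have Us : U (x + s *: P k + s ^+ 2 *: (c *: e)) by near: s.
move=> /(hU _ Us); move: h1; rewrite real_normK ?num_real // ler_norml => /andP[+ _].
have -> : 'D_(P k) ('D_(P k) rho) x / 2 + - c * g = eta * g by rewrite /c; field.
have : 0 <= eta * g * s ^+ 2 by rewrite mulr_ge0 ?sqr_ge0 // mulr_ge0 // ltW.
by move: rx; set r1 := rho (_ + _); set s2 := s ^+ 2; clear -R; lra.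
Unshelve. all: by end_near.
Qed.
End BG.

(** * A modulus of continuity independent of the initial data *)

Definition mcf_on {R : realType} {n : nat} (Omega : set 'rV[R]_n) (v : 'rV[R]_n -> R -> R) : Prop :=
  forall x t, Omega x -> 0 < t -> exists p H vt, mcf_jet v x t p H vt.

Lemma curve_at0 {R : realType} {V : lmodType R} (x v w : V) : x + (0 : R) *: v + (0 : R) ^+ 2 *: w = x.
Proof. by rewrite expr0n /= !scale0r !addr0. Qed.

Lemma near_curve3 {R : realType} {n : nat} (P : 'rV[R]_n * 'rV[R]_n * R -> Prop)
    (x y a d b : 'rV[R]_n) (t : R) :
  (\forall q \near (x, y, t), P q) ->
  \forall s \near (0 : R), P (x + s *: a + s ^+ 2 *: d, y + s *: b, t).
Proof.
move=> h.
have c : (fun s : R => (x + s *: a + s ^+ 2 *: d, y + s *: b, t)) @ (0 : R) --> (x, y, t).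
  have c1 : (fun s : R => x + s *: a + s ^+ 2 *: d) @ (0 : R) --> x.
    rewrite -[X in _ --> X](curve_at0 x a d).
    apply: cvgD; first apply: cvgD; first exact: cvg_cst.
      by apply: cvgZ; [exact: cvg_id|exact: cvg_cst].
    by apply: cvgZ; [exact: exprn_continuous|exact: cvg_cst].
  have c2 : (fun s : R => y + s *: b) @ (0 : R) --> y.
    rewrite -[X in _ --> X](addr0 y) -(scale0r b).
    apply: cvgD; first exact: cvg_cst.
    by apply: cvgZ; [exact: cvg_id|exact: cvg_cst].
  exact: cvg_pair (cvg_pair c1 c2) (cvg_cst _).
exact: (c _ h).
Qed.

Lemma near_time3 {R : realType} {n : nat} (P : 'rV[R]_n * 'rV[R]_n * R -> Prop)
    (x y : 'rV[R]_n) (t : R) :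
  (\forall q \near (x, y, t), P q) -> \forall s \near (0 : R), P (x, y, t + s).
Proof.
move=> h.
have c : (fun s : R => (x, y, t + s)) @ (0 : R) --> (x, y, t).
  have c2 : (fun s : R => t + s) @ (0 : R) --> t.
    rewrite -[X in _ --> X](addr0 t); apply: cvgD; [exact: cvg_cst|exact: cvg_id].
  exact: cvg_pair (cvg_cst _) c2.
exact: (c _ h).
Qed.

Section Mod.
Context {R : realType} {n : nat}.
Implicit Types (x y a d e xi : 'rV[R]_n).

Lemma jet2_pen (eps C tau : R) y xi :
  jet2 (fun s => pen eps C (y + s *: xi) tau) (pen eps C y tau) (- 2 * eps * dotp y xi) (- eps * dotp xi xi).
Proof.
have h := jet2_sqn y xi 0; have h2 := jet2B (jet2_cst 1) (jet2Z eps (jet2D h (jet2_cst (C * tau)))).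
apply: (jet2_ext _ _ _ _ h2) => [s|||]; rewrite /pen ?scaler0 ?addr0 //; rewrite ?dotpE; ring.
Qed.

(** The acceleration [d] of the curve followed by [x] enters only through its component along [e];
    this is the term on which the boundary curvature acts. *)
Lemma jet2_mod (Hh tau eps C m z b1 b2 al ga : R) (w : R -> R) (w0 : R) x y a d e xi :
  0 < z -> y - x = z *: e -> dotp e e = 1 ->
  (forall f (a c : R), jet2 f w0 a c -> jet2 (fun s => beta Hh tau (f s)) (beta Hh tau w0)
      (b1 * a) (b1 * c + b2 / 2 * a ^+ 2)) ->
  jet2 w w0 al ga ->
  let F := pen eps C y tau in let b0 := beta Hh tau w0 in let h := xi - a in
  jet2 (fun s => beta Hh tau (w s) * pen eps C (y + s *: xi) tau ^+ 2
     - m * enorm (y + s *: xi - (x + s *: a + s ^+ 2 *: d)))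
    (b0 * F ^+ 2 - m * z)
    (F ^+ 2 * b1 * al - 4 * eps * F * b0 * dotp y xi - m * dotp e h)
    (F ^+ 2 * (b1 * ga + b2 / 2 * al ^+ 2) + b1 * al * (- 4 * eps * F * dotp y xi)
     + b0 * (4 * eps ^+ 2 * dotp y xi ^+ 2 - 2 * eps * F * dotp xi xi)
     - m * ((dotp h h - dotp e h ^+ 2) / (2 * z) - dotp e d)).
Proof.
move=> z0 yx ee Jb jw F b0 h.
have jp := jet2_pen eps C tau y xi.
have zn : z != 0 by rewrite gt_eqF.
have ez : enorm (z *: e) = z by rewrite enormZ /enorm ee sqrtr1 mulr1 gtr0_norm.
have jn := jet2_enorm z (z *: e) h (- d) z0 ez.
have := jet2B (jet2M (Jb _ _ _ jw) (jet2M jp jp)) (jet2Z m jn) => hh.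
apply: (jet2_ext _ _ _ _ hh) => [s|||].
- have -> : y + s *: xi - (x + s *: a + s ^+ 2 *: d) = z *: e + s *: h + s ^+ 2 *: - d.
    by rewrite -yx /h; apply/rowP => i; rewrite !mxE; ring.
  by rewrite expr2.
- by rewrite -/F -/b0; ring.
- by rewrite -/F -/b0 !dotpZl; field.
- by rewrite -/F -/b0 !dotpE; field.
Qed.

Lemma jet1_mod (Hh tau eps C m z b1 bt vt : R) (w : R -> R) (w0 : R) y :
  (forall f (a : R), jet1 f w0 a -> jet1 (fun s => beta Hh (tau + s) (f s)) (beta Hh tau w0) (b1 * a + bt)) ->
  jet1 w w0 vt ->
  let F := pen eps C y tau in
  jet1 (fun s => beta Hh (tau + s) (w s) * pen eps C y (tau + s) ^+ 2 - m * z)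
    (beta Hh tau w0 * F ^+ 2 - m * z)
    ((b1 * vt + bt) * F ^+ 2 - 2 * eps * C * F * beta Hh tau w0).
Proof.
move=> Jt jw F.
have jp : jet1 (fun s => pen eps C y (tau + s)) F (- eps * C).
  by apply: (jet1_ext _ _ _ (jet1_poly F (- eps * C) 0)) => // s; rewrite /F /pen; ring.
have hh := jet1B (jet1M (Jt _ _ jw) (jet1M jp jp)) (jet1_cst (m * z)).
apply: (jet1_ext _ _ _ hh) => [s||]; by [rewrite expr2|rewrite expr2|ring].
Qed.

End Mod.

Lemma le0_eta {R : realType} (A m k : R) : 0 < m ->
  (forall eta, 0 < eta -> A + m * (k - eta) <= 0) -> A + m * k <= 0.
Proof.
move=> m0 h; apply/ler_addgt0Pr => e e0.
have e1 : 0 < e / m by rewrite divr_gt0.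
have := h _ e1; rewrite mulrBr [m * (e / m)]mulrC divfK ?gt_eqF //; lra.
Qed.

Section Boundary.
Context {R : realType} {n : nat}.
Implicit Types (Omega : set 'rV[R]_n.+1).

Lemma boundary_of Omega x : open Omega -> closure Omega x -> ~ Omega x -> boundary Omega x.
Proof. by move=> oO cx nx; split => // /interior_subset. Qed.

(** The second function is zero on the complement of [Omega]. Since [v] vanishes on the boundary and
    [dl > 0], a positive [w] forces [y] into [Omega], where [v] has expansions; varying [x] alone
    shows that it is a nearest point of the complement to [y], so [boundary_touch] applies. *)
Lemma modulus_boundary Omega (v : 'rV[R]_n.+1 -> R -> R) (Hh dl s eps : R) :
  open Omega -> mean_convex Omega -> mcf_on Omega v ->
  cont_on (cyl (closure Omega)) (fun p => v p.1 p.2) ->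
  (forall x t, boundary Omega x -> 0 < t -> v x t = 0) ->
  (forall y t, closure Omega y -> 0 < t -> v y t - dl <= Hh - 1) ->
  0 < dl -> 0 < s -> 0 < eps -> eps <= 1 / 1024 -> 1 <= Hh ->
  forall x y t, ~ Omega x -> closure Omega y -> s < t -> t <= s + 2 ->
  let F := pen eps (2 * n.+1%:R + 4) y (t - s) in
  0 <= F -> beta Hh (t - s) (v y t - dl) * F ^+ 2 <= enorm (y - x).
Proof.
move=> oO mc hv cv v0 hB dl0 s0 e0 e1 H1.
have C0 : 0 <= 2 * n.+1%:R + 4 :> R by rewrite addr_ge0 // mulr_ge0.
move=> x y t nx Dy st ts2 F F0.
have := @modulus_core R n.+1 (~` Omega) (closure Omega) (fun _ _ => 0) v Hh dl s eps (2 * n.+1%:R + 4).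
rewrite -[v y t](subr0 (v y t)); apply => //.
- exact: open_closedC.
- exact: closed_closure.
- exact: cont_on_cst.
- by move=> ? ? ? _ ? ?; rewrite subr0; exact: hB.
- move=> x' t' nx' cx' t0'; rewrite subr0 v0 //; first by rewrite sub0r oppr_lt0.
  exact: boundary_of.
move=> {x y t nx Dy st ts2 F F0} x y t m nx Dy st ts2 z w F z0 w0 F0 F1 eY m1 hE hN.
have t0 : 0 < t by exact: lt_trans st.
have wE : w = v y t - dl by rewrite /w subr0.
have Oy : Omega y.
  apply: contrapT => nOy; move: w0; rewrite wE v0 //; last exact: boundary_of.
  by rewrite sub0r oppr_gt0 ltNge ltW.
have [p [H [vt [j1 j2 hvt]]]] := hv y t Oy t0.
have tau0 : 0 < t - s by rewrite subr_gt0.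
have tau2 : t - s <= 2 by rewrite lerBlDl.
have wH : w <= Hh - 1 by rewrite wE; exact: hB.
have [b1 [b2 [bt [[b10 b12 b20 hb12 hbt] Jx Jt]]]] := beta_jets Hh (t - s) w tau0 tau2 wH.
set b0 := beta Hh (t - s) w in hE Jx Jt.
have F20 : 0 < F ^+ 2 by rewrite exprn_gt0.
have m0 : 0 < m by apply: lt_le_trans m1.
have b00 : 0 < b0.
  have : 0 < b0 * F ^+ 2 by rewrite hE mulr_gt0.
  by rewrite pmulr_lgt0.
have zn : z != 0 by rewrite gt_eqF.
pose e := z^-1 *: (y - x).
have yx : y - x = z *: e by rewrite /e scalerA mulfV // scale1r.
have ee : dotp e e = 1.
  rewrite /e dotpZl dotpZr -enorm_sqr -/z; field; exact: zn.
have nD xi : \forall s \near (0 : R), closure Omega (y + s *: xi).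
  have := near_curve Omega y xi 0 oO Oy; apply: filterS => r.
  by rewrite scaler0 addr0; exact: subset_closure.
have key a d xi : (\forall s \near (0 : R), ~ Omega (x + s *: a + s ^+ 2 *: d)) ->
    F ^+ 2 * b1 * dotp p xi - 4 * eps * F * b0 * dotp y xi - m * dotp e (xi - a) = 0 /\
    F ^+ 2 * (b1 * (qf H xi / 2) + b2 / 2 * dotp p xi ^+ 2) + b1 * dotp p xi * (- 4 * eps * F * dotp y xi)
     + b0 * (4 * eps ^+ 2 * dotp y xi ^+ 2 - 2 * eps * F * dotp xi xi)
     - m * ((dotp (xi - a) (xi - a) - dotp e (xi - a) ^+ 2) / (2 * z) - dotp e d) <= 0.
  move=> ha.
  have jw : jet2 (fun r => v (y + r *: xi) t - 0 - dl) w (dotp p xi) (qf H xi / 2).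
    apply: (jet2_ext _ _ _ _ (jet2B (j2 xi) (jet2_cst dl))) => [r|||]; rewrite ?subr0 //.
  have := jet2_mod Hh (t - s) eps (2 * n.+1%:R + 4) m z b1 b2 _ _ _ _ x y a d e xi z0 yx ee Jx jw.
  move=> /jet2_max; apply.
  have h3 := near_curve3 _ _ _ a d xi _ hN; have h4 := nD xi.
  apply: filterS (filterI h3 (filterI ha h4)) => r [h7 [h5 h6]].
  rewrite -/F -/b0 hE subrr subr_le0; exact: (h7 h5 h6 (lexx _)).
have key0 xi : F ^+ 2 * b1 * dotp p xi - 4 * eps * F * b0 * dotp y xi - m * dotp e xi = 0 /\
    F ^+ 2 * (b1 * (qf H xi / 2) + b2 / 2 * dotp p xi ^+ 2) + b1 * dotp p xi * (- 4 * eps * F * dotp y xi)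
     + b0 * (4 * eps ^+ 2 * dotp y xi ^+ 2 - 2 * eps * F * dotp xi xi)
     - m * ((dotp xi xi - dotp e xi ^+ 2) / (2 * z)) <= 0.
  have := key 0 0 xi; rewrite subr0 dotp0r subr0; apply.
  by apply: filterE => r; rewrite !scaler0 !addr0; exact: nx.
have hmin : \forall x' \near x, ~ Omega x' -> z <= enorm (x + z *: e - x').
  have c : continuous (fun x' : 'rV[R]_n.+1 => (x', y, t)).
    have ci : continuous (fun x' : 'rV[R]_n.+1 => x') by move=> q; exact: cvg_id.
    exact: (continuous_pair2 _ _ (continuous_pair2 _ _ ci (@cst_continuous _ _ y)) (@cst_continuous _ _ t)).
  have hc : \forall x' \near x, (~` Omega) x' -> closure Omega y -> t <= t ->
      beta Hh (t - s) (v y t - 0 - dl) * pen eps (2 * n.+1%:R + 4) y (t - s) ^+ 2 <= m * enorm (y - x').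
    exact: (c x _ hN).
  apply: filterS hc => x' h nOx'.
  have := h nOx' Dy (lexx _); rewrite -/w -/F -/b0 hE ler_pM2l //.
  by rewrite -yx (addrC x) subrK.
have [kappa skappa hkappa] := boundary_touch _ _ _ _ oO mc nx z0 ee hmin.
apply: (@modulus_touch R n.+1 eps m z F b0 b1 b2 bt vt 0 y e p H (fun k => m * kappa k)) => //.
- exact: beta_lt4.
- by move=> xi; have [h _] := key0 xi; move: h; clear -R; lra.
- move=> b k0 bb eb pE k; cbv zeta; set xi := perp e _; set xi' := rotv e b xi.
  apply: le0_eta => // eta eta0.
  have [_ h] := key (perp e (delta_mx ord0 k)) ((kappa k - eta) *: e) xi' (hkappa k eta eta0).
  have p0 : dotp p xi' = 0 by rewrite pE dotpZl dotp_rot // mulr0.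
  move: h; rewrite p0 dotpZr ee -/xi; clear -R; lra.
- by move=> xi; have [_ h] := key0 xi.
- have jw : jet1 (fun r => v y (t + r) - 0 - dl) w vt.
    by apply: (jet1_ext _ _ _ (jet1B j1 (jet1_cst dl))) => [r||]; rewrite ?subr0.
  have := jet1_mod Hh (t - s) eps (2 * n.+1%:R + 4) m z b1 bt vt _ _ y Jt jw.
  move=> /jet1_left_max; rewrite subr0; apply.
  have h3 := near_time3 _ _ _ _ hN.
  apply: filterS h3 => r h7 r0; rewrite -/F -/b0 hE subrr subr_le0 addrAC.
  by apply: h7 => //=; rewrite gerDl.
- by rewrite mulr0 mul0r oppr0 -mulr_sumr mulr_ge0 // ltW.
Qed.

End Boundary.

Lemma pen_limit {R : realType} {n : nat} (b0 z C tau : R) (y : 'rV[R]_n) :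
  0 <= z -> 0 <= C -> 0 <= tau ->
  (forall eps, 0 < eps -> eps <= 1 / 1024 -> 0 <= pen eps C y tau ->
     b0 * pen eps C y tau ^+ 2 <= z) -> b0 <= z.
Proof.
move=> z0 C0 t0; set c : R := 1 / 1024; have c0 : 0 < c by rewrite /c; lra.
clearbody c => h; rewrite leNgt; apply/negP => hb.
pose K := dotp y y + C * tau.
have K0 : 0 <= K by rewrite addr_ge0 ?dotp_ge0 // mulr_ge0.
have b00 : 0 < b0 by apply: le_lt_trans hb.
have d0 : 0 < (b0 - z) / (4 * b0 * (K + 1)).
  by rewrite divr_gt0 ?subr_gt0 // !mulr_gt0 // ltr_wpDl.
pose eps := Num.min c ((b0 - z) / (4 * b0 * (K + 1))).
have e0 : 0 < eps by rewrite lt_min d0 c0.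
have e1 : eps <= c by rewrite ge_min lexx.
have e2 : eps <= (b0 - z) / (4 * b0 * (K + 1)) by rewrite ge_min lexx orbT.
have eK : eps * K <= (b0 - z) / (4 * b0).
  apply: (@le_trans _ _ ((b0 - z) / (4 * b0 * (K + 1)) * (K + 1))).
    by apply: ler_pM => //; rewrite ?(ltW e0) // lerDl.
  rewrite le_eqVlt; apply/orP; left; apply/eqP; field.
  by rewrite !gt_eqF // ltr_wpDl.
have h1 : b0 * (eps * K) <= (b0 - z) / 4.
  have : b0 * (eps * K) <= b0 * ((b0 - z) / (4 * b0)) by rewrite ler_pM2l.
  by have -> : b0 * ((b0 - z) / (4 * b0)) = (b0 - z) / 4 by field; rewrite gt_eqF.
have eK1 : eps * K <= 1 / 4.
  apply: (le_trans eK); rewrite ler_pdivrMr ?mulr_gt0 //; move: z0; clear -R; lra.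
have p0 : 0 <= pen eps C y tau by rewrite /pen -/K; move: eK1; clear -R; lra.
have := h eps e0 e1 p0; rewrite /pen -/K.
have eK0 : 0 <= eps * K by rewrite mulr_ge0 // ltW.
have : 0 <= b0 * (eps * K) ^+ 2 by rewrite mulr_ge0 ?(ltW b00) // sqr_ge0.
rewrite leNgt => q0 /negP; apply.
have -> : b0 * (1 - eps * K) ^+ 2 = b0 - 2 * (b0 * (eps * K)) + b0 * (eps * K) ^+ 2 by ring.
by move: h1 q0 hb; rewrite -leNgt; clear -R; lra.
Qed.

Lemma mcfop_perp {R : realType} {n : nat} (H : 'M[R]_n) (e q : 'rV[R]_n) (k : R) :
  dotp e e = 1 -> q = k *: e ->
  \sum_k qf H (perp e (delta_mx ord0 k)) + qf H e / (1 + dotp q q) = mcfop q H.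
Proof.
move=> ee qE; rewrite -(sum_qf_rot q e e k H) // ?ee //; congr (_ + _).
apply: eq_bigr => i _; congr qf; rewrite -/(perp e _).
by rewrite /rotv dotp_perp // mul0r scale0r subr0.
Qed.

(** The gradient at [x] carries no penalty and is parallel to [e], so only the directions orthogonal
    to [e] have to be coupled. The remaining second derivative at [x] has the right sign and is
    dropped. *)
Lemma modulus_interior {R : realType} {n : nat} (Omega : set 'rV[R]_n) (v : 'rV[R]_n -> R -> R)
    (Hh dl s eps : R) :
  open Omega -> mcf_on Omega v ->
  cont_on (cyl (closure Omega)) (fun p => v p.1 p.2) ->
  (forall x y t, closure Omega x -> ~ Omega x \/ ~ Omega y -> closure Omega y -> s < t -> t <= s + 2 ->
     beta Hh (t - s) (v y t - v x t - dl) <= enorm (y - x)) ->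
  (forall x y t, closure Omega x -> closure Omega y -> 0 < t -> v y t - v x t - dl <= Hh - 1) ->
  0 < dl -> 0 < s -> 0 < eps -> eps <= 1 / 1024 -> 1 <= Hh ->
  forall x y t, closure Omega x -> closure Omega y -> s < t -> t <= s + 2 ->
  let F := pen eps (2 * n%:R + 4) y (t - s) in
  0 <= F -> beta Hh (t - s) (v y t - v x t - dl) * F ^+ 2 <= enorm (y - x).
Proof.
move=> oO hv cv hbd hB dl0 s0 e0 e1 H1.
have C00 : 0 < 2 * n%:R + 4 :> R by rewrite ltr_wpDl // mulr_ge0.
have C0 := ltW C00.
move=> x y t nx Dy st ts2 F F0.
have := @modulus_core R n (closure Omega) (closure Omega) v v Hh dl s eps (2 * n%:R + 4).
apply => //.
- exact: closed_closure.
- exact: closed_closure.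
- by move=> x' t' _ _ _; rewrite subrr sub0r oppr_lt0.
move=> {x y t nx Dy st ts2 F F0} x y t m Dx Dy st ts2 z w F z0 w0 F0 F1 eY m1 hE hN.
have t0 : 0 < t by exact: lt_trans st.
have tau0 : 0 < t - s by rewrite subr_gt0.
have tau2 : t - s <= 2 by rewrite lerBlDl.
have F20 : 0 < F ^+ 2 by rewrite exprn_gt0.
have m0 : 0 < m by apply: lt_le_trans m1.
set b0 := beta Hh (t - s) w in hE.
have b00 : 0 < b0.
  have : 0 < b0 * F ^+ 2 by rewrite hE mulr_gt0.
  by rewrite pmulr_lgt0.
have F1' : F < 1.
  rewrite /F /pen gtrBl mulr_gt0 // ltr_wpDl ?dotp_ge0 // mulr_gt0 //.
(* The strict inequality [F < 1] turns [m * z = b0 * F ^+ 2] into a violation of the unpenalised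
   boundary estimate, so neither point lies on the boundary. *)
have bz : z < b0.
  apply: (@le_lt_trans _ _ (m * z)); first by rewrite ler_peMl // ltW.
  by rewrite -hE gtr_pMr // expr2 mulr_ilt1 // ltW.
have [Ox Oy] : Omega x /\ Omega y.
  apply: contrapT => /not_andP h.
  by have := hbd x y t Dx h Dy st ts2; rewrite -/w -/b0 leNgt bz.
have [p [H [vt [j1 j2 hvt]]]] := hv y t Oy t0.
have [q [G [ut [i1 i2 hut]]]] := hv x t Ox t0.
have wH : w <= Hh - 1 by exact: hB.
have [b1 [b2 [bt [[b10 b12 b20 hb12 hbt] Jx Jt]]]] := beta_jets Hh (t - s) w tau0 tau2 wH.
rewrite -/b0 in Jx Jt.
have zn : z != 0 by rewrite gt_eqF.
pose e := z^-1 *: (y - x).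
have yx : y - x = z *: e by rewrite /e scalerA mulfV // scale1r.
have ee : dotp e e = 1.
  rewrite /e dotpZl dotpZr -enorm_sqr -/z; field; exact: zn.
have nD xi : \forall s \near (0 : R), closure Omega (y + s *: xi).
  have := near_curve Omega y xi 0 oO Oy; apply: filterS => r.
  by rewrite scaler0 addr0; exact: subset_closure.
have nX xi : \forall s \near (0 : R), closure Omega (x + s *: xi + s ^+ 2 *: (0 : 'rV[R]_n)).
  have := near_curve Omega x xi 0 oO Ox; apply: filterS => r.
  exact: subset_closure.
have key a xi :
    F ^+ 2 * b1 * (dotp p xi - dotp q a) - 4 * eps * F * b0 * dotp y xi - m * dotp e (xi - a) = 0 /\
    F ^+ 2 * (b1 * (qf H xi / 2 - qf G a / 2) + b2 / 2 * (dotp p xi - dotp q a) ^+ 2)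
     + b1 * (dotp p xi - dotp q a) * (- 4 * eps * F * dotp y xi)
     + b0 * (4 * eps ^+ 2 * dotp y xi ^+ 2 - 2 * eps * F * dotp xi xi)
     - m * ((dotp (xi - a) (xi - a) - dotp e (xi - a) ^+ 2) / (2 * z) - dotp e (0 : 'rV[R]_n)) <= 0.
  have jw : jet2 (fun r => v (y + r *: xi) t - v (x + r *: a + r ^+ 2 *: (0 : 'rV[R]_n)) t - dl) w
      (dotp p xi - dotp q a) (qf H xi / 2 - qf G a / 2).
    apply: (jet2_ext _ _ _ _ (jet2B (jet2B (j2 xi) (i2 a)) (jet2_cst dl))) => [r|||]; rewrite ?subr0 //.
    by rewrite scaler0 addr0.
  have := jet2_mod Hh (t - s) eps (2 * n%:R + 4) m z b1 b2 _ _ _ _ x y a 0 e xi z0 yx ee Jx jw.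
  move=> /jet2_max; apply.
  have h3 := near_curve3 _ _ _ a 0 xi _ hN; have h4 := nD xi.
  apply: filterS (filterI h3 (filterI (nX a) h4)) => r [h7 [h5 h6]].
  rewrite -/F -/b0 hE subrr subr_le0; exact: (h7 h5 h6 (lexx _)).
have key0 xi : F ^+ 2 * b1 * dotp p xi - 4 * eps * F * b0 * dotp y xi - m * dotp e xi = 0 /\
    F ^+ 2 * (b1 * (qf H xi / 2) + b2 / 2 * dotp p xi ^+ 2) + b1 * dotp p xi * (- 4 * eps * F * dotp y xi)
     + b0 * (4 * eps ^+ 2 * dotp y xi ^+ 2 - 2 * eps * F * dotp xi xi)
     - m * ((dotp xi xi - dotp e xi ^+ 2) / (2 * z)) <= 0.
  have q0 : qf G 0 = 0 by rewrite -(scale0r 0) qfZ expr0n mul0r.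
  by have := key 0 xi; rewrite !subr0 !dotp0r !subr0 q0 mul0r !subr0.
have bF : 0 < F ^+ 2 * b1 by rewrite mulr_gt0.
have bFn : F ^+ 2 * b1 != 0 by rewrite gt_eqF.
have qE : q = (m / (F ^+ 2 * b1)) *: e.
  apply/rowP => i; have [h _] := key (delta_mx ord0 i) 0.
  have sb : 0 - delta_mx ord0 i = - delta_mx ord0 i :> 'rV[R]_n by rewrite sub0r.
  move: h; rewrite sb !dotp0r dotpNr !dotp_eps mulr0 subr0 sub0r => h.
  apply: (mulfI bFn); rewrite [in RHS]mxE; set K := F ^+ 2 * b1 in bFn h *.
  have -> : K * (m / K * e ord0 i) = m * e ord0 i by field.
  by move: h; clear -R; lra.
have qperp k : dotp q (perp e (delta_mx ord0 k)) = 0 by rewrite qE dotpZl dotp_perp // mulr0.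
(* From moving [x] alone along [e]: the distance changes linearly and the penalty not at all, so the
   Hessian at [x] has to compensate the term in [b2]. *)
have hG : 0 <= F ^+ 2 * b1 * qf G e.
  have [_ h] := key e 0.
  have p0 : qf H 0 = 0 by rewrite -(scale0r 0) qfZ expr0n mul0r.
  have sb : 0 - e = - e by rewrite sub0r.
  move: h; rewrite sb !dotp0r !dotpNr !dotpNl ee p0 => h.
  have sq : 0 <= F ^+ 2 * (b2 / 2 * (0 - dotp q e) ^+ 2).
    by rewrite mulr_ge0 ?(ltW F20) // mulr_ge0 ?sqr_ge0 // divr_ge0 // ltW.
  have h' : F ^+ 2 * (b1 * (0 / 2 - qf G e / 2) + b2 / 2 * (0 - dotp q e) ^+ 2) <= 0.
    apply: le_trans h; rewrite le_eqVlt; apply/orP; left; apply/eqP; field; exact: zn.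
  by move: h' sq; clear -R; lra.
apply: (@modulus_touch R n eps m z F b0 b1 b2 bt vt ut y e p H
   (fun k => - (F ^+ 2 * b1 * (qf G (perp e (delta_mx ord0 k)) / 2)))) => //.
- exact: beta_lt4.
- by move=> xi; have [h _] := key0 xi; move: h; clear -R; lra.
- move=> b k0 bb eb pE k; cbv zeta; set xi := perp e _; set xi' := rotv e b xi.
  have [_ h] := key xi xi'.
  have p0 : dotp p xi' = 0 by rewrite pE dotpZl dotp_rot // mulr0.
  by move: h; rewrite p0 qperp dotp0r; clear -R; lra.
- by move=> xi; have [_ h] := key0 xi.
- have jw : jet1 (fun r => v y (t + r) - v x (t + r) - dl) w (vt - ut).
    by apply: (jet1_ext _ _ _ (jet1B (jet1B j1 i1) (jet1_cst dl))) => [r||]; rewrite ?subr0.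
  have := jet1_mod Hh (t - s) eps (2 * n%:R + 4) m z b1 bt (vt - ut) _ _ y Jt jw.
  move=> /jet1_left_max; apply.
  have h3 := near_time3 _ _ _ _ hN.
  apply: filterS h3 => r h7 r0; rewrite -/F -/b0 hE subrr subr_le0 addrAC.
  by apply: h7 => //=; rewrite gerDl.
- rewrite sumrN -mulr_sumr -mulr_suml lerN2.
  rewrite hut -(mcfop_perp G e q _ ee qE).
  have : 0 <= F ^+ 2 * b1 * qf G e / (1 + dotp q q) by rewrite divr_ge0 // ltW // onep_gt0.
  by set A := \sum_k _; set B := qf G e; clear -R; lra.
Qed.

Lemma beta_mono {R : realType} (H t w1 w2 : R) : 0 < t -> w1 <= w2 -> w2 <= H ->
  beta H t w1 <= beta H t w2.
Proof.
move=> t0 w12 w2H; rewrite /beta ler_pM2r ?invr_gt0 // lerD2r ler_expR ler_pM2r ?invr_gt0 //.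
by rewrite lerN2 ler_pM2l // ler_sqr ?nnegrE ?subr_ge0 //; [lra|exact: le_trans w2H].
Qed.

Definition bounded_flow {R : realType} {n : nat} (Omega : set 'rV[R]_n) (M : R)
    (v : 'rV[R]_n -> R -> R) : Prop :=
  [/\ mcf_on Omega v, cont_on (cyl (closure Omega)) (fun p => v p.1 p.2),
      forall x t, boundary Omega x -> 0 < t -> v x t = 0 &
      forall x t, closure Omega x -> 0 < t -> `|v x t| <= M].

Lemma mcfopN {R : realType} {n : nat} (p : 'rV[R]_n) (H : 'M[R]_n) :
  mcfop (- p) (- H) = - mcfop p H.
Proof.
rewrite /mcfop -sumrN; apply: eq_bigr => i _; rewrite -sumrN; apply: eq_bigr => j _.
by rewrite /mcfa !mxE dotpNl dotpNr opprK; ring.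
Qed.

Lemma qfN {R : realType} {n : nat} (H : 'M[R]_n) xi : qf (- H) xi = - qf H xi.
Proof.
rewrite /qf -sumrN; apply: eq_bigr => i _; rewrite -sumrN; apply: eq_bigr => j _.
by rewrite !mxE; ring.
Qed.

Lemma mcf_onN {R : realType} {n : nat} (Omega : set 'rV[R]_n) v :
  mcf_on Omega v -> mcf_on Omega (fun x t => - v x t).
Proof.
move=> h x t Ox t0; have [p [H [vt [j1 j2 hv]]]] := h x t Ox t0.
exists (- p), (- H), (- vt); split.
- exact: jet1N.
- by move=> xi; apply: (jet2_ext _ _ _ _ (jet2N (j2 xi))) => //; rewrite ?dotpNl ?qfN ?mulNr.
- by rewrite mcfopN hv.
Qed.

Lemma bounded_flowN {R : realType} {n : nat} (Omega : set 'rV[R]_n) M v :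
  bounded_flow Omega M v -> bounded_flow Omega M (fun x t => - v x t).
Proof.
move=> [h1 h2 h3 h4]; split.
- exact: mcf_onN.
- exact: cont_onN.
- by move=> x t bx t0; rewrite h3 // oppr0.
- by move=> x t cx t0; rewrite normrN; exact: h4.
Qed.

Section UM.
Context {R : realType} {n : nat}.
Implicit Types (Omega : set 'rV[R]_n.+1).

Lemma enormB (x y : 'rV[R]_n.+1) : enorm (x - y) = enorm (y - x).
Proof. by rewrite -opprB /enorm dotpNl dotpNr opprK. Qed.

Lemma beta_boundary Omega M v (dl s t : R) x y : open Omega -> mean_convex Omega ->
  bounded_flow Omega M v -> 0 <= M -> 0 < dl -> 0 < s -> s < t -> t <= s + 2 ->
  ~ Omega x -> closure Omega y ->
  beta (2 * M + dl + 1) (t - s) (v y t - dl) <= enorm (y - x).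
Proof.
move=> oO mc [h1 h2 h3 h4] M0 dl0 s0 st ts2 nx cy.
apply: (pen_limit _ _ (2 * n.+1%:R + 4) (t - s) y).
- exact: enorm_ge0.
- by rewrite addr_ge0 // mulr_ge0.
- by rewrite subr_ge0 ltW.
move=> eps e0 e1 F0.
apply: (modulus_boundary Omega v (2 * M + dl + 1) dl s eps) => //; last by rewrite lerDr addr_ge0 ?(ltW dl0) // mulr_ge0.
by move=> y' t' cy' t0'; have := h4 _ _ cy' t0'; rewrite ler_norml => /andP[_]; move: M0 dl0; clear -n; lra.
Qed.

(** The height [2 * M + dl + 1] lies at least one above every value of [w], as the bounds on [beta]
    require. When [y] is the boundary point, the boundary estimate is applied to [- v] with the
    points exchanged. *)
Lemma beta_interior Omega M v (dl s t : R) x y : open Omega -> mean_convex Omega ->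
  bounded_flow Omega M v -> 0 <= M -> 0 < dl -> 0 < s -> s < t -> t <= s + 2 ->
  closure Omega x -> closure Omega y ->
  beta (2 * M + dl + 1) (t - s) (v y t - v x t - dl) <= enorm (y - x).
Proof.
move=> oO mc hf M0 dl0 s0 st ts2 cx cy; have [h1 h2 h3 h4] := hf.
apply: (pen_limit _ _ (2 * n.+1%:R + 4) (t - s) y).
- exact: enorm_ge0.
- by rewrite addr_ge0 // mulr_ge0.
- by rewrite subr_ge0 ltW.
move=> eps e0 e1 F0.
apply: (modulus_interior Omega v (2 * M + dl + 1) dl s eps) => //;
  last by rewrite lerDr addr_ge0 ?(ltW dl0) // mulr_ge0.
- move=> x' y' t' cx' hxy cy' st' ts2'.
  have t0' : 0 < t' by apply: lt_trans st'.
  case: hxy => h.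
    rewrite (h3 x') // ?subr0; last exact: boundary_of.
    exact: (beta_boundary Omega M).
  rewrite (h3 y') // ?sub0r; last exact: boundary_of.
  rewrite enormB; apply: (beta_boundary Omega M (fun x t => - v x t)) => //.
  exact: bounded_flowN.
- move=> x' y' t' cx' cy' t0'.
  have := h4 _ _ cy' t0'; rewrite ler_norml => /andP[_ q1].
  have := h4 _ _ cx' t0'; rewrite ler_norml => /andP[q2 _].
  by move: q1 q2 dl0; clear -n; lra.
Qed.

(* Neither the bound on the boundary curvature nor the modulus of continuity of the
   initial data enters the constant [z0]. *)
Lemma uniform_modulus Omega M v (dl s : R) : open Omega -> mean_convex Omega ->
  bounded_flow Omega M v -> 0 <= M -> 0 < dl -> 0 < s ->
  exists2 z0, 0 < z0 & forall x y t, s <= t -> closure Omega y -> enorm (y - x) < z0 ->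
    (~ Omega x -> v y t <= dl) /\ (closure Omega x -> v y t - v x t <= dl).
Proof.
move=> oO mc hf M0 dl0 s0.
(* The estimate is restarted at time [t - tau], so that the elapsed time, and with it [z0], does not
   depend on [t]. *)
pose tau := Num.min 1 (s / 2).
have tau0 : 0 < tau by rewrite lt_min ltr01 divr_gt0.
have tau1 : tau <= 1 by rewrite ge_min lexx.
have taus : tau <= s / 2 by rewrite ge_min lexx orbT.
have dl20 : 0 < dl / 2 by rewrite divr_gt0.
have dM : dl / 2 <= 2 * M + dl / 2 + 1 - 1 by move: M0; clear -n; lra.
exists (beta (2 * M + dl / 2 + 1) tau (dl / 2)).
  by rewrite beta_gt0 //; move: M0 dl0; clear -n; lra.
move=> x y t st cy hz.
have q1 : 0 < t - tau by move: taus st s0; clear -n; lra.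
have q2 : t - tau < t by rewrite gtrBl.
have q3 : t <= t - tau + 2 by move: tau1; clear -n; lra.
have qE : t - (t - tau) = tau by ring.
have t0 : 0 < t by apply: lt_le_trans st.
have [_ _ _ h4] := hf.
split=> hx; rewrite leNgt; apply/negP => hv; move: hz; apply/negP; rewrite -leNgt.
  have := beta_boundary Omega M v (dl / 2) (t - tau) t x y oO mc hf M0 dl20 q1 q2 q3 hx cy.
  rewrite qE; apply: le_trans; apply: beta_mono => //; first by move: hv; clear -n; lra.
  have := h4 _ _ cy t0; rewrite ler_norml => /andP[_].
  by move: M0 dl0; clear -n; lra.
have := beta_interior Omega M v (dl / 2) (t - tau) t x y oO mc hf M0 dl20 q1 q2 q3 hx cy.
rewrite qE; apply: le_trans; apply: beta_mono => //; first by move: hv; clear -n; lra.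
have := h4 _ _ cy t0; rewrite ler_norml => /andP[_].
have := h4 _ _ hx t0; rewrite ler_norml => /andP[+ _].
by move: M0 dl0; clear -n; lra.
Qed.

End UM.

(** * The oscillation comparison *)

Definition csf_at {R : realType} (f : R -> R -> R) (z t a b : R) : Prop :=
  jet1 (fun s => f z (t + s)) (f z t) (b / (1 + a ^+ 2)) /\
  jet2 (fun s => f (z + s) t) (f z t) a (b / 2).

Definition quadrant {R : realType} : set (R * R) := [set p | 0 < p.1 /\ 0 < p.2].

(** The last three clauses control the profile near the diagonal, at early times and at large
    distances. They push a violation into a compact range of positive distances and times, where
    [f1] and [f2] are bounded. *)
Definition csf_barrier {R : realType} (M : R) (f f1 f2 : R -> R -> R) : Prop :=
  [/\ forall z t, 0 < z -> 0 < t -> csf_at f z t (f1 z t) (f2 z t),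
      [/\ cont_on quadrant (fun p : R * R => f p.1 p.2),
          cont_on quadrant (fun p : R * R => f1 p.1 p.2) &
          cont_on quadrant (fun p : R * R => f2 p.1 p.2)],
      forall d T, 0 < d -> exists2 z1, 0 < z1 &
        forall z t, 0 <= z -> z <= z1 -> 0 < t -> t <= T -> - d <= f z t,
      forall d z0, 0 < d -> 0 < z0 -> exists2 t0, 0 < t0 &
        forall z t, z0 <= z -> 0 < t -> t <= t0 -> 2 * M - d <= f z t &
      forall d T, 0 < d -> exists2 Z, 0 < Z &
        forall z t, Z <= z -> 0 < t -> t <= T -> 2 * M - d <= f z t].

Lemma rect_compact {R : realType} (a b c d : R) :
  compact [set p : R * R | a <= p.1 <= b /\ c <= p.2 <= d].
Proof.
have := compact_setX (itv_compact a b) (itv_compact c d); congr compact.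
Qed.

Lemma rect_bounded {R : realType} (a b c d : R) (f : R -> R -> R) : 0 < a -> 0 < c ->
  cont_on quadrant (fun p : R * R => f p.1 p.2) ->
  exists B, forall z t, a <= z -> z <= b -> c <= t -> t <= d -> `|f z t| <= B.
Proof.
move=> a0 c0 cf; pose K : set (R * R) := [set p | a <= p.1 <= b /\ c <= p.2 <= d].
have [[p0 Kp0]|K0] := pselect (K !=set0); last first.
  by exists 0 => z t *; exfalso; apply: K0; exists (z, t); split; apply/andP.
have cK : cont_on K (fun p : R * R => `|f p.1 p.2|).
  move=> p Kp; apply: cvg_norm; apply: (cont_on_sub _ _ _ _ cf) Kp => q [/andP[q1 _] /andP[q2 _]].
  by split; [exact: lt_le_trans a0 q1|exact: lt_le_trans c0 q2].
have [p Kp hp] := compact_max K _ (rect_compact a b c d) (ex_intro _ p0 Kp0) cK.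
exists `|f p.1 p.2| => z t z1 z2 t1 t2; apply: (hp (z, t)).
by split; apply/andP.
Qed.

(** * Existence of a touching point for the profile itself *)

Section Compare.
Context {R : realType} {n : nat}.
Implicit Types (x y : 'rV[R]_n) (X D : set 'rV[R]_n) (v u : 'rV[R]_n -> R -> R).

Let T : topologicalType := ('rV[R]_n * 'rV[R]_n * R)%type.

(** The order of choice matters: [za], [B] and [A] are fixed before [eps] and [sig]. The errors at a
    touching point are multiples of [B / za] and [B], and must tend to 0 with the penalties. *)
Lemma compare_core X D u v (M dl s Tm : R) f f1 f2 : closed X -> closed D ->
  cont_on (cyl D) (fun p => v p.1 p.2) -> cont_on (cyl X) (fun p => u p.1 p.2) ->
  (forall x y t, X x -> D y -> 0 < t -> v y t - u x t <= 2 * M) ->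
  (exists2 z0, 0 < z0 & forall x y t, X x -> D y -> s <= t -> enorm (y - x) < z0 ->
     v y t - u x t <= dl) ->
  csf_barrier M f f1 f2 -> 0 < dl -> 0 < s ->
  exists za B A, 0 < za /\ forall eps sig, 0 < eps -> 0 < sig ->
  let G x y t := v y t - u x t - f (enorm (y - x)) (t - s) - sig * (t - s) - eps * dotp y y in
  (forall x y t, X x -> D y -> s < t -> let z := enorm (y - x) in
    za <= z -> `|f1 z (t - s)| <= B -> `|f2 z (t - s)| <= B ->
    eps * dotp y y <= A -> 4 * dl < G x y t ->
    (forall x' y' t', X x' -> D y' -> s < t' -> t' <= t -> G x' y' t' <= G x y t) -> False) ->
  forall x y t, X x -> D y -> s < t -> t <= Tm -> G x y t <= 4 * dl.
Proof.
move=> cX cD cv cu hM [z0 z00 hz0] [hcsf [cf cf1 cf2] P1 P2 P3] dl0 s0.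
have [z1 z10 hz1] := P1 dl (Tm - s) dl0.
have [Z Z0 hZ] := P3 dl (Tm - s) dl0.
pose za := Num.min z0 z1.
have za0 : 0 < za by rewrite lt_min z00.
have [t0 t00 ht0] := P2 dl za dl0 za0.
have [B1 hB1] := rect_bounded za Z t0 (Tm - s) f1 za0 t00 cf1.
have [B2 hB2] := rect_bounded za Z t0 (Tm - s) f2 za0 t00 cf2.
have [B0 hB0] := rect_bounded za Z t0 (Tm - s) f za0 t00 cf.
exists za, (Num.max B1 B2), (2 * M + B0); split=> // eps sig e0 sg0 G touch x0 y0 tt0 Xx0 Dy0 st0 tT0.
rewrite leNgt; apply/negP => hbad.
pose z (p : T) := enorm (p.1.2 - p.1.1).
pose g (p : T) := G p.1.1 p.1.2 p.2.
pose A := 2 * M + B0.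
pose r0 := 1 + A / eps.
pose K0 : set T := [set p | [/\ (X `&` [set x : 'rV[R]_n | `|x - 0| <= r0 + Z]) p.1.1,
   (D `&` [set x : 'rV[R]_n | `|x - 0| <= r0]) p.1.2 & s + t0 <= p.2 <= Tm]].
have cK0 : compact K0.
  exact: (compact_prod3 _ _ _ (compact_closedIl _ _ (rV_ball_compact 0 _) cX)
    (compact_closedIl _ _ (rV_ball_compact 0 _) cD) (itv_compact _ _)).
pose K : set T := [set p | K0 p /\ za <= z p].
have cz E : cont_on E z by apply: continuous_cont_on; exact: continuous_dist.
have cK : compact K by exact: compact_ge.
have inK p : X p.1.1 -> D p.1.2 -> s < p.2 -> p.2 <= Tm -> 4 * dl < g p ->
    [/\ K p, z p <= Z, t0 <= p.2 - s, p.2 - s <= Tm - s & eps * dotp p.1.2 p.1.2 <= A].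
  move=> Xp Dp sp pT hg.
  have tp : 0 < p.2 - s by rewrite subr_gt0.
  have tT : p.2 - s <= Tm - s by rewrite lerD2r.
  have p20 : 0 < p.2 by apply: lt_trans sp.
  have yy0 : 0 <= eps * dotp p.1.2 p.1.2 by rewrite mulr_ge0 ?dotp_ge0 // ltW.
  have st : 0 <= sig * (p.2 - s) by rewrite mulr_ge0 // ltW.
  have hb := hM _ _ _ Xp Dp p20.
  have hz := enorm_ge0 (p.1.2 - p.1.1).
  have gE : g p = v p.1.2 p.2 - u p.1.1 p.2 - f (z p) (p.2 - s) - sig * (p.2 - s) - eps * dotp p.1.2 p.1.2 by [].
  have zap : za <= z p.
    rewrite leNgt; apply/negP; rewrite lt_min => /andP[h1 h2].
    have h3 := hz0 _ _ _ Xp Dp (ltW sp) h1.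
    have h4 := hz1 _ _ hz (ltW h2) tp tT.
    by move: h3 h4 hg yy0 st dl0; rewrite gE -/(z p); clear -R; lra.
  have tpp : t0 <= p.2 - s.
    rewrite leNgt; apply/negP => h1.
    have h4 := ht0 _ _ zap tp (ltW h1).
    by move: h4 hg yy0 st dl0 hb; rewrite gE -/(z p); clear -R; lra.
  have zZ : z p <= Z.
    rewrite leNgt; apply/negP => h1.
    have h4 := hZ _ _ (ltW h1) tp tT.
    by move: h4 hg yy0 st dl0 hb; rewrite gE -/(z p); clear -R; lra.
  have fge : - B0 <= f (z p) (p.2 - s).
    by have := hB0 _ _ zap zZ tpp tT; rewrite ler_norml => /andP[].
  have ey : eps * dotp p.1.2 p.1.2 <= A.
    by move: fge hg st dl0 hb; rewrite gE /A; clear -R; lra.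
  have Mp : 0 <= A by apply: le_trans ey.
  have yr : enorm p.1.2 <= r0.
    have h1 : dotp p.1.2 p.1.2 <= A / eps by rewrite ler_pdivlMr // mulrC.
    have h2 : enorm p.1.2 ^+ 2 <= r0 ^+ 2.
      rewrite enorm_sqr; apply: (le_trans h1); rewrite /r0.
      have : 0 <= A / eps by rewrite divr_ge0 // ltW.
      set a := A / eps; have := sqr_ge0 a; rewrite sqrrD expr1n mul1r; clear -R; lra.
    by move: h2; rewrite ler_sqr ?nnegrE ?enorm_ge0 // addr_ge0 // divr_ge0 // ltW.
  have yn : `|p.1.2| <= r0 by apply: le_trans (norm_le_enorm _) yr.
  have xn : `|p.1.1| <= r0 + Z.
    have -> : p.1.1 = p.1.2 - (p.1.2 - p.1.1) by rewrite subKr.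
    apply: le_trans (ler_normB _ _) _; apply: lerD => //.
    by apply: le_trans (norm_le_enorm _) _.
  split => //; split=> //; split; [by rewrite /= subr0|by rewrite /= subr0|].
  by rewrite pT andbT; move: tpp; clear -R; lra.
have Kh p : K p -> [/\ X p.1.1, D p.1.2, s < p.2, p.2 <= Tm & 0 < z p].
  move=> [[[h1 _] [h2 _] /andP[h3 h4]] h5]; split => //; last exact: lt_le_trans h5.
  by move: h3 t00; clear -R; lra.
have ct : continuous (fun p : T => p.2 - s).
  by move=> p; apply: (@cvgB _ _ _ (nbhs p)); [exact: continuous_snd|exact: cvg_cst].
have cg : cont_on K g.
  apply: cont_onB; first apply: cont_onB; first apply: cont_onB.
  - apply: (cont_on_diff X D) => // p /Kh[h1 h2 h3 _ _]; split => //; exact: lt_trans h3.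
  - apply: (cont_on_comp K quadrant (fun p : T => (z p, p.2 - s)) (fun p => f p.1 p.2)) => //.
      by apply: continuous_pair2; [exact: continuous_dist|exact: ct].
    by move=> p /Kh[_ _ h3 _ h5]; split => //=; rewrite subr_gt0.
  - apply: cont_onM; first exact: cont_on_cst.
    exact: continuous_cont_on.
  - apply: cont_onM; first exact: cont_on_cst.
    by apply: continuous_cont_on; apply: continuous_dotp; exact: continuous_T2.
pose p0 : T := (x0, y0, tt0).
have [Kp0 _ _ _ _] := inK p0 Xx0 Dy0 st0 tT0 hbad.
have [p Kp hp] := compact_max K g cK (ex_intro _ p0 Kp0) cg.
have gp : 4 * dl < g p by apply: lt_le_trans (hp _ Kp0).
have [Xp Dp sp pT zp] := Kh _ Kp.
have [_ zZ tpp tT ey] := inK p Xp Dp sp pT gp.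
apply: (touch p.1.1 p.1.2 p.2) => //; first by case: Kp.
- by apply: le_trans (hB1 _ _ _ zZ tpp tT) _; [case: Kp|rewrite le_max lexx].
- by apply: le_trans (hB2 _ _ _ zZ tpp tT) _; [case: Kp|rewrite le_max lexx orbT].
move=> x' y' t' Xx' Dy' st' tt'; rewrite leNgt; apply/negP => hlt.
have [Kq _ _ _ _] := inK (x', y', t') Xx' Dy' st' (le_trans tt' pT) (lt_trans gp hlt).
by have := hp _ Kq; rewrite leNgt hlt.
Qed.

End Compare.

(** The fraction is the coefficient of [mcfa p] in the direction [e] when [p] has component [d1 + g]
    along [e] and a part of squared length [S] orthogonal to it. The estimate is uniform in the
    slope [d1]. *)
Lemma speed_perturbation {R : realType} (d1 g S th : R) : 0 <= S -> S <= th ^+ 2 -> `|g| <= th ->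
  th <= 1 -> `|(1 + S) / (1 + (d1 + g) ^+ 2 + S) - (1 + d1 ^+ 2)^-1| <= 2 * th.
Proof.
move=> S0 Sth gth th1; set a := d1 + g.
have th0 : 0 <= th by apply: le_trans gth.
have a2 := sqr_ge0 a; have d2 := sqr_ge0 d1.
have p1 : 0 < 1 + a ^+ 2 + S by lra.
have p2 : 0 < 1 + d1 ^+ 2 by lra.
have -> : (1 + S) / (1 + a ^+ 2 + S) - (1 + d1 ^+ 2)^-1 =
    (S * d1 ^+ 2 + (d1 ^+ 2 - a ^+ 2)) / ((1 + a ^+ 2 + S) * (1 + d1 ^+ 2)).
  by field; rewrite !gt_eqF.
have den : 0 < (1 + a ^+ 2 + S) * (1 + d1 ^+ 2) by rewrite mulr_gt0.
rewrite normrM normfV (gtr0_norm den) ler_pdivrMr //.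
apply: le_trans (ler_normD _ _) _.
have Sth1 : S <= th by apply: (le_trans Sth); rewrite expr2 ler_piMr.
have h1 : `|S * d1 ^+ 2| <= th * ((1 + a ^+ 2 + S) * (1 + d1 ^+ 2)).
  rewrite ger0_norm; last exact: mulr_ge0.
  apply: ler_pM => //.
  apply: (@le_trans _ _ (1 * (1 + d1 ^+ 2))); first by lra.
  by rewrite ler_pM2r //; lra.
have h2 : `|d1 ^+ 2 - a ^+ 2| <= th * ((1 + a ^+ 2 + S) * (1 + d1 ^+ 2)).
  have -> : d1 ^+ 2 - a ^+ 2 = - g * (d1 + a) by rewrite /a; ring.
  rewrite normrM normrN; apply: ler_pM => //.
  apply: le_trans (ler_normD _ _) _.
  have q1 : `|d1| <= (1 + d1 ^+ 2) / 2.
    have := sqr_ge0 (1 - `|d1|); rewrite -[d1 ^+ 2]real_normK ?num_real // sqrrB expr1n; lra.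
  have q2 : `|a| <= (1 + a ^+ 2) / 2.
    have := sqr_ge0 (1 - `|a|); rewrite -[a ^+ 2]real_normK ?num_real // sqrrB expr1n; lra.
  have q3 : (1 + a ^+ 2) * (1 + d1 ^+ 2) <= (1 + a ^+ 2 + S) * (1 + d1 ^+ 2).
    by rewrite ler_pM2r //; lra.
  have q4 : 0 <= a ^+ 2 * d1 ^+ 2 by rewrite mulr_ge0.
  lra.
lra.
Qed.

(** * Defects of the square-root coupling *)

Section Msq.
Context {R : realType} {n : nat}.
Implicit Types (p e : 'rV[R]_n) (H : 'M[R]_n).

Lemma msq_bounds p : [/\ 0 < msq p, msq p <= 1 & msq p * dotp p p <= 1].
Proof.
rewrite /msq; set w := Num.sqrt _.
have w1 : 1 <= w.
  by rewrite -[leLHS]sqrtr1 ler_sqrt ?lerDl ?dotp_ge0 // ltW // onep_gt0.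
have wE : dotp p p = w ^+ 2 - 1 by rewrite sqr_sqrtr ?(ltW (onep_gt0 _)) //; ring.
have w0 : 0 < w by apply: lt_le_trans w1.
have ww : 0 < w * (1 + w) by rewrite mulr_gt0 // ltr_wpDl.
split; first by rewrite invr_gt0.
  by rewrite invf_le1 //; move: w1; clear -R; nra.
rewrite mulrC ler_pdivrMr // wE; move: w1; clear -R; rewrite mul1r; lra.
Qed.

Lemma sum_dotp_perp2 p e : dotp e e = 1 ->
  \sum_(k < n) dotp p (perp e (delta_mx ord0 k)) ^+ 2 = dotp p p - dotp e p ^+ 2.
Proof.
move=> e1; transitivity (dotp (p - dotp e p *: e) (p - dotp e p *: e)).
  rewrite -sum_dotp_eps2; apply: eq_bigr => k _; rewrite /perp !dotpE (dotpC p e).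
  by congr (_ ^+ 2); ring.
by rewrite !dotpE e1 (dotpC p e); ring.
Qed.

(* The horizontal and vertical defects of the coupling of [e^perp] with its image under
   the square root of [mcfa p]; both vanish when [p] is parallel to [e]. *)
Lemma msq_perp p e : dotp e e = 1 ->
  let c := msq p in let t := dotp e p in let S := dotp p p - t ^+ 2 in
  let X := c ^+ 2 * t ^+ 2 * S in let me := 1 - c * t ^+ 2 in
  [/\ \sum_(k < n) (let h := msqv p (perp e (delta_mx ord0 k)) - perp e (delta_mx ord0 k) in
         dotp h h - dotp e h ^+ 2) = c ^+ 2 * S ^+ 2,
      \sum_(k < n) (let h := msqv p (perp e (delta_mx ord0 k)) - perp e (delta_mx ord0 k) in
         dotp e h ^+ 2) = X,
      dotp (msqv p e) (msqv p e) - dotp e (msqv p e) ^+ 2 = X,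
      dotp e (msqv p e) = me & X + me ^+ 2 = 1 - t ^+ 2 / (1 + dotp p p)].
Proof.
move=> e1 c t S X me.
have hE k : msqv p (perp e (delta_mx ord0 k)) - perp e (delta_mx ord0 k) =
   - (c * dotp p (perp e (delta_mx ord0 k))) *: p.
  by rewrite /msqv addrAC subrr add0r scaleNr.
have eM : dotp e (msqv p e) = me.
  by rewrite /msqv dotpDr dotpNr dotpZr e1 (dotpC p e) -/t /me -/c; ring.
split => //.
- transitivity (c ^+ 2 * S * \sum_(k < n) dotp p (perp e (delta_mx ord0 k)) ^+ 2).
    rewrite mulr_sumr; apply: eq_bigr => k _; cbv zeta.
    by rewrite hE !dotpZl !dotpZr -/t /S; ring.
  by rewrite sum_dotp_perp2 // -/t -/S; ring.
- transitivity (c ^+ 2 * t ^+ 2 * \sum_(k < n) dotp p (perp e (delta_mx ord0 k)) ^+ 2).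
    rewrite mulr_sumr; apply: eq_bigr => k _; cbv zeta.
    by rewrite hE !dotpZr -/t; ring.
  by rewrite sum_dotp_perp2 // -/t -/S.
- rewrite eM /msqv !dotpDl !dotpDr !dotpNl !dotpNr !dotpZl !dotpZr e1 (dotpC p e) -/t -/c /X /S /me; ring.
- have := msq_eq p; rewrite -/c; set q := dotp p p; set s := (1 + q)^-1 => h.
  have -> : t ^+ 2 * s = t ^+ 2 * (2 * c - q * c ^+ 2) by rewrite h; ring.
  by rewrite /X /S /me -/q; ring.
Qed.

(** Here [g] is the gradient of the penalty. It leaves each defect of [msq_perp] within a multiple
    of [th] of its value for [g = 0], uniformly in [d1]. The first bound serves the boundary case,
    the second the lengthening transverse to [e], the third the interior case. *)
Lemma compare_algebra (d1 d2 B z za th : R) (e p : 'rV[R]_n) (g : 'rV[R]_n) :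
  dotp e e = 1 -> p = d1 *: e + g -> dotp g g <= th ^+ 2 -> 0 <= th -> th <= 1 ->
  `|d1| <= B -> `|d2| <= B -> 0 < za -> za <= z ->
  let c := msq p in let t := dotp e p in let S := dotp p p - t ^+ 2 in
  let X := c ^+ 2 * t ^+ 2 * S in let me := 1 - c * t ^+ 2 in
  let k2 := (1 + d1 ^+ 2)^-1 in
  let k := Num.sqrt k2 in
  [/\ d2 * (X + me ^+ 2) - d2 * k2 <= 2 * B * th,
      d1 / z * (c ^+ 2 * S ^+ 2 + X) <= 2 * B / za * th &
      d2 * (X + (me - k) ^+ 2 / 2 + k2 / 2 + me ^+ 2 / 2) - d2 * k2 <= 5 * B * th].
Proof.
move=> e1 pE gth th0 th1 hd1 hd2 za0 zaz c t S X me k2 k.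
have B0 : 0 <= B by apply: le_trans hd1.
pose ge := dotp e g.
have tE : t = d1 + ge by rewrite /t pE dotpDr dotpZr e1 mulr1.
have ge2 : ge ^+ 2 <= dotp g g by have := dotp_CS e g; rewrite e1 mul1r.
have SE : S = dotp g g - ge ^+ 2.
  by rewrite /S tE pE !dotpE e1 (dotpC g e) -/ge; ring.
have S0 : 0 <= S by rewrite SE subr_ge0.
have Sth : S <= th ^+ 2 by apply: le_trans gth; rewrite SE gerBl sqr_ge0.
have geth : `|ge| <= th.
  have : `|ge| ^+ 2 <= th ^+ 2 by rewrite real_normK ?num_real //; exact: le_trans gth.
  by rewrite ler_sqr ?nnegrE.
have ppE : dotp p p = t ^+ 2 + S by rewrite /S; ring.
have [c0 c1 cpp] := msq_bounds p; rewrite -/c in c0 c1 cpp.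
have th2 : th ^+ 2 <= th by rewrite expr2 ler_piMr.
have t20 := sqr_ge0 t.
have ct1 : c * t ^+ 2 <= 1.
  by apply: le_trans cpp; rewrite ppE ler_pM2l // lerDl.
have ct0 : 0 <= c * t ^+ 2 by rewrite mulr_ge0 // ltW.
have X0 : 0 <= X by rewrite mulr_ge0 // mulr_ge0 // sqr_ge0.
have XS : X <= S.
  rewrite /X ler_piMl //; have -> : c ^+ 2 * t ^+ 2 = c * (c * t ^+ 2) by ring.
  by rewrite mulr_ile1 // ltW.
have Xth : X <= th by apply: (le_trans XS); exact: le_trans th2.
have hQ : `|X + me ^+ 2 - k2| <= 2 * th.
  have [_ _ _ _ ->] := msq_perp p e e1; rewrite -/t ppE.
  have -> : 1 - t ^+ 2 / (1 + (t ^+ 2 + S)) = (1 + S) / (1 + t ^+ 2 + S).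
    by field; rewrite gt_eqF //; move: t20 S0; clear -R; lra.
  by rewrite tE; exact: speed_perturbation.
have dQ a th' : `|a| <= th' -> d2 * a <= B * th'.
  move=> ha; apply: le_trans (ler_norm _) _; rewrite normrM; exact: ler_pM.
split.
- by have := dQ _ _ hQ; rewrite mulrBr; clear -R; lra.
- have h1 : c ^+ 2 * S ^+ 2 <= th.
    have S1 : S <= 1 by apply: (le_trans Sth); apply: (le_trans th2).
    apply: (@le_trans _ _ S); last exact: le_trans th2.
    have -> : c ^+ 2 * S ^+ 2 = (c ^+ 2 * S) * S by ring.
    by rewrite ler_piMl // mulr_ile1 ?sqr_ge0 // expr2 mulr_ile1 // ltW.
  have h0 : 0 <= c ^+ 2 * S ^+ 2 by rewrite mulr_ge0 ?sqr_ge0.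
  have h2 : d1 / z <= B / za.
    apply: (@le_trans _ _ (B / z)).
      by rewrite ler_pM2r ?invr_gt0 ?(lt_le_trans za0) //; apply: le_trans (ler_norm _) hd1.
    by rewrite ler_wpM2l // lef_pV2 ?posrE // (lt_le_trans za0).
  apply: (@le_trans _ _ (B / za * (c ^+ 2 * S ^+ 2 + X))).
    by rewrite ler_wpM2r // addr_ge0.
  have -> : 2 * B / za * th = B / za * (th + th) by ring.
  by rewrite ler_wpM2l ?divr_ge0 ?(ltW za0) // lerD.
- have k20 : 0 < k2 by rewrite invr_gt0 ltr_pwDl // sqr_ge0.
  have kk : k ^+ 2 = k2 by rewrite sqr_sqrtr // ltW.
  have k0 : 0 <= k by exact: sqrtr_ge0.
  have me0 : 0 <= me by rewrite /me subr_ge0.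
  have hm : `|me ^+ 2 - k2| <= 3 * th.
    have -> : me ^+ 2 - k2 = (X + me ^+ 2 - k2) - X by ring.
    by apply: le_trans (ler_normB _ _) _; rewrite (ger0_norm X0); move: hQ Xth; clear -R; lra.
  have hk : `|k * (me - k)| <= 3 * th.
    apply: le_trans hm; rewrite -kk.
    have -> : me ^+ 2 - k ^+ 2 = (me + k) * (me - k) by ring.
    by rewrite !normrM ler_wpM2r // (ger0_norm k0) (ger0_norm (addr_ge0 me0 k0)) lerDr.
  have hh : `|(X + me ^+ 2 - k2) - k * (me - k)| <= 5 * th.
    by apply: le_trans (ler_normB _ _) _; move: hQ hk; clear -R; lra.
  have := dQ _ _ hh.
  have -> : d2 * (X + me ^+ 2 - k2 - k * (me - k)) =
     d2 * (X + (me - k) ^+ 2 / 2 + k2 / 2 + me ^+ 2 / 2) - d2 * k2 + d2 * (k ^+ 2 - k2) / 2 by field.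
  by rewrite kk subrr mulr0 mul0r addr0; clear -R; lra.
Qed.

End Msq.

Section Touch.
Context {R : realType} {n : nat}.
Implicit Types (x y e a d xi : 'rV[R]_n) (X D : set 'rV[R]_n) (v u : 'rV[R]_n -> R -> R).

Lemma jet2_touch (f : R -> R -> R) (z tau d1 d2 eps K al ga w0 : R) (w : R -> R) x y a d e xi :
  0 < z -> y - x = z *: e -> dotp e e = 1 -> csf_at f z tau d1 d2 -> jet2 w w0 al ga ->
  let h := xi - a in
  jet2 (fun s => w s - f (enorm (y + s *: xi - (x + s *: a + s ^+ 2 *: d))) tau - K
          - eps * dotp (y + s *: xi) (y + s *: xi))
    (w0 - f z tau - K - eps * dotp y y)
    (al - d1 * dotp e h - 2 * eps * dotp y xi)
    (ga - d1 * ((dotp h h - dotp e h ^+ 2) / (2 * z) - dotp e d) - d2 / 2 * dotp e h ^+ 2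
      - eps * dotp xi xi).
Proof.
move=> z0 yx ee [_ Jf] jw h.
have zn : z != 0 by rewrite gt_eqF.
have ez : enorm (z *: e) = z by rewrite enormZ /enorm ee sqrtr1 mulr1 gtr0_norm.
have jn := @jet2_comp R (f^~ tau) _ _ _ _ _ _ _ (jet2_enorm z (z *: e) h (- d) z0 ez) Jf.
have hh := jet2B (jet2B (jet2B jw jn) (jet2_cst K)) (jet2Z eps (jet2_sqn y xi 0)).
apply: (jet2_ext _ _ _ _ hh) => [s|||].
- have -> : y + s *: xi - (x + s *: a + s ^+ 2 *: d) = z *: e + s *: h + s ^+ 2 *: - d.
    by rewrite -yx /h; apply/rowP => i; rewrite !mxE; ring.
  by rewrite scaler0 addr0.
- by [].
- by rewrite !dotpZl; field.
- by rewrite !dotpZl !dotpNr !dotp0r; field.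
Qed.

(** At a touching point the rate [sig] of the linear penalty in time would be at most an error
    vanishing with [th] and [eps]. So [sig] is taken from the tolerance [de], then [th] from [sig],
    and last [eps] from [th], [sig] and [y0]. *)
Lemma compare_limit X D u v (M dl s : R) f f1 f2 : closed X -> closed D ->
  cont_on (cyl D) (fun p => v p.1 p.2) -> cont_on (cyl X) (fun p => u p.1 p.2) ->
  (forall x y t, X x -> D y -> 0 < t -> v y t - u x t <= 2 * M) ->
  (exists2 z0, 0 < z0 & forall x y t, X x -> D y -> s <= t -> enorm (y - x) < z0 ->
     v y t - u x t <= dl) ->
  csf_barrier M f f1 f2 -> 0 < dl -> 0 < s ->
  (forall za B th eps sig x y t, 0 < za -> 0 <= th -> th <= 1 -> 0 < eps -> 0 < sig ->
    let G x y t := v y t - u x t - f (enorm (y - x)) (t - s) - sig * (t - s) - eps * dotp y y in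
    X x -> D y -> s < t -> let z := enorm (y - x) in
    za <= z -> `|f1 z (t - s)| <= B -> `|f2 z (t - s)| <= B ->
    dotp ((2 * eps) *: y) ((2 * eps) *: y) <= th ^+ 2 -> 4 * dl < G x y t ->
    (forall x' y' t', X x' -> D y' -> s < t' -> t' <= t -> G x' y' t' <= G x y t) ->
    sig <= (2 * B / za + 5 * B) * th + 2 * eps * n%:R) ->
  forall x y t, X x -> D y -> s < t -> v y t - u x t <= f (enorm (y - x)) (t - s) + 4 * dl.
Proof.
move=> cX cD cv cu hM hz0 hf dl0 s0 touch x0 y0 t0 Xx0 Dy0 st0.
have [za [B [A [za0 hcore]]]] := compare_core X D u v M dl s t0 f f1 f2 cX cD cv cu hM hz0 hf dl0 s0.
apply/ler_addgt0Pr => de de0.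
have tau0 : 0 < t0 - s by rewrite subr_gt0.
pose sig := de / (2 * (t0 - s)).
have sig0 : 0 < sig by rewrite divr_gt0 // mulr_gt0.
pose C := 2 * `|B| / za + 5 * `|B| + 1.
have C0 : 0 < C by rewrite ltr_wpDl // addr_ge0 // ?mulr_ge0 ?invr_ge0 // ltW.
pose th := Num.min 1 (sig / (4 * C)).
have th0 : 0 < th by rewrite lt_min ltr01 divr_gt0 // mulr_gt0.
have th1 : th <= 1 by rewrite ge_min lexx.
have thC : C * th <= sig / 4.
  have : C * th <= C * (sig / (4 * C)) by rewrite ler_pM2l // ge_min lexx orbT.
  by have -> : C * (sig / (4 * C)) = sig / 4 by field; rewrite gt_eqF.
(* [e1] keeps the gradient of the penalty below [th], because [|2 eps y|^2 = 4 eps (eps |y|^2)] and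
   [eps |y|^2 <= A]; [e2] controls the trace of its Hessian and [e3] its value at [y0]. *)
pose e1 := th ^+ 2 / (4 * (`|A| + 1)).
pose e2 := sig / (4 * (n%:R + 1)).
pose e3 := de / (2 * (dotp y0 y0 + 1)).
have A0 : 0 < `|A| + 1 by rewrite ltr_wpDl.
have n0 : 0 < n%:R + 1 :> R by rewrite ltr_wpDl.
have y00 : 0 < dotp y0 y0 + 1 by rewrite ltr_wpDl // dotp_ge0.
pose eps := Num.min e1 (Num.min e2 e3).
have eps0 : 0 < eps.
  by rewrite !lt_min !divr_gt0 ?exprn_gt0 // mulr_gt0.
have ep1 : eps * (4 * (`|A| + 1)) <= th ^+ 2.
  by rewrite -ler_pdivlMr ?mulr_gt0 // ge_min lexx.
have ep2 : eps * (4 * (n%:R + 1)) <= sig.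
  by rewrite -ler_pdivlMr ?mulr_gt0 // !ge_min lexx orbT.
have ep3 : eps * (2 * (dotp y0 y0 + 1)) <= de.
  by rewrite -ler_pdivlMr ?mulr_gt0 // !ge_min lexx !orbT.
have sE : sig * (t0 - s) = de / 2 by rewrite /sig; field; rewrite gt_eqF.
have eps1 : eps <= 1.
  have : eps <= eps * (4 * (`|A| + 1)).
    by rewrite ler_peMr ?(ltW eps0) //; have := normr_ge0 A; lra.
  move=> h; apply: (le_trans h); apply: (le_trans ep1); by rewrite exprn_ile1 // ltW.
have := hcore eps sig eps0 sig0 _ x0 y0 t0 Xx0 Dy0 st0 (lexx _).
suff h : forall G : R, v y0 t0 - u x0 t0 - f (enorm (y0 - x0)) (t0 - s) - sig * (t0 - s) - eps * dotp y0 y0 <= 4 * dl ->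
   v y0 t0 - u x0 t0 <= f (enorm (y0 - x0)) (t0 - s) + 4 * dl + de.
  move=> q; apply: (h 0); apply: q.
  move=> x y t Xx Dy st z zaz b1 b2 ey g4 hmax.
  have := touch za B th eps sig x y t za0 (ltW th0) th1 eps0 sig0 Xx Dy st zaz b1 b2 _ g4 hmax.
  have B0 : 0 <= B by apply: le_trans b1.
  have hg : dotp ((2 * eps) *: y) ((2 * eps) *: y) <= th ^+ 2.
    apply: le_trans ep1; rewrite dotpZl dotpZr.
    have -> : 2 * eps * (2 * eps * dotp y y) = eps * (4 * (eps * dotp y y)) by ring.
    rewrite ler_pM2l // ler_pM2l //; apply: (le_trans ey).
    by have := ler_norm A; clear -R; lra.
  move=> /(_ hg); rewrite leNgt => /negP; apply.
  have : (2 * B / za + 5 * B) * th <= C * th.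
    by rewrite ler_pM2r // /C (ger0_norm B0) lerDl.
  by move: thC ep2 eps0 sig0; clear -n; lra.
by move=> _; rewrite sE; move: ep3 eps0; clear -n; lra.
Qed.

End Touch.

Lemma jet1_pos_left {R : realType} {f : R -> R} {a b : R} : jet1 f a b -> 0 < b ->
  \forall s \near (0 : R), s < 0 -> f s < a.
Proof.
move=> hf b0; have b20 : 0 < b / 2 by rewrite divr_gt0.
apply: filterS (hf _ b20) => s; rewrite expr1 => h s0.
move: h; rewrite (ltr0_norm s0) => /ler_normlP[_]; have : b * s < 0 by rewrite pmulr_rlt0.
lra.
Qed.

Section CB.
Context {R : realType} {n : nat}.
Implicit Types (p e y : 'rV[R]_n) (H : 'M[R]_n).

Lemma sum_dotp_msqP p e : dotp e e = 1 ->
  \sum_(k < n) dotp (msqv p (perp e (delta_mx ord0 k))) (msqv p (perp e (delta_mx ord0 k)))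
  + dotp (msqv p e) (msqv p e) <= n%:R.
Proof.
move=> e1; under eq_bigr do rewrite dotp_qf.
by rewrite dotp_qf sum_qf_msqP // mcfop1_le.
Qed.

(** If [d1 <= 0], lengthening the segment has a favourable sign, and moving [y] alone in every
    direction suffices. Only for [d1 > 0] is [x] a nearest point of the complement, and then the
    curvatures of the boundary are available. *)
Lemma boundary_speed (d1 d2 B z za th eps : R) (e y p : 'rV[R]_n) H :
  dotp e e = 1 -> p = d1 *: e + (2 * eps) *: y ->
  dotp ((2 * eps) *: y) ((2 * eps) *: y) <= th ^+ 2 -> 0 <= th -> th <= 1 ->
  `|d1| <= B -> `|d2| <= B -> 0 < za -> za <= z -> 0 < eps ->
  (0 < d1 -> exists2 kappa : 'I_n -> R, 0 <= \sum_k kappa k & forall k,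
     let a := perp e (delta_mx ord0 k) in let xi := msqv p a in let h := xi - a in
     qf H xi / 2 - d1 * ((dotp h h - dotp e h ^+ 2) / (2 * z) - kappa k) - d2 / 2 * dotp e h ^+ 2
      - eps * dotp xi xi <= 0) ->
  (forall xi, qf H xi / 2 - d1 * ((dotp xi xi - dotp e xi ^+ 2) / (2 * z)) - d2 / 2 * dotp e xi ^+ 2
      - eps * dotp xi xi <= 0) ->
  mcfop p H - d2 / (1 + d1 ^+ 2) <= (2 * B / za + 5 * B) * th + 2 * eps * n%:R.
Proof.
move=> e1 pE gth th0 th1 hd1 hd2 za0 zaz eps0 hk hy.
have B0 : 0 <= B by apply: le_trans hd1.
have z0 : 0 < z by apply: lt_le_trans zaz.
have Bza : 0 <= B / za by rewrite divr_ge0 // ltW.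
have Bth : 0 <= B * th by rewrite mulr_ge0.
have Bzath : 0 <= B / za * th by rewrite mulr_ge0.
have zn : z != 0 by rewrite gt_eqF.
have [] := compare_algebra d1 d2 B z za th e p _ e1 pE gth th0 th1 hd1 hd2 za0 zaz.
have [] := msq_perp p e e1.
set c := msq p; set t := dotp e p; set S := dotp p p - t ^+ 2.
set X := c ^+ 2 * t ^+ 2 * S; set me := 1 - c * t ^+ 2.
cbv zeta => E1 E2 E3 E4 E5 A1 A2 _.
have [d10|d10] := ltP 0 d1; last first.
  have hxi xi : qf H xi <= d2 * dotp e xi ^+ 2 + 2 * eps * dotp xi xi.
    have cs : 0 <= (dotp xi xi - dotp e xi ^+ 2) / (2 * z).
      rewrite divr_ge0 ?subr_ge0 ?mulr_ge0 ?(ltW z0) //.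
      by have := dotp_CS e xi; rewrite e1 mul1r.
    have : 0 <= - d1 * ((dotp xi xi - dotp e xi ^+ 2) / (2 * z)) by rewrite mulr_ge0 // oppr_ge0.
    by have := hy xi; clear -R; lra.
  have : mcfop p H <= d2 * (1 - t ^+ 2 / (1 + dotp p p)) + 2 * eps * n%:R.
    rewrite -(sum_qf_msq p H) -{1}e1 -sum_dotp_msq.
    apply: (@le_trans _ _ (\sum_(k < n) (d2 * dotp e (msqv p (delta_mx ord0 k)) ^+ 2 +
        2 * eps * dotp (msqv p (delta_mx ord0 k)) (msqv p (delta_mx ord0 k))))).
      by apply: ler_sum => k _; exact: hxi.
    rewrite big_split /= -!mulr_sumr lerD2l ler_pM2l ?mulr_gt0 //.
    exact: sum_dotp_msq_le.
  by rewrite -E5; move: A1 Bth Bzath; clear -R; lra.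
have [kappa kap0 hkap] := hk d10.
have hS : \sum_k qf H (msqv p (perp e (delta_mx ord0 k))) <=
   d1 / z * (c ^+ 2 * S ^+ 2) + d2 * X +
   2 * eps * \sum_(k < n) dotp (msqv p (perp e (delta_mx ord0 k))) (msqv p (perp e (delta_mx ord0 k)))
    - 2 * d1 * \sum_k kappa k.
  rewrite -{}E1 -{}E2 !mulr_sumr -!big_split /= -sumrB; apply: ler_sum => k _.
  have := hkap k; cbv zeta; set xi := msqv _ _; set h := xi - _.
  have -> : d1 * ((dotp h h - dotp e h ^+ 2) / (2 * z) - kappa k) =
    d1 / z * (dotp h h - dotp e h ^+ 2) / 2 - d1 * kappa k by field.
  clear -R; lra.
have hm := hy (msqv p e).
have dk : 0 <= d1 * \sum_k kappa k by rewrite mulr_ge0 // ltW.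
have hn : 2 * eps * (\sum_(k < n) dotp (msqv p (perp e (delta_mx ord0 k))) (msqv p (perp e (delta_mx ord0 k)))
  + dotp (msqv p e) (msqv p e)) <= 2 * eps * n%:R.
  by rewrite ler_pM2l ?mulr_gt0 // sum_dotp_msqP.
rewrite -(sum_qf_msqP p e H e1).
move: hm; rewrite E3 E4.
have -> : d1 * (X / (2 * z)) = d1 / z * X / 2 by field.
rewrite /perp in hS hn A1 A2 dk *.
by move: hS dk hn A1 A2 Bth Bzath; clear -R; lra.
Qed.

(** As [d2] has no sign, the variations along [e] must produce it with the exact coefficient
    [1 / (1 + d1 ^+ 2)]. Moving both points in parallel gives 0, moving each one alone gives twice
    this coefficient in total; the sum of these three second-order conditions, each of which carries
    the Hessians with a factor one half, is the mean of both and hence exact up to [th]. *)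
Lemma interior_speed (d1 d2 B z za th eps : R) (e y p q : 'rV[R]_n) H G :
  dotp e e = 1 -> p = d1 *: e + (2 * eps) *: y -> q = d1 *: e ->
  dotp ((2 * eps) *: y) ((2 * eps) *: y) <= th ^+ 2 -> 0 <= th -> th <= 1 ->
  `|d1| <= B -> `|d2| <= B -> 0 < za -> za <= z -> 0 < eps ->
  (forall a xi, let h := xi - a in
     qf H xi / 2 - qf G a / 2 - d1 * ((dotp h h - dotp e h ^+ 2) / (2 * z)) - d2 / 2 * dotp e h ^+ 2
      - eps * dotp xi xi <= 0) ->
  mcfop p H - mcfop q G - d2 / (1 + d1 ^+ 2) <= (2 * B / za + 5 * B) * th + 2 * eps * n%:R.
Proof.
move=> e1 pE qE gth th0 th1 hd1 hd2 za0 zaz eps0 hk.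
have B0 : 0 <= B by apply: le_trans hd1.
have z0 : 0 < z by apply: lt_le_trans zaz.
have zn : z != 0 by rewrite gt_eqF.
have [] := compare_algebra d1 d2 B z za th e p _ e1 pE gth th0 th1 hd1 hd2 za0 zaz.
have [] := msq_perp p e e1.
set c := msq p; set t := dotp e p; set S := dotp p p - t ^+ 2.
set X := c ^+ 2 * t ^+ 2 * S; set me := 1 - c * t ^+ 2.
set kk := Num.sqrt _.
cbv zeta => E1 E2 E3 E4 E5 _ A2 A3.
have p1 : 0 < 1 + d1 ^+ 2 by rewrite ltr_pwDl // sqr_ge0.
have kkE : kk ^+ 2 = (1 + d1 ^+ 2)^-1 by rewrite sqr_sqrtr // invr_ge0 ltW.
have q0 K : qf K (0 : 'rV[R]_n) = 0 by rewrite -(scale0r 0) qfZ expr0n mul0r.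
have hS : \sum_k qf H (msqv p (perp e (delta_mx ord0 k))) - \sum_k qf G (perp e (delta_mx ord0 k)) <=
   d1 / z * (c ^+ 2 * S ^+ 2) + d2 * X +
   2 * eps * \sum_(k < n) dotp (msqv p (perp e (delta_mx ord0 k))) (msqv p (perp e (delta_mx ord0 k))).
  rewrite -{}E1 -{}E2 !mulr_sumr -!big_split /= -sumrB; apply: ler_sum => k _.
  have := hk (perp e (delta_mx ord0 k)) (msqv p (perp e (delta_mx ord0 k))).
  cbv zeta; set xi := msqv _ _; set h := xi - _.
  have -> : d1 * ((dotp h h - dotp e h ^+ 2) / (2 * z)) =
    d1 / z * (dotp h h - dotp e h ^+ 2) / 2 by field.
  clear -R; lra.
have hn : 2 * eps * (\sum_(k < n) dotp (msqv p (perp e (delta_mx ord0 k))) (msqv p (perp e (delta_mx ord0 k)))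
  + dotp (msqv p e) (msqv p e)) <= 2 * eps * n%:R.
  by rewrite ler_pM2l ?mulr_gt0 // sum_dotp_msqP.
move: E3 E4 hn (hk (kk *: e) (msqv p e)) (hk 0 (msqv p e)); rewrite -(sum_qf_msqP p e H e1).
set m := msqv p e; move: m => m E3 E4 hn m1 m3.
have m2 := hk (kk *: e) 0.
rewrite -(mcfop_perp G e q _ e1 qE).
have qq : dotp q q = d1 ^+ 2 by rewrite qE dotpZl dotpZr e1; ring.
rewrite qq -kkE.
have hX : dotp (m - kk *: e) (m - kk *: e) - dotp e (m - kk *: e) ^+ 2 = X.
  rewrite -E3 !dotpDl !dotpDr !dotpNl !dotpNr !dotpZl !dotpZr e1 (dotpC (m) e); ring.
have ek : dotp e (m - kk *: e) = me - kk by rewrite dotpDr dotpNr dotpZr e1 E4 mulr1.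
move: m1 m2 m3; cbv zeta; rewrite hX ek !subr0 sub0r !dotpNr !dotpNl opprK !dotpZl !dotpZr !dotp0r e1 !q0 !qfZ E3 E4.
have -> : d1 * (X / (2 * z)) = d1 / z * X / 2 by field.
have -> : kk * (kk * 1) - (- (kk * 1)) ^+ 2 = 0 by ring.
have -> : (- (kk * 1)) ^+ 2 = kk ^+ 2 by ring.
rewrite -kkE in A3.
rewrite /perp in hS hn *.
by move: hS hn A2 A3; clear -R; lra.
Qed.

End CB.

Section CB.
Context {R : realType} {n : nat}.
Implicit Types (Omega : set 'rV[R]_n.+1) (v : 'rV[R]_n.+1 -> R -> R).

Lemma touch_gradient (p e y : 'rV[R]_n.+1) (d1 eps : R) :
  (forall xi, dotp p xi - d1 * dotp e xi - 2 * eps * dotp y xi = 0) ->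
  p = d1 *: e + (2 * eps) *: y.
Proof.
move=> h; apply/rowP => i; have := h (delta_mx ord0 i).
rewrite !dotp_eps !mxE => h'; apply/eqP; rewrite -subr_eq0; apply/eqP; rewrite -[RHS]h'; ring.
Qed.

(** The nonnegativity of [f] together with [v = 0] on the boundary forces a touching [y] into
    [Omega]; near the diagonal the uniform modulus of continuity takes over. *)
Lemma compare_boundary Omega M v (dl s : R) f f1 f2 : open Omega -> mean_convex Omega ->
  bounded_flow Omega M v -> 0 <= M -> csf_barrier M f f1 f2 ->
  (forall z t, 0 <= z -> 0 < t -> 0 <= f z t) -> 0 < dl -> 0 < s ->
  forall x y t, ~ Omega x -> closure Omega y -> s < t ->
    v y t <= f (enorm (y - x)) (t - s) + 4 * dl.
Proof.
move=> oO mc hv M0 hf f0 dl0 s0 x0 y0 t0 nx0 cy0 st0.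
have [hmcf cv v0 hM] := hv; have [hcsf _ _ _ _] := hf.
have := @compare_limit R n.+1 (~` Omega) (closure Omega) (fun _ _ => 0) v M dl s f f1 f2.
move=> h; rewrite -[v y0 t0]subr0; apply: h => //.
- exact: open_closedC.
- exact: closed_closure.
- exact: cont_on_cst.
- move=> x y t nx cy t0'; rewrite subr0; have := hM _ _ cy t0'.
  by rewrite ler_norml => /andP[_]; move: M0; clear -n; lra.
- have [z0 z00 hz0] := uniform_modulus Omega M v dl s oO mc hv M0 dl0 s0.
  by exists z0 => // x y t nx cy st hz; rewrite subr0; have [h _] := hz0 x y t st cy hz; exact: h.
move=> {x0 y0 t0 nx0 cy0 st0} za B th eps sig x y t za0 th0 th1 eps0 sig0 G nx Dy st z zaz B1 B2 hg G4 hN.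
have t0 : 0 < t by exact: lt_trans st.
have tau0 : 0 < t - s by rewrite subr_gt0.
have z0 : 0 < z by apply: lt_le_trans zaz.
have zn : z != 0 by rewrite gt_eqF.
have eyy : 0 <= eps * dotp y y by rewrite mulr_ge0 ?dotp_ge0 // ltW.
have Oy : Omega y.
  apply: contrapT => nOy; move: G4; rewrite /G v0 //; last exact: boundary_of.
  have := f0 z (t - s) (ltW z0) tau0; have : 0 < sig * (t - s) by rewrite mulr_gt0.
  by rewrite -/z; move: eyy dl0; clear -n; lra.
have [p [H [vt [j1 j2 hvt]]]] := hmcf y t Oy t0.
set d1 := f1 z (t - s) in B1; set d2 := f2 z (t - s) in B2.
have hJ := hcsf z (t - s) z0 tau0; rewrite -/d1 -/d2 in hJ.
pose e := z^-1 *: (y - x).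
have yx : y - x = z *: e by rewrite /e scalerA mulfV // scale1r.
have ee : dotp e e = 1.
  rewrite /e dotpZl dotpZr -enorm_sqr -/z; field; exact: zn.
have nD xi : \forall s \near (0 : R), closure Omega (y + s *: xi).
  have := near_curve Omega y xi 0 oO Oy; apply: filterS => r.
  by rewrite scaler0 addr0; exact: subset_closure.
have key a d xi : (\forall s \near (0 : R), ~ Omega (x + s *: a + s ^+ 2 *: d)) ->
    let h := xi - a in
    dotp p xi - d1 * dotp e h - 2 * eps * dotp y xi = 0 /\
    qf H xi / 2 - d1 * ((dotp h h - dotp e h ^+ 2) / (2 * z) - dotp e d) - d2 / 2 * dotp e h ^+ 2
     - eps * dotp xi xi <= 0.
  move=> ha h.
  have jw : jet2 (fun r => v (y + r *: xi) t - 0) (v y t - 0) (dotp p xi) (qf H xi / 2).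
    by apply: (jet2_ext _ _ _ _ (j2 xi)) => [r|||]; rewrite ?subr0.
  have := jet2_touch f z (t - s) d1 d2 eps (sig * (t - s)) _ _ _ _ x y a d e xi z0 yx ee hJ jw.
  move=> /jet2_max; apply.
  apply: filterS (filterI ha (nD xi)) => r [h5 h6].
  exact: hN.
have key0 xi : dotp p xi - d1 * dotp e xi - 2 * eps * dotp y xi = 0 /\
    qf H xi / 2 - d1 * ((dotp xi xi - dotp e xi ^+ 2) / (2 * z)) - d2 / 2 * dotp e xi ^+ 2
     - eps * dotp xi xi <= 0.
  have := key 0 0 xi; cbv zeta; rewrite subr0 dotp0r subr0; apply.
  by apply: filterE => r; rewrite !scaler0 !addr0; exact: nx.
have pE : p = d1 *: e + (2 * eps) *: y by apply: touch_gradient => xi; have [] := key0 xi.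
have ht : sig <= vt - d2 / (1 + d1 ^+ 2).
  have [hJ1 _] := hJ.
  have jw := jet1B (jet1B (jet1B (jet1B j1 (jet1_cst 0)) hJ1) (jet1_poly (sig * (t - s)) sig 0)) (jet1_cst (eps * dotp y y)).
  have hl : \forall r \near (0 : R), r <= 0 ->
     v y (t + r) - 0 - f z (t - s + r) - (sig * (t - s) + sig * r + 0 * r ^+ 2) - eps * dotp y y <= G x y t.
    have hr : \forall r \near (0 : R), - (t - s) < r by apply: filterS (nbhs0_lt tau0) => r; rewrite ltr_norml => /andP[].
    apply: filterS hr => r r1 r0.
    have := hN x y (t + r) nx Dy _ _.
    rewrite /G -/z; have -> : t + r - s = t - s + r by ring.
    have -> : sig * (t - s) + sig * r + 0 * r ^+ 2 = sig * (t - s + r) by ring.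
    by apply; move: r1 r0; clear -n; lra.
  have := jet1_left_max jw hl; rewrite !subr0; clear -n; lra.
apply: (le_trans ht); rewrite hvt.
apply: (@boundary_speed R n.+1 d1 d2 B z za th eps e y p H) => //; last first.
  by move=> xi; have [] := key0 xi.
move=> d10.
(* Since [0 < d1], the profile is smaller at slightly smaller distances; a point of the complement
   closer to [y] would therefore increase [G]. *)
have hmin : \forall x' \near x, ~ Omega x' -> z <= enorm (x + z *: e - x').
  have [_ hJ2] := hJ; have /(jet1_pos_left)/(_ d10) hlt := jet2_jet1 hJ2.
  have c : (fun x' : 'rV[R]_n.+1 => enorm (y - x') - z) @ x --> (0 : R).
    have ci : continuous (fun x' : 'rV[R]_n.+1 => y - x').
      by move=> q; exact: (@cvgB _ _ _ (nbhs q) _ (fun=> y) id _ _ (cvg_cst y) (@cvg_id _ (nbhs q))).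
    rewrite -[X in _ --> X](subrr z); exact: (cvgB (continuous_enorm _ ci x) (cvg_cst z)).
  have hc : \forall x' \near x, enorm (y - x') - z < 0 -> f (z + (enorm (y - x') - z)) (t - s) < f z (t - s).
    exact: (c _ hlt).
  apply: filterS hc => x' h nOx'.
  rewrite -yx (addrC x) subrK leNgt; apply/negP => hz.
  have := h; rewrite subr_lt0 => /(_ hz); rewrite (addrC z) subrK.
  have := hN x' y t nOx' Dy st (lexx _); rewrite /G -/z; clear -n; lra.
have [kappa skappa hkappa] := boundary_touch _ _ _ _ oO mc nx z0 ee hmin.
exists kappa => // k; cbv zeta; set a := perp e _; set xi := msqv p a; set h := xi - a.
have := @le0_eta R (qf H xi / 2 - d1 * ((dotp h h - dotp e h ^+ 2) / (2 * z)) - d2 / 2 * dotp e h ^+ 2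
     - eps * dotp xi xi) d1 (kappa k) d10 => hle.
have -> : qf H xi / 2 - d1 * ((dotp h h - dotp e h ^+ 2) / (2 * z) - kappa k) -
   d2 / 2 * dotp e h ^+ 2 - eps * dotp xi xi = (qf H xi / 2 - d1 * ((dotp h h - dotp e h ^+ 2) / (2 * z)) - d2 / 2 * dotp e h ^+ 2
     - eps * dotp xi xi) + d1 * kappa k by ring.
apply: hle => eta eta0.
have [_ ] := key a ((kappa k - eta) *: e) xi (hkappa k eta eta0).
rewrite dotpZr ee -/h; clear -n; lra.
Qed.

Lemma compare_interior Omega M v (dl s : R) f f1 f2 : open Omega -> mean_convex Omega ->
  bounded_flow Omega M v -> 0 <= M -> csf_barrier M f f1 f2 ->
  (forall z t, 0 <= z -> 0 < t -> 0 <= f z t) -> 0 < dl -> 0 < s ->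
  forall x y t, closure Omega x -> closure Omega y -> s < t ->
    v y t - v x t <= f (enorm (y - x)) (t - s) + 4 * dl.
Proof.
move=> oO mc hv M0 hf f0 dl0 s0 x0 y0 t0 nx0 cy0 st0.
have [hmcf cv v0 hM] := hv; have [hcsf _ _ _ _] := hf.
apply: (@compare_limit R n.+1 (closure Omega) (closure Omega) v v M dl s f f1 f2) => //.
- exact: closed_closure.
- exact: closed_closure.
- move=> x y t cx cy t0'; have := hM _ _ cy t0'; have := hM _ _ cx t0'.
  by rewrite !ler_norml => /andP[+ _] /andP[_]; clear -n; lra.
- have [z0 z00 hz0] := uniform_modulus Omega M v dl s oO mc hv M0 dl0 s0.
  by exists z0 => // x y t nx cy st hz; have [_ h] := hz0 x y t st cy hz; exact: h.
move=> {x0 y0 t0 nx0 cy0 st0} za B th eps sig x y t za0 th0 th1 eps0 sig0 G Dx Dy st z zaz B1 B2 hg G4 hN.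
have t0 : 0 < t by exact: lt_trans st.
have tau0 : 0 < t - s by rewrite subr_gt0.
have z0 : 0 < z by apply: lt_le_trans zaz.
have zn : z != 0 by rewrite gt_eqF.
have eyy : 0 <= eps * dotp y y by rewrite mulr_ge0 ?dotp_ge0 // ltW.
have st' : 0 < sig * (t - s) by rewrite mulr_gt0.
have Ox : Omega x.
  apply: contrapT => nOx; move: G4; rewrite /G (v0 x) //; last exact: boundary_of.
  have := compare_boundary Omega M v dl s f f1 f2 oO mc hv M0 hf f0 dl0 s0 x y t nOx Dy st.
  by rewrite -/z; move: eyy dl0 st'; clear -n; lra.
have Oy : Omega y.
  apply: contrapT => nOy; move: G4; rewrite /G (v0 y) //; last exact: boundary_of.
  have := compare_boundary Omega M _ dl s f f1 f2 oO mc (bounded_flowN _ _ _ hv) M0 hf f0 dl0 s0 y x t nOy Dx st.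
  by rewrite enormB -/z; move: eyy dl0 st'; clear -n; lra.
have [p [H [vt [j1 j2 hvt]]]] := hmcf y t Oy t0.
have [q [K [ut [i1 i2 hut]]]] := hmcf x t Ox t0.
set d1 := f1 z (t - s) in B1; set d2 := f2 z (t - s) in B2.
have hJ := hcsf z (t - s) z0 tau0; rewrite -/d1 -/d2 in hJ.
pose e := z^-1 *: (y - x).
have yx : y - x = z *: e by rewrite /e scalerA mulfV // scale1r.
have ee : dotp e e = 1.
  rewrite /e dotpZl dotpZr -enorm_sqr -/z; field; exact: zn.
have nD x' xi : Omega x' -> \forall s \near (0 : R), closure Omega (x' + s *: xi).
  move=> Ox'; have := near_curve Omega x' xi 0 oO Ox'; apply: filterS => r.
  by rewrite scaler0 addr0; exact: subset_closure.
have key a xi : let h := xi - a in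
    dotp p xi - dotp q a - d1 * dotp e h - 2 * eps * dotp y xi = 0 /\
    qf H xi / 2 - qf K a / 2 - d1 * ((dotp h h - dotp e h ^+ 2) / (2 * z)) - d2 / 2 * dotp e h ^+ 2
     - eps * dotp xi xi <= 0.
  move=> h.
  have jw := jet2B (j2 xi) (i2 a).
  have := jet2_touch f z (t - s) d1 d2 eps (sig * (t - s)) _ _ _ _ x y a 0 e xi z0 yx ee hJ jw.
  rewrite dotp0r => /jet2_max hh; rewrite -{1}(subr0 ((dotp h h - dotp e h ^+ 2) / (2 * z))); apply: hh.
  apply: filterS (filterI (nD x a Ox) (nD y xi Oy)) => r [h5 h6].
  rewrite scaler0 addr0; exact: hN.
have pE : p = d1 *: e + (2 * eps) *: y.
  by apply: touch_gradient => xi; have [] := key 0 xi; rewrite subr0 dotp0r subr0.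
have qE : q = d1 *: e.
  rewrite -[RHS](addr0) -(scaler0 _ (2 * eps)); apply: touch_gradient => xi.
  have [h _] := key xi 0; rewrite dotp0l mulr0 subr0.
  move: h; rewrite !dotp0r (sub0r xi) sub0r dotpNr !mulr0 mulrN; clear -n; lra.
have ht : sig <= vt - ut - d2 / (1 + d1 ^+ 2).
  have [hJ1 _] := hJ.
  have jw := jet1B (jet1B (jet1B (jet1B j1 i1) hJ1) (jet1_poly (sig * (t - s)) sig 0)) (jet1_cst (eps * dotp y y)).
  have hl : \forall r \near (0 : R), r <= 0 ->
     v y (t + r) - v x (t + r) - f z (t - s + r) - (sig * (t - s) + sig * r + 0 * r ^+ 2) - eps * dotp y y <= G x y t.
    have hr : \forall r \near (0 : R), - (t - s) < r by apply: filterS (nbhs0_lt tau0) => r; rewrite ltr_norml => /andP[].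
    apply: filterS hr => r r1 r0.
    have := hN x y (t + r) Dx Dy _ _.
    rewrite /G -/z; have -> : t + r - s = t - s + r by ring.
    have -> : sig * (t - s) + sig * r + 0 * r ^+ 2 = sig * (t - s + r) by ring.
    by apply; move: r1 r0; clear -n; lra.
  have := jet1_left_max jw hl; rewrite !subr0; clear -n; lra.
apply: (le_trans ht); rewrite hvt hut.
apply: (@interior_speed R n.+1 d1 d2 B z za th eps e y p q H K) => //.
by move=> a xi; have [] := key a xi.
Qed.

(* The comparison loses nothing in the limit: [f] does not depend on [dl]. *)
Lemma oscillation_bound Omega M v (s : R) f f1 f2 : open Omega -> mean_convex Omega ->
  bounded_flow Omega M v -> 0 <= M -> csf_barrier M f f1 f2 ->
  (forall z t, 0 <= z -> 0 < t -> 0 <= f z t) -> 0 < s ->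
  forall x y t, closure Omega x -> closure Omega y -> s < t ->
    v y t - v x t <= f (enorm (y - x)) (t - s).
Proof.
move=> oO mc hv M0 hf f0 s0 x y t cx cy st; apply/ler_addgt0Pr => e e0.
have e40 : 0 < e / 4 by rewrite divr_gt0.
have := compare_interior Omega M v (e / 4) s f f1 f2 oO mc hv M0 hf f0 e40 s0 x y t cx cy st.
clear -n; lra.
Qed.

End CB.

(** * The curve shortening flow on the half-line *)

Section Csf.
Context {R : realType}.
Implicit Types (v w : R -> R -> R) (z t a b : R) (K : set (R * R)).

Definition csf_sol v z t : Prop := exists a b, csf_at v z t a b.

Definition csf_super w z t : Prop := exists a b wt,
  [/\ jet1 (fun s => w z (t + s)) (w z t) wt,
      jet2 (fun s => w (z + s) t) (w z t) a (b / 2) & b / (1 + a ^+ 2) <= wt].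

Lemma csf_solN v z t : csf_sol v z t -> csf_sol (fun z t => - v z t) z t.
Proof.
move=> [a [b [j1 j2]]]; exists (- a), (- b); split.
  by apply: (jet1_ext _ _ _ (jet1N j1)) => //; rewrite sqrrN mulNr.
by apply: (jet2_ext _ _ _ _ (jet2N j2)) => //; rewrite mulNr.
Qed.

Lemma csf_solD v z t (k : R) : csf_sol v z t -> csf_sol (fun z t => k + v z t) z t.
Proof.
move=> [a [b [j1 j2]]]; exists a, b; split.
  by apply: (jet1_ext _ _ _ (jet1D (jet1_cst k) j1)) => //; rewrite add0r.
by apply: (jet2_ext _ _ _ _ (jet2D (jet2_cst k) j2)) => //; rewrite add0r.
Qed.

Lemma csf_sol_reflect v z t : csf_sol v z t -> csf_sol (fun z t => v (- z) t) (- z) t.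
Proof.
move=> [a [b [j1 j2]]]; exists (- a), b; split.
  by apply: (jet1_ext _ _ _ j1) => [s||]; rewrite ?opprK // sqrrN.
have jn : jet2 (fun s : R => 0 + -1 * s + 0 * s ^+ 2) 0 (-1) 0 := jet2_poly 0 (-1) 0.
have jv : jet2 (fun h => (fun s => v (z + s) t) (0 + h)) (v z t) a (b / 2).
  by apply: (jet2_ext _ _ _ _ j2) => // s; rewrite add0r.
have := @jet2_comp R (fun s => v (z + s) t) _ _ _ _ _ _ _ jn jv => h.
apply: (jet2_ext _ _ _ _ h) => [s|||]; rewrite ?opprK //; last 2 first.
- ring.
- ring.
- by congr v; ring.
Qed.

Lemma csf_compare K v w : compact K ->
  cont_on K (fun p => v p.1 p.2) -> cont_on K (fun p => w p.1 p.2) ->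
  (forall z t, K (z, t) -> w z t < v z t ->
    [/\ \forall r \near (0 : R), K (z + r, t), \forall r \near (0 : R), r <= 0 -> K (z, t + r),
        csf_sol v z t & csf_super w z t]) ->
  forall z t, K (z, t) -> v z t <= w z t.
Proof.
move=> cK cv cw hin z0 t0 K0; rewrite leNgt; apply/negP => hvw.
have K00 : K !=set0 by exists (z0, t0).
have ct : cont_on K (fun p : R * R => p.2).
  by apply: continuous_cont_on => p; exact: cvg_snd.
have [[zm tm] Km hm] := compact_min K _ cK K00 ct.
pose D := v z0 t0 - w z0 t0; have D0 : 0 < D by rewrite subr_gt0.
have tm0 : tm <= t0 by exact: (hm (z0, t0)).
(* The tilt in time makes the parabolic inequality strict; it is small enough that [v] still exceeds
   [w] at the maximum of the tilted difference. *)
pose eps := D / (2 * (t0 - tm + 1)).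
have tp : 0 < t0 - tm + 1 by rewrite ltr_wpDl // subr_ge0.
have eps0 : 0 < eps by rewrite divr_gt0 // mulr_gt0.
pose F (p : R * R) := v p.1 p.2 - w p.1 p.2 - eps * (p.2 - t0).
have cF : cont_on K F.
  apply: cont_onB; first exact: cont_onB.
  apply: cont_onM; first exact: cont_on_cst.
  by apply: cont_onB => //; exact: cont_on_cst.
have [[z t] Kp hp] := compact_max K F cK K00 cF.
have hz : w z t < v z t.
  have := hp _ K0; rewrite /F /= subrr mulr0 subr0 -/D => h.
  have : eps * (t0 - tm) <= D / 2.
    have -> : D / 2 = eps * (t0 - tm + 1) by rewrite /eps; field; rewrite gt_eqF.
    by rewrite ler_pM2l // lerDl.
  have h2 : tm <= t by exact: (hm (z, t)).
  have : eps * (t0 - t) <= eps * (t0 - tm) by rewrite ler_pM2l // lerD2l lerN2.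
  by move: h D0; clear -R; lra.
have [n1 n2 [a [b [j1 j2]]] [a' [b' [wt [i1 i2 hw]]]]] := hin z t Kp hz.
have jz := jet2B (jet2B j2 i2) (jet2_cst (eps * (t - t0))).
have [] := jet2_max jz _.
  by apply: filterS n1 => r Kr; exact: hp Kr.
rewrite subr0 => ha hb.
have jt := jet1B (jet1B j1 i1) (jet1_poly (eps * (t - t0)) eps 0).
have := jet1_left_max jt _.
have hn : \forall s \near (0 : R), s <= 0 -> v z (t + s) - w z (t + s)
   - (eps * (t - t0) + eps * s + 0 * s ^+ 2) <= v z t - w z t - eps * (t - t0).
  apply: filterS n2 => r Kr r0; have := hp _ (Kr r0); rewrite /F /=; clear -R; lra.
move=> /(_ hn); have aE : a = a' by move: ha; clear -R; lra.
have p1 : 0 < 1 + a' ^+ 2 by rewrite ltr_pwDl // sqr_ge0.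
have : b / (1 + a ^+ 2) <= b' / (1 + a' ^+ 2).
  by rewrite aE ler_pM2r ?invr_gt0 //; move: hb; clear -R; lra.
by move: hw eps0; clear -R; lra.
Qed.

Lemma csf_super_cst k z t : csf_super (fun _ _ => k) z t.
Proof.
exists 0, 0, 0; split; [exact: jet1_cst| |by rewrite mul0r].
by apply: (jet2_ext _ _ _ _ (jet2_cst k)) => //; rewrite mul0r.
Qed.

Lemma interior_time (c m s tau z t : R) : c < z -> z < m -> s < t -> t <= tau ->
  (\forall r \near (0 : R), c <= z + r <= m /\ s <= t <= tau) /\
  (\forall r \near (0 : R), r <= 0 -> c <= z <= m /\ s <= t + r <= tau).
Proof.
move=> cz zm st tt; split.
  have h1 : 0 < z - c by rewrite subr_gt0.
  have h2 : 0 < m - z by rewrite subr_gt0.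
  apply: filterS (filterI (nbhs0_lt h1) (nbhs0_lt h2)) => r [].
  rewrite !ltr_norml => /andP[q1 q2] /andP[q3 q4]; split; apply/andP; split;
    move: q1 q2 q3 q4 st tt; clear -R; lra.
have h1 : 0 < t - s by rewrite subr_gt0.
apply: filterS (nbhs0_lt h1) => r.
rewrite !ltr_norml => /andP[q1 q2] r0; split; apply/andP; split;
    move: q1 q2 cz zm st tt r0; clear -R; lra.
Qed.

Lemma csf_max_rect (c m s tau : R) v w :
  cont_on [set p : R * R | c <= p.1 <= m /\ s <= p.2 <= tau] (fun p => v p.1 p.2) ->
  cont_on [set p : R * R | c <= p.1 <= m /\ s <= p.2 <= tau] (fun p => w p.1 p.2) ->
  (forall z t, c < z -> z < m -> s < t -> t <= tau -> csf_sol v z t) ->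
  (forall z t, c < z -> z < m -> s < t -> t <= tau -> csf_super w z t) ->
  (forall t, s <= t -> t <= tau -> v c t <= w c t) ->
  (forall t, s <= t -> t <= tau -> v m t <= w m t) ->
  (forall z, c <= z -> z <= m -> v z s <= w z s) ->
  forall z t, c <= z -> z <= m -> s <= t -> t <= tau -> v z t <= w z t.
Proof.
move=> cv cw hv hw b1 b2 b3 z t cz zm st tt.
apply: (csf_compare [set p : R * R | c <= p.1 <= m /\ s <= p.2 <= tau]) => //.
- exact: rect_compact.
- move=> {cz zm st tt} {}z {}t [/andP[/= cz zm] /andP[st tt]] hvw.
  have cz' : c < z.
    by rewrite lt_neqAle cz andbT; apply/eqP => E; move: hvw; rewrite -E ltNge b1.
  have zm' : z < m.
    by rewrite lt_neqAle zm andbT; apply/eqP => E; move: hvw; rewrite E ltNge b2.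
  have st' : s < t.
    by rewrite lt_neqAle st andbT; apply/eqP => E; move: hvw; rewrite -E ltNge b3.
  have [n1 n2] := interior_time _ _ _ _ _ _ cz' zm' st' tt.
  by split => //; [exact: hv|exact: hw].
- by split; apply/andP.
Qed.

Lemma jet2_inv (a : R) : a != 0 -> jet2 (fun s => (a + s)^-1) a^-1 (- (a ^+ 2)^-1) (a ^+ 3)^-1.
Proof.
move=> a0.
have b : bounded_near0 (fun s : R => - ((a ^+ 3) * (a + s))^-1).
  exists ((`|a| ^+ 3 * (`|a| / 2))^-1).
  have h : 0 < `|a| / 2 by rewrite divr_gt0 // normr_gt0.
  apply: filterS (nbhs0_lt h) => s hs.
  rewrite normrN normfV normrM normrX lef_pV2 ?posrE.
  - rewrite ler_pM2l ?exprn_gt0 ?normr_gt0 //.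
    have : `|a| <= `|a + s| + `|s| by rewrite -{1}(addrK s a); exact: ler_normB.
    by move: hs; clear -R; lra.
  - rewrite mulr_gt0 ?exprn_gt0 ?normr_gt0 // addr_eq0; apply/eqP => E.
    by move: hs h; rewrite E normrN; clear -R; lra.
  - by rewrite mulr_gt0 ?exprn_gt0 ?normr_gt0.
apply: small_near (smallM b (small_pow 2)) _.
have h : 0 < `|a| by rewrite normr_gt0.
apply: filterS (nbhs0_lt h) => s hs.
have as0 : a + s != 0.
  by rewrite addr_eq0; apply/eqP => E; move: hs; rewrite E normrN ltxx.
by field; rewrite as0 a0.
Qed.

End Csf.

(** * Removability of a singular corner *)

Section Corner.
Context {R : realType}.
Implicit Types (v w : R -> R -> R) (z t a b c m s tau : R).

Definition strip c m : set (R * R) := [set p | c <= p.1 <= m /\ 0 < p.2].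

Lemma strip_bounded c m s tau v : 0 < s -> cont_on (strip c m) (fun p => v p.1 p.2) ->
  exists2 B, 0 <= B & forall z t, c <= z -> z <= m -> s <= t -> t <= tau -> v z t <= B.
Proof.
move=> s0 cv; pose K : set (R * R) := [set p | c <= p.1 <= m /\ s <= p.2 <= tau].
have [[p0 Kp0]|K0] := pselect (K !=set0); last first.
  by exists 0 => // z t *; exfalso; apply: K0; exists (z, t); split; apply/andP.
have cK : cont_on K (fun p : R * R => v p.1 p.2).
  by apply: cont_on_sub cv => q [q1 /andP[q2 _]]; split => //; exact: lt_le_trans q2.
have [p Kp hp] := compact_max K _ (rect_compact c m s tau) (ex_intro _ p0 Kp0) cK.
exists `|v p.1 p.2| => // z t z1 z2 t1 t2; apply: le_trans (ler_norm _).
by apply: (hp (z, t)); split; apply/andP.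
Qed.

(** However steep the hyperbola [dl ^+ 2 / x] becomes, it moves with speed at most [2 / dl]: the
    denominator grows as the fourth power of [1 / x], the second derivative only as the third. *)
Lemma pole_curvature (dl x : R) : 0 < dl -> 0 < x ->
  2 * dl ^+ 2 / x ^+ 3 / (1 + (dl ^+ 2 / x ^+ 2) ^+ 2) <= 2 / dl.
Proof.
move=> d0 x0; have xn : x != 0 by rewrite gt_eqF.
have x4 : 0 < x ^+ 4 + dl ^+ 4 by rewrite addr_gt0 // exprn_gt0.
have -> : 2 * dl ^+ 2 / x ^+ 3 / (1 + (dl ^+ 2 / x ^+ 2) ^+ 2) = 2 * dl ^+ 2 * x / (x ^+ 4 + dl ^+ 4).
  by field; rewrite xn gt_eqF //= gt_eqF.
rewrite ler_pdivrMr // [leRHS]mulrAC ler_pdivlMr //.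
have -> : 2 * dl ^+ 2 * x * dl = 2 * (dl ^+ 3 * x) by ring.
rewrite ler_pM2l //.
have [h|h] := leP x dl.
  by apply: (@le_trans _ _ (dl ^+ 4)); [rewrite [leRHS]exprSr ler_pM2l // exprn_gt0|rewrite lerDr exprn_ge0 // ltW].
apply: (@le_trans _ _ (x ^+ 4)); last by rewrite lerDl exprn_ge0 // ltW.
by rewrite [leRHS]exprSr ler_pM2r // lerXn2r ?nnegrE ?ltW.
Qed.

Lemma csf_super_pole (dl c z t : R) : 0 < dl -> c < z ->
  csf_super (fun z t => 2 * t / dl + dl ^+ 2 / (z - c)) z t.
Proof.
move=> d0 cz; have x0 : 0 < z - c by rewrite subr_gt0.
have xn : z - c != 0 by rewrite gt_eqF.
have dn : dl != 0 by rewrite gt_eqF.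
set x := z - c in x0 xn *.
exists (- (dl ^+ 2 / x ^+ 2)), (2 * dl ^+ 2 / x ^+ 3), (2 / dl); split.
- apply: (jet1_ext _ _ _ (jet1_poly (2 * t / dl + dl ^+ 2 / x) (2 / dl) 0)) => // s.
  by rewrite /= -/x; field; rewrite xn dn.
- apply: (jet2_ext _ _ _ _ (jet2D (jet2_cst (2 * t / dl)) (jet2Z (dl ^+ 2) (jet2_inv x xn)))) => [s|||].
  + by rewrite /x addrAC.
  + by [].
  + by rewrite add0r mulrN.
  + by rewrite add0r; field.
- rewrite sqrrN; exact: pole_curvature.
Qed.

(** Early smallness is uniform on every [[c', m]] with [c' > c], but not up to [c], and no bound on
    [v] near the corner [(c, 0)] is included. *)
Definition corner_data c m tau v := [/\ c < m,
  cont_on (strip c m) (fun p => v p.1 p.2),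
  forall z t, c < z -> z < m -> 0 < t -> csf_sol v z t,
  (forall t, 0 < t -> t <= tau -> v c t <= 0) /\ (forall t, 0 < t -> t <= tau -> v m t <= 0) &
  forall c', c < c' -> c' <= m -> exists2 s, 0 < s &
    forall z t, c' <= z -> z <= m -> 0 < t -> t <= s -> v z t <= 0].

(** The pole is first placed at some [c' > c]. To the right of it [v <= 0] up to some time [s], and
    from then on [v] is bounded, so the pole dominates near [c']. Then [c'] tends to [c]. *)
Lemma corner_pole c m tau v : corner_data c m tau v ->
  forall dl z t, 0 < dl -> c < z -> z <= m -> 0 < t -> t <= tau ->
    v z t <= 2 * t / dl + dl ^+ 2 / (z - c).
Proof.
move=> [cm cv hv [b1 b2] h0] dl z t d0 cz zm t0 tt.
have dn : dl != 0 by rewrite gt_eqF.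
have key c' : c < c' -> c' < z -> v z t <= 2 * t / dl + dl ^+ 2 / (z - c').
  move=> cc' cz'; have [s s0 hs] := h0 c' cc' (ltW (lt_le_trans cz' zm)).
  have W0 z' t' : c' < z' -> 0 < t' -> 0 <= 2 * t' / dl + dl ^+ 2 / (z' - c').
    move=> q1 q2; rewrite addr_ge0 // divr_ge0 ?sqr_ge0 ?subr_ge0 ?(ltW d0) ?(ltW q1) // mulr_ge0 // ltW //.
  have [ts|st] := leP t s.
    by apply: le_trans (W0 z t cz' t0); apply: hs => //; exact: ltW.
  have [B B0 hB] := strip_bounded c m s t v s0 cv.
  have B10 : 0 < B + 1 by rewrite ltr_wpDl.
  pose eta := Num.min (z - c') (dl ^+ 2 / (B + 1)).
  have eta0 : 0 < eta by rewrite lt_min subr_gt0 cz' divr_gt0 // exprn_gt0.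
  have eta1 : eta <= z - c' by rewrite ge_min lexx.
  have eta2 : eta * (B + 1) <= dl ^+ 2 by rewrite -ler_pdivlMr // ge_min lexx orbT.
  have cc : c <= c' + eta by move: cc' eta0; clear -R; lra.
  pose w z t := 2 * t / dl + dl ^+ 2 / (z - c').
  apply: (@csf_max_rect R (c' + eta) m s t v w) => //.
  - apply: cont_on_sub cv => p [/andP[q1 q2] /andP[q3 q4]]; split; last exact: lt_le_trans q3.
    by apply/andP; split => //; exact: le_trans q1.
  - have pos (p : R * R) : [set p : R * R | c' + eta <= p.1 <= m /\ s <= p.2 <= t] p -> p.1 - c' != 0.
      by move=> [/andP[q1 _] _]; rewrite gt_eqF //; move: q1 eta0; clear -R; lra.
    apply: cont_onD.
      apply: cont_onM; last exact: cont_on_cst.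
      apply: cont_onM; first exact: cont_on_cst.
      by apply: continuous_cont_on => p; exact: cvg_snd.
    apply: cont_onM; first exact: cont_on_cst.
    apply: cont_onV => //.
    apply: cont_onB; last exact: cont_on_cst.
    by apply: continuous_cont_on => p; exact: cvg_fst.
  - move=> z' t' q1 q2 q3 q4; apply: hv => //; last exact: lt_trans q3.
    exact: le_lt_trans cc q1.
  - move=> z' t' q1 _ _ _; apply: csf_super_pole => //; move: q1 eta0; clear -R; lra.
  - move=> t' q1 q2; apply: (@le_trans _ _ B).
      by apply: hB => //; move: eta1 zm; clear -R; lra.
    have hB2 : B <= dl ^+ 2 / eta.
      rewrite ler_pdivlMr // mulrC; apply: le_trans eta2; rewrite ler_pM2l //; clear -R; lra.
    apply: (le_trans hB2); rewrite /w; have -> : c' + eta - c' = eta by ring.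
    by rewrite lerDr divr_ge0 ?(ltW d0) // mulr_ge0 // (le_trans (ltW s0)).
  - move=> t' q1 q2; have q0 : 0 < t' by apply: lt_le_trans q1.
    apply: (@le_trans _ _ 0); first by apply: b2 => //; exact: le_trans tt.
    by apply: W0 => //; exact: lt_le_trans zm.
  - move=> z' q1 q2; have q0 : c' < z' by move: q1 eta0; clear -R; lra.
    apply: (@le_trans _ _ 0); last exact: W0.
    by apply: hs => //; exact: ltW.
  - by move: eta1; clear -R; lra.
  - exact: ltW.
rewrite leNgt; apply/negP => hlt.
set g := v z t - 2 * t / dl.
have x0 : 0 < z - c by rewrite subr_gt0.
have hg : dl ^+ 2 / (z - c) < g by rewrite /g; move: hlt; clear -R; lra.
have g0 : 0 < g by apply: lt_trans hg; rewrite divr_gt0 // exprn_gt0.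
have hg2 : dl ^+ 2 / g < z - c by rewrite ltr_pdivrMr // mulrC -ltr_pdivrMr.
have dg : 0 < dl ^+ 2 / g by rewrite divr_gt0 // exprn_gt0.
(* A strict violation for the pole at [c] persists for a pole slightly to the right of [c]; this
   [c'] is half the admissible shift. *)
pose c' := (c + (z - dl ^+ 2 / g)) / 2.
have h1 : c < c' by rewrite /c'; move: hg2; clear -R; lra.
have h2 : c' < z by rewrite /c'; move: cz dg; clear -R; lra.
have h3 : dl ^+ 2 / g < z - c' by rewrite /c'; move: hg2; clear -R; lra.
have := key c' h1 h2; rewrite leNgt => /negP; apply.
have : dl ^+ 2 / (z - c') < g by rewrite ltr_pdivrMr ?subr_gt0 // mulrC -ltr_pdivrMr.
by rewrite /g; clear -R; lra.
Qed.

End Corner.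

Section Corner.
Context {R : realType}.
Implicit Types (v w : R -> R -> R) (z t a b c m s tau sg th : R).

(** A concave cap over the corner: at its centre it comes down from infinity at time [sg ^+ 2] to
    the height [64 * sg] at time [2 * sg ^+ 2]. *)
Definition dome c sg z t : R :=
  64 * sg ^+ 3 / (t - sg ^+ 2) - 128 * sg ^+ 3 * (z - c) ^+ 2 / (t - sg ^+ 2) ^+ 2.

(* On the strip [x <= th ^+ 2 / (256 * sg ^+ 3)] the slope of the dome is at most [1], which
   halves its curvature; the width is also what makes [corner_pole] bound [v] by half
   the height of the dome at the edge. *)
Lemma csf_super_dome c sg z t : 0 < sg -> sg ^+ 2 < t -> 0 <= z - c ->
  256 * sg ^+ 3 * (z - c) <= (t - sg ^+ 2) ^+ 2 -> csf_super (dome c sg) z t.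
Proof.
move=> s0 st x0 hx; set x := z - c in x0 hx *; set th := t - sg ^+ 2 in hx *.
have th0 : 0 < th by rewrite subr_gt0.
have thn : th != 0 by rewrite gt_eqF.
pose q := sg ^+ 3; have q0 : 0 < q by rewrite exprn_gt0.
rewrite -/q in hx.
have ji := @jet1_inv R (fun s => th + 1 * s + 0 * s ^+ 2) th 1 thn (jet1_poly th 1 0).
have j1 := jet1B (jet1Z (64 * q) ji) (jet1Z (128 * q * x ^+ 2) (jet1M ji ji)).
exists (- (256 * q * x / th ^+ 2)), (- (256 * q / th ^+ 2)), (- (64 * q / th ^+ 2) + 256 * q * x ^+ 2 / th ^+ 3).
split.
- apply: (jet1_ext _ _ _ j1) => [s||].
  + rewrite /dome /= -/x -/q; have -> : t + s - sg ^+ 2 = th + 1 * s + 0 * s ^+ 2 by rewrite /th; ring.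
    by rewrite -exprVn expr2; ring.
  + by rewrite /dome -/x -/q -/th; field.
  + by field.
- apply: (jet2_ext _ _ _ _ (jet2_poly (64 * q / th - 128 * q * x ^+ 2 / th ^+ 2)
     (- (256 * q * x / th ^+ 2)) (- (128 * q / th ^+ 2)))) => [s|||].
  + rewrite /dome /= -/q -/th; have -> : z + s - c = x + s by rewrite /x; ring.
    by field.
  + by rewrite /dome -/x -/q -/th.
  + by [].
  + by field.
- set X := (- (256 * q * x / th ^+ 2)) ^+ 2.
  have X1 : X <= 1.
    have h : `|256 * q * x / th ^+ 2| <= 1.
      rewrite ger0_norm; last exact: (divr_ge0 (mulr_ge0 (mulr_ge0 (ler0n R 256) (ltW q0)) x0) (sqr_ge0 th)).
      by rewrite ler_pdivrMr ?exprn_gt0 // mul1r.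
    rewrite /X sqrrN -real_normK ?num_real // expr2 -[leRHS]mulr1; exact: ler_pM.
  have X0 : 0 <= X by exact: sqr_ge0.
  have p1 : 0 < 1 + X by rewrite ltr_pwDl.
  have hq : 0 < q / th ^+ 2 by rewrite divr_gt0 ?exprn_gt0.
  have hx3 : 0 <= 256 * q * x ^+ 2 / th ^+ 3.
    exact: (divr_ge0 (mulr_ge0 (mulr_ge0 (ler0n R 256) (ltW q0)) (sqr_ge0 x)) (exprn_ge0 3 (ltW th0))).
  rewrite ler_pdivrMr //; set Y := 256 * q * x ^+ 2 / _ in hx3 *.
  have hY : 0 <= Y * (1 + X) by rewrite mulr_ge0 // ltW.
  have hqX : 0 <= q / th ^+ 2 * (1 - X) by rewrite mulr_ge0 ?(ltW hq) // subr_ge0.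
  have -> : - (256 * q / th ^+ 2) = - 256 * (q / th ^+ 2) by rewrite -mulrA; ring.
  have -> : - (64 * q / th ^+ 2) = - 64 * (q / th ^+ 2) by rewrite -mulrA; ring.
  move: hY hqX hq; set Q := q / th ^+ 2; clear -R; lra.
Qed.

(** Away from the corner the pole with [dl = sg] gives [4 sg + 256 sg]; close to it the dome gives
    [64 sg]. The bound does not involve the size of [v]. *)
Lemma corner_sup c m tau v sg : corner_data c m tau v -> 0 < sg -> 2 * sg ^+ 2 <= tau ->
  sg <= m - c -> forall z, c <= z -> z <= m -> v z (2 * sg ^+ 2) <= 260 * sg.
Proof.
move=> hc s0 st sm z cz zm; have [cm cv hv [b1 b2] h0] := hc.
have sn : sg != 0 by rewrite gt_eqF.
have sg20 : 0 < sg ^+ 2 by rewrite exprn_gt0.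
have tt0 : 0 < 2 * sg ^+ 2 by rewrite mulr_gt0.
have [hx|hx] := leP (256 * sg ^+ 3 * (z - c)) (sg ^+ 4); last first.
  have xs : sg < 256 * (z - c).
    have : sg ^+ 3 * sg < sg ^+ 3 * (256 * (z - c)) by move: hx; clear -R; lra.
    by rewrite ltr_pM2l // exprn_gt0.
  have x0 : 0 < z - c by move: xs s0; clear -R; lra.
  have cz' : c < z by rewrite -subr_gt0.
  apply: (le_trans (corner_pole c m tau v hc sg z (2 * sg ^+ 2) s0 cz' zm tt0 st)).
  have -> : 2 * (2 * sg ^+ 2) / sg = 4 * sg by field.
  have : sg ^+ 2 / (z - c) <= 256 * sg.
    rewrite ler_pdivrMr //; have -> : 256 * sg * (z - c) = sg * (256 * (z - c)) by ring.
    by rewrite expr2 ler_pM2l // ltW.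
  by clear -R; lra.
pose q := sg ^+ 3; have q0 : 0 < q by rewrite exprn_gt0.
have [B B0 hB] := strip_bounded c m (sg ^+ 2) (2 * sg ^+ 2) v sg20 cv.
have B10 : 0 < B + 1 by rewrite ltr_wpDl.
(* The comparison starts at [sg ^+ 2 + eta], when the dome is still higher than the bound [B] of
   [v]. *)
pose eta := Num.min (sg ^+ 2) (32 * q / (B + 1)).
have eta0 : 0 < eta by rewrite lt_min sg20 divr_gt0 // mulr_gt0.
have eta1 : eta <= sg ^+ 2 by rewrite ge_min lexx.
have eta2 : eta * (B + 1) <= 32 * q by rewrite -ler_pdivlMr // ge_min lexx orbT.
pose K0 : set (R * R) := [set p | c <= p.1 <= m /\ sg ^+ 2 + eta <= p.2 <= 2 * sg ^+ 2].
pose gap (p : R * R) := (p.2 - sg ^+ 2) * (p.2 - sg ^+ 2) - 256 * q * (p.1 - c).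
pose K : set (R * R) := [set p | K0 p /\ 0 <= gap p].
have c1 A : cont_on A (fun p : R * R => p.1) by apply: continuous_cont_on => p; exact: cvg_fst.
have c2 A : cont_on A (fun p : R * R => p.2) by apply: continuous_cont_on => p; exact: cvg_snd.
have cth A : cont_on A (fun p : R * R => p.2 - sg ^+ 2) by apply: cont_onB => //; exact: cont_on_cst.
have cx A : cont_on A (fun p : R * R => p.1 - c) by apply: cont_onB => //; exact: cont_on_cst.
have cgap : cont_on K0 gap.
  apply: cont_onB; first exact: cont_onM.
  by apply: cont_onM => //; exact: cont_on_cst.
have cK : compact K by apply: compact_ge => //; exact: rect_compact.
have Kth p : K p -> 0 < p.2 - sg ^+ 2.
  by move=> [[_ /andP[h _]] _]; move: h eta0; clear -R; lra.
have dome_lo z' t' : K (z', t') -> 32 * q / (t' - sg ^+ 2) <= dome c sg z' t'.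
  move=> hK; have th0 := Kth _ hK; have [[/andP[/= q1 q2] /andP[q3 q4]]] := hK.
  rewrite /gap /= /dome -/q; set th := t' - sg ^+ 2 in th0 *; set x := z' - c => hg.
  have x0 : 0 <= x by rewrite subr_ge0.
  have th1 : th <= sg ^+ 2 by rewrite /th; move: q4; clear -R; lra.
  have thq : th ^+ 3 <= q ^+ 2.
    have -> : q ^+ 2 = (sg ^+ 2) ^+ 3 by rewrite /q; ring.
    by rewrite lerXn2r ?nnegrE // ltW.
  have qth : 0 < q / th by rewrite divr_gt0.
  have hx2 : (256 * q * x) ^+ 2 <= th ^+ 4.
    have -> : th ^+ 4 = (th * th) ^+ 2 by ring.
    have x256 : 0 <= 256 * q * x := (mulr_ge0 (mulr_ge0 (ler0n R 256) (ltW q0)) x0).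
    have thh : 0 <= th * th by rewrite mulr_ge0 // ltW.
    by rewrite lerXn2r ?nnegrE //; move: hg; clear -R; lra.
  have h2 : 128 * q * x ^+ 2 / th ^+ 2 <= q / th.
    have thn : th != 0 by rewrite gt_eqF.
    rewrite ler_pdivrMr ?exprn_gt0 //.
    have -> : q / th * th ^+ 2 = q * th by field.
    rewrite -(ler_pM2l q0); rewrite -(ler_pM2l th0).
    have e1 : th * (q * (128 * q * x ^+ 2)) = th * (256 * q * x) ^+ 2 / 512 by field.
    have e2 : th * (q * (q * th)) = th ^+ 2 * q ^+ 2 by ring.
    rewrite e1 e2.
    have h3 : th * (256 * q * x) ^+ 2 <= th * th ^+ 4 by rewrite ler_pM2l.
    have h4 : th * th ^+ 4 <= th ^+ 2 * q ^+ 2.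
      have -> : th * th ^+ 4 = th ^+ 2 * th ^+ 3 by ring.
      by rewrite ler_pM2l // exprn_gt0.
    have h5 : 0 <= th ^+ 2 * q ^+ 2 by rewrite mulr_ge0 ?sqr_ge0.
    by move: h3 h4 h5; clear -R; lra.
  have -> : 64 * q / th = 64 * (q / th) by rewrite mulrA.
  have -> : 32 * q / th = 32 * (q / th) by rewrite mulrA.
  by move: h2 qth; clear -R; lra.
have Kz : K (z, 2 * sg ^+ 2).
  split; first split; [by apply/andP| |].
    by apply/andP; split => //=; move: eta1; clear -R; lra.
  rewrite /gap /= subr_ge0; apply: (le_trans hx); rewrite le_eqVlt; apply/orP; left; apply/eqP; ring.
have hdom : dome c sg z (2 * sg ^+ 2) <= 64 * sg.
  rewrite /dome; have -> : 2 * sg ^+ 2 - sg ^+ 2 = sg ^+ 2 by ring.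
  have -> : 64 * sg ^+ 3 / sg ^+ 2 = 64 * sg by field.
  rewrite gerBl; apply: divr_ge0 (sqr_ge0 _); apply: mulr_ge0 (sqr_ge0 _).
  exact: (mulr_ge0 (ler0n R 128) (exprn_ge0 3 (ltW s0))).
suff : v z (2 * sg ^+ 2) <= dome c sg z (2 * sg ^+ 2).
  by move: hdom s0; clear -R; lra.
apply: (csf_compare K) => //.
- by apply: cont_on_sub cv => p hp; have := Kth _ hp; case: hp => -[q1 _] _ q2; split => //; move: q2 sg20; clear -R; lra.
- apply: cont_onB; apply: cont_onM.
  + exact: cont_on_cst.
  + by apply: cont_onV => // p /Kth h; rewrite gt_eqF.
  + apply: cont_onM; first exact: cont_on_cst.
    by apply: cont_onM.
  + apply: cont_onV; first by move=> p /Kth h; rewrite expf_eq0 /= gt_eqF.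
    exact: cont_onM.
move=> {z cz zm hx Kz hdom} z t hK hlt.
have th0 := Kth _ hK; have dl := dome_lo _ _ hK.
have [[/andP[/= q1 q2] /andP[/= q3 q4]]] := hK; rewrite /gap /= => hg.
rewrite /= in th0; set th := t - sg ^+ 2 in th0 dl hg *; set x := z - c in hg.
have thn : th != 0 by rewrite gt_eqF.
have qth : 0 < 32 * q / th by rewrite divr_gt0 // mulr_gt0.
have t0 : 0 < t by move: th0 sg20; rewrite /th; clear -R; lra.
have tT : t <= tau by apply: le_trans st.
have cz : c < z.
  rewrite lt_neqAle q1 andbT; apply/eqP => E; move: hlt; rewrite ltNge => /negP; apply.
  by rewrite -E in dl *; apply: (@le_trans _ _ 0); [exact: b1|exact: le_trans (ltW qth) dl].
have x0 : 0 < x by rewrite subr_gt0.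
have xn : x != 0 by rewrite gt_eqF.
have ths : th <= sg ^+ 2 by rewrite /th; move: q4; clear -R; lra.
have hg1 : 256 * q * x < th * th.
  rewrite lt_neqAle -subr_ge0 hg andbT; apply/eqP => E.
  (* On the curved edge of the region this [dl] balances the two terms of [corner_pole]: each is at
     most [16 sg^3 / th], together no more than the lower bound of the dome. *)
  have d0 : 0 < th / (4 * sg) by rewrite divr_gt0 // mulr_gt0.
  have := corner_pole c m tau v hc _ z t d0 cz q2 t0 tT; rewrite -/x.
  have -> : (th / (4 * sg)) ^+ 2 / x = 16 * sg.
    have -> : (th / (4 * sg)) ^+ 2 / x = (th * th) / (16 * sg ^+ 2 * x) by field; rewrite sn xn.
    by rewrite -E /q; field; rewrite xn sn.
  have h1 : 2 * t / (th / (4 * sg)) <= 16 * q / th.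
    have -> : 2 * t / (th / (4 * sg)) = 8 * sg * t / th by field; rewrite thn sn.
    rewrite ler_pM2r ?invr_gt0 //.
    have -> : 16 * q = 8 * sg * (2 * sg ^+ 2) by rewrite /q; ring.
    by rewrite ler_pM2l // mulr_gt0.
  have h2 : 16 * sg <= 16 * q / th.
    rewrite ler_pdivlMr //; have -> : 16 * q = 16 * sg * sg ^+ 2 by rewrite /q; ring.
    by rewrite ler_pM2l // mulr_gt0.
  have e1 : 16 * q / th + 16 * q / th = 32 * q / th by field.
  by move: hlt dl h1 h2; rewrite -e1; clear -R; lra.
have st' : sg ^+ 2 + eta < t.
  rewrite lt_neqAle q3 andbT; apply/eqP => E.
  have hvB : v z t <= B by apply: hB => //; rewrite -E lerDl ltW.
  have the : th = eta by rewrite /th -E; ring.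
  have : B <= 32 * q / th.
    rewrite ler_pdivlMr // the mulrC; apply: le_trans eta2.
    by rewrite ler_pM2l // lerDl.
  by move: hvB hlt dl; clear -R; lra.
have zm : z < m.
  have th2 : th * th <= sg ^+ 2 * sg ^+ 2 by apply: ler_pM => //; exact: ltW.
  have : q * (256 * x) < q * sg.
    by have -> : q * sg = sg ^+ 2 * sg ^+ 2 by [rewrite /q; ring]; move: th2 hg1; clear -R; lra.
  rewrite ltr_pM2l // /x => hxx.
  by move: hxx sm cz s0; clear -R; lra.
have [n1 n2] := interior_time c m (sg ^+ 2 + eta) (2 * sg ^+ 2) z t cz zm st' q4.
have gap0 : 0 < th * th - 256 * q * x by rewrite subr_gt0.
have q256 : 0 < 256 * q := mulr_gt0 (ltr0Sn R 255) q0.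
have th2 : 0 < 2 * th := mulr_gt0 (ltr0Sn R 1) th0.
split.
- have h1 : 0 < (th * th - 256 * q * x) / (256 * q) := divr_gt0 gap0 q256.
  have hn : \forall r \near (0 : R), `|r| < (th * th - 256 * q * x) / (256 * q) by exact: nbhs0_lt.
  apply: filterS2 n1 hn => r r1 r2; split; first by case: r1.
  rewrite /gap /=.
  have : r <= (th * th - 256 * q * x) / (256 * q) by apply: le_trans (ler_norm _) (ltW r2).
  rewrite (ler_pdivlMr _ _ q256) -/th /x; clear -R; lra.
- have h1 : 0 < (th * th - 256 * q * x) / (2 * th) := divr_gt0 gap0 th2.
  have hn : \forall r \near (0 : R), `|r| < (th * th - 256 * q * x) / (2 * th) by exact: nbhs0_lt.
  apply: filterS2 n2 hn => r r1 r2 r0; split; first by case: (r1 r0).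
  rewrite /gap /=.
  have : - r <= (th * th - 256 * q * x) / (2 * th) by apply: le_trans (ltW r2); rewrite -normrN ler_norm.
  rewrite (ler_pdivlMr _ _ th2) => h.
  have -> : t + r - sg ^+ 2 = th + r by rewrite /th; ring.
  have := sqr_ge0 r; rewrite -/x; move: h; clear -R; lra.
- exact: hv.
- apply: csf_super_dome => //; rewrite -/x -/th -/q //; last by rewrite subr_ge0 in hg; rewrite expr2.
    by move: th0; rewrite /th subr_gt0.
  exact: ltW.
Qed.

(** At time [2 * sg ^+ 2] the error is at most [260 * sg], whatever happened before. The ordinary
    maximum principle starts there, and [sg] tends to 0. *)
Lemma csf_corner c m tau v : corner_data c m tau v ->
  forall z t, c <= z -> z <= m -> 0 < t -> t <= tau -> v z t <= 0.
Proof.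
move=> hc z t cz zm t0 tt; have [cm cv hv [b1 b2] h0] := hc.
apply/ler_addgt0Pr => eps e0; rewrite add0r.
pose sg := Num.min (Num.min 1 (t / 2)) (Num.min (m - c) (eps / 260)).
have cm0 : 0 < m - c by rewrite subr_gt0.
have eps260 : 0 < eps / 260 := divr_gt0 e0 (ltr0Sn R 259).
have sg0 : 0 < sg by rewrite !lt_min ltr01 cm0 eps260 divr_gt0.
have sg1 : sg <= 1 by rewrite !ge_min lexx.
have sg2 : sg <= t / 2 by rewrite !ge_min lexx orbT.
have sg3 : sg <= m - c by rewrite !ge_min lexx !orbT.
have sg4 : sg <= eps / 260 by rewrite !ge_min lexx !orbT.
have sq : sg ^+ 2 <= sg by rewrite expr2 ler_piMr // ltW.
have st : 2 * sg ^+ 2 <= t by move: sq sg2; clear -R; lra.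
have s20 : 0 < 2 * sg ^+ 2 by rewrite mulr_gt0 // exprn_gt0.
apply: (@csf_max_rect R c m (2 * sg ^+ 2) t v (fun _ _ => eps)) => //.
- by apply: cont_on_sub cv => p [q1 /andP[q2 _]]; split => //; exact: lt_le_trans q2.
- exact: cont_on_cst.
- by move=> z' t' q1 q2 q3 q4; apply: hv => //; exact: lt_trans q3.
- by move=> *; exact: csf_super_cst.
- move=> t' q1 q2; apply: le_trans (ltW e0); apply: b1; [exact: lt_le_trans q1|exact: le_trans tt].
- move=> t' q1 q2; apply: le_trans (ltW e0); apply: b2; [exact: lt_le_trans q1|exact: le_trans tt].
- move=> z' q1 q2.
  apply: (le_trans (corner_sup c m tau v sg hc sg0 (le_trans st tt) sg3 z' q1 q2)).
  by move: sg4; clear -R; lra.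
Qed.

End Corner.

(** * Early times: bad points and Baire category *)

Section Early.
Context {R : realType}.
Implicit Types (v w : R -> R -> R) (z t a b c d m s tau rho : R).

Lemma sol_pos_near v z t : csf_sol v z t -> 0 < v z t ->
  exists2 rho, 0 < rho & forall x, `|x - z| < rho -> 0 < v x t.
Proof.
move=> [a [b [_ j2]]] h; have hc := jet2_cvg0 j2.
have /nbhs_norm0P[rho /= r0 hr] : \forall r \near (0 : R), - v z t < v (z + r) t - v z t.
  by have := @cvgr_gt R R (nbhs (0 : R)) _ _ _ hc; apply; rewrite oppr_lt0.
exists rho => // x xr; have := hr (x - z) xr; rewrite (addrC z) subrK; clear -R; lra.
Qed.

(** A point is bad when the pointwise bound for small times fails to be uniform in any neighbourhood
    of it. *)
Definition good v z : Prop := exists rho s, [/\ 0 < rho, 0 < s &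
  forall x t, `|x - z| < rho -> 0 < t -> t <= s -> v x t <= 0].

Lemma good_compact v a b : (forall z, a <= z -> z <= b -> good v z) ->
  exists2 s, 0 < s & forall z t, a <= z -> z <= b -> 0 < t -> t <= s -> v z t <= 0.
Proof.
move=> hg.
have := (compact_near_coveringP _).1 (itv_compact a b) R (0 : R)^'+
  (fun s x => forall t, 0 < t -> t <= s -> v x t <= 0) _.
have hn : forall x, [set z : R | a <= z <= b] x ->
   \forall x' \near x & s \near (0 : R)^'+, forall t, 0 < t -> t <= s -> v x' t <= 0.
  move=> x /andP[ax xb]; have [rho [s [r0 s0 h]]] := hg x ax xb.
  exists ([set y | `|x - y| < rho], [set s' | s' < s]) => /=.
    split; first by apply/nbhs_normP; exists rho.
    exact: nbhs_right_lt.
  move=> [y s'] /= [xy ss] t t0 ts; apply: h => //; first by rewrite distrC.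
  exact: le_trans (ltW ss).
move=> /(_ _ hn) hs.
have /filter_ex[s [s0 h]] : \forall s \near (0 : R)^'+, 0 < s /\
    [set z : R | a <= z <= b] `<=` (fun x => forall t, 0 < t -> t <= s -> v x t <= 0).
  by apply: filterS2 (nbhs_right_gt 0) hs => s.
by exists s => // z t az zb; apply: h => /=; rewrite az.
Qed.

Lemma corner_data_reflect c m tau v : c < m ->
  cont_on (strip c m) (fun p => v p.1 p.2) ->
  (forall z t, c < z -> z < m -> 0 < t -> csf_sol v z t) ->
  (forall t, 0 < t -> t <= tau -> v c t <= 0) -> (forall t, 0 < t -> t <= tau -> v m t <= 0) ->
  (forall m', c <= m' -> m' < m -> exists2 s, 0 < s &
    forall z t, c <= z -> z <= m' -> 0 < t -> t <= s -> v z t <= 0) ->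
  corner_data (- m) (- c) tau (fun z t => v (- z) t).
Proof.
move=> cm cv hv b1 b2 h0; split.
- by rewrite ltrN2.
- have cr : continuous (fun p : R * R => (- p.1, p.2)).
    apply: continuous_pair2; last exact: continuous_snd.
    by move=> p; apply: cvgN; exact: cvg_fst.
  apply: (cont_on_comp (strip (- m) (- c)) (strip c m) _ (fun p => v p.1 p.2) cr) cv.
  by move=> p [/andP[h1 h2] h3]; split => //=; rewrite lerNr h2 lerNl h1.
- move=> z t h1 h2 t0; rewrite -(opprK z); apply: csf_sol_reflect; apply: hv => //.
    by rewrite ltrNr.
  by rewrite ltrNl.
- by split=> t; rewrite opprK; [exact: b2|exact: b1].
- move=> c' h1 h2; have [|| s s0 hs] := h0 (- c'); [by rewrite lerNr|by rewrite ltrNl|].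
  exists s => // z t h3 h4; apply: hs; first by rewrite lerNr.
  by rewrite lerN2.
Qed.

(** Cutting the gap at its midpoint leaves in each half only one end at which early smallness may
    fail to be uniform, which is the situation of [csf_corner]; the right half is reflected. *)
Lemma gap_bound c d tau v : c < d -> 0 < c ->
  cont_on quadrant (fun p => v p.1 p.2) ->
  (forall z t, 0 < z -> 0 < t -> csf_sol v z t) ->
  (forall z, 0 < z -> exists2 s, 0 < s & forall t, 0 < t -> t <= s -> v z t <= 0) ->
  (forall t, 0 < t -> t <= tau -> v c t <= 0) -> (forall t, 0 < t -> t <= tau -> v d t <= 0) ->
  (forall z, c < z -> z < d -> good v z) ->
  forall z t, c <= z -> z <= d -> 0 < t -> t <= tau -> v z t <= 0.
Proof.
move=> cd c0 cv hv hp b1 b2 hg z t cz zd t0 tt.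
have cvs a b : 0 < a -> cont_on (strip a b) (fun p => v p.1 p.2).
  move=> a0; apply: cont_on_sub cv => p [/andP[h _] h2]; split => //; exact: lt_le_trans h.
pose e := (c + d) / 2.
have ce : c < e by rewrite /e; move: cd; clear -R; lra.
have ed : e < d by rewrite /e; move: cd; clear -R; lra.
have e0 : 0 < e by apply: lt_trans ce.
have [se se0 hse] := hp e e0.
pose tau' := Num.min t se.
have tau0 : 0 < tau' by rewrite lt_min t0.
have tau1 : tau' <= t by rewrite ge_min lexx.
have tau2 : tau' <= se by rewrite ge_min lexx orbT.
have B1 s : 0 < s -> s <= tau' -> v c s <= 0.
  by move=> s0 ss; apply: b1 => //; apply: le_trans tt; exact: le_trans tau1.
have B2 s : 0 < s -> s <= tau' -> v d s <= 0.
  by move=> s0 ss; apply: b2 => //; apply: le_trans tt; exact: le_trans tau1.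
have B3 s : 0 < s -> s <= tau' -> v e s <= 0.
  by move=> s0 ss; apply: hse => //; exact: le_trans tau2.
have left_ x s : c <= x -> x <= e -> 0 < s -> s <= tau' -> v x s <= 0.
  apply: csf_corner; split => //.
  - exact: cvs.
  - by move=> *; apply: hv => //; apply: lt_trans c0 _.
  - move=> c' cc' c'e; apply: good_compact => y h1 h2; apply: hg; first exact: lt_le_trans h1.
    exact: le_lt_trans ed.
have right_ x s : e <= x -> x <= d -> 0 < s -> s <= tau' -> v x s <= 0.
  move=> h1 h2 h3 h4; rewrite -(opprK x).
  apply: (@csf_corner R (- d) (- e) tau' (fun z t => v (- z) t)) => //; last 2 first.
  - by rewrite lerN2.
  - by rewrite lerN2.
  apply: corner_data_reflect => //.
  - exact: cvs.
  - by move=> *; apply: hv => //; apply: lt_trans e0 _.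
  - move=> m' em' m'd; apply: good_compact => y h5 h6; apply: hg; first exact: lt_le_trans h5.
    exact: le_lt_trans m'd.
have [tt'|tt'] := leP t tau'.
  by have [h|h] := leP z e; [exact: left_|apply: right_ => //; exact: ltW].
apply: (@csf_max_rect R c d tau' t v (fun _ _ => 0)) => //.
- by apply: cont_on_sub (cvs c d c0) => p [q1 /andP[q2 _]]; split => //; exact: lt_le_trans q2.
- exact: cont_on_cst.
- by move=> z' t' q1 q2 q3 q4; apply: hv; [exact: lt_trans q1|exact: lt_trans q3].
- by move=> *; exact: csf_super_cst.
- by move=> t' q1 q2; apply: b1; [exact: lt_le_trans q1|exact: le_trans tt].
- by move=> t' q1 q2; apply: b2; [exact: lt_le_trans q1|exact: le_trans tt].
- move=> z' q1 q2; have [h|h] := leP z' e; [exact: left_|apply: right_ => //; exact: ltW].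
Qed.

(* Baire category on the bad set: otherwise nested intervals meeting the bad set would
   shrink to a point at which [v] is positive at arbitrarily small times. *)
Lemma bad_interval v z0 :
  (forall z t, 0 < z -> 0 < t -> csf_sol v z t) ->
  (forall z, 0 < z -> exists2 s, 0 < s & forall t, 0 < t -> t <= s -> v z t <= 0) ->
  0 < z0 -> ~ good v z0 ->
  exists a b tau z, [/\ 0 < tau, a < z < b, 0 < z, ~ good v z &
    forall x t, 0 < x -> a < x -> x < b -> ~ good v x -> 0 < t -> t <= tau -> v x t <= 0].
Proof.
move=> hv hp z00 hz0; apply: contrapT => hA.
pose inv (p : R * R) := [/\ 0 < p.1, p.1 < p.2 & exists z, [/\ p.1 < z, z < p.2 & ~ good v z]].
have step (pk : (R * R) * nat) : exists q, inv pk.1 -> [/\ inv q, pk.1.1 <= q.1, q.2 <= pk.1.2 &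
    exists2 t, 0 < t <= pk.2.+1%:R^-1 & forall x, q.1 <= x -> x <= q.2 -> 0 < v x t].
  case: pk => [[a b] k] /=.
  have [hi|ni] := pselect (inv (a, b)); last by exists (a, b).
  have [/= a0 ab [z [az zb bz]]] := hi.
  have tk : 0 < k.+1%:R^-1 :> R by rewrite invr_gt0.
  have [x [t [x0 ax xb bx [t0 [tt vx]]]]] : exists x t, [/\ 0 < x, a < x, x < b, ~ good v x &
      0 < t /\ t <= k.+1%:R^-1 /\ 0 < v x t].
    apply: contrapT => hn; apply: hA; exists a, b, k.+1%:R^-1, z; split => //.
    - by rewrite az.
    - exact: lt_trans az.
    - move=> x t x0 ax xb bx t0 tt; rewrite leNgt; apply/negP => vx; apply: hn.
      by exists x, t.
  have [rho r0 hr] := sol_pos_near _ _ _ (hv x t x0 t0) vx.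
  pose r := Num.min (rho / 2) (Num.min ((x - a) / 2) ((b - x) / 2)).
  have r00 : 0 < r by rewrite !lt_min !divr_gt0 ?subr_gt0.
  have r1 : r <= rho / 2 by rewrite ge_min lexx.
  have r2 : r <= (x - a) / 2 by rewrite !ge_min lexx orbT.
  have r3 : r <= (b - x) / 2 by rewrite !ge_min lexx !orbT.
  exists (x - r, x + r) => _; split => /=.
  - split => /=; [|by move: r00; clear -R; lra|].
      by move: r2 ax a0; clear -R; lra.
    by exists x; split => //; move: r00; clear -R; lra.
  - by move: r2 ax; clear -R; lra.
  - by move: r3 xb; clear -R; lra.
  - exists t; first by rewrite t0.
    move=> y h1 h2; apply: hr; rewrite ltr_norml; apply/andP; split;
      by move: h1 h2 r1 r0; clear -R; lra.
have [F hF] := choice step.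
pose S := fix S k : R * R := if k is k'.+1 then F (S k', k') else (z0 / 2, 2 * z0).
have Sinv k : inv (S k).
  elim: k => [|k IH]; last by have [] := hF (S k, k) IH.
  split=> /=; [by rewrite divr_gt0|by move: z00; clear -R; lra|].
  by exists z0; split => //; move: z00; clear -R; lra.
have mono k j : (S k).1 <= (S (k + j)%N).1 /\ (S (k + j)%N).2 <= (S k).2.
  elim: j => [|j [h1 h2]]; first by rewrite addn0.
  rewrite addnS; have [_ /= h3 h4 _] := hF (S (k + j)%N, (k + j)%N) (Sinv _).
  by split; [exact: le_trans h3|exact: le_trans h2].
have cross k j : (S k).1 <= (S j).2.
  have [h1 _] := mono k j; have [_ h2] := mono j k; rewrite addnC in h2.
  have [_ h3 _] := Sinv (k + j)%N.
  by apply: (le_trans h1); apply: le_trans h2; exact: ltW.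
pose E := [set (S k).1 | k in setT].
have E0 : E !=set0 by exists (S 0%N).1; exists 0%N.
have hE : has_ubound E by exists (S 0%N).2 => _ [k _ <-].
pose x := sup E.
have x1 k : (S k).1 <= x by apply: ub_le_sup => //; exists k.
have x2 k : x <= (S k).2 by apply: ge_sup => // _ [j _ <-].
have x0 : 0 < x by apply: lt_le_trans (x1 0%N); case: (Sinv 0%N).
have [s s0 hs] := hp x x0.
have [k hk] : exists k, k.+1%:R^-1 <= s.
  exists (Num.truncn s^-1); rewrite invf_ple ?posrE //; apply: ltW; exact: truncnS_gt.
have [_ _ _ [t /andP[t0 tk] ht]] := hF (S k, k) (Sinv k).
have := ht x (x1 k.+1) (x2 k.+1); rewrite ltNge hs //; exact: le_trans hk.
Qed.

(** On the interval provided by [bad_interval] all bad points satisfy [P] for one common time. [P]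
    is a closed condition, so a point violating it lies in a maximal gap whose ends satisfy [P] and
    whose inner points are good; [gap_bound] then yields [P] in the gap as well. Thus the allegedly
    bad [z1] is good. *)
Lemma all_good v : cont_on quadrant (fun p => v p.1 p.2) ->
  (forall z t, 0 < z -> 0 < t -> csf_sol v z t) ->
  (forall z, 0 < z -> exists2 s, 0 < s & forall t, 0 < t -> t <= s -> v z t <= 0) ->
  forall z, 0 < z -> good v z.
Proof.
move=> cv hv hp z0 z00; apply: contrapT => hz0.
have [a [b [tau [z1 [tau0 /andP[az zb] z10 bz hN]]]]] := bad_interval v z0 hv hp z00 hz0.
apply: bz.
pose rho := Num.min (z1 / 2) (Num.min ((z1 - a) / 2) ((b - z1) / 2)).
have r0 : 0 < rho by rewrite !lt_min !divr_gt0 ?subr_gt0.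
have r1 : rho <= z1 / 2 by rewrite ge_min lexx.
have r2 : rho <= (z1 - a) / 2 by rewrite !ge_min lexx orbT.
have r3 : rho <= (b - z1) / 2 by rewrite !ge_min lexx !orbT.
pose e1 := z1 - rho; pose e2 := z1 + rho.
have e10 : 0 < e1 by rewrite /e1; move: r1 z10; clear -R; lra.
have e12 : e1 < e2 by rewrite /e1 /e2; move: r0; clear -R; lra.
have e20 : 0 < e2 by exact: lt_trans e12.
have ae1 : a < e1 by rewrite /e1; move: r2 az; clear -R; lra.
have e2b : e2 < b by rewrite /e2; move: r3 zb; clear -R; lra.
have [s1 s10 hs1] := hp e1 e10; have [s2 s20 hs2] := hp e2 e20.
pose T := Num.min tau (Num.min s1 s2).
have T0 : 0 < T by rewrite !lt_min tau0 s10.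
have T1 : T <= tau by rewrite ge_min lexx.
have T2 : T <= s1 by rewrite !ge_min lexx orbT.
have T3 : T <= s2 by rewrite !ge_min lexx !orbT.
pose P x := forall t, 0 < t -> t <= T -> v x t <= 0.
have Pbad x : e1 <= x -> x <= e2 -> ~ P x -> good v x.
  move=> h1 h2 nP; apply: contrapT => hb; apply: nP => t t0 tT.
  apply: (hN x t) => //; [exact: lt_le_trans h1|exact: lt_le_trans h1|exact: le_lt_trans e2b|exact: le_trans T1].
have Pe1 : P e1 by move=> t t0 tT; apply: hs1 => //; exact: le_trans T2.
have Pe2 : P e2 by move=> t t0 tT; apply: hs2 => //; exact: le_trans T3.
have Popen x : 0 < x -> ~ P x -> exists2 r, 0 < r & forall y, `|y - x| < r -> ~ P y.
  move=> x0 nP; have [t [t0 tT vx]] : exists t, [/\ 0 < t, t <= T & 0 < v x t].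
    apply: contrapT => hn; apply: nP => t t0 tT; rewrite leNgt; apply/negP => vx; apply: hn.
    by exists t.
  have [r rp hr] := sol_pos_near _ _ _ (hv x t x0 t0) vx.
  by exists r => // y hy hPy; have := hr y hy; rewrite ltNge hPy.
exists rho, T; split => // z t hz t0 tT.
have [ez1 ez2] : e1 <= z /\ z <= e2.
  by move: hz; rewrite ltr_norml /e1 /e2 => /andP[]; clear -R; lra.
have [Pz|nPz] := pselect (P z); first exact: Pz.
pose A := [set x | [/\ e1 <= x, x <= z & P x]].
pose B := [set x | [/\ z <= x, x <= e2 & P x]].
have A0 : A !=set0 by exists e1.
have B0 : B !=set0 by exists e2.
have uA : has_ubound A by exists z => x [].
have lB : has_lbound B by exists z => x [].
pose c := sup A; pose d := inf B.
have c1 : e1 <= c by apply: ub_le_sup.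
have c2 : c <= z by apply: ge_sup => // x [].
have d1 : z <= d by apply: lb_le_inf => // x [].
have d2 : d <= e2 by apply: ge_inf.
have Pc : P c.
  apply: contrapT => nP; have [r rp hr] := Popen c (lt_le_trans e10 c1) nP.
  have [x Ax hx] := sup_adherent rp (conj A0 uA).
  have xc : x <= c by apply: ub_le_sup.
  case: Ax => _ _; apply: hr; rewrite ler0_norm ?subr_le0 //.
  by move: hx; rewrite -/c; clear -R; lra.
have Pd : P d.
  apply: contrapT => nP; have [r rp hr] := Popen d (lt_le_trans (lt_le_trans e10 ez1) d1) nP.
  have [x Ax hx] := inf_adherent rp (conj B0 lB).
  have xc : d <= x by apply: ge_inf.
  case: Ax => _ _; apply: hr; rewrite ger0_norm ?subr_ge0 //.
  by move: hx; rewrite -/d; clear -R; lra.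
have cz : c < z by rewrite lt_neqAle c2 andbT; apply/eqP => E; apply: nPz; rewrite -E.
have zd : z < d by rewrite lt_neqAle d1 andbT; apply/eqP => E; apply: nPz; rewrite E.
apply: (gap_bound c d T v) => //; try exact: ltW.
- exact: lt_trans zd.
- exact: lt_le_trans c1.
move=> x cx xd; apply: Pbad.
- by apply: le_trans c1 (ltW cx).
- by apply: le_trans (ltW xd) d2.
move=> Px; have [h|h] := leP x z.
  by move: (cx); rewrite ltNge => /negP; apply; apply: ub_le_sup => //; split => //; exact: le_trans c1 (ltW cx).
by move: (xd); rewrite ltNge => /negP; apply; apply: ge_inf => //; split => //; [exact: ltW|exact: le_trans (ltW xd) d2].
Qed.

End Early.

(** * Uniform limits and nonnegativity of the profile *)

Section Far.
Context {R : realType}.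
Implicit Types (v w phi : R -> R -> R) (z t a b c d m s tau rho r T : R).

(* Localised by the shrinking paraboloid [r ^+ 2 - (z - z1) ^+ 2 - 3 * t], so that no
   information on [v] at infinity is needed. *)
Lemma far_bound v z1 r t : cont_on quadrant (fun p => v p.1 p.2) ->
  (forall z t, 0 < z -> 0 < t -> csf_sol v z t) ->
  (forall z, 0 < z -> good v z) ->
  0 < r -> r < z1 -> 0 < t -> 3 * t < r ^+ 2 -> v z1 t * (r ^+ 2 - 3 * t) <= 3 * r * t.
Proof.
move=> cv hv hg r0 rz t0 tr.
have zr0 : 0 < z1 - r by rewrite subr_gt0.
have [s s0 hs] : exists2 s, 0 < s & forall z t, z1 - r <= z -> z <= z1 + r -> 0 < t -> t <= s -> v z t <= 0.
  by apply: good_compact => z h _; apply: hg; exact: lt_le_trans h.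
have z1r : z1 - r <= z1 <= z1 + r by apply/andP; split; move: r0; clear -R; lra.
have [ts|st] := leP t s.
  apply: (@le_trans _ _ 0); last by rewrite !mulr_ge0 // ltW.
  have /andP[h1 h2] := z1r; have := hs z1 t h1 h2 t0 ts => h.
  by rewrite mulr_le0_ge0 // subr_ge0 ltW.
rewrite leNgt; apply/negP => hlt.
pose K0 : set (R * R) := [set p | z1 - r <= p.1 <= z1 + r /\ s <= p.2 <= t].
pose g (p : R * R) := r ^+ 2 - (p.1 - z1) * (p.1 - z1) - 3 * p.2.
pose K : set (R * R) := [set p | K0 p /\ 0 <= g p].
have c1 A : cont_on A (fun p : R * R => p.1 - z1).
  apply: cont_onB; last exact: cont_on_cst.
  by apply: continuous_cont_on => p; exact: cvg_fst.
have c2 A : cont_on A (fun p : R * R => p.2) by apply: continuous_cont_on => p; exact: cvg_snd.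
have cg A : cont_on A g.
  apply: cont_onB.
    by apply: cont_onB; [exact: cont_on_cst|exact: cont_onM].
  by apply: cont_onM => //; exact: cont_on_cst.
have cK : compact K by apply: compact_ge => //; exact: rect_compact.
pose G (p : R * R) := v p.1 p.2 * g p - 3 * r * p.2.
have cG : cont_on K G.
  apply: cont_onB; last by apply: cont_onM => //; exact: cont_on_cst.
  apply: cont_onM => //.
  by apply: cont_on_sub cv => p [[/andP[q1 _] /andP[q2 _]] _]; split; [exact: lt_le_trans q1|exact: lt_le_trans q2].
have g1 : g (z1, t) = r ^+ 2 - 3 * t by rewrite /g /=; ring.
have Kz : K (z1, t).
  split; last by rewrite g1 subr_ge0 ltW.
  by split => //=; rewrite lexx andbT ltW.
have [[z tau] Kp hp] := compact_max K G cK (ex_intro _ _ Kz) cG.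
have G0 : 0 < G (z, tau).
  by apply: lt_le_trans (hp _ Kz); rewrite /G g1 /= subr_gt0.
have [[/andP[/= q1 q2] /andP[q3 q4]] q5] := Kp.
have ta0 : 0 < tau by apply: lt_le_trans q3.
have z0 : 0 < z by apply: lt_le_trans q1.
have rt0 : 0 < 3 * r * tau by rewrite !mulr_gt0.
set gp := g (z, tau) in q5.
have hvg : 0 < v z tau * gp by move: G0; rewrite /G /= -/gp; move: rt0; clear -R; lra.
have gp0 : 0 < gp.
  by rewrite lt_neqAle q5 andbT; apply/eqP => E; move: hvg; rewrite -E mulr0 ltxx.
have v0 : 0 < v z tau by move: hvg; rewrite pmulr_lgt0.
have st' : s < tau.
  rewrite lt_neqAle q3 andbT; apply/eqP => E; move: v0; rewrite ltNge hs // -?E //.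
pose x := z - z1.
have gpE : gp = r ^+ 2 - x * x - 3 * tau by [].
have xr : `|x| < r.
  have : `|x| ^+ 2 < r ^+ 2 by rewrite real_normK ?num_real // expr2; move: gp0 ta0; rewrite gpE; clear -R; lra.
  by rewrite ltr_sqr ?nnegrE // ltW.
have [a [b [j1 j2]]] := hv z tau z0 ta0.
have jg : jet2 (fun s => g (z + s, tau)) gp (- 2 * x) (-1).
  by apply: (jet2_ext _ _ _ _ (jet2_poly gp (- 2 * x) (-1))) => // s'; rewrite /g /gp /g /= /x; ring.
have jG := jet2B (jet2M j2 jg) (jet2_cst (3 * r * tau)).
have [] := jet2_max jG _.
  have hx : 0 < r - `|x| by rewrite subr_gt0.
  have h1 : \forall s \near (0 : R), `|s| < r - `|x| by exact: nbhs0_lt.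
  have hgn : \forall s \near (0 : R), - gp < g (z + s, tau) - gp.
    by have := @cvgr_gt R R (nbhs (0 : R)) _ _ _ (jet2_cvg0 jg); apply; rewrite oppr_lt0.
  apply: filterS2 h1 hgn => s' h1 h2.
  have hK : K (z + s', tau).
    split; last by move: h2; clear -R; lra.
    split; last by apply/andP.
    have : `|x + s'| <= r by apply: le_trans (ler_normD _ _) _; move: h1; clear -R; lra.
    by rewrite ler_norml /x => /andP[]; move=> h3 h4; apply/andP; split; move: h3 h4 => /=; clear -R; lra.
  by have := hp _ hK; rewrite /G /= -/gp.
rewrite subr0 => E1; rewrite subr0 => E2.
have jt := jet1B (jet1M j1 (jet1_poly gp (-3) 0)) (jet1_poly (3 * r * tau) (3 * r) 0).
have := jet1_left_max jt _.
have hn : \forall s' \near (0 : R), s' <= 0 -> v z (tau + s') * (gp + - 3 * s' + 0 * s' ^+ 2)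
   - (3 * r * tau + 3 * r * s' + 0 * s' ^+ 2) <= v z tau * gp - 3 * r * tau.
  have h : 0 < tau - s by rewrite subr_gt0.
  have h1 : \forall s' \near (0 : R), `|s'| < tau - s by exact: nbhs0_lt.
  apply: filterS h1 => s'; rewrite ltr_norml => /andP[h2 _] h3.
  have gE : g (z, tau + s') = gp + - 3 * s' + 0 * s' ^+ 2 by rewrite gpE /g /= /x; ring.
  have hK : K (z, tau + s').
    split; last by rewrite gE; move: h3 gp0; clear -R; lra.
    by split; apply/andP; split => //=; move: h2 h3 q4; clear -R; lra.
  by have := hp _ hK; rewrite /G gE /= -/gp; clear -R; lra.
move=> /(_ hn) E3.
have p1 : 0 < 1 + a ^+ 2 by rewrite ltr_pwDl // sqr_ge0.
(* The first-order term of the cut-off is absorbed by the denominator through [2 |a| <= 1 + a^2], so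
   no gradient bound is needed. *)
have xa : 4 * x * a <= 2 * r * (1 + a ^+ 2).
  have h1 : 4 * x * a <= 4 * (`|x| * `|a|).
    by rewrite -normrM -mulrA ler_pM2l // ler_norm.
  have h2 : 2 * `|a| <= 1 + a ^+ 2.
    have := sqr_ge0 (1 - `|a|); rewrite -[a ^+ 2]real_normK ?num_real // sqrrB expr1n; clear -R; lra.
  have h3 : `|x| * (2 * `|a|) <= r * (1 + a ^+ 2) by apply: ler_pM => //; exact: ltW.
  by move: h1 h3; clear -R; lra.
have h4 : b / (1 + a ^+ 2) * gp <= 2 * r + 2 * v z tau.
  rewrite mulrAC ler_pdivrMr //.
  have hva : 0 <= v z tau * a ^+ 2 by rewrite mulr_ge0 ?sqr_ge0 // ltW.
  by move: E2 xa hva; clear -R; lra.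
by move: E3 h4 v0 r0; clear -R; lra.
Qed.

Definition csf_limit_one phi : Prop := [/\
  forall z t, 0 < z -> 0 < t -> csf_sol phi z t,
  cont_on [set p : R * R | 0 <= p.1 /\ 0 < p.2] (fun p => phi p.1 p.2),
  forall t, 0 < t -> phi 0 t = 0 &
  forall z d, 0 < z -> 0 < d -> exists2 s, 0 < s & forall t, 0 < t -> t <= s -> 1 - d <= phi z t].

Lemma csf_limit_defect phi d : csf_limit_one phi -> 0 < d ->
  [/\ cont_on quadrant (fun p : R * R => (1 - d) + - phi p.1 p.2),
     forall z t, 0 < z -> 0 < t -> csf_sol (fun z t => (1 - d) + - phi z t) z t &
     forall z, 0 < z -> good (fun z t => (1 - d) + - phi z t) z].
Proof.
move=> [hs cp _ hp] d0.
have h1 : cont_on quadrant (fun p : R * R => (1 - d) + - phi p.1 p.2).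
  apply: cont_onD; first exact: cont_on_cst.
  by apply: cont_onN; apply: cont_on_sub cp => p [q1 q2]; split => //; exact: ltW.
have h2 z t : 0 < z -> 0 < t -> csf_sol (fun z t => (1 - d) + - phi z t) z t.
  by move=> z0 t0; apply: csf_solD; apply: csf_solN; exact: hs.
split => //; apply: all_good => // z z0; have [s s0 hh] := hp z d z0 d0.
by exists s => // t t0 ts; rewrite subr_le0; exact: hh.
Qed.

Lemma csf_far phi : csf_limit_one phi -> forall d T, 0 < d -> 0 < T -> exists2 Z, 0 < Z &
  forall z t, Z <= z -> 0 < t -> t <= T -> 1 - d <= phi z t.
Proof.
move=> hphi d T d0 T0; have d20 : 0 < d / 2 by rewrite divr_gt0.
have [h1 h2 h3] := csf_limit_defect phi (d / 2) hphi d20.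
(* Large enough that [3 r t <= d / 2 * (r^2 - 3 t)] for all [r >= R0] and [t <= T]. *)
pose R0 := 1 + 3 * T + (6 * T + 3 * T * d) / d.
have q0 : 0 <= (6 * T + 3 * T * d) / d by rewrite divr_ge0 ?(ltW d0) // addr_ge0 // !mulr_ge0 // ltW.
have R00 : 0 < R0 by rewrite /R0; move: T0 q0; clear -R; lra.
exists (2 * R0); first by rewrite mulr_gt0.
move=> z t hz t0 tT; pose r := z / 2.
have rR : R0 <= r by rewrite /r; move: hz; clear -R; lra.
have r0 : 0 < r by apply: lt_le_trans rR.
have rz : r < z by rewrite /r; move: r0; rewrite /r; clear -R; lra.
have r1 : 1 <= r by apply: le_trans rR; rewrite /R0; move: T0 q0; clear -R; lra.
have rr : r <= r ^+ 2 by rewrite expr2 ler_peMr // ltW.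
have tr : 3 * t < r ^+ 2.
  apply: lt_le_trans rr; apply: lt_le_trans rR; rewrite /R0; move: tT q0; clear -R; lra.
have := far_bound _ z r t h1 h2 h3 r0 rz t0 tr.
set V := 1 - d / 2 + - phi z t => hV.
suff : V <= d / 2 by rewrite /V; clear -R; lra.
have gp : 0 < r ^+ 2 - 3 * t by rewrite subr_gt0.
rewrite -(ler_pM2r gp); apply: (le_trans hV).
have hd : (6 * T + 3 * T * d) <= d * r.
  rewrite [leRHS]mulrC -ler_pdivrMr //; apply: le_trans rR; rewrite /R0; move: T0; clear -R; lra.
have h4 : 3 * r * t <= 3 * r * T by rewrite ler_pM2l // mulr_gt0.
have h5 : d * t <= d * T by rewrite ler_pM2l.
have h6 : d * T <= d * T * r by rewrite ler_peMr // ltW // mulr_gt0.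
have h7 : r * (6 * T + 3 * T * d) <= r * (d * r) by rewrite ler_pM2l.
by move: h4 h5 h6 h7; clear -R; lra.
Qed.

(** Large [z] are covered by [csf_far] on the time interval of length 1; what remains is a compact
    interval of good points. *)
Lemma csf_early phi : csf_limit_one phi -> forall d z0, 0 < d -> 0 < z0 -> exists2 t0, 0 < t0 &
  forall z t, z0 <= z -> 0 < t -> t <= t0 -> 1 - d <= phi z t.
Proof.
move=> hphi d z0 d0 z00.
have [Z Z0 hZ] := csf_far phi hphi d 1 d0 ltr01.
have [_ _ h3] := csf_limit_defect phi d hphi d0.
have [s s0 hs] : exists2 s, 0 < s & forall z t, z0 <= z -> z <= Z -> 0 < t -> t <= s ->
    (1 - d) + - phi z t <= 0.
  by apply: (good_compact (fun z t => (1 - d) + - phi z t)) => z h _; apply: h3; exact: lt_le_trans h.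
exists (Num.min 1 s); first by rewrite lt_min ltr01.
move=> z t h t0; rewrite le_min => /andP[t1 ts].
have [hz|hz] := leP z Z; last by apply: hZ => //; exact: ltW.
by have := hs z t h hz t0 ts; rewrite subr_le0.
Qed.

(** [csf_corner] is applied to [- phi], written as the defect for [d = 1]: the corner [(0, 0)] is
    the only singular point, and [csf_far] provides a right edge where [phi] is nonnegative. *)
Lemma csf_ge0 phi : csf_limit_one phi -> forall z t, 0 <= z -> 0 < t -> 0 <= phi z t.
Proof.
move=> hphi z t z0 t0; have [hs cp h0 _] := hphi.
have [Z Z0 hZ] := csf_far phi hphi 1 t ltr01 t0.
have [h1 h2 h3] := csf_limit_defect phi 1 hphi ltr01.
have [zZ|zZ] := leP z Z; last by have := hZ z t (ltW zZ) t0 (lexx _); rewrite subrr.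
suff : (1 - 1) + - phi z t <= 0 by rewrite subrr add0r oppr_le0.
apply: (@csf_corner R 0 Z t (fun z t => (1 - 1) + - phi z t)) => //.
split => //.
- apply: cont_onD; first exact: cont_on_cst.
  by apply: cont_onN; apply: cont_on_sub cp => p [/andP[q1 _] q2].
- by move=> z' t' q1 q2 q3; exact: h2.
- split=> t' q1 q2; first by rewrite h0 // subrr subr0.
  by rewrite subr_le0; exact: hZ.
- move=> c' c0 cZ.
  by apply: (good_compact (fun z t => (1 - 1) + - phi z t)) => z' q1 _; apply: h3; exact: lt_le_trans q1.
Qed.

End Far.

(** * Expansions of the given solution of the curve shortening flow *)

Section Extract.
Context {R : realType}.

Lemma derive_congr {V W : normedModType R} (F : V -> R) (G : W -> R) (x v : V) (y w : W) :
  (forall h : R, F (h *: v + x) = G (h *: w + y)) -> 'D_v F x = 'D_w G y.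
Proof.
move=> h; have E := h 0; rewrite !scale0r !add0r in E.
rewrite /derive; have -> : (fun k : R => k^-1 *: ((F \o shift x) (k *: v) - F x)) =
    (fun k : R => k^-1 *: ((G \o shift y) (k *: w) - G y)); last by [].
by apply/funext => k; rewrite /= h E.
Qed.

Lemma open_quadrant : open (@quadrant R).
Proof.
have -> : @quadrant R = (fst @^-1` [set x | 0 < x]) `&` (snd @^-1` [set x | 0 < x]) by [].
by apply: openI; apply: open_comp; [move=> p _; exact: cvg_fst|exact: open_gt|move=> p _; exact: cvg_snd|exact: open_gt].
Qed.

Lemma csf_solution_jets (phi : R -> R -> R) : csf_from_one phi ->
  exists f1 f2, [/\ forall z t, 0 < z -> 0 < t -> csf_at phi z t (f1 z t) (f2 z t),
    cont_on quadrant (fun p => f1 p.1 p.2) & cont_on quadrant (fun p => f2 p.1 p.2)].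
Proof.
move=> [sm cp hcsf _ _]; pose P (p : R * R) := phi p.1 p.2.
pose e1 : R * R := (1, 0); pose e2 : R * R := (0, 1).
have [d0 h1] := sm 2%N; have [d1 h2] := h1 e1.
pose g1 := 'D_e1 P; pose g2 := 'D_e1 g1.
have [c1 c2] : cont_on quadrant g1 /\ cont_on quadrant g2.
  split=> p hp; apply: cvg_within_filter; last exact: (h2 e1 p hp).
  exact: (differentiable_continuous (d1 p hp)).
exists (fun z t => g1 (z, t)), (fun z t => g2 (z, t)); split; last 2 first.
- by move=> p hp; rewrite -surjective_pairing; have := c1 p hp; apply: cvg_trans; apply: near_eq_cvg; apply: filterE => q; rewrite -surjective_pairing.
- by move=> p hp; rewrite -surjective_pairing; have := c2 p hp; apply: cvg_trans; apply: near_eq_cvg; apply: filterE => q; rewrite -surjective_pairing.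
move=> z t z0 t0; have qzt : quadrant (z, t) by [].
have E1 z' t' : derive1 (phi^~ t') z' = g1 (z', t').
  rewrite derive1E; apply: derive_congr => h.
  by rewrite /P /= scaler0 add0r.
have E2 : derive1n 2 (phi^~ t) z = g2 (z, t).
  rewrite derive1nS derive1n1 derive1E.
  have -> : (derive1 (phi^~ t)) = (fun z => g1 (z, t)) by apply/funext => z'; exact: E1.
  apply: derive_congr => h; congr g1.
  by apply/pair_equal_spec; split => //=; rewrite scaler0 add0r.
have Et : derive1 (phi z) t = 'D_e2 P (z, t).
  rewrite derive1E; apply: derive_congr => h.
  by rewrite /P /= scaler0 add0r.
have hc := hcsf z t z0 t0; rewrite E1 E2 Et in hc.
split.
- have := jet1_derive (derivableP (diff_derivable (d0 _ qzt))) => j.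
  rewrite -hc; refine (jet1_ext _ _ _ (j e2) _ erefl erefl) => s.
  by rewrite /P /= scaler0 addr0 /GRing.scale /= mulr1.
- have hd : \forall q \near ((z, t) : R * R), is_derive q e1 P (g1 q).
    have hq : \forall q \near ((z, t) : R * R), quadrant q by exact: (open_quadrant _ qzt).
    by apply: filterS hq => q hq; apply: derivableP; apply: diff_derivable; exact: d0.
  have hd2 : is_derive ((z, t) : R * R) e1 g1 (g2 (z, t)).
    by apply: derivableP; apply: diff_derivable; exact: d1.
  refine (jet2_ext _ _ _ _ (jet2_taylor hd hd2) _ erefl erefl erefl) => s.
  by rewrite /P /= scaler0 addr0 /GRing.scale /= mulr1.
Qed.

End Extract.

(** * Parabolic rescaling by [2 M] *)

Section Scale.
Context {R : realType}.

Lemma csf_from_one_limit (phi : R -> R -> R) : csf_from_one phi -> csf_limit_one phi.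
Proof.
move=> h; have [f1 [f2 [hJ _ _]]] := csf_solution_jets phi h.
have [_ cp _ h0 [h1 _]] := h; split => //.
- by move=> z t z0 t0; exists (f1 z t), (f2 z t); exact: hJ.
- exact/cont_onP.
- move=> z d z0 d0.
  have [rho /= rho0 hr] : \forall t \near (0 : R)^'+, 1 - d < phi z t.
    by have := @cvgr_gt R R ((0 : R)^'+) _ _ _ (h1 z z0); apply; rewrite ltrBlDr ltrDl.
  exists (rho / 2); first by rewrite divr_gt0.
  move=> t t0 tr; apply: ltW; apply: hr => //=.
  by rewrite sub0r normrN gtr0_norm //; move: tr rho0; clear -R; lra.
Qed.

Definition csf_scaled (M : R) (phi : R -> R -> R) z t : R :=
  2 * M * phi (z / (2 * M)) (t / (4 * M ^+ 2)).

Lemma jet1_scale (g : R -> R) (x k a b : R) : jet1 (fun s => g (x + s)) a b ->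
  jet1 (fun s => g (x + s * k)) a (b * k).
Proof.
move=> h; have jl := jet1_poly 0 k (0 : R).
have := @jet1_comp R (fun s => g (x + s)) _ 0 k a b jl.
have hh : jet1 (fun h => g (x + (0 + h))) a b.
  by apply: (jet1_ext _ _ _ h) => // s; rewrite add0r.
move=> /(_ hh) j; apply: (jet1_ext _ _ _ j) => // s; congr g; ring.
Qed.

Lemma jet2_scale (g : R -> R) (x k a b c : R) : jet2 (fun s => g (x + s)) a b c ->
  jet2 (fun s => g (x + s * k)) a (b * k) (c * k ^+ 2).
Proof.
move=> h; have jl := jet2_poly 0 k (0 : R).
have hh : jet2 (fun h => g (x + (0 + h))) a b c.
  by apply: (jet2_ext _ _ _ _ h) => // s; rewrite add0r.
have j := @jet2_comp R (fun s => g (x + s)) _ _ _ _ _ _ _ jl hh.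
apply: (jet2_ext _ _ _ _ j) => [s|||] //; last by ring.
by congr g; ring.
Qed.

(** Heights and lengths are multiplied by [2 M] and times by its square. Slopes are unchanged, which
    is why the quasilinear equation survives. *)
Lemma csf_at_scaled M phi z t a b : 0 < M ->
  csf_at phi (z / (2 * M)) (t / (4 * M ^+ 2)) a b ->
  csf_at (csf_scaled M phi) z t a (b / (2 * M)).
Proof.
move=> M0 [j1 j2]; have Mn : M != 0 by rewrite gt_eqF.
have p1 : 0 < 1 + a ^+ 2 by rewrite ltr_pwDl // sqr_ge0.
split.
- have j := jet1Z (2 * M) (jet1_scale _ _ (4 * M ^+ 2)^-1 _ _ j1).
  apply: (jet1_ext _ _ _ j) => // [s|].
    by rewrite /csf_scaled (mulrDl t s).
  by field; rewrite Mn; apply: lt0r_neq0.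
- have j := jet2Z (2 * M) (jet2_scale (fun z => phi z (t / (4 * M ^+ 2))) _ (2 * M)^-1 _ _ _ j2).
  apply: (jet2_ext _ _ _ _ j) => // [s||].
  + by rewrite /csf_scaled (mulrDl z s).
  + by field.
  + by field.
Qed.

Lemma csf_scaled_ge0 M phi : csf_from_one phi -> 0 < M ->
  forall z t, 0 <= z -> 0 < t -> 0 <= csf_scaled M phi z t.
Proof.
move=> /csf_from_one_limit h M0 z t z0 t0; rewrite mulr_ge0 // ?mulr_ge0 ?(ltW M0) //.
by apply: csf_ge0 => //; [rewrite divr_ge0 // mulr_ge0 // ltW|rewrite divr_gt0 // mulr_gt0 // exprn_gt0].
Qed.

Lemma csf_scaled_barrier M phi : csf_from_one phi -> 0 < M ->
  exists f1 f2, csf_barrier M (csf_scaled M phi) f1 f2.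
Proof.
move=> hphi M0; have [g1 [g2 [hJ c1 c2]]] := csf_solution_jets phi hphi.
have hl := csf_from_one_limit phi hphi; have [_ cp _ _] := hl.
have k0 : 0 < 2 * M by rewrite mulr_gt0.
have k20 : 0 < 4 * M ^+ 2 by rewrite mulr_gt0 // exprn_gt0.
have cs : continuous (fun p : R * R => (p.1 / (2 * M), p.2 / (4 * M ^+ 2))).
  apply: continuous_pair2 => p.
    exact: (@cvgM _ _ (nbhs p) _ fst (fun=> (2 * M)^-1) _ _ cvg_fst (cvg_cst _)).
  exact: (@cvgM _ _ (nbhs p) _ snd (fun=> (4 * M ^+ 2)^-1) _ _ cvg_snd (cvg_cst _)).
have qs p : @quadrant R p -> quadrant (p.1 / (2 * M), p.2 / (4 * M ^+ 2)).
  by move=> [h1 h2]; split; rewrite /= divr_gt0.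
have cc (g : R -> R -> R) : cont_on quadrant (fun p => g p.1 p.2) ->
    cont_on quadrant (fun p => g (p.1 / (2 * M)) (p.2 / (4 * M ^+ 2))).
  by move=> cg; exact: (cont_on_comp _ _ _ _ cs qs cg).
have sc d : 0 < d -> 2 * M * (1 - d / (2 * M)) = 2 * M - d.
  by move=> d0; field; rewrite gt_eqF.
exists (fun z t => g1 (z / (2 * M)) (t / (4 * M ^+ 2))),
       (fun z t => g2 (z / (2 * M)) (t / (4 * M ^+ 2)) / (2 * M)); split.
- by move=> z t z0 t0; apply: csf_at_scaled => //; apply: hJ; rewrite divr_gt0.
- split; first apply: cont_onM; first exact: cont_on_cst.
  + apply: (cc phi); apply: cont_on_sub cp => p [h1 h2]; split => //; exact: ltW.
  + exact: (cc g1).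
  + by apply: cont_onM; [exact: (cc g2)|exact: cont_on_cst].
- move=> d T d0; exists 1 => // z t z0 _ t0 _.
  apply: (@le_trans _ _ 0); first by rewrite oppr_le0 ltW.
  exact: csf_scaled_ge0.
- move=> d z0 d0 z00.
  have [||t0 t00 h] := csf_early phi hl (d / (2 * M)) (z0 / (2 * M)); [by rewrite divr_gt0|by rewrite divr_gt0|].
  exists (t0 * (4 * M ^+ 2)); first by rewrite mulr_gt0.
  move=> z t hz t1 t2; rewrite -sc // ler_pM2l //; apply: h.
  + by rewrite ler_pM2r // invr_gt0.
  + by rewrite divr_gt0.
  + by rewrite ler_pdivrMr.
- move=> d T d0; have [T0|T0] := leP T 0.
    by exists 1 => // z t _ t0 tT; have := lt_le_trans t0 (le_trans tT T0); rewrite ltxx.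
  have [||Z Z0 h] := csf_far phi hl (d / (2 * M)) (T / (4 * M ^+ 2)); [by rewrite divr_gt0|by rewrite divr_gt0|].
  exists (Z * (2 * M)); first by rewrite mulr_gt0.
  move=> z t hz t1 t2; rewrite -sc // ler_pM2l //; apply: h.
  + by rewrite ler_pdivlMr.
  + by rewrite divr_gt0.
  + by rewrite ler_pM2r // invr_gt0.
Qed.

End Scale.

(** * The maximum principle for the mean curvature flow *)

Section Chart.
Context {R : realType} {n : nat}.
Implicit Types (Omega : set 'rV[R]_n) (x p v : 'rV[R]_n) (f : 'rV[R]_n -> R).

Definition hess f x : 'M[R]_n := \matrix_(i, j) partial i (partial j f) x.

Lemma hess_qf f x v : (\forall y \near x, differentiable f y) ->
  (forall u, differentiable ('D_u f) x) -> 'D_v ('D_v f) x = qf (hess f x) v.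
Proof.
move=> df d2f.
have dp i : derivable (partial i f) x v by apply: diff_derivable; exact: d2f.
have -> : 'D_v ('D_v f) x = 'D_v (\sum_(j < n) (v ord0 j \*: partial j f)) x.
  apply: near_eq_derive; apply: filterS df => y dy.
  rewrite derive_grad // fct_sumE /dotp; apply: eq_bigr => j _.
  by rewrite !mxE mulrC.
rewrite derive_sum; last by move=> j; apply: derivableZ.
rewrite /qf exchange_big /=; apply: eq_bigr => j _.
rewrite deriveZ // derive_grad; last exact: d2f.
rewrite /dotp scaler_sumr; apply: eq_bigr => i _; rewrite !mxE /GRing.scale /=; ring.
Qed.

Lemma hess_jet2 f x v : (\forall y \near x, differentiable f y) ->
  (forall u, differentiable ('D_u f) x) ->
  jet2 (fun s => f (x + s *: v)) (f x) (dotp (grad f x) v) (qf (hess f x) v / 2).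
Proof.
move=> df d2f; have := jet2_parabola f x v 0 df d2f.
rewrite hess_qf // derive_grad; last exact: nbhs_singleton df.
move=> j; apply: (jet2_ext _ _ _ _ j) => // [s|]; first by rewrite scaler0 addr0.
rewrite derive_grad; last exact: nbhs_singleton df.
by rewrite dotp0r addr0.
Qed.

Lemma qf_bound (H : 'M[R]_n) (C : R) v : 0 <= C -> (forall i j, `|H i j| <= C) ->
  `|qf H v| <= C * n%:R * dotp v v.
Proof.
move=> C0 hH.
have h1 : `|qf H v| <= \sum_(i < n) \sum_(j < n) C * ((v ord0 i ^+ 2 + v ord0 j ^+ 2) / 2).
  apply: le_trans (ler_norm_sum _ _ _) _; apply: ler_sum => i _.
  apply: le_trans (ler_norm_sum _ _ _) _; apply: ler_sum => j _.
  rewrite normrM; apply: ler_pM => //; rewrite normrM.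
  have := sqr_ge0 (`|v ord0 i| - `|v ord0 j|).
  by rewrite sqrrB !real_normK ?num_real //; clear -R; lra.
apply: (le_trans h1); rewrite le_eqVlt; apply/orP; left; apply/eqP.
transitivity (\sum_(i < n) (C / 2 * (n%:R * v ord0 i ^+ 2) + C / 2 * dotp v v)).
  apply: eq_bigr => i _; rewrite -mulr_sumr -mulr_suml big_split /= sumr_const card_ord -mulr_natl.
  have -> : \sum_(j < n) v ord0 j ^+ 2 = dotp v v by apply: eq_bigr => j _; rewrite expr2.
  by field.
rewrite big_split /= sumr_const card_ord -mulr_natl -!mulr_sumr.
have -> : \sum_(j < n) v ord0 j ^+ 2 = dotp v v by apply: eq_bigr => j _; rewrite expr2.
by field.
Qed.

(* [d] plays the role of the distance to the boundary. *)
Lemma boundary_chart Omega p : open Omega -> C2_boundary Omega -> boundary Omega p ->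
  exists (d : 'rV[R]_n -> R) (N : 'rV[R]_n -> 'rV[R]_n) (H : 'rV[R]_n -> 'M[R]_n) (r c1 c2 C : R),
  [/\ 0 < r, 0 < c1 & 0 <= C] /\ forall x, `|x - p| <= r ->
  [/\ c1 <= dotp (N x) (N x) <= c2,
      forall xi, `|qf (H x) xi| <= C * dotp xi xi,
      forall xi, jet2 (fun s => d (x + s *: xi)) (d x) (dotp (N x) xi) (qf (H x) xi / 2),
      (Omega x <-> 0 < d x) /\ (closure Omega x -> 0 <= d x) &
      {for x, continuous d}].
Proof.
move=> oO hC2 bp; have [rho [U [oU Up C2 g0 hU]]] := hC2 p bp.
pose NN x := dotp (grad rho x) (grad rho x).
have cp i : {for p, continuous (partial i rho)}.
  have [_ h _] := C2_facts _ _ _ oU Up C2.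
  exact: differentiable_continuous (h _).
have NNp : 0 < NN p by exact: dotp_gt0.
have cNN : {for p, continuous NN}.
  have -> : NN = \sum_(i < n) (fun x => partial i rho x * partial i rho x).
    by apply/funext => x; rewrite fct_sumE; apply: eq_bigr => i _; rewrite !mxE.
  have c0 : {for p, continuous (fun _ : 'rV[R]_n => 0 : R)} by apply: (@cst_continuous _ _ (0 : R) p).
  elim/big_ind : _ => [|f g cf cg|i _]; first exact: c0.
    exact: (@cvgD _ _ _ (nbhs p) _ f g _ _ cf cg).
  exact: (@cvgM _ _ (nbhs p) _ _ _ _ _ (cp i) (cp i)).
have nU : \forall x \near p, U x by exact: open_nbhs_nbhs.
have n1 : \forall x \near p, NN p / 2 < NN x.
  by apply: (@cvgr_gt R _ (nbhs p) _ NN _ cNN); move: NNp; clear -R; lra.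
have n2 : \forall x \near p, NN x < NN p + 1.
  by apply: (@cvgr_lt R _ (nbhs p) _ NN _ cNN); rewrite ltrDl.
pose Hp := \sum_(i < n) \sum_(j < n) `|hess rho p i j| + 1.
have Hp0 : 0 <= Hp by rewrite addr_ge0 // sumr_ge0 // => i _; rewrite sumr_ge0.
have n3 : \forall x \near p, forall i j, `|hess rho x i j| <= Hp.
  have hij i j : \forall x \near p, `|hess rho x i j| <= Hp.
    have c : (fun x => `|hess rho x i j|) @ p --> `|hess rho p i j|.
      have -> : (fun x => `|hess rho x i j|) = (fun x => `|partial i (partial j rho) x|).
        by apply/funext => x; rewrite mxE.
      rewrite mxE; apply: (@cvg_norm _ _ _ (nbhs p)).
      have [_ _ h] := C2_facts _ _ _ oU Up C2; exact: (h (delta_mx ord0 j) (delta_mx ord0 i)).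
    have lt : `|hess rho p i j| < Hp.
      rewrite /Hp (bigD1 i) //= (bigD1 j) //= -!addrA ltrDl.
      apply: ltr_wpDl; first exact: sumr_ge0.
      by apply: ltr_wpDl => //; apply: sumr_ge0 => k _; exact: sumr_ge0.
    have h : \forall x \near p, `|hess rho x i j| < Hp by exact: (@cvgr_lt R _ (nbhs p) _ _ _ c Hp lt).
    by apply: filterS h => x; exact: ltW.
  have hi i : \forall x \near p, forall j, `|hess rho x i j| <= Hp by exact: (@filter_forall _ _ _ _ (nbhs_filter p) (hij i)).
  exact: (@filter_forall _ _ _ _ (nbhs_filter p) hi).
have /nbhs_normP[r0 /= r00 hr] : \forall x \near p, [/\ U x, NN p / 2 < NN x, NN x < NN p + 1 &
     forall i j, `|hess rho x i j| <= Hp].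
  by near=> x; split; near: x.
exists (fun x => - rho x), (fun x => - grad rho x), (fun x => - hess rho x), (r0 / 2), (NN p / 2), (NN p + 1), (Hp * n%:R).
split; first by split; rewrite ?divr_gt0 // mulr_ge0.
move=> x xr; have [Ux N1 N2 N3] : [/\ U x, NN p / 2 < NN x, NN x < NN p + 1 &
     forall i j, `|hess rho x i j| <= Hp].
  by apply: hr; rewrite /= distrC; move: xr r00; clear -R; lra.
have [df d2f _] := C2_facts _ _ _ oU Ux C2.
have cd : {for x, continuous (fun x => - rho x)}.
  exact: (@cvgN _ _ _ (nbhs x) _ rho _ (differentiable_continuous (nbhs_singleton df))).
split => //.
- by rewrite dotpNl dotpNr opprK -/(NN x) !ltW.
- by move=> xi; rewrite qfN normrN; exact: qf_bound.
- move=> xi; apply: (jet2_ext _ _ _ _ (jet2N (hess_jet2 rho x xi df d2f))) => //.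
    by rewrite dotpNl.
  by rewrite qfN mulNr.
- split; first by rewrite oppr_gt0; exact: hU.
  move=> cx; rewrite leNgt; apply/negP => dx.
  have hn : \forall y \near x, U y /\ - rho y < 0.
    have nUx : \forall y \near x, U y by exact: open_nbhs_nbhs.
    have hd : \forall y \near x, - rho y < 0 by exact: (@cvgr_lt R _ (nbhs x) _ _ _ cd 0 dx).
    by apply: filterS2 nUx hd => y h1 h2; split.
  have [y [Oy [Uy ry]]] := cx _ hn.
  by have /hU := Oy => /(_ Uy); move: ry; clear -R; lra.
Unshelve. all: by end_near.
Qed.

End Chart.

(** * Comparison with strict supersolutions *)

Section MCF.
Context {R : realType} {n : nat}.
Implicit Types (x y N P : 'rV[R]_n) (v W : 'rV[R]_n -> R -> R).

(** [q] stands for the Hessian of [W] as a quadratic form, kept as a mere function so that sums of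
    forms need no matrix. The strict inequality takes the place of a tilt in time. *)
Definition mcf_super W x t : Prop := exists P q Wt,
  [/\ jet1 (fun r => W x (t + r)) (W x t) Wt,
      forall xi, jet2 (fun s => W (x + s *: xi) t) (W x t) (dotp P xi) (q xi / 2) &
      \sum_(k < n) q (msqv P (delta_mx ord0 k)) < Wt].

Lemma mcf_compare (K : set ('rV[R]_n * R)) v W : compact K ->
  cont_on K (fun p => v p.1 p.2) -> cont_on K (fun p => W p.1 p.2) ->
  (forall x t, K (x, t) -> W x t < v x t ->
    [/\ forall xi, \forall s \near (0 : R), K (x + s *: xi, t),
        \forall r \near (0 : R), r <= 0 -> K (x, t + r),
        exists p H vt, mcf_jet v x t p H vt & mcf_super W x t]) ->
  forall x t, K (x, t) -> v x t <= W x t.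
Proof.
move=> cK cv cW hin x0 t0 K0; rewrite leNgt; apply/negP => hvw.
have [[x t] Kp hp] := compact_max K _ cK (ex_intro _ _ K0) (cont_onB _ _ _ cv cW).
have hx : W x t < v x t.
  by rewrite -subr_gt0; apply: lt_le_trans (hp _ K0); rewrite subr_gt0.
have [n1 n2 [p [H [vt [j1 j2 hvt]]]] [P [q [Wt [i1 i2 hW]]]]] := hin x t Kp hx.
have hs xi : dotp p xi = dotp P xi /\ qf H xi <= q xi.
  have [] := jet2_max (jet2B (j2 xi) (i2 xi)) _.
    by apply: filterS (n1 xi) => s Ks; exact: hp Ks.
  by move=> h1 h2; split; [apply/eqP; rewrite -subr_eq0 h1|move: h2; clear -R; lra].
have pP : p = P.
  by apply/rowP => i; have [h _] := hs (delta_mx ord0 i); rewrite !dotp_eps in h.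
have := jet1_left_max (jet1B j1 i1) _.
have hn : \forall s \near (0 : R), s <= 0 -> v x (t + s) - W x (t + s) <= v x t - W x t.
  by apply: filterS n2 => r Kr r0; exact: hp (Kr r0).
move=> /(_ hn); rewrite hvt -(sum_qf_msq p H) pP.
have : \sum_(k < n) qf H (msqv P (delta_mx ord0 k)) <= \sum_(k < n) q (msqv P (delta_mx ord0 k)).
  by apply: ler_sum => k _; have [_] := hs (msqv P (delta_mx ord0 k)).
by move: hW; clear -R; lra.
Qed.

(** The form [q] splits into a multiple of the identity, a rank-one part along [N] and the curvature
    of the level sets of [d]. Of the last only the size [C] is known, so it is estimated by its
    absolute value; the rank-one part is evaluated exactly. *)
Lemma barrier_super (d : 'rV[R]_n -> R) N H (C L C0 a t ps1 ps2 pst : R) (psi : R -> R -> R) (p x : 'rV[R]_n) :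
  0 <= L -> 0 <= C ->
  (forall xi, `|qf H xi| <= C * dotp xi xi) ->
  (forall xi, jet2 (fun s => d (x + s *: xi)) (d x) (dotp N xi) (qf H xi / 2)) ->
  jet1 (fun r => psi (d x) (t + r)) (psi (d x) t) pst ->
  jet2 (fun h => psi (d x + h) t) (psi (d x) t) ps1 (ps2 / 2) ->
  let P := (2 * L) *: (x - p) + ps1 *: N in
  2 * L * n%:R + ps2 * (dotp N N - dotp N P ^+ 2 / (1 + dotp P P)) + `|ps1| * C * n%:R < C0 + pst ->
  mcf_super (fun x t => a + L * dotp (x - p) (x - p) + C0 * t + psi (d x) t) x t.
Proof.
move=> L0 C00 hC jd jt jz P hlt.
pose q xi := 2 * L * dotp xi xi + ps2 * dotp N xi ^+ 2 + ps1 * qf H xi.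
exists P, q, (C0 + pst); split.
- have j := jet1D (jet1_poly (a + L * dotp (x - p) (x - p) + C0 * t) C0 0) jt.
  by apply: (jet1_ext _ _ _ j) => // s; ring.
- move=> xi.
  have jc := @jet2_comp R (psi^~ t) _ _ _ _ _ _ _ (jd xi) jz.
  have j := jet2D (jet2D (jet2D (jet2_cst a) (jet2Z L (jet2_sqn (x - p) xi 0))) (jet2_cst (C0 * t))) jc.
  apply: (jet2_ext _ _ _ _ j) => [s|||].
  + rewrite scaler0 addr0; have -> : x + s *: xi - p = x - p + s *: xi by rewrite addrAC.
    by [].
  + by [].
  + by rewrite /P !dotpE; ring.
  + by rewrite /q !dotpE; field.
- apply: le_lt_trans hlt.
  apply: (@le_trans _ _ (\sum_(k < n) (2 * L * dotp (msqv P (delta_mx ord0 k)) (msqv P (delta_mx ord0 k))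
     + ps2 * dotp N (msqv P (delta_mx ord0 k)) ^+ 2
     + `|ps1| * C * dotp (msqv P (delta_mx ord0 k)) (msqv P (delta_mx ord0 k))))).
    apply: ler_sum => k _; rewrite lerD2l; set xi := msqv _ _.
    apply: le_trans (ler_norm _) _; rewrite normrM -mulrA; exact: ler_wpM2l.
  rewrite !big_split /= -!mulr_sumr sum_dotp_msq.
  have h := sum_dotp_msq_le P.
  apply: lerD; first by rewrite lerD2r ler_wpM2l // mulr_ge0.
  by rewrite ler_wpM2l // mulr_ge0.
Qed.

Lemma dotp_sub_le (x y : 'rV[R]_n) : dotp (x - y) (x - y) <= 2 * dotp x x + 2 * dotp y y.
Proof.
have := dotp_ge0 (x + y); rewrite !dotpDl !dotpDr !dotpNl !dotpNr (dotpC y x); clear -R; lra.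
Qed.

(** [a] is the value of the coefficient matrix at [N] for a gradient that is a bounded perturbation
    of [ps *: N]. It decays like [1 / (1 + ps^2)], which keeps a pole at bounded speed; for slopes
    at most 1 it is bounded below, which drives a concave barrier down. *)
Lemma slope_algebra N y (L ps Yb c1 c2 : R) : 0 < c1 -> c1 <= dotp N N -> dotp N N <= c2 ->
  dotp y y <= Yb -> let P := (2 * L) *: y + ps *: N in
  let a := dotp N N - dotp N P ^+ 2 / (1 + dotp P P) in
  let E := 1 + 4 * L ^+ 2 * Yb in
  [/\ 0 <= a, a * (Num.min 1 (c1 / 2) * (1 + ps ^+ 2)) <= c2 * E ^+ 2 &
      `|ps| <= 1 -> c1 / (1 + (8 * L ^+ 2 * Yb + 2 * c2)) <= a].
Proof.
move=> c10 N1 N2 hy P a E.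
have yy0 := dotp_ge0 y; have NN0 := dotp_ge0 N; have PP0 := dotp_ge0 P.
have L20 : 0 <= 4 * L ^+ 2 by rewrite mulr_ge0 ?sqr_ge0.
have Ly : 4 * L ^+ 2 * dotp y y <= 4 * L ^+ 2 * Yb by rewrite ler_wpM2l.
have Ly0 : 0 <= 4 * L ^+ 2 * dotp y y by rewrite mulr_ge0.
have p1 := onep_gt0 P.
have c20 : 0 <= c2 by apply: le_trans N2.
have E1 : 1 <= E by rewrite /E; move: Ly Ly0; clear -R; lra.
have E0 : 0 <= E by apply: le_trans E1.
have aE : a * (1 + dotp P P) = dotp N N + (dotp N N * dotp P P - dotp N P ^+ 2).
  by rewrite /a; field; rewrite gt_eqF.
have cs : 0 <= dotp N N * dotp P P - dotp N P ^+ 2 by rewrite subr_ge0 dotp_CS.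
have csE : dotp N N * dotp P P - dotp N P ^+ 2 = 4 * L ^+ 2 * (dotp N N * dotp y y - dotp N y ^+ 2).
  by rewrite /P !dotpE (dotpC y N); ring.
have a0 : 0 <= a.
  by have : 0 <= a * (1 + dotp P P) by [rewrite aE addr_ge0]; rewrite pmulr_lge0.
split => //.
- have psN : ps ^+ 2 * dotp N N <= 2 * dotp P P + 2 * (4 * L ^+ 2 * dotp y y).
    have -> : ps ^+ 2 * dotp N N = dotp (P - (2 * L) *: y) (P - (2 * L) *: y).
      have -> : P - (2 * L) *: y = ps *: N by rewrite /P addrAC subrr add0r.
      by rewrite !dotpE; ring.
    apply: (le_trans (dotp_sub_le _ _)); rewrite dotpZl dotpZr; clear -R; lra.
  have h3 : Num.min 1 (c1 / 2) * (1 + ps ^+ 2) <= E * (1 + dotp P P).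
    apply: (@le_trans _ _ (1 + ps ^+ 2 * dotp N N / 2)).
      rewrite mulrDr mulr1; apply: lerD; first by rewrite ge_min lexx.
      rewrite mulrC -mulrA ler_wpM2l ?sqr_ge0 //.
      by apply: (@le_trans _ _ (c1 / 2)); [rewrite ge_min lexx orbT|rewrite ler_pM2r ?invr_gt0].
    have hEP : dotp P P <= E * dotp P P by rewrite ler_peMl.
    by rewrite mulrDr mulr1; move: hEP psN Ly; rewrite /E; clear -R; lra.
  apply: (@le_trans _ _ (a * (E * (1 + dotp P P)))); first by rewrite ler_wpM2l.
  have -> : a * (E * (1 + dotp P P)) = E * (a * (1 + dotp P P)) by ring.
  have -> : c2 * E ^+ 2 = E * (c2 * E) by ring.
  rewrite ler_wpM2l // aE csE.
  have h4 : 4 * L ^+ 2 * (dotp N N * dotp y y - dotp N y ^+ 2) <= dotp N N * (4 * L ^+ 2 * Yb).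
    apply: (@le_trans _ _ (dotp N N * (4 * L ^+ 2 * dotp y y))); last by rewrite ler_wpM2l.
    have : 0 <= 4 * L ^+ 2 * dotp N y ^+ 2 by rewrite mulr_ge0 ?sqr_ge0.
    clear -R; lra.
  have h5 : dotp N N * E <= c2 * E by rewrite ler_wpM2r.
  by move: h4 h5; rewrite /E; clear -R; lra.
- move=> ps1.
  have ps2 : ps ^+ 2 <= 1.
    by rewrite -real_normK ?num_real // expr2 -[leRHS]mulr1; exact: ler_pM.
  have PPb : dotp P P <= 8 * L ^+ 2 * Yb + 2 * c2.
    have psN : ps ^+ 2 * dotp N N <= c2.
      by apply: le_trans N2; rewrite ler_piMl.
    have -> : P = (2 * L) *: y - (- ps) *: N by rewrite scaleNr opprK.
    apply: (le_trans (dotp_sub_le _ _)); rewrite !dotpZl !dotpZr.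
    move: psN Ly; clear -R; lra.
  have q1 : 0 < 1 + (8 * L ^+ 2 * Yb + 2 * c2).
    by move: PPb PP0; clear -R; lra.
  rewrite ler_pdivrMr //; apply: (@le_trans _ _ (a * (1 + dotp P P))).
    by rewrite aE; move: cs N1; clear -R; lra.
  by rewrite ler_wpM2l // lerD2l.
Qed.

End MCF.

(** * The pole and the dome near a boundary point *)

Section Super.
Context {R : realType} {n : nat}.
Implicit Types (x y N P p : 'rV[R]_n) (d : 'rV[R]_n -> R).

(* The pole sits on the wall [d = eta + C' * t]: its motion pays for the mean curvature of
   the level sets of [d], which the blow-up of the slope would otherwise amplify. *)
Definition pole_at (A dl eta C' d t : R) : R := A * t / dl + dl ^+ 2 / (d - eta - C' * t).

(** On the layer [0 <= d <= La * t] the parabola has slope at most 1 and second derivative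
    [- 1 / (La * t)]. The resulting speed is of order [1 / t], and its integral is the logarithm. *)
Definition log_dome (m La t1 d t : R) : R := - m * (ln t - ln t1) - d ^+ 2 / (2 * La * t).

Lemma jet1_ln (t : R) : 0 < t -> jet1 (fun r => ln (t + r)) (ln t) t^-1.
Proof.
move=> t0; have := jet1_derive (is_derive1_ln t0) => j.
by apply: (jet1_ext _ _ _ j) => // r; rewrite /GRing.scale /= mulr1.
Qed.

(** [A] combines two facts: the second derivative of the pole is at most [2 / dl] times [1 + ps1^2],
    as in [pole_curvature], and the coefficient in front of it decays at the inverse rate by
    [slope_algebra]. *)
Lemma pole_super d N H (C L Yb c1 c2 a t A dl eta : R) p x :
  0 <= L -> 0 <= C -> 0 < c1 -> c1 <= dotp N N <= c2 ->
  (forall xi, `|qf H xi| <= C * dotp xi xi) ->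
  (forall xi, jet2 (fun s => d (x + s *: xi)) (d x) (dotp N xi) (qf H xi / 2)) ->
  dotp (x - p) (x - p) <= Yb ->
  A = 2 * (c2 * (1 + 4 * L ^+ 2 * Yb) ^+ 2) / Num.min 1 (c1 / 2) ->
  0 < dl -> 0 < d x - eta - C * n%:R * t ->
  mcf_super (fun x t => a + L * dotp (x - p) (x - p) + (2 * L * n%:R + C * n%:R + 1) * t
     + pole_at A dl eta (C * n%:R) (d x) t) x t.
Proof.
move=> L0 C0 c10 /andP[N1 N2] hC jd hY AE dl0; set X := d x - eta - _ => X0.
have Xn : X != 0 by rewrite gt_eqF.
have dn : dl != 0 by rewrite gt_eqF.
have Cn : 0 <= C * n%:R by rewrite mulr_ge0.
pose ps1 := - (dl ^+ 2 / X ^+ 2); pose ps2 := 2 * dl ^+ 2 / X ^+ 3.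
have X2 : 0 < dl ^+ 2 / X ^+ 2 by rewrite divr_gt0 // exprn_gt0.
apply: (barrier_super d N H C L _ a t ps1 ps2 (A / dl + C * n%:R * (dl ^+ 2 / X ^+ 2))) => //.
- have ji := @jet1_inv R (fun s => X + - (C * n%:R) * s + 0 * s ^+ 2) X (- (C * n%:R)) Xn (jet1_poly X _ 0).
  have j := jet1D (jet1_poly (A * t / dl) (A / dl) 0) (jet1Z (dl ^+ 2) ji).
  apply: (jet1_ext _ _ _ j) => // [r|].
    rewrite /pole_at; have -> : d x - eta - C * n%:R * (t + r) = X + - (C * n%:R) * r + 0 * r ^+ 2.
      by rewrite /X; ring.
    by rewrite mulrDr mulrDl; ring.
  by rewrite opprK mulrA; ring.
- have j := jet2D (jet2_cst (A * t / dl)) (jet2Z (dl ^+ 2) (jet2_inv X Xn)).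
  apply: (jet2_ext _ _ _ _ j) => // [h||].
  + rewrite /pole_at; congr (_ + _ / _); rewrite /X; ring.
  + by rewrite /ps1 add0r mulrN.
  + by rewrite /ps2 add0r; field.
- set P := (2 * L) *: (x - p) + ps1 *: N; have [a0 a1 _] := slope_algebra N (x - p) L ps1 Yb c1 c2 c10 N1 N2 hY.
  rewrite -/P in a0 a1; set aa := dotp N N - _ in a0 a1 *.
  have nrm : `|ps1| = dl ^+ 2 / X ^+ 2 by rewrite /ps1 normrN gtr0_norm.
  set c3 := Num.min _ _ in AE a1.
  have c30 : 0 < c3 by rewrite lt_min ltr01 divr_gt0.
  have hp := pole_curvature _ _ dl0 X0.
  have p1 : 0 < 1 + ps1 ^+ 2 by rewrite ltr_pwDl // sqr_ge0.
  have hp' : ps2 <= 2 / dl * (1 + ps1 ^+ 2).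
    by rewrite -ler_pdivrMr // /ps1 sqrrN.
  have ha : ps2 * aa <= A / dl.
    apply: (@le_trans _ _ (2 / dl * (1 + ps1 ^+ 2) * aa)); first by rewrite ler_wpM2r.
    have -> : 2 / dl * (1 + ps1 ^+ 2) * aa = 2 / dl * (aa * (c3 * (1 + ps1 ^+ 2))) / c3.
      by field; rewrite dn gt_eqF.
    have -> : A / dl = 2 / dl * (c2 * (1 + 4 * L ^+ 2 * Yb) ^+ 2) / c3.
      by rewrite AE; field; rewrite dn gt_eqF.
    by rewrite ler_pM2r ?invr_gt0 // ler_pM2l // divr_gt0.
  rewrite nrm; set Q := dl ^+ 2 / X ^+ 2; move: ha Cn; clear -R; lra.
Qed.

Lemma dome_super d N H (C L Yb c1 c2 a t La t1 : R) p x :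
  0 <= L -> 0 <= C -> 0 < c1 -> c1 <= dotp N N <= c2 ->
  (forall xi, `|qf H xi| <= C * dotp xi xi) ->
  (forall xi, jet2 (fun s => d (x + s *: xi)) (d x) (dotp N xi) (qf H xi / 2)) ->
  dotp (x - p) (x - p) <= Yb -> 0 < La -> 0 < t -> 0 <= d x -> d x <= La * t ->
  mcf_super (fun x t => a + L * dotp (x - p) (x - p) + (2 * L * n%:R + C * n%:R + 1) * t
     + log_dome (c1 / (La * (1 + (8 * L ^+ 2 * Yb + 2 * c2)))) La t1 (d x) t) x t.
Proof.
move=> L0 C0 c10 /andP[N1 N2] hC jd hY La0 t0 d0 dt.
have Yb0 : 0 <= Yb by apply: le_trans hY; exact: dotp_ge0.
have c20 : 0 <= c2 by apply: le_trans N2; exact: dotp_ge0.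
set P0 := 8 * L ^+ 2 * Yb + 2 * c2.
have P00 : 0 < 1 + P0 by rewrite ltr_pwDl // addr_ge0 // !mulr_ge0 // sqr_ge0.
set m := c1 / _.
have tn : t != 0 by rewrite gt_eqF.
have Lan : La != 0 by rewrite gt_eqF.
have Lt0 : 0 < La * t by rewrite mulr_gt0.
have Cn : 0 <= C * n%:R by rewrite mulr_ge0.
pose ps1 := - (d x / (La * t)); pose ps2 := - (La * t)^-1.
have nrm : `|ps1| <= 1.
  by rewrite /ps1 normrN ger0_norm ?divr_ge0 ?(ltW Lt0) // ler_pdivrMr // mul1r.
apply: (barrier_super d N H C L _ a t ps1 ps2 (- m / t + d x ^+ 2 / (2 * La * t ^+ 2))) => //.
- have ji := @jet1_inv R (fun s => t + 1 * s + 0 * s ^+ 2) t 1 tn (jet1_poly t _ 0).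
  have j := jet1B (jet1Z (- m) (jet1B (jet1_ln t t0) (jet1_cst (ln t1)))) (jet1Z (d x ^+ 2 / (2 * La)) ji).
  apply: (jet1_ext _ _ _ j) => // [r||].
  + rewrite /log_dome; have -> : t + 1 * r + 0 * r ^+ 2 = t + r by ring.
    by rewrite invfM; ring.
  + by rewrite /log_dome; field; rewrite tn Lan.
  + by field; rewrite tn Lan.
- have j := jet2_poly (log_dome m La t1 (d x) t) ps1 (ps2 / 2).
  apply: (jet2_ext _ _ _ _ j) => // h.
  by rewrite /log_dome /ps1 /ps2; field; rewrite tn Lan.
- set P := (2 * L) *: (x - p) + ps1 *: N; have [a0 _ /(_ nrm) a1] := slope_algebra N (x - p) L ps1 Yb c1 c2 c10 N1 N2 hY.
  rewrite -/P -/P0 in a0 a1; set aa := dotp N N - _ in a0 a1 *.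
  have hm : ps2 * aa <= - m / t.
    rewrite /ps2 mulNr mulNr lerN2.
    have -> : m / t = (La * t)^-1 * (c1 / (1 + P0)).
      by rewrite /m; field; rewrite tn Lan /= gt_eqF.
    by rewrite ler_pM2l ?invr_gt0.
  have hd : 0 <= d x ^+ 2 / (2 * La * t ^+ 2).
    by rewrite divr_ge0 ?sqr_ge0 // mulr_ge0 ?sqr_ge0 // mulr_ge0 // ltW.
  have hn : `|ps1| * C * n%:R <= C * n%:R by rewrite -mulrA ler_piMl.
  by move: hm hd hn; clear -R; lra.
Qed.

End Super.

(** * The bound at the corner of the parabolic boundary *)

Section Corner.
Context {R : realType} {n : nat}.
Implicit Types (x y N P : 'rV[R]_n) (d : 'rV[R]_n -> R) (Omega : set 'rV[R]_n)
  (v W : 'rV[R]_n -> R -> R).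

(** An upper bound for the limit superior at [(x, 0)] through positive times. Being local in [x], it
    becomes uniform on compact sets. *)
Definition early_le Omega v (c : R) (x : 'rV[R]_n) : Prop := forall e, 0 < e ->
  \forall y \near x & t \near (0 : R)^'+, 0 < t -> closure Omega y -> v y t <= c + e.

Lemma early_compact Omega v c (K : set 'rV[R]_n) e : compact K ->
  (forall x, K x -> early_le Omega v c x) -> 0 < e ->
  exists2 s, 0 < s & forall x t, K x -> closure Omega x -> 0 < t -> t <= s -> v x t <= c + e.
Proof.
move=> cK hK e0.
have := (compact_near_coveringP _).1 cK R (0 : R)^'+
  (fun t x => 0 < t -> closure Omega x -> v x t <= c + e) _.
move=> /(_ _ (fun x Kx => hK x Kx e e0)) [s /= s0 hs].
exists (s / 2); first by rewrite divr_gt0.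
move=> x t Kx cx t0 ts; apply: hs => //=.
by rewrite sub0r normrN gtr0_norm //; move: ts s0; clear -R; lra.
Qed.

Lemma cont_on_barrier (K : set ('rV[R]_n * R)) d (psi : R -> R -> R) (a L C0 : R) (p : 'rV[R]_n) :
  cont_on K (fun q => psi (d q.1) q.2) ->
  cont_on K (fun q => a + L * dotp (q.1 - p) (q.1 - p) + C0 * q.2 + psi (d q.1) q.2).
Proof.
move=> h; apply: cont_onD => //; apply: cont_onD; first apply: cont_onD.
- exact: cont_on_cst.
- apply: cont_onM; first exact: cont_on_cst.
  have cB : continuous (fun q : 'rV[R]_n * R => q.1 - p).
    by move=> q; exact: (@cvgB _ _ _ (nbhs q) _ _ _ _ _ (continuous_fst q) (cvg_cst p)).
  by apply: continuous_cont_on; exact: (continuous_dotp _ _ cB cB).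
- apply: cont_onM; first exact: cont_on_cst.
  by apply: continuous_cont_on; exact: continuous_snd.
Qed.

Lemma cont_on_pole (K : set ('rV[R]_n * R)) d A dl eta C' :
  cont_on K (fun q => d q.1) -> (forall q, K q -> d q.1 - eta - C' * q.2 != 0) ->
  cont_on K (fun q => pole_at A dl eta C' (d q.1) q.2).
Proof.
move=> cd h0.
have ct : cont_on K (fun q => q.2) by apply: continuous_cont_on; exact: continuous_snd.
apply: cont_onD.
  by apply: cont_onM; [apply: cont_onM => //; exact: cont_on_cst|exact: cont_on_cst].
apply: cont_onM; first exact: cont_on_cst.
apply: cont_onV => //; apply: cont_onB; first by apply: cont_onB => //; exact: cont_on_cst.
by apply: cont_onM => //; exact: cont_on_cst.
Qed.

Lemma cont_on_dome (K : set ('rV[R]_n * R)) d m La t1 : 0 < La ->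
  cont_on K (fun q => d q.1) -> (forall q, K q -> 0 < q.2) ->
  cont_on K (fun q => log_dome m La t1 (d q.1) q.2).
Proof.
move=> La0 cd h0.
have ct : cont_on K (fun q => q.2) by apply: continuous_cont_on; exact: continuous_snd.
apply: cont_onB; last first.
  apply: cont_onM; first exact: cont_onM.
  apply: cont_onV; last by apply: cont_onM => //; exact: cont_on_cst.
  by move=> q /h0 q0; rewrite gt_eqF // !mulr_gt0.
apply: cont_onM; first exact: cont_on_cst.
apply: cont_onB; last exact: cont_on_cst.
by apply: cont_on_postcomp => // q /h0; exact: continuous_ln.
Qed.

Record corner_setup Omega v (p : 'rV[R]_n) d (N : 'rV[R]_n -> 'rV[R]_n)
  (H : 'rV[R]_n -> 'M[R]_n) (r c1 c2 C L Yb B M e T0 : R) : Prop := CornerSetup {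
  cs_flow : [/\ open Omega, mcf_on Omega v, cont_on (cyl (closure Omega)) (fun q => v q.1 q.2) &
    forall x t, closure Omega x -> ~ Omega x -> 0 < t -> v x t = 0];
  cs_signs : [/\ 0 < r, 0 < c1, 0 <= C & 0 <= L] /\ [/\ 0 <= M, 0 <= B & 0 < e];
  cs_chart : forall x, `|x - p| <= r ->
  [/\ c1 <= dotp (N x) (N x) <= c2,
      forall xi, `|qf (H x) xi| <= C * dotp xi xi,
      forall xi, jet2 (fun s => d (x + s *: xi)) (d x) (dotp (N x) xi) (qf (H x) xi / 2),
      (Omega x <-> 0 < d x) /\ (closure Omega x -> 0 <= d x) &
      {for x, continuous d}];
  cs_bound : forall x t, closure Omega x -> `|x - p| <= r -> 0 < t -> t <= T0 -> v x t <= B;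
  cs_early : forall x, Omega x -> early_le Omega v M x;
  cs_consts : L * r ^+ 2 = B /\ Yb = n%:R * r ^+ 2 }.

(** With [L * r ^+ 2 = B] it exceeds [a + B] on the lateral boundary of the ball, where only the
    local bound [B] is known. The coefficient of [t] pays for the Hessian of the quadratic term and,
    for slopes in [d] at most 1, for the curvature of the level sets, with 1 to spare. *)
Definition cbase (p : 'rV[R]_n) (L C a : R) x t : R :=
  a + L * dotp (x - p) (x - p) + (2 * L * n%:R + C * n%:R + 1) * t.

Definition cball (p : 'rV[R]_n) (r : R) : set 'rV[R]_n := [set x | `|x - p| <= r].

Lemma cball_Yb {Omega v} {p : 'rV[R]_n} {d} {N : 'rV[R]_n -> 'rV[R]_n} {H} {r c1 c2 C L Yb B M e T0 : R}
  (hc : corner_setup Omega v p d N H r c1 c2 C L Yb B M e T0) x :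
  cball p r x -> dotp (x - p) (x - p) <= Yb.
Proof.
have [[oO hv cv v0] [[r0 c10 C0 L0] [M0 B0 e0]] hd hB hearly [hL hYb]] := hc.
move=> xr; apply: le_trans (dotp_le_norm _) _; rewrite hYb ler_wpM2l //.
by rewrite lerXn2r ?nnegrE // ltW.
Qed.

Lemma lateral {Omega v} {p : 'rV[R]_n} {d} {N : 'rV[R]_n -> 'rV[R]_n} {H} {r c1 c2 C L Yb B M e T0 : R}
  (hc : corner_setup Omega v p d N H r c1 c2 C L Yb B M e T0) a x t :
  r <= `|x - p| -> 0 <= t -> a + B <= cbase p L C a x t.
Proof.
have [[oO hv cv v0] [[r0 c10 C0 L0] [M0 B0 e0]] hd hB hearly [hL hYb]] := hc.
move=> xr t0; rewrite /cbase -addrA lerD2l; apply: (@le_trans _ _ (L * dotp (x - p) (x - p))).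
  rewrite -hL ler_wpM2l // -enorm_sqr lerXn2r ?nnegrE ?enorm_ge0 ?(ltW r0) //.
  exact: le_trans (norm_le_enorm _).
by rewrite lerDl mulr_ge0 // !addr_ge0 // !mulr_ge0.
Qed.

Lemma base_ge {Omega v} {p : 'rV[R]_n} {d} {N : 'rV[R]_n -> 'rV[R]_n} {H} {r c1 c2 C L Yb B M e T0 : R}
  (hc : corner_setup Omega v p d N H r c1 c2 C L Yb B M e T0) a x t :
  0 <= t -> a <= cbase p L C a x t.
Proof.
have [[oO hv cv v0] [[r0 c10 C0 L0] [M0 B0 e0]] hd hB hearly [hL hYb]] := hc.
move=> t0; rewrite /cbase -addrA lerDl addr_ge0 // !mulr_ge0 // ?dotp_ge0 //.
by rewrite !addr_ge0 // !mulr_ge0.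
Qed.

Lemma cont_d {Omega v} {p : 'rV[R]_n} {d} {N : 'rV[R]_n -> 'rV[R]_n} {H} {r c1 c2 C L Yb B M e T0 : R}
  (hc : corner_setup Omega v p d N H r c1 c2 C L Yb B M e T0) (K : set ('rV[R]_n * R)) :
  (forall q, K q -> cball p r q.1) -> cont_on K (fun q => d q.1).
Proof.
have [[oO hv cv v0] [[r0 c10 C0 L0] [M0 B0 e0]] hd hB hearly [hL hYb]] := hc.
move=> hK q /hK bq; have [_ _ _ _ cd] := hd _ bq.
apply: cvg_within_filter.
exact: (continuous_comp (@continuous_fst _ _ q) cd).
Qed.

Lemma near_inner {Omega v} {p : 'rV[R]_n} {d} {N : 'rV[R]_n -> 'rV[R]_n} {H} {r c1 c2 C L Yb B M e T0 : R}
  (hc : corner_setup Omega v p d N H r c1 c2 C L Yb B M e T0) x :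
  Omega x -> `|x - p| < r -> forall xi : 'rV[R]_n, \forall s \near (0 : R),
  closure Omega (x + s *: xi) /\ cball p r (x + s *: xi).
Proof.
have [[oO hv cv v0] [[r0 c10 C0 L0] [M0 B0 e0]] hd hB hearly [hL hYb]] := hc.
move=> Ox xr xi.
have h1 := near_curve Omega x xi 0 oO Ox.
have ob : open [set x | `|x - p| < r].
  have -> : [set x : 'rV[R]_n | `|x - p| < r] = ball p r.
    by rewrite -ball_normE; apply/seteqP; split => y /=; rewrite distrC.
  exact: ball_open.
have h2 := near_curve [set x | `|x - p| < r] x xi 0 ob xr.
apply: filterS2 h1 h2 => s; rewrite scaler0 addr0 => q1 q2.
by split; [exact: subset_closure|exact: ltW].
Qed.

(** The wall starts at distance [eta] inside [Omega], where compactness makes the early bound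
    [M + e] uniform up to some time [s]. From then on [v <= B] is enough, because the pole exceeds
    [B] close to the wall. *)
Lemma pole_stage {Omega v} {p : 'rV[R]_n} {d} {N : 'rV[R]_n -> 'rV[R]_n} {H} {r c1 c2 C L Yb B M e T0 : R}
  (hc : corner_setup Omega v p d N H r c1 c2 C L Yb B M e T0) A dl eta t :

  A = 2 * (c2 * (1 + 4 * L ^+ 2 * Yb) ^+ 2) / Num.min 1 (c1 / 2) ->
  0 < dl -> 0 < eta -> 0 < t -> t <= T0 ->
  forall x, closure Omega x -> cball p r x -> 0 < d x - eta - C * n%:R * t ->
    v x t <= cbase p L C (M + e) x t + pole_at A dl eta (C * n%:R) (d x) t.
Proof.
have [[oO hv cv v0] [[r0 c10 C0 L0] [M0 B0 e0]] hd hB hearly [hL hYb]] := hc.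
move=> AE dl0 eta0 t0 tT x cx bx hx.
pose K00 : set 'rV[R]_n := [set x : 'rV[R]_n | `|x - p| <= r] `&` closure Omega.
have cK00 : compact K00.
  rewrite /K00 setIC; exact: (compact_closedIl _ _ (rV_ball_compact p r) (@closed_closure _ _)).
have cd0 : cont_on K00 d.
  move=> y [by_ _]; have [_ _ _ _ cd] := hd _ by_; exact: cvg_within_filter cd.
have Cn : 0 <= C * n%:R by rewrite mulr_ge0.
have [s s0 hs] : exists2 s, 0 < s & forall x t, [set x | K00 x /\ eta <= d x] x -> closure Omega x ->
    0 < t -> t <= s -> v x t <= M + e.
  apply: early_compact => //; first exact: compact_ge.
  move=> y [[by_ _] dy]; apply: hearly; have [_ _ _ [h _] _] := hd _ by_.
  by apply/h; apply: lt_le_trans dy.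
have c20 : 0 <= c2 by have [/andP[_ h] _ _ _ _] := hd _ bx; apply: le_trans h; exact: dotp_ge0.
have A0 : 0 <= A.
  rewrite AE divr_ge0 //; first by rewrite mulr_ge0 // mulr_ge0 // sqr_ge0.
  by rewrite le_min ler01 divr_ge0 // ltW.
have pole_ge y t' : 0 < t' -> 0 < d y - eta - C * n%:R * t' -> 0 <= pole_at A dl eta (C * n%:R) (d y) t'.
  by move=> q0 q1; rewrite /pole_at addr_ge0 // divr_ge0 ?sqr_ge0 ?(ltW q1) ?(ltW dl0) // mulr_ge0 // ltW.
have [ts|st] := leP t s.
  apply: (@le_trans _ _ (M + e)).
    apply: hs => //; split => //; move: hx; have : 0 <= C * n%:R * t by rewrite mulr_ge0 // ltW.
    clear -R; lra.
  by rewrite -[leLHS]addr0 lerD // ?pole_ge //; apply: (base_ge hc); exact: ltW.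
pose eta' := Num.min (d x - eta - C * n%:R * t) (dl ^+ 2 / (B + 1)).
have B10 : 0 < B + 1 by rewrite ltr_wpDl.
have e'0 : 0 < eta' by rewrite lt_min hx divr_gt0 // exprn_gt0.
have e'1 : eta' <= d x - eta - C * n%:R * t by rewrite ge_min lexx.
have e'2 : eta' * (B + 1) <= dl ^+ 2 by rewrite -ler_pdivlMr // ge_min lexx orbT.
clearbody eta'.
pose K0 : set ('rV[R]_n * R) := [set q | K00 q.1 /\ s <= q.2 <= t].
have cK0 : compact K0.
  have := compact_setX cK00 (itv_compact s t); congr compact.
pose K : set ('rV[R]_n * R) := [set q | K0 q /\ eta' <= d q.1 - eta - C * n%:R * q.2].
have cK : compact K.
  apply: compact_ge => //; apply: cont_onB; first apply: cont_onB.
  - by apply: (cont_d hc) => q [[]].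
  - exact: cont_on_cst.
  - apply: cont_onM; first exact: cont_on_cst.
    by apply: continuous_cont_on; exact: continuous_snd.
pose W := fun x t => cbase p L C (M + e) x t + pole_at A dl eta (C * n%:R) (d x) t.
apply: (mcf_compare K v W) => //.
- apply: cont_on_sub cv => q [[[_ q1] /andP[q2 _]] _]; split => //; exact: lt_le_trans q2.
- apply: cont_on_barrier; apply: cont_on_pole; first by apply: (cont_d hc) => q [[[]]].
  by move=> q [_ q1]; rewrite gt_eqF //; exact: lt_le_trans q1.
- clear x cx bx hx e'1;move=> x t' [[[/= bx cx] /andP[st' tt']] hx] hlt.
  have t'0 : 0 < t' by apply: lt_le_trans st'.
  have X0 : 0 < d x - eta - C * n%:R * t' by apply: lt_le_trans hx.
  have pg := pole_ge x t' t'0 X0.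
  have vB : v x t' <= B by apply: hB => //; exact: le_trans tT.
  have Ct0 : 0 <= C * n%:R * t' by rewrite mulr_ge0 // ltW.
  have [N1 hC jd [hO _] _] := hd _ bx.
  have Ox : Omega x by apply/hO; move: X0 Ct0 eta0; clear -R; lra.
  have xr : `|x - p| < r.
    rewrite lt_neqAle bx andbT; apply/eqP => E.
    have rx : r <= `|x - p| by rewrite E.
    have := lateral hc (M + e) x t' rx (ltW t'0).
    by move: hlt pg vB M0 e0; rewrite /W; clear -R; lra.
  have st1 : s < t'.
    rewrite lt_neqAle st' andbT; apply/eqP => E.
    have : v x t' <= M + e.
      apply: hs => //; last by rewrite -E.
      by split => //; move: X0 Ct0; clear -R; lra.
    by have := base_ge hc (M + e) x t' (ltW t'0); move: hlt pg; rewrite /W; clear -R; lra.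
  have hx1 : eta' < d x - eta - C * n%:R * t'.
    rewrite lt_neqAle hx andbT; apply/eqP => E.
    have : B <= pole_at A dl eta (C * n%:R) (d x) t'.
      rewrite /pole_at -E; apply: (@le_trans _ _ (dl ^+ 2 / eta')).
        rewrite ler_pdivlMr // mulrC; apply: le_trans e'2; rewrite ler_pM2l //; clear -R; lra.
      by rewrite lerDr divr_ge0 ?(ltW dl0) // mulr_ge0 // ltW.
    by have := base_ge hc (M + e) x t' (ltW t'0); move: hlt vB M0 e0; rewrite /W; clear -R; lra.
  split.
  + move=> xi; have h1 := near_inner hc x Ox xr xi.
    have lo : eta' + eta + C * n%:R * t' - d x < 0 by move: hx1; clear -R; lra.
    have h2 : \forall s \near (0 : R), eta' + eta + C * n%:R * t' - d x < d (x + s *: xi) - d x.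
      exact: (@cvgr_gt R R (nbhs (0 : R)) _ _ _ (jet2_cvg0 (jd xi)) _ lo).
    apply: filterS2 h1 h2 => k [k1 k2] k3; split; last by move: k3 => /=; clear -R; lra.
    by split => //; apply/andP.
  + have h1 : 0 < t' - s by rewrite subr_gt0.
    have h2 : \forall k \near (0 : R), `|k| < t' - s by exact: nbhs0_lt.
    apply: filterS h2 => k; rewrite ltr_norml => /andP[k1 k2] k0; split.
      by split => //; apply/andP; split => /=; move: k1 k0 tt'; clear -R; lra.
    have : C * n%:R * k <= 0 by rewrite mulr_ge0_le0.
    by move: hx => /=; rewrite mulrDr; clear -R; lra.
  + exact: hv.
  + by apply: (pole_super d (N x) (H x) C L Yb c1 c2) => //; exact: (cball_Yb hc).
split; last by [].
by split => //; apply/andP; split => /=; [exact: ltW|].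
Qed.

End Corner.

Section Corner.
Context {R : realType} {n : nat}.
Implicit Types (x y : 'rV[R]_n) (d : 'rV[R]_n -> R) (Omega : set 'rV[R]_n)
  (v W : 'rV[R]_n -> R -> R).

Lemma cbaseD (p : 'rV[R]_n) (L C a b : R) x t : cbase p L C (a + b) x t = cbase p L C a x t + b.
Proof. by rewrite /cbase; ring. Qed.

(* [pole_stage] with [eta = t1] bounds [v] on the edge [d = La * s] of the layer for all
   [s >= t1], and the height [B] of the dome is lost between [t1] and [t]. *)
Lemma dome_stage {Omega v} {p : 'rV[R]_n} {d} {N : 'rV[R]_n -> 'rV[R]_n} {H}
  {r c1 c2 C L Yb B M e T0 : R}
  (hc : corner_setup Omega v p d N H r c1 c2 C L Yb B M e T0) A dl La m t t1 :
  A = 2 * (c2 * (1 + 4 * L ^+ 2 * Yb) ^+ 2) / Num.min 1 (c1 / 2) ->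
  La = C * n%:R + 2 -> m = c1 / (La * (1 + (8 * L ^+ 2 * Yb + 2 * c2))) ->
  0 < m -> 0 <= A -> 0 < dl -> 0 < t -> t <= T0 -> 0 < t1 -> t1 <= t ->
  m * (ln t - ln t1) = B -> A * t / dl + dl ^+ 2 / t1 + La * t / 2 <= e ->
  forall x, closure Omega x -> cball p r x -> v x t <= cbase p L C (M + 2 * e) x t.
Proof.
have [[oO hv cv v0] [[r0 c10 C0 L0] [M0 B0 e0]] hd hB hearly [hL hYb]] := hc.
move=> AE LaE mE m0 A0 dl0 t0 tT t10 t1t hln hedge x cx bx.
have Cn : 0 <= C * n%:R by rewrite mulr_ge0.
have La0 : 0 < La by rewrite LaE ltr_wpDl.
have Adl : 0 <= A / dl by rewrite divr_ge0 // ltW.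
have edge y s : closure Omega y -> cball p r y -> t1 <= s -> s <= t -> La * s <= d y ->
    v y s <= cbase p L C (M + e) y s + (A * t / dl + dl ^+ 2 / t1).
  move=> cy by_ t1s st hdy.
  have s0 : 0 < s by apply: lt_le_trans t1s.
  have X1 : t1 <= d y - t1 - C * n%:R * s.
    by move: hdy t1s; rewrite LaE mulrDl; clear -R; lra.
  have X0 : 0 < d y - t1 - C * n%:R * s by apply: lt_le_trans X1.
  apply: (le_trans (pole_stage hc A dl t1 s AE dl0 t10 s0 (le_trans st tT) y cy by_ X0)).
  rewrite lerD2l /pole_at; apply: lerD.
    by rewrite ler_pM2r ?invr_gt0 // ler_wpM2l.
  by rewrite ler_wpM2l ?sqr_ge0 // lef_pV2.
have h0 : 0 <= A * t / dl by rewrite mulr_ge0 ?invr_ge0 ?(ltW dl0) // mulr_ge0 // ltW.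
have h1 : 0 <= dl ^+ 2 / t1 by rewrite divr_ge0 ?sqr_ge0 // ltW.
have h2 : 0 <= La * t / 2 by rewrite divr_ge0 // mulr_ge0 // ltW.
have [hx|hx] := leP (La * t) (d x).
  apply: (le_trans (edge x t cx bx t1t (lexx _) hx)).
  have -> : M + 2 * e = (M + e) + e by ring.
  by rewrite (cbaseD p L C (M + e) e) lerD2l; move: hedge h2; clear -R; lra.
pose K0 : set ('rV[R]_n * R) := [set q | ([set x : 'rV[R]_n | `|x - p| <= r] `&` closure Omega) q.1 /\ t1 <= q.2 <= t].
have cK00 : compact ([set x : 'rV[R]_n | `|x - p| <= r] `&` closure Omega).
  by rewrite setIC; exact: (compact_closedIl _ _ (rV_ball_compact p r) (@closed_closure _ _)).
have cK0 : compact K0.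
  have := compact_setX cK00 (itv_compact t1 t); congr compact.
pose K : set ('rV[R]_n * R) := [set q | K0 q /\ 0 <= La * q.2 - d q.1].
have cK : compact K.
  apply: compact_ge => //; apply: cont_onB; last by apply: (cont_d hc) => q [[]].
  apply: cont_onM; first exact: cont_on_cst.
  by apply: continuous_cont_on; exact: continuous_snd.
pose W := fun x t => cbase p L C (M + 2 * e + B) x t + log_dome m La t1 (d x) t.
have hend : W x t <= cbase p L C (M + 2 * e) x t.
  rewrite /W cbaseD -addrA gerDl /log_dome mulNr hln.
  have : 0 <= d x ^+ 2 / (2 * La * t) by rewrite divr_ge0 ?sqr_ge0 // !mulr_ge0 // ltW.
  by clear -R; lra.
apply: le_trans hend.
apply: (mcf_compare K v W) => //.
- by apply: cont_on_sub cv => q [[[_ q1] /andP[q2 _]] _]; split => //; exact: lt_le_trans q2.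
- apply: cont_on_barrier; apply: cont_on_dome => //; first by apply: (cont_d hc) => q [[[]]].
  by move=> q [[_ /andP[q1 _]] _]; exact: lt_le_trans q1.
- clear x cx bx hx; move=> x s [[[/= bx cx] /andP[t1s st]] hx] hlt.
  have s0 : 0 < s by apply: lt_le_trans t1s.
  have vB : v x s <= B by apply: hB => //; exact: le_trans tT.
  have [N1 hC jd [hO hO2] _] := hd _ bx.
  have dx0 := hO2 cx.
  have dx1 : d x <= La * s by rewrite -subr_ge0.
  have Ls0 : 0 < La * s by rewrite mulr_gt0.
  have dd : d x ^+ 2 / (2 * La * s) <= La * t / 2.
    apply: (@le_trans _ _ (La * s / 2)); last by rewrite ler_pM2r ?invr_gt0 // ler_pM2l.
    have -> : La * s / 2 = (La * s) ^+ 2 / (2 * La * s) by field; rewrite !gt_eqF.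
    rewrite ler_pM2r ?invr_gt0 ?mulr_gt0 //.
    by rewrite lerXn2r ?nnegrE // ltW.
  have lns : m * (ln s - ln t1) <= B.
    by rewrite -hln ler_pM2l // lerD2r ler_ln ?posrE.
  have lo : cbase p L C (M + 2 * e) x s - La * t / 2 <= W x s.
    by rewrite /W (cbaseD p L C (M + 2 * e) B) /log_dome mulNr; move: dd lns; clear -R; lra.
  have bg := base_ge hc (M + 2 * e) x s (ltW s0).
  have hL2 : La * t / 2 <= e by move: hedge h0 h1; clear -R; lra.
  have Ox : Omega x.
    apply: contrapT => nOx; move: hlt; rewrite v0 //; move: lo bg hL2 e0 M0; clear -R; lra.
  have xr : `|x - p| < r.
    rewrite lt_neqAle bx andbT; apply/eqP => E.
    have rx : r <= `|x - p| by rewrite E.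
    have := lateral hc (M + 2 * e) x s rx (ltW s0).
    by move: hlt lo hL2 vB M0 e0; clear -R; lra.
  have ts1 : t1 < s.
    rewrite lt_neqAle t1s andbT; apply/eqP => E.
    have : M + 2 * e + B - La * t / 2 <= W x s.
      have := base_ge hc (M + 2 * e + B) x s (ltW s0).
      have hz : m * (ln s - ln t1) = 0 by rewrite E subrr mulr0.
      by rewrite /W /log_dome mulNr hz; move: dd; clear -R; lra.
    by move: hlt hL2 vB M0 e0; clear -R; lra.
  have hx1 : d x < La * s.
    rewrite lt_neqAle dx1 andbT; apply/eqP => E.
    have Lsd : La * s <= d x by rewrite E.
    have := edge x s cx bx t1s st Lsd.
    have -> : M + e = M + 2 * e - e by ring.
    by rewrite (cbaseD p L C (M + 2 * e) (- e)); move: hlt lo hedge; clear -R; lra.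
  split.
  + move=> xi; have q1 := near_inner hc x Ox xr xi.
    have lo' : 0 < La * s - d x by rewrite subr_gt0.
    have q2 : \forall k \near (0 : R), d (x + k *: xi) - d x < La * s - d x.
      exact: (@cvgr_lt R R (nbhs (0 : R)) _ _ _ (jet2_cvg0 (jd xi)) _ lo').
    apply: filterS2 q1 q2 => k [k1 k2] k3; split; last by move: k3 => /=; clear -R; lra.
    by split => //; apply/andP.
  + have q1 : 0 < Num.min (s - t1) ((La * s - d x) / La).
      by rewrite lt_min subr_gt0 ts1 divr_gt0 // subr_gt0.
    have q2 : \forall k \near (0 : R), `|k| < Num.min (s - t1) ((La * s - d x) / La) by exact: nbhs0_lt.
    apply: filterS q2 => k; rewrite lt_min => /andP[].
    rewrite ltr_norml => /andP[k1 _] k2 k0; split.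
      by split => //; apply/andP; split => /=; move: k1 k0 st; clear -R; lra.
    move: k2; rewrite ltr_norml => /andP[k2 _].
    have : - k * La <= La * s - d x by rewrite -ler_pdivlMr //; move: k2; clear -R; lra.
    by rewrite /=; clear -R; lra.
  + exact: hv.
  + rewrite /W mE; apply: (dome_super d (N x) (H x) C L Yb c1 c2) => //; exact: (cball_Yb hc).
split; last by rewrite subr_ge0 ltW.
by split => //; apply/andP; split => //=; exact: ltW.
Qed.

Lemma corner_bound Omega v p (M B r1 : R) : open Omega -> C2_boundary Omega -> mcf_on Omega v ->
  cont_on (cyl (closure Omega)) (fun q => v q.1 q.2) ->
  (forall x t, closure Omega x -> ~ Omega x -> 0 < t -> v x t = 0) ->
  0 <= M -> 0 <= B -> 0 < r1 -> boundary Omega p ->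
  (forall x t, closure Omega x -> `|x - p| <= r1 -> 0 < t -> t <= r1 -> v x t <= B) ->
  (forall x, Omega x -> early_le Omega v M x) -> early_le Omega v M p.
Proof.
move=> oO hC2 hv cv v0 M0 B0 r10 bp hB hearly e0 e00.
have [d [N [H [r2 [c1 [c2 [C [[r20 c10 C0] hd]]]]]]]] := boundary_chart Omega p oO hC2 bp.
pose e := e0 / 4; have ep : 0 < e by rewrite divr_gt0.
pose r := Num.min r1 r2.
have r0 : 0 < r by rewrite lt_min r10.
have rr1 : r <= r1 by rewrite ge_min lexx.
have rr2 : r <= r2 by rewrite ge_min lexx orbT.
pose L := B / r ^+ 2; pose Yb := n%:R * r ^+ 2.
have L0 : 0 <= L by rewrite divr_ge0 // sqr_ge0.
have Yb0 : 0 <= Yb by rewrite mulr_ge0 // sqr_ge0.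
have hc : corner_setup Omega v p d N H r c1 c2 C L Yb B M e r1.
  split => //.
  - by move=> x xr; apply: hd; exact: le_trans rr2.
  - by move=> x t cx xr; apply: hB => //; exact: le_trans rr1.
  - by split => //; rewrite /L divfK // gt_eqF // exprn_gt0.
have c20 : 0 <= c2.
  have [|/andP[h1 h2] _ _ _ _] := hd p; first by rewrite subrr normr0 ltW.
  by apply: le_trans h2; apply: le_trans h1; exact: ltW.
pose A := 2 * (c2 * (1 + 4 * L ^+ 2 * Yb) ^+ 2) / Num.min 1 (c1 / 2).
have A0 : 0 <= A.
  rewrite divr_ge0 //; first by rewrite mulr_ge0 // mulr_ge0 // sqr_ge0.
  by rewrite le_min ler01 divr_ge0 // ltW.
pose La := C * n%:R + 2.
have La0 : 0 < La by rewrite ltr_wpDl // mulr_ge0.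
pose m := c1 / (La * (1 + (8 * L ^+ 2 * Yb + 2 * c2))).
have m0 : 0 < m.
  have q0 : 0 <= 8 * L ^+ 2 * Yb + 2 * c2.
    apply: addr_ge0; last exact: mulr_ge0.
    by apply: mulr_ge0 => //; apply: mulr_ge0 => //; exact: sqr_ge0.
  by rewrite divr_gt0 // mulr_gt0 // ltr_pwDl.
(* With [t1 = t * ka] the dome descends by exactly [m * ln (1 / ka) = B] between [t1] and [t]; the
   ratio of the two times does not depend on [t]. *)
pose ka := expR (- (B / m)).
have ka0 : 0 < ka by exact: expR_gt0.
have ka1 : ka <= 1 by rewrite -expR0 ler_expR oppr_le0 divr_ge0 // ltW.
(* The pole is used with [dl = a * t]. Then [A * t / dl = A / a] is at most [e / 3] for this [a],
   while [dl ^+ 2 / t1] and [La * t / 2] are linear in [t] and small once [t <= T1]. *)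
pose a := 3 * A / e + 1.
have a0 : 0 < a by rewrite ltr_wpDl // divr_ge0 ?(ltW ep) // mulr_ge0.
have hAa : A / a <= e / 3.
  rewrite ler_pdivrMr // /a; have -> : e / 3 * (3 * A / e + 1) = A + e / 3 by field; rewrite gt_eqF.
  by rewrite lerDl divr_ge0 // ltW.
pose T1 := Num.min (Num.min r1 (e * ka / (3 * a ^+ 2))) (2 * e / (3 * La)).
have T10 : 0 < T1.
  by rewrite !lt_min r10 !divr_gt0 // ?mulr_gt0 // exprn_gt0.
have key (t : R) (x : 'rV[R]_n) : 0 < t -> t <= T1 -> closure Omega x -> `|x - p| <= r ->
    v x t <= cbase p L C (M + 2 * e) x t.
  move=> t0 tT1 cx xr; move: tT1; rewrite !le_min -andbA => /and3P[t1 t2 t3].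
  have tn : t != 0 by rewrite gt_eqF.
  have an : a != 0 by rewrite gt_eqF.
  have kn : ka != 0 by rewrite gt_eqF.
  apply: (dome_stage hc A (a * t) La m t (t * ka)) => //.
  - exact: mulr_gt0.
  - exact: mulr_gt0.
  - by rewrite ler_piMr // ltW.
  - rewrite lnM ?posrE // /ka expRK; field; rewrite gt_eqF //.
  - have -> : A * t / (a * t) = A / a by field; rewrite tn an.
    have -> : (a * t) ^+ 2 / (t * ka) = t * (a ^+ 2 / ka) by field; rewrite tn kn.
    have h1 : t * (a ^+ 2 / ka) <= e / 3.
      apply: (@le_trans _ _ (e * ka / (3 * a ^+ 2) * (a ^+ 2 / ka))).
        by rewrite ler_pM2r // divr_gt0 // exprn_gt0.
      rewrite le_eqVlt; apply/orP; left; apply/eqP; field; by rewrite an kn.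
    have h2 : La * t / 2 <= e / 3.
      apply: (@le_trans _ _ (La * (2 * e / (3 * La)) / 2)); first by rewrite ler_pM2r ?invr_gt0 // ler_pM2l.
      rewrite le_eqVlt; apply/orP; left; apply/eqP; field; by rewrite gt_eqF.
    by move: hAa h1 h2; clear -R; lra.
pose C1 := 2 * L * n%:R + C * n%:R + 1.
have C10 : 0 < C1.
  by apply: ltr_wpDl => //; apply: addr_ge0; [apply: mulr_ge0 => //; exact: mulr_ge0|exact: mulr_ge0].
pose rho := Num.min r (Num.min 1 (e / (L * n%:R + 1))).
have Ln0 : 0 < L * n%:R + 1 by rewrite ltr_wpDl // mulr_ge0.
have rho0 : 0 < rho by rewrite lt_min r0 lt_min ltr01 divr_gt0.
pose T2 := Num.min T1 (e / C1).
have T20 : 0 < T2 by rewrite lt_min T10 divr_gt0.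
have n1 : \forall y \near p, `|p - y| < rho by apply/nbhs_normP; exists rho.
have n2 : \forall t \near (0 : R)^'+, t < T2 by exact: nbhs_right_lt.
exists ([set y : 'rV[R]_n | `|p - y| < rho], [set t | t < T2]) => //=.
move=> [y t] /= [yr tT] t0 cy.
move: yr; rewrite distrC lt_min => /andP[y1]; rewrite lt_min => /andP[y2 y3].
move: tT; rewrite lt_min => /andP[tT1 tT2].
apply: (le_trans (key t y t0 (ltW tT1) cy (ltW y1))); rewrite /cbase -/C1.
have h1 : C1 * t <= e.
  by rewrite mulrC -ler_pdivlMr // ltW.
have h2 : L * dotp (y - p) (y - p) <= e.
  apply: (@le_trans _ _ ((L * n%:R + 1) * `|y - p|)).
    apply: (@le_trans _ _ (L * (n%:R * `|y - p| ^+ 2))); first by rewrite ler_wpM2l // dotp_le_norm.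
    have h3 : `|y - p| ^+ 2 <= `|y - p| by rewrite expr2 ler_piMr // ltW.
    have h4 : L * n%:R * `|y - p| ^+ 2 <= L * n%:R * `|y - p| by rewrite ler_wpM2l // mulr_ge0.
    rewrite mulrA (le_trans h4) // ler_wpM2r // lerDl //.
  by rewrite mulrC -ler_pdivlMr // ltW.
by move: h1 h2; rewrite /e; clear -R; lra.
Qed.

End Corner.

(** * Localisation by a shrinking paraboloid *)

Section Global.
Context {R : realType} {n : nat}.
Implicit Types (x y : 'rV[R]_n) (Omega : set 'rV[R]_n) (v : 'rV[R]_n -> R -> R).

(** At a maximum of [w * g] the gradient is [p = k *: x] with [k = 2 * w / g]. The first-order term
    of the cut-off then becomes a multiple of [k |x|^2 / (1 + k^2 |x|^2)], bounded by a multiple of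
    [|x|] uniformly in [k]: the flow slows down where it is steep, so the ratio [w / g] is
    harmless. *)
Lemma paraboloid_speed (p x : 'rV[R]_n) H (w g r : R) : 0 < w -> 0 < g -> 0 <= r ->
  dotp x x <= r ^+ 2 ->
  (forall xi, w * (- 2 * dotp x xi) + g * dotp p xi = 0 /\
     w * - dotp xi xi + dotp p xi * (- 2 * dotp x xi) + g * (qf H xi / 2) <= 0) ->
  mcfop p H * g <= 2 * n%:R * w + 2 * r.
Proof.
move=> w0 g0 r0 xr hxi.
have wn : w != 0 by rewrite gt_eqF.
have gn : g != 0 by rewrite gt_eqF.
have xp xi : dotp x xi = g / (2 * w) * dotp p xi.
  have [h _] := hxi xi; apply: (mulfI wn); apply: (@mulIf _ (-2)); first by rewrite oppr_eq0 pnatr_eq0.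
  have -> : w * (g / (2 * w) * dotp p xi) * -2 = - (g * dotp p xi) by field.
  move: h; clear -R; lra.
pose k := 2 * w / g; have k0 : 0 < k by rewrite divr_gt0 // mulr_gt0.
have pE : p = k *: x.
  apply/rowP => i; have := xp (delta_mx ord0 i); rewrite !dotp_eps mxE => ->.
  by rewrite /k; field; rewrite gn wn.
have pp : dotp p p = k ^+ 2 * dotp x x by rewrite pE dotpZl dotpZr; ring.
have p1 := onep_gt0 p.
have hq xi : g * qf H xi <= 2 * w * dotp xi xi + 2 * g / w * dotp p xi ^+ 2.
  have [_] := hxi xi; rewrite xp.
  have -> : dotp p xi * (-2 * (g / (2 * w) * dotp p xi)) = - (g / w * dotp p xi ^+ 2) by field.
  have -> : 2 * g / w * dotp p xi ^+ 2 = 2 * (g / w * dotp p xi ^+ 2) by rewrite -!mulrA.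
  clear -R; lra.
have hs : mcfop p H * g <= 2 * w * n%:R + 2 * g / w * (dotp p p - dotp p p ^+ 2 / (1 + dotp p p)).
  rewrite -(sum_qf_msq p H) -sum_dotp_msq mulrC !mulr_sumr.
  apply: (@le_trans _ _ (\sum_(j < n) (2 * w * dotp (msqv p (delta_mx ord0 j)) (msqv p (delta_mx ord0 j))
     + 2 * g / w * dotp p (msqv p (delta_mx ord0 j)) ^+ 2))).
    by apply: ler_sum => j _; exact: hq.
  rewrite big_split /= -!mulr_sumr lerD2r ler_wpM2l ?mulr_ge0 ?(ltW w0) //.
  exact: sum_dotp_msq_le.
have h2 : 2 * g / w * (dotp p p - dotp p p ^+ 2 / (1 + dotp p p)) <= 2 * r.
  have -> : 2 * g / w * (dotp p p - dotp p p ^+ 2 / (1 + dotp p p)) =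
     2 * (g / w * dotp p p) / (1 + dotp p p) by field; rewrite wn gt_eqF.
  rewrite ler_pdivrMr // -(mulrA 2 r) ler_pM2l //.
  have -> : g / w * dotp p p = 2 * k * enorm x ^+ 2.
    by rewrite enorm_sqr pp /k; field; rewrite gn wn.
  rewrite pp -enorm_sqr; set a := enorm x.
  have a0 : 0 <= a by exact: enorm_ge0.
  have ar : a <= r by rewrite -ler_sqr ?nnegrE // enorm_sqr.
  have h3 : 2 * k * a <= 1 + k ^+ 2 * a ^+ 2 by have := sqr_ge0 (k * a - 1); clear -R; lra.
  apply: (@le_trans _ _ (a * (1 + k ^+ 2 * a ^+ 2))).
    have -> : 2 * k * a ^+ 2 = a * (2 * k * a) by ring.
    by rewrite ler_wpM2l.
  by rewrite ler_wpM2r // addr_ge0 // mulr_ge0 // sqr_ge0.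
by move: hs h2; clear -R; lra.
Qed.

(** The excess of [v] over [M + de] is multiplied by a cut-off with compact support, so nothing is
    needed at infinity. The early bound excludes the initial time, and [v = 0] excludes the
    boundary. *)
Lemma global_bound Omega v (M : R) : open Omega -> mcf_on Omega v ->
  cont_on (cyl (closure Omega)) (fun q => v q.1 q.2) ->
  (forall x t, closure Omega x -> ~ Omega x -> 0 < t -> v x t = 0) ->
  0 <= M -> (forall x, closure Omega x -> early_le Omega v M x) ->
  forall x t, closure Omega x -> 0 < t -> v x t <= M.
Proof.
move=> oO hv cv v0 M0 hearly x0 t0 cx0 t00; apply/ler_addgt0Pr => de de0.
rewrite leNgt; apply/negP => hlt.
pose w0 := v x0 t0 - (M + de); have w00 : 0 < w0 by rewrite subr_gt0.
pose q0 := dotp x0 x0 + 2 * n%:R * t0.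
have q00 : 0 <= q0 by rewrite addr_ge0 ?dotp_ge0 // !mulr_ge0 // ltW.
(* The loss [(2 r + 1) t0] is linear in the radius and the gain [w0 (r^2 - q0)] quadratic; this [r]
   makes the gain win at [(x0, t0)]. *)
pose r := (3 * t0 + w0 * q0) / w0 + 1.
have r1 : 1 <= r by rewrite lerDr divr_ge0 ?(ltW w00) // addr_ge0 // mulr_ge0 // ltW.
have r0 : 0 < r by apply: lt_le_trans r1.
have rw : r * w0 = 3 * t0 + w0 * q0 + w0 by rewrite /r; field; rewrite gt_eqF.
have hr : (2 * r + 1) * t0 < w0 * (r ^+ 2 - q0).
  have h1 : 0 <= (r - 1) * (w0 * q0) by rewrite !mulr_ge0 ?subr_ge0 // ltW.
  have h2 : 0 <= (r - 1) * t0 by rewrite mulr_ge0 ?subr_ge0 // ltW.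
  have h3 : 0 < r * w0 by rewrite mulr_gt0.
  have -> : w0 * (r ^+ 2 - q0) = r * (r * w0) - w0 * q0 by ring.
  rewrite {1}rw; move: h1 h2 h3; clear -R; lra.
have g00 : 0 < r ^+ 2 - q0.
  have : 0 < w0 * (r ^+ 2 - q0) by apply: le_lt_trans hr; rewrite ltW // mulr_gt0 // addr_gt0 // mulr_gt0.
  by rewrite pmulr_rgt0.
pose K00 : set 'rV[R]_n := [set x : 'rV[R]_n | `|x - 0| <= r] `&` closure Omega.
have cK00 : compact K00.
  by rewrite /K00 setIC; exact: (compact_closedIl _ _ (rV_ball_compact 0 r) (@closed_closure _ _)).
have [s s0 hs] : exists2 s, 0 < s & forall x t, K00 x -> closure Omega x -> 0 < t -> t <= s -> v x t <= M + de.
  by apply: early_compact => // x [_ cx]; exact: hearly.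
have K00x0 : K00 x0.
  split => //=; rewrite subr0; apply: le_trans (norm_le_enorm _) _.
  rewrite -ler_sqr ?nnegrE ?enorm_ge0 ?(ltW r0) // enorm_sqr.
  have : 0 <= 2 * n%:R * t0 by rewrite !mulr_ge0 // ltW.
  by move: g00; rewrite /q0; clear -R; lra.
have st0 : s < t0.
  by rewrite ltNge; apply/negP => ts; move: hlt; rewrite ltNge hs.
pose g (q : 'rV[R]_n * R) := r ^+ 2 - dotp q.1 q.1 - 2 * n%:R * q.2.
pose K0 : set ('rV[R]_n * R) := [set q | K00 q.1 /\ s <= q.2 <= t0].
have cK0 : compact K0 by have := compact_setX cK00 (itv_compact s t0); congr compact.
have cg A : cont_on A g.
  apply: cont_onB; first apply: cont_onB; first exact: cont_on_cst.
  - by apply: continuous_cont_on; exact: (continuous_dotp _ _ (@continuous_fst _ _) (@continuous_fst _ _)).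
  - apply: cont_onM; first exact: cont_on_cst.
    by apply: continuous_cont_on; exact: continuous_snd.
pose K : set ('rV[R]_n * R) := [set q | K0 q /\ 0 <= g q].
have cK : compact K by exact: compact_ge.
pose G (q : 'rV[R]_n * R) := (v q.1 q.2 - (M + de)) * g q - (2 * r + 1) * q.2.
have cG : cont_on K G.
  apply: cont_onB; last first.
    apply: cont_onM; first exact: cont_on_cst.
    by apply: continuous_cont_on; exact: continuous_snd.
  apply: cont_onM => //; apply: cont_onB; last exact: cont_on_cst.
  by apply: cont_on_sub cv => q [[[_ q1] /andP[q2 _]] _]; split => //; exact: lt_le_trans q2.
have gE : g (x0, t0) = r ^+ 2 - q0 by rewrite /g /q0 /=; ring.
have Kx0 : K (x0, t0).
  by split; [split => //; apply/andP; split => //=; exact: ltW|rewrite gE ltW].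
have [[x t] Kp hp] := compact_max K G cK (ex_intro _ _ Kx0) cG.
have G0 : 0 < G (x, t).
  by apply: lt_le_trans (hp _ Kx0); rewrite /G gE /= -/w0 subr_gt0.
have [[[/= xr cx] /andP[/= st tt]] gp] := Kp.
set gg := g (x, t) in gp.
pose w := v x t - (M + de).
have t0' : 0 < t by apply: lt_le_trans st.
have wg : 0 < w * gg.
  have : 0 < (2 * r + 1) * t by rewrite mulr_gt0 // addr_gt0 // mulr_gt0.
  by move: G0; rewrite /G /= -/gg -/w; clear -R; lra.
have gg0 : 0 < gg by rewrite lt_neqAle gp andbT; apply/eqP => E; move: wg; rewrite -E mulr0 ltxx.
have w0' : 0 < w by move: wg; rewrite pmulr_lgt0.
have Ox : Omega x.
  apply: contrapT => nOx; move: w0'; rewrite /w v0 //; move: M0 de0; clear -R; lra.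
have st' : s < t.
  rewrite lt_neqAle st andbT; apply/eqP => E; move: w0'; rewrite subr_gt0 ltNge hs // -?E //.
have ggE : gg = r ^+ 2 - dotp x x - 2 * n%:R * t by [].
have xxr : dotp x x < r ^+ 2.
  have : 0 <= 2 * n%:R * t by rewrite !mulr_ge0 // ltW.
  by move: gg0; rewrite ggE; clear -R; lra.
have xr' : `|x| < r.
  apply: le_lt_trans (norm_le_enorm _) _.
  by rewrite -ltr_sqr ?nnegrE ?enorm_ge0 ?(ltW r0) // enorm_sqr.
have [p [H [vt [j1 j2 hvt]]]] := hv x t Ox t0'.
have hxi xi : w * (- 2 * dotp x xi) + gg * dotp p xi = 0 /\
     w * - dotp xi xi + dotp p xi * (- 2 * dotp x xi) + gg * (qf H xi / 2) <= 0.
  have jg : jet2 (fun k => g (x + k *: xi, t)) gg (- 2 * dotp x xi) (- dotp xi xi).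
    apply: (jet2_ext _ _ _ _ (jet2_poly gg (- 2 * dotp x xi) (- dotp xi xi))) => // k.
    by rewrite ggE /g /= !dotpDl !dotpDr !dotpZl !dotpZr (dotpC xi x); ring.
  have jG := jet2B (jet2M (jet2B (j2 xi) (jet2_cst (M + de))) jg) (jet2_cst ((2 * r + 1) * t)).
  have hn : \forall k \near (0 : R), (v (x + k *: xi) t - (M + de)) * g (x + k *: xi, t) - (2 * r + 1) * t
      <= (v x t - (M + de)) * gg - (2 * r + 1) * t.
    have h1 := near_curve Omega x xi 0 oO Ox.
    have ob : open [set y : 'rV[R]_n | `|y| < r].
      have -> : [set y : 'rV[R]_n | `|y| < r] = ball (0 : 'rV[R]_n) r.
        by rewrite -ball_normE; apply/seteqP; split => y /=; rewrite sub0r normrN.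
      exact: ball_open.
    have h2 := near_curve [set y : 'rV[R]_n | `|y| < r] x xi 0 ob xr'.
    have lo : - gg < 0 by rewrite oppr_lt0.
    have h3 : \forall k \near (0 : R), - gg < g (x + k *: xi, t) - gg.
      exact: (@cvgr_gt R R (nbhs (0 : R)) _ _ _ (jet2_cvg0 jg) _ lo).
    apply: filterS3 h1 h2 h3 => k; rewrite scaler0 addr0 => k1 k2 k3.
    have hK : K (x + k *: xi, t).
      split; last by move: k3; clear -R; lra.
      split; last by apply/andP.
      by split; [rewrite /= subr0 ltW|exact: subset_closure].
    exact: hp _ hK.
  have [] := jet2_max jG hn; rewrite !subr0 -/w => h1 h2; split; move: h1 h2; clear -R; lra.
have := paraboloid_speed p x H w gg r w0' gg0 (ltW r0) (ltW xxr) hxi.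
rewrite -hvt => hsp.
have jt := jet1B (jet1M (jet1B j1 (jet1_cst (M + de))) (jet1_poly gg (- (2 * n%:R)) 0)) (jet1_poly ((2 * r + 1) * t) (2 * r + 1) 0).
have hn : \forall k \near (0 : R), k <= 0 -> (v x (t + k) - (M + de)) * (gg + - (2 * n%:R) * k + 0 * k ^+ 2)
   - ((2 * r + 1) * t + (2 * r + 1) * k + 0 * k ^+ 2) <= (v x t - (M + de)) * gg - (2 * r + 1) * t.
  have h : 0 < t - s by rewrite subr_gt0.
  have h1 : \forall k \near (0 : R), `|k| < t - s by exact: nbhs0_lt.
  apply: filterS h1 => k; rewrite ltr_norml => /andP[k1 _] k0.
  have gkE : g (x, t + k) = gg + - (2 * n%:R) * k + 0 * k ^+ 2 by rewrite ggE /g /=; ring.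
  have hK : K (x, t + k).
    split; last first.
      rewrite gkE; have : 2 * n%:R * k <= 0 by rewrite mulr_ge0_le0 // mulr_ge0.
      by move: gg0; clear -R; lra.
    by split => //; apply/andP; split => /=; move: k1 k0 tt; clear -R; lra.
  by have := hp _ hK; rewrite /G gkE /= -/gg; clear -R; lra.
have := jet1_left_max jt hn; rewrite subr0 -/w.
by move: hsp r0; clear -R; lra.
Qed.

End Global.

(** * The theorem *)

Section Final.
Context {R : realType} {n : nat}.
Implicit Types (x y : 'rV[R]_n) (Omega : set 'rV[R]_n) (v u : 'rV[R]_n -> R -> R).

Lemma differentiable_slice (F : 'rV[R]_n * R -> R) x (t : R) :
  differentiable F (x, t) -> differentiable (fun y => F (y, t)) x.
Proof.
move=> dF; have dp : differentiable (fun y : 'rV[R]_n => (y, t)) x.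
  by apply: differentiable_pair.
exact: (@differentiable_comp _ _ _ _ (fun y : 'rV[R]_n => (y, t)) F x dp dF).
Qed.

Lemma mcf_on_graphical Omega u : open Omega ->
  smooth_on [set p : 'rV[R]_n * R | Omega p.1 /\ 0 < p.2] (fun p => u p.1 p.2) ->
  graphical_mcf Omega u -> mcf_on Omega u.
Proof.
move=> oO sm hg x t Ox t0; pose U (p : 'rV[R]_n * R) := u p.1 p.2.
have [d0 h1] := sm 2%N.
have D2 w (q : 'rV[R]_n * R) : Omega q.1 -> 0 < q.2 -> differentiable ('D_w U) q.
  by move=> Oq q0; have [h _] := h1 w; exact: h.
have Dw w : 'D_w (u^~ t) = fun y => 'D_((w, 0) : 'rV[R]_n * R) U (y, t).
  by apply/funext => y; apply: derive_congr => h; rewrite /U /= scaler0 add0r.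
have df : \forall y \near x, differentiable (u^~ t) y.
  have hO : \forall y \near x, Omega y by exact: open_nbhs_nbhs.
  by apply: filterS hO => y Oy; apply: (differentiable_slice U); exact: d0.
have d2f w : differentiable ('D_w (u^~ t)) x.
  by rewrite Dw; exact: (differentiable_slice _ x t (D2 (w, 0) (x, t) Ox t0)).
have Et : derive1 (u x) t = 'D_((0, 1) : 'rV[R]_n * R) U (x, t).
  by rewrite derive1E; apply: derive_congr => h; rewrite /U /= scaler0 add0r.
exists (grad (u^~ t) x), (hess (u^~ t) x), (derive1 (u x) t); split.
- have dU : differentiable U (x, t) by exact: d0.
  have := jet1_derive (derivableP (diff_derivable dU)) => j.
  rewrite Et; refine (jet1_ext _ _ _ (j ((0, 1) : 'rV[R]_n * R)) _ erefl erefl) => s.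
  by rewrite /U /= scaler0 addr0 /GRing.scale /= mulr1.
- by move=> xi; exact: (hess_jet2 (u^~ t)).
- rewrite hg // /mcfop; apply: eq_bigr => i _; apply: eq_bigr => j _.
  by rewrite /mcfa enorm_sqr !mxE.
Qed.

Lemma early_initial Omega v (M : R) x :
  cont_on [set p : 'rV[R]_n * R | (closure Omega p.1 /\ 0 < p.2) \/ (Omega p.1 /\ p.2 = 0)]
    (fun p => v p.1 p.2) ->
  Omega x -> v x 0 <= M -> early_le Omega v M x.
Proof.
move=> cv Ox vM e e0.
set Q := [set p : 'rV[R]_n * R | _] in cv.
have Qx : Q (x, 0) by right.
have lt : v x 0 < M + e by rewrite ltr_pwDr.
have := @cvgr_lt R _ (within Q (nbhs ((x, 0) : 'rV[R]_n * R))) _ _ _ (cv _ Qx) _ lt.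
move=> [[A B] /= [hA hB] hAB].
exists (A, B) => /=.
  by split => //; apply: cvg_within.
move=> [y t] /= [Ay Bt] t0 cy; apply: ltW; apply: (hAB (y, t)) => //.
by left.
Qed.

Lemma local_bound Omega v x :
  (exists B : R, \forall p \near within
     [set p : 'rV[R]_n * R | (closure Omega p.1 /\ 0 < p.2) \/ (Omega p.1 /\ p.2 = 0)]
     (nbhs (x, 0)), `|v p.1 p.2| <= B) ->
  exists B r1 : R, [/\ 0 <= B, 0 < r1 & forall y t, closure Omega y -> `|y - x| <= r1 -> 0 < t -> t <= r1 ->
    `|v y t| <= B].
Proof.
move=> [B [[A1 A2] /= [/nbhs_normP[a /= a0 ha] /nbhs_normP[b /= b0 hb]] hAB]].
have m0 : 0 < Num.min a b by rewrite lt_min a0.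
exists `|B|, (Num.min a b / 2); split => //; first by rewrite divr_gt0.
move=> y t cy yr t0 tr; apply: le_trans (ler_norm _).
have ma : Num.min a b <= a by rewrite ge_min lexx.
have mb : Num.min a b <= b by rewrite ge_min lexx orbT.
apply: (hAB (y, t)); last by left.
split => /=; first by apply: ha; rewrite /= distrC; move: yr ma m0; clear -R; lra.
apply: hb; rewrite /= sub0r normrN gtr0_norm //; move: tr mb m0; clear -R; lra.
Qed.

Lemma flow_upper Omega v (M : R) : open Omega -> C2_boundary Omega -> mcf_on Omega v ->
  cont_on [set p : 'rV[R]_n * R | (closure Omega p.1 /\ 0 < p.2) \/ (Omega p.1 /\ p.2 = 0)]
    (fun p => v p.1 p.2) ->
  (forall x t, boundary Omega x -> 0 < t -> v x t = 0) ->
  (forall x, boundary Omega x -> exists B r1 : R, [/\ 0 <= B, 0 < r1 &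
     forall y t, closure Omega y -> `|y - x| <= r1 -> 0 < t -> t <= r1 -> `|v y t| <= B]) ->
  (forall x, Omega x -> v x 0 <= M) -> 0 <= M ->
  forall x t, closure Omega x -> 0 < t -> v x t <= M.
Proof.
move=> oO hC2 hv cv v0 hB hM M0.
have bd x : closure Omega x -> ~ Omega x -> boundary Omega x.
  by move=> cx nx; split => // /interior_subset.
have cc : cont_on (cyl (closure Omega)) (fun p => v p.1 p.2).
  by apply: cont_on_sub cv => p hp; left.
have v0' x t : closure Omega x -> ~ Omega x -> 0 < t -> v x t = 0.
  by move=> cx nx; apply: v0; exact: bd.
have hearly x : Omega x -> early_le Omega v M x.
  by move=> Ox; apply: early_initial => //; exact: hM.
apply: global_bound => // x cx.
have [Ox|nOx] := pselect (Omega x); first exact: hearly.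
have [B [r1 [B0 r0 h]]] := hB x (bd x cx nOx).
apply: (corner_bound Omega v x M B r1) => //; first exact: bd.
by move=> y t cy yr t0 tr; apply: le_trans (ler_norm _) _; exact: h.
Qed.

Lemma dirichlet_bounded_flow Omega (u0 : 'rV[R]_n -> R) u (M : R) : open Omega -> C2_boundary Omega ->
  smooth_dirichlet_mcf_solution Omega u0 u -> 0 <= M ->
  (forall x, Omega x -> `|u0 x| <= M) -> bounded_flow Omega M u.
Proof.
move=> oO hC2 [sm /cont_onP cQ hB hg [u00 u0E]] M0 hM.
have hv := mcf_on_graphical Omega u oO sm hg.
have up : forall x t, closure Omega x -> 0 < t -> u x t <= M.
  apply: flow_upper => //.
    by move=> x bx; apply: local_bound; exact: hB.
  by move=> x Ox; rewrite u0E //; apply: le_trans (ler_norm _) (hM x Ox).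
have lo : forall x t, closure Omega x -> 0 < t -> - u x t <= M.
  apply: (@flow_upper Omega (fun x t => - u x t)) => //.
  - exact: mcf_onN.
  - exact: cont_onN.
  - by move=> x t bx t0; rewrite u00 // oppr0.
  - move=> x bx; have [B [r1 [B0 r0 h]]] := local_bound Omega u x (hB x bx).
    by exists B, r1; split => // y t *; rewrite normrN; exact: h.
  - by move=> x Ox; rewrite u0E //; apply: le_trans (hM x Ox); rewrite -normrN ler_norm.
split => //; first by apply: cont_on_sub cQ => p hp; left.
by move=> x t cx t0; rewrite ler_norml up // andbT lerNl lo.
Qed.

End Final.

(** The comparison has to start at a positive time [s], which costs a delay in the profile.
    Continuity of the profile at positive times removes it as [s] tends to 0. *)
Lemma le_time_shift {R : realType} (phi : R -> R -> R) (M z t w : R) : csf_from_one phi ->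
  0 < M -> 0 <= z -> 0 < t ->
  (forall s, 0 < s -> s < t -> w <= csf_scaled M phi z (t - s)) -> w <= csf_scaled M phi z t.
Proof.
move=> [_ /cont_onP cp _ _ _] M0 z0 t0 h; rewrite leNgt; apply/negP => hlt.
have k0 : 0 < 2 * M by rewrite mulr_gt0.
have k20 : 0 < 4 * M ^+ 2 by rewrite mulr_gt0 // exprn_gt0.
have cs : continuous (fun s : R => (z / (2 * M), s / (4 * M ^+ 2))).
  apply: continuous_pair2; first exact: cst_continuous.
  by move=> s; exact: (@cvgM _ _ (nbhs s) _ id (fun=> (4 * M ^+ 2)^-1) _ _ cvg_id (cvg_cst _)).
have cc : cont_on [set s : R | 0 < s] (csf_scaled M phi z).
  apply: cont_onM; first exact: cont_on_cst.
  apply: (cont_on_comp _ _ _ _ cs _ cp) => s s0; split => /=; first by rewrite divr_ge0 // ltW.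
  by rewrite divr_gt0.
have hn : \forall s \near t, 0 < s -> csf_scaled M phi z s < w.
  exact: (@cvgr_lt R _ (within [set s : R | 0 < s] (nbhs t)) _ _ _ (cc _ t0) _ hlt).
have /nbhs_normP[rho /= r0 hr] := hn.
pose s := Num.min (t / 2) (rho / 2).
have s0 : 0 < s by rewrite lt_min !divr_gt0.
have s1 : s <= t / 2 by rewrite ge_min lexx.
have s2 : s <= rho / 2 by rewrite ge_min lexx orbT.
have st : s < t by move: s1 t0; clear -R; lra.
have := h s s0 st; rewrite leNgt => /negP; apply; apply: hr => /=; last by rewrite subr_gt0.
rewrite opprB addrC subrK gtr0_norm //; move: s2 r0; clear -R; lra.
Qed.

Theorem theorem5p4 (R : realType) (n : nat) (Omega : set 'rV[R]_n)
  (u0 : 'rV[R]_n -> R) (u : 'rV[R]_n -> R -> R) (phi : R -> R -> R) (M : R)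
  (hn : (0 < n)%N)
  (hOmega : domain Omega)
  (hC2 : C2_boundary Omega)
  (hmc : mean_convex Omega)
  (hu : smooth_dirichlet_mcf_solution Omega u0 u)
  (hphi : csf_from_one phi)
  (hu0 : has_ubound [set `|u0 x| | x in Omega])
  (hM : M = sup [set `|u0 x| | x in Omega]) :
  forall (x y : 'rV[R]_n) (t : R), Omega x -> Omega y -> 0 < t ->
    `|u y t - u x t|
      <= 2 * M * phi (enorm (y - x) / (2 * M)) (t / (4 * M ^+ 2)).
Proof.
move=> x y t Ox Oy t0; case: hOmega => _ oO _.
have uM z : Omega z -> `|u0 z| <= M by move=> Oz; rewrite hM; apply: ub_le_sup => //; exists z.
have M0 : 0 <= M by apply: le_trans (uM x Ox).
have hf := dirichlet_bounded_flow Omega u0 u M oO hC2 hu M0 uM.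
(* The geometric lemmas are stated in dimension [m.+1], where the index type of the principal
   curvatures reduces to ['I_m]. *)
case: n Omega u0 u hn hC2 hmc hu hu0 hM x y Ox Oy oO uM hf => // m Omega u0 u _ _ hmc _ _ _ x y Ox Oy oO _ hf.
have cx : closure Omega x by exact: subset_closure.
have cy : closure Omega y by exact: subset_closure.
(* For [M = 0] the rescaling degenerates, but then [u] vanishes identically for positive times and
   both sides are 0. *)
have [M1|M1] := ltP 0 M; last first.
  have -> : M = 0 by apply/eqP; rewrite eq_le M1.
  have [_ _ _ hb] := hf.
  have uz z : closure Omega z -> u z t = 0.
    by move=> cz; apply/eqP; rewrite -normr_le0; apply: le_trans M1; exact: hb.
  by rewrite !uz // subrr normr0 mulr0 mul0r.
have [f1 [f2 hbar]] := csf_scaled_barrier M phi hphi M1.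
have f0 := csf_scaled_ge0 M phi hphi M1.
have half a b : closure Omega a -> closure Omega b -> u b t - u a t <= csf_scaled M phi (enorm (b - a)) t.
  move=> ca cb; apply: le_time_shift => //; first exact: enorm_ge0.
  by move=> s s0 st; apply: (oscillation_bound Omega M u s _ f1 f2).
have h1 := half x y cx cy; have := half y x cy cx; rewrite (enormB x y) => h2.
by rewrite ler_norml; apply/andP; split; [rewrite lerNl opprB; exact: h2|exact: h1].
Qed.
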